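(* Let $K_\nu$ be a completion (archimedean or not) of a number field and let $X_\nu$ be the group of unitary characters of $K_\nu^\times$ with its Plancherel measure $\mu$. Under the isometries $L^2(K_\nu,dx)\sim L^2(K_\nu^\times,d^*t)\sim L^2(X_\nu,d\mu)$: (1) the Inversion is transported to the unitary $f(\chi)\mapsto f(\overline{\chi})$; (2) the additive Fourier transform is transported to the unitary $f(\chi)\mapsto \Gamma(\chi,1/2)\,f(\overline\chi)$; (3) the conductor operator $H$ is transported to the hermitian operator $f(\chi)\mapsto -\Lambda(\chi,1/2)\,f(\chi)$.
   Context: $\lambda$ is the additive character of $K_\nu$ given by $\lambda(x)=\exp(2\pi i\{\mathrm{Tr}(x)\})$ for $\nu$ finite ($\mathrm{Tr}$ the trace to $\mathbb{Q}_p$, $\{a\}$ the polar part of $a\in\mathbb{Q}_p$) and $\lambda(x)=\exp(-2\pi i\,\mathrm{Tr}(x))$ for $\nu$ archimedean ($\mathrm{Tr}$ the trace to $\mathbb{R}$). $dx$ is the self-dual Haar measure for $\lambda$, and the additive Fourier transform is $\mathcal{F}(\varphi)(y)=\int_{K_\nu}\varphi(x)\lambda(-xy)\,dx$. $|t|$ is the module: $d(tx)=|t|\,dx$ (so $|z|=z\bar z$ on $\mathbb{C}$). The multiplicative Haar measure $d^*t$ on $K_\nu^\times$ gives the units volume $1$ if $\nu$ is finite, and has push-forward $du/u$ on $(0,\infty)$ under $t\mapsto|t|$ if $\nu$ is archimedean; $\alpha>0$ is the constant with $d^*t=\alpha^{-2}\,dt/|t|$. The first isometry sends $\varphi\in L^2(K_\nu,dx)$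 to $t\mapsto\alpha\sqrt{|t|}\,\varphi(t)$. The second is $f(\chi)=\int_{K_\nu^\times}f(t)\chi(t)\,d^*t$, with $\mu$ the Haar measure on $X_\nu$ such that $f(t)=\int_{X_\nu}f(\chi)\overline{\chi(t)}\,d\mu(\chi)$ and Plancherel's identity holds. The Inversion on $L^2(K_\nu,dx)$ is $\varphi(x)\mapsto\frac1{|x|}\varphi(\frac1x)$. The conductor operator is $H(\varphi)(x)=\log(|x|)\varphi(x)+\mathcal{F}(\log(|y|)\,\mathcal{F}^{-1}(\varphi)(y))(x)$, and statements about it are to be understood on $\mathcal{S}_0$, the space of Schwartz-Bruhat functions on $K_\nu$ with compact support vanishing identically in a neighborhood of the origin. For $\chi$ a unitary character of $K_\nu^\times$ and $0<\mathrm{Re}(s)<1$ the Tate-Gel'fand-Graev Gamma function $\Gamma(\chi,s)$ is defined by the identity of tempered distributions $\mathcal{F}(\chi(x)|x|^{s-1})=\Gamma(\chi,s)\,\chi^{-1}(y)|y|^{-s}$; it is analytic and non-vanishing in this strip. $\Lambda(\chi,s)=-\Gamma'(\chi,s)/\Gamma(\chi,s)$, the prime denoting $\partial/\partial s$. *)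

(* Defs.v *)
From HB Require Import structures.
From mathcomp Require Import all_boot all_order all_algebra all_field.
From mathcomp Require Import complex.
From mathcomp Require Import all_classical all_reals all_analysis.

Set Implicit Arguments.
Unset Strict Implicit.
Unset Printing Implicit Defensive.

Import Order.TTheory GRing.Theory Num.Theory.
Import numFieldNormedType.Exports.
Import ComplexField.Normc.

Local Open Scope classical_set_scope.
Local Open Scope ring_scope.
Local Open Scope complex_scope.

HB.instance Definition _ (R : realType) :=
  PseudoPointedMetric.copy R[i] R[i]^o.
HB.instance Definition _ (R : realType) := NormedModule.copy R[i] R[i]^o.

(* Elements of L2 are represented by functions, taken up to equality a.e. *)

Section complex_integration.
Context d (T : measurableType d) (R : realType).
Variable mu : {measure set T -> \bar R}.
Implicit Types (f g : T -> R[i]) (B : (T -> R[i]) -> T -> R[i]).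

Definition cmeasurable f :=
  measurable_fun setT (fun x => complex.Re (f x)) /\
  measurable_fun setT (fun x => complex.Im (f x)).

Definition L1 f :=
  mu.-integrable setT (fun x => (complex.Re (f x))%:E) /\
  mu.-integrable setT (fun x => (complex.Im (f x))%:E).

Definition cintegral f : R[i] :=
  (\int[mu]_x complex.Re (f x)) +i* (\int[mu]_x complex.Im (f x)).

Definition sqnormL2 f : \bar R := (\int[mu]_x ((normc (f x)) ^+ 2)%:E)%E.

Definition L2 f := cmeasurable f /\ (sqnormL2 f < +oo)%E.

Definition innerL2 f g : R[i] := cintegral (fun x => f x * (g x)^*).

Definition eqL2 f g := {ae mu, forall x, f x = g x}.

Definition cvgL2 (u : nat -> T -> R[i]) f :=
  (fun n => sqnormL2 (fun x => u n x - f x)) @ \oo --> 0%E.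

Definition linear_op B := forall (a : R[i]) f g,
  B (fun x => a * f x + g x) = (fun x => a * B f x + B g x).

Definition unitaryL2 B :=
  [/\ linear_op B,
      forall f, L2 f -> L2 (B f) /\ sqnormL2 (B f) = sqnormL2 f
    & forall g, L2 g -> exists2 f, L2 f & eqL2 (B f) g].

(* B may be unbounded: its domain is the set of f in L2 such that B f is in L2,
   which has to be dense. *)
Definition hermitianL2 B :=
  let D f := L2 f /\ L2 (B f) in
  [/\ linear_op B,
      forall f, L2 f -> exists2 u, forall n, D (u n) & cvgL2 u f
    & forall f g, D f -> D g -> innerL2 (B f) g = innerL2 f (B g)].

End complex_integration.

(* Graph of the extension by continuity to L2 of an integral transform that is
   given by its formula on the intersection of L1 and L2. *)
Definition extensionL2 (R : realType) d1 (T1 : measurableType d1)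
    d2 (T2 : measurableType d2) (mu1 : {measure set T1 -> \bar R})
    (mu2 : {measure set T2 -> \bar R}) (U : (T1 -> R[i]) -> T2 -> R[i])
    (f : T1 -> R[i]) (g : T2 -> R[i]) :=
  [/\ L2 mu1 f, L2 mu2 g &
    exists u : nat -> T1 -> R[i],
      [/\ forall n, [/\ L1 mu1 (u n), L2 mu1 (u n) & L2 mu2 (U (u n))],
          cvgL2 mu1 u f & cvgL2 mu2 (fun n => U (u n)) g]].

Definition borel (T : ptopologicalType) := g_sigma_algebraType (@open T).

(* Haar measure on a group G whose law is the restriction of op and which is an
   open subspace of T; the measure is seen as a Borel measure on T. *)
Definition is_haar (R : realType) (T : ptopologicalType) (G : set T)
    (op : T -> T -> T) (mu : {measure set (borel T) -> \bar R}) :=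
  [/\ mu (~` G) = 0%E,
      forall (t : T) (A : set (borel T)), G t -> measurable A -> A `<=` G ->
        mu (op t @` A) = mu A,
      forall A : set T, compact A -> A `<=` G -> (mu A < +oo)%E
    & forall A : set T, open A -> A `<=` G -> A !=set0 -> (0 < mu A)%E].

Record absolute_value (R : realType) (K : fieldType) := AbsoluteValue {
  absv :> K -> R;
  absv_ge0 : forall x, 0 <= absv x;
  absv_eq0 : forall x, (absv x == 0) = (x == 0);
  absvM : {morph absv : x y / x * y};
  absvD : forall x y, absv (x + y) <= absv x + absv y
}.

(* The field K with the metric given by the absolute value v. *)
Definition valued (R : realType) (K : fieldType) (v : absolute_value R K) : Type
  := K.

Section valued_field.
Context (R : realType) (K : fieldType) (v : absolute_value R K).

HB.instance Definition _ := GRing.Field.on (valued v).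
HB.instance Definition _ := isPointed.Build (valued v) 0.

Lemma absv0 : v 0 = 0.
Proof. by apply/eqP; rewrite absv_eq0. Qed.

Lemma absv1 : v 1 = 1.
Proof.
have v1 : v 1 != 0 by rewrite absv_eq0 oner_eq0.
by apply: (mulfI v1); rewrite -absvM !mulr1.
Qed.

Lemma absvN x : v (- x) = v x.
Proof.
have vN1 : v (-1) = 1.
  apply/eqP; rewrite -(@eqrXn2 _ 2) ?absv_ge0 ?ler01//.
  by rewrite expr1n expr2 -absvM mulrNN mulr1 absv1.
by rewrite -mulN1r absvM vN1 mul1r.
Qed.

Let dist (x y : valued v) : R := v ((x : K) - y).

Let distxx x : dist x x = 0.
Proof. by rewrite /dist subrr absv0. Qed.

Let dist_positivity x y : dist x y = 0 -> x = y.
Proof. by move/eqP; rewrite absv_eq0 subr_eq0 => /eqP. Qed.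

Let dist_sym x y : dist x y = dist y x.
Proof. by rewrite /dist -absvN opprB. Qed.

Let dist_triangle y x z : dist x z <= dist x y + dist y z.
Proof. by rewrite /dist -[(x : K) - z](subrKA y) absvD. Qed.

HB.instance Definition _ := isMetric.Build R (valued v)
  distxx dist_positivity dist_sym dist_triangle.

End valued_field.

Section local_field.
Context (R : realType) (K0 : fieldType) (v : absolute_value R K0).
Local Notation K := (valued v).
Implicit Types (x y t u : K) (phi psi f : K -> R[i]).

(* K is the completion of the number field F (a finite extension of rat) at the
   place defined by the restriction of v to F. *)
Definition is_completion (F : fieldExtType rat) (iota : {rmorphism F -> K}) :=
  [/\ forall G : set_system K, ProperFilter G -> cauchy G -> cvg G,
      dense (range iota) & exists2 z : F, z != 0 & v (iota z) != 1].

Definition ultrametric := forall x y, v (x + y) <= Num.max (v x) (v y).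

(* The completion of rat at the place below: Q_p or the field of reals. *)
Definition base_field : set K := closure (range (ratr : rat -> K)).

Definition is_base_basis n (b : 'I_n -> K) :=
  forall x, exists! c : 'rV[K]_n,
    (forall i, base_field (c 0 i)) /\ x = \sum_(i < n) c 0 i * b i.

(* Trace over base_field: the trace of the matrix of multiplication by x. *)
Definition trace x : K := xget 0 [set a |
  exists n (b : 'I_n -> K) (M : 'M[K]_n),
    [/\ is_base_basis b, forall i j, base_field (M i j),
        forall i, x * b i = \sum_(j < n) M i j * b j & a = \tr M]].

(* For an archimedean K, base_field is a copy of R; this is the isomorphism. *)
Definition same_real (a : K) (r : R) := forall e : R, 0 < e ->
  exists q : rat, v (a - ratr q) < e /\ `|r - ratr q| < e.
Definition to_real (a : K) : R := xget 0 [set r | same_real a r].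
Definition of_real (r : R) : K := xget 0 [set a | same_real a r].

(* For K over Q_p, v a <= 1 means that a is in Z_p, for a in Q_p. *)
Definition polar_part (a : K) : rat := xget 0 [set q |
  [/\ 0 <= q < 1, v (a - ratr q) <= 1 &
    exists (p n : nat) (m : int),
      [/\ prime p, v (p%:R : K) < 1 & q = m%:~R / (p ^ n)%:R]]].

Definition expi (r : R) : R[i] := cos r +i* sin r.

Definition lambda x : R[i] :=
  if `[< ultrametric >] then expi (2 * pi * ratr (polar_part (trace x)))
  else expi (- (2 * pi * to_real (trace x))).

Definition fourier (dx : {measure set (borel K) -> \bar R}) phi y : R[i] :=
  cintegral dx (fun x => phi x * lambda (- (x * y))).
Definition fourier_inv (dx : {measure set (borel K) -> \bar R}) phi y : R[i] :=
  cintegral dx (fun x => phi x * lambda (x * y)).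

Definition compact_support phi :=
  exists2 C : set K, compact C & forall x, ~ C x -> phi x = 0.

Definition directional_derivative u phi psi := forall x,
  (fun h : R => (phi (x + of_real h * u) - phi x) / h%:C) @ 0^' --> psi x.

(* D us is the iterated derivative of phi along the directions in us. *)
Definition schwartz_arch phi := exists D : seq K -> K -> R[i],
  [/\ D [::] = phi,
      forall us u, directional_derivative u (D us) (D (u :: us))
    & forall us (N : nat), exists M : R, forall x,
        v x ^+ N * normc (D us x) <= M].

Definition schwartz_bruhat phi :=
  if `[< ultrametric >]
  then (forall x, \forall y \near x, phi y = phi x) /\ compact_support phi
  else schwartz_arch phi.

Definition schwartz_bruhat0 phi :=
  [/\ schwartz_bruhat phi, compact_support phi & \forall x \near 0, phi x = 0].

Definition is_self_dual_haar (dx : {measure set (borel K) -> \bar R}) :=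
  @is_haar R K setT +%R dx /\
  forall phi, schwartz_bruhat phi ->
    forall x, fourier_inv dx (fourier dx phi) x = phi x.

Definition modulus (dx : {measure set (borel K) -> \bar R}) t : R :=
  xget 0 [set c | 0 <= c /\ forall A : set (borel K), measurable A ->
    dx ( *%R t @` A) = (c%:E * dx A)%E].

Definition is_normalized_mulhaar (dx dt : {measure set (borel K) -> \bar R}) :=
  [/\ @is_haar R K [set t | t != 0] *%R dt,
      ultrametric -> dt [set t : K | v t = 1] = 1%E
    & ~ ultrametric -> forall B : set R, measurable B -> B `<=` `]0, +oo[ ->
        dt (modulus dx @^-1` B) =
        (\int[lebesgue_measure]_(u in B) (u^-1)%:E)%E].

Definition is_alpha (dx dt : {measure set (borel K) -> \bar R}) (alpha : R) :=
  0 < alpha /\ forall A : set (borel K), measurable A -> A `<=` [set t | t != 0] ->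
    dt A = (\int[dx]_(t in A) (alpha ^- 2 / modulus dx t)%:E)%E.

(* Unitary characters of the multiplicative group, extended by 0 at 0, with the
   topology of uniform convergence on the compact subsets of that group. *)

Definition mul_compact (A : set K) := compact A /\ ~ A 0.

Definition unitary_character : set {family mul_compact, K -> R[i]} :=
  [set chi | [/\ chi 0 = 0,
    {in [pred x : K | x != 0] &, {morph chi : x y / x * y}},
    forall x, x != 0 -> `|chi x| = 1
  & {within [set x : K | x != 0], continuous (chi : K -> R[i])}]].

Definition Xnu : Type := set_type unitary_character.
HB.instance Definition _ := Topological.on Xnu.

Definition char_fun (chi : Xnu) : K -> R[i] := val chi.
Coercion char_fun : Xnu >-> Funclass.

Lemma trivial_char_subproof :
  unitary_character (fun x : K => if x == 0 then 0 else 1 : R[i]).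
Proof.
split.
- by rewrite eqxx.
- move=> x y /negPf x0 /negPf y0 /=.
  by rewrite mulf_eq0 x0 y0 mulr1.
- by move=> x /negPf ->; rewrite normr1.
- apply: (@subspace_eq_continuous _ _ _ (fun=> 1 : R[i])).
    by move=> x; rewrite inE /= => /negPf x0; rewrite /from_subspace /= x0.
  by move=> x; apply: cvg_cst.
Qed.

Lemma char_mul_subproof (chi eta : Xnu) :
  unitary_character (fun x => chi x * eta x).
Proof.
have [chi0 chiM chi1 chiC] := set_valP chi.
have [eta0 etaM eta1 etaC] := set_valP eta.
split.
- by rewrite /char_fun chi0 mul0r.
- by move=> x y x0 y0; rewrite /char_fun chiM// etaM// mulrACA.
- by move=> x x0; rewrite normrM chi1// eta1// mulr1.
- by move=> x; apply: cvgM; [exact: chiC|exact: etaC].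
Qed.

Lemma char_conj_subproof (chi : Xnu) : unitary_character (fun x => (chi x)^*).
Proof.
have [chi0 chiM chi1 chiC] := set_valP chi.
have conjV z : `|z| = 1 -> z^* = z^-1 :> R[i].
  move=> z1; have z0 : z != 0 by rewrite -normr_eq0 z1 oner_eq0.
  by apply: (mulfI z0); rewrite divff// -sqr_normc z1 expr1n.
split.
- by rewrite /char_fun chi0 conjc0.
- by move=> x y x0 y0; rewrite /char_fun chiM// rmorphM.
- by move=> x x0; rewrite conjV ?chi1// normfV chi1// invr1.
- apply: (@subspace_eq_continuous _ _ _ (fun x : K => (chi x)^-1)).
    by move=> x; rewrite inE /= => x0; rewrite /from_subspace /= conjV ?chi1.
  apply/subspace_continuousP => x x0; apply: cvgV.
    by rewrite -normr_eq0 chi1// oner_eq0.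
  by move/subspace_continuousP : chiC; exact.
Qed.

Definition trivial_char : Xnu := SigSub (mem_set trivial_char_subproof).
Definition char_mul chi eta : Xnu := SigSub (mem_set (char_mul_subproof chi eta)).
Definition char_conj chi : Xnu := SigSub (mem_set (char_conj_subproof chi)).

HB.instance Definition _ := isPointed.Build Xnu trivial_char.

Section transport.
Variables (dx dt : {measure set (borel K) -> \bar R}) (alpha : R).
Variable mu : {measure set (borel Xnu) -> \bar R}.
Variable Gamma : Xnu -> R[i] -> R[i].

Definition first_isometry phi t : R[i] :=
  (alpha * Num.sqrt (modulus dx t))%:C * phi t.

Definition mellin f (chi : Xnu) : R[i] := cintegral dt (fun t => f t * chi t).

Definition is_plancherel :=
  [/\ @is_haar R Xnu setT char_mul mu,
      forall f, L1 dt f -> L1 mu (mellin f) -> {ae dt, forall t,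
        f t = cintegral mu (fun chi : Xnu => mellin f chi * (chi t)^*)}
    & forall f, L1 dt f -> L2 dt f ->
        L2 mu (mellin f) /\ sqnormL2 mu (mellin f) = sqnormL2 dt f].

(* Graph of the composite of the two isometries. *)
Definition isometry phi (f : Xnu -> R[i]) :=
  L2 dx phi /\ extensionL2 dt mu mellin (first_isometry phi) f.

(* The operator on L2(K, dx) with graph A and domain D is transported to B. *)
Definition transported (D : (K -> R[i]) -> Prop)
    (A : (K -> R[i]) -> (K -> R[i]) -> Prop)
    (B : (Xnu -> R[i]) -> Xnu -> R[i]) :=
  forall phi, D phi -> (exists g : Xnu -> R[i], isometry phi g) /\
    forall (f : Xnu -> R[i]) psi, isometry phi f -> (A phi psi <-> isometry psi (B f)).

Definition graphL2 (A : (K -> R[i]) -> K -> R[i]) phi psi :=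
  L2 dx psi /\ eqL2 dx psi (A phi).

Definition inversion phi x : R[i] := (modulus dx x)^-1%:C * phi x^-1.

Definition fourierL2 := extensionL2 dx dx (fourier dx).

(* For phi in schwartz_bruhat0 all the integrals below converge absolutely. *)
Definition conductor phi x : R[i] :=
  (ln (modulus dx x))%:C * phi x +
  fourier dx (fun y => (ln (modulus dx y))%:C * fourier_inv dx phi y) x.

Definition cpow (r : R) (s : R[i]) : R[i] :=
  (r `^ complex.Re s)%:C * expi (complex.Im s * ln r).

(* The Fourier transform of a tempered distribution T is phi |-> T(F phi). *)
Definition is_gamma := forall (chi : Xnu) (s : R[i]),
  0 < complex.Re s < 1 -> forall phi, schwartz_bruhat phi ->
    cintegral dx (fun x => chi x * cpow (modulus dx x) (s - 1) * fourier dx phi x)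
    = Gamma chi s *
      cintegral dx (fun y => (chi y)^-1 * cpow (modulus dx y) (- s) * phi y).

Definition Lambda (chi : Xnu) (s : R[i]) : R[i] :=
  - (derive1 (Gamma chi) s / Gamma chi s).

End transport.

End local_field.

(* Main.v *)
(** With [zeta phi chi s] the integral of [chi(x)|x|^(s-1) phi(x)], the composite of the two isometries sends a rapidly decreasing [phi] to [alpha^-1 zeta phi chi 1/2], and the definition of Gamma is the functional equation [zeta (F phi) chi s = Gamma(chi,s) zeta phi chi^-1 (1-s)].

Using this equation twice, with [F(F phi)(x) = phi(-x)] and complex conjugation, gives [|Gamma(chi,1/2+it)| = 1]; hence F preserves the L2 norm up to a constant on [S_0], and since [S_0] is dense in L1 and L2 simultaneously and the graph of the isometry is closed, (2) extends from [S_0] to L2. The same identity makes [Gamma'/Gamma] real at [1/2]. (1) is the invariance of [d*t] and of [mu] under inversion.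

For (3), differentiating the functional equation at [s = 1/2] with [psi = F^-1 phi] gives [zeta' phi chi = Gamma' zeta psi chi^-1 - Gamma zeta' psi chi^-1], where [zeta'] is the transform of [log|x| phi]; the last term is cancelled by the transform of [F(log|y| psi)], which leaves [Gamma'/Gamma] times the transform of [phi]. Measurability of [Gamma(.,1/2)] and [Lambda(.,1/2)] comes from writing them locally as quotients of transforms of test functions. *)

Require Import Defs.
From HB Require Import structures.
From mathcomp Require Import all_boot all_order all_algebra all_field.
From mathcomp Require Import complex.
From mathcomp Require Import all_classical all_reals all_analysis.
From mathcomp Require Import measurable_realfun.
From mathcomp Require Import zify ring lra.

Set Implicit Arguments.
Unset Strict Implicit.
Unset Printing Implicit Defensive.

Import Order.TTheory GRing.Theory Num.Theory.
Import numFieldNormedType.Exports.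
Import ComplexField.Normc.

Local Open Scope classical_set_scope.
Local Open Scope ring_scope.
Local Open Scope complex_scope.
(** * Complex L1 and L2 spaces *)

(** The structure of K is not given: it has to be drawn from completeness and the density of F.
    Bounded sets of rationals are totally bounded, so the closure of the rationals is locally
    compact. A finite basis of F over the rationals is then thinned to a family whose coordinates
    are bounded linear functions, a property that survives completion. The module is defined by Haar
    measure alone; as a ratio of volumes of balls it is a monotone function of v, and the powers of
    one small element give geometric series in place of polar coordinates.

    Gamma is known only through its functional equation, so its derivative at 1/2 comes from
    dividing by a zeta integral that does not vanish. For each character a bump concentrated at 1
    provides one; the same bumps give the sigma-finiteness of mu.

    Uniqueness of Haar measure is replaced by a single Tonelli identity, used for the module, for dt
    and for mu. L2 estimates rest on |z + w|^2 <= 2|z|^2 + 2|w|^2, so isometries appear with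
    constants such as 4 and 16; these suffice for closed graphs and injectivity. *)

Section complex_L2.
Context d (T : measurableType d) (R : realType).
Variable mu : {measure set T -> \bar R}.
Implicit Types (f g h : T -> R[i]) (z w : R[i]).

Lemma normcE2 z : normc z ^+ 2 = complex.Re z ^+ 2 + complex.Im z ^+ 2.
Proof. by case: z => a b /=; rewrite sqr_sqrtr// addr_ge0// sqr_ge0. Qed.

Lemma normcr_ge0 z : 0 <= normc z.
Proof. by case: z => a b; rewrite sqrtr_ge0. Qed.

Lemma normr_normc z : `|z| = (normc z)%:C.
Proof. by []. Qed.

Lemma normc_mul z w : normc (z * w) = normc z * normc w.
Proof. exact: normcM. Qed.

Lemma normc_opp z : normc (- z) = normc z.
Proof. exact: normcN. Qed.

Lemma normc_add z w : normc (z + w) <= normc z + normc w.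
Proof. exact: le_normcD. Qed.

Lemma normc_real (r : R) : normc (r%:C) = `|r|.
Proof. by rewrite /= expr0n addr0 sqrtr_sqr. Qed.

Lemma normc_conj z : normc (z^*) = normc z.
Proof. by case: z => a b /=; rewrite sqrrN. Qed.

Lemma normc_sub0 z w : normc (z - w) = 0 -> z = w.
Proof. by move/eq0_normc/eqP; rewrite subr_eq0 => /eqP. Qed.

Lemma normc_eq0 z : (normc z == 0) = (z == 0).
Proof.
apply/eqP/eqP => [/eq0_normc//|->]; exact: normc0.
Qed.

Lemma Re_le_normc z : `|complex.Re z| <= normc z.
Proof.
rewrite -(@ler_sqr _ `|_|) ?nnegrE ?normr_ge0 ?normcr_ge0//.
by rewrite normcE2 real_normK ?num_real// lerDl sqr_ge0.
Qed.

Lemma Im_le_normc z : `|complex.Im z| <= normc z.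
Proof.
rewrite -(@ler_sqr _ `|_|) ?nnegrE ?normr_ge0 ?normcr_ge0//.
by rewrite normcE2 real_normK ?num_real// lerDr sqr_ge0.
Qed.

Lemma normc_leD z : normc z <= `|complex.Re z| + `|complex.Im z|.
Proof.
rewrite -(@ler_sqr _ (normc z)) ?nnegrE ?addr_ge0 ?normr_ge0 ?normcr_ge0//.
rewrite normcE2 sqrrD !real_normK ?num_real//.
by rewrite lerD2r lerDl mulrn_wge0// mulr_ge0.
Qed.

Lemma ReD z w : complex.Re (z + w) = complex.Re z + complex.Re w.
Proof. by case: z w => [? ?] []. Qed.
Lemma ImD z w : complex.Im (z + w) = complex.Im z + complex.Im w.
Proof. by case: z w => [? ?] []. Qed.
Lemma ReN z : complex.Re (- z) = - complex.Re z.
Proof. by case: z. Qed.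
Lemma ImN z : complex.Im (- z) = - complex.Im z.
Proof. by case: z. Qed.
Lemma ReM z w : complex.Re (z * w) =
  complex.Re z * complex.Re w - complex.Im z * complex.Im w.
Proof. by case: z w => [? ?] []. Qed.
Lemma ImM z w : complex.Im (z * w) =
  complex.Re z * complex.Im w + complex.Im z * complex.Re w.
Proof. by case: z w => [? ?] []. Qed.
Lemma Re_conj z : complex.Re (z^*) = complex.Re z. Proof. by case: z. Qed.
Lemma Im_conj z : complex.Im (z^*) = - complex.Im z. Proof. by case: z. Qed.

Lemma complex_eq z w : complex.Re z = complex.Re w ->
  complex.Im z = complex.Im w -> z = w.
Proof. by case: z w => [a b] [a' b'] /= -> ->. Qed.

(** By the parallelogram identity the two sides differ by |z - w|^2. This replaces Minkowski's
    inequality, so that all L2 estimates stay on squared norms. *)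
Lemma sqnormcD z w : normc (z + w) ^+ 2 <= 2 * normc z ^+ 2 + 2 * normc w ^+ 2.
Proof.
rewrite !normcE2 ReD ImD.
set a := complex.Re z; set b := complex.Im z.
set c := complex.Re w; set e := complex.Im w.
rewrite -subr_ge0.
suff -> : 2 * (a ^+ 2 + b ^+ 2) + 2 * (c ^+ 2 + e ^+ 2) -
  ((a + c) ^+ 2 + (b + e) ^+ 2) = (a - c) ^+ 2 + (b - e) ^+ 2.
  by rewrite addr_ge0 ?sqr_ge0.
by ring.
Qed.

Lemma cmeas_cst z : cmeasurable (fun _ : T => z).
Proof. by split; exact: measurable_cst. Qed.

Lemma cmeasD f g : cmeasurable f -> cmeasurable g ->
  cmeasurable (fun x => f x + g x).
Proof.
move=> [f1 f2] [g1 g2]; split.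
  by under eq_fun do rewrite ReD; exact: measurable_funD.
by under eq_fun do rewrite ImD; exact: measurable_funD.
Qed.

Lemma cmeasM f g : cmeasurable f -> cmeasurable g ->
  cmeasurable (fun x => f x * g x).
Proof.
move=> [f1 f2] [g1 g2]; split.
  under eq_fun do rewrite ReM.
  by apply: measurable_funB; exact: measurable_funM.
under eq_fun do rewrite ImM.
by apply: measurable_funD; exact: measurable_funM.
Qed.

Lemma cmeasZ z f : cmeasurable f -> cmeasurable (fun x => z * f x).
Proof. by move=> mf; apply: cmeasM => //; exact: cmeas_cst. Qed.

Lemma cmeasN f : cmeasurable f -> cmeasurable (fun x => - f x).
Proof. by move/(cmeasZ (-1)); under eq_fun do rewrite mulN1r. Qed.

Lemma cmeasB f g : cmeasurable f -> cmeasurable g ->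
  cmeasurable (fun x => f x - g x).
Proof. by move=> mf mg; apply: cmeasD => //; exact: cmeasN. Qed.

Lemma cmeas_conj f : cmeasurable f -> cmeasurable (fun x => (f x)^*).
Proof.
move=> [f1 f2]; split; first by under eq_fun do rewrite Re_conj.
under eq_fun do rewrite Im_conj.
by apply: measurableT_comp => //.
Qed.

Lemma cmeas_real (r : T -> R) : measurable_fun setT r ->
  cmeasurable (fun x => (r x)%:C).
Proof. by move=> mr; split => //=; exact: measurable_cst. Qed.

Lemma measurable_sqnormc f : cmeasurable f ->
  measurable_fun setT (fun x => normc (f x) ^+ 2).
Proof.
move=> [f1 f2]; under eq_fun do rewrite normcE2.
by apply: measurable_funD; apply: measurable_funX.
Qed.

Lemma measurable_normc f : cmeasurable f ->
  measurable_fun setT (fun x => normc (f x)).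
Proof.
move=> mf.
have -> : (fun x => normc (f x)) = Num.sqrt \o (fun x => normc (f x) ^+ 2).
  by apply/funext => x /=; rewrite sqrtr_sqr ger0_norm// normcr_ge0.
apply: measurableT_comp; last exact: measurable_sqnormc.
by apply: continuous_measurable_fun; exact: sqrt_continuous.
Qed.

(** The inverse of a nonnegative real is its power -1, also at 0 where both are 0 by convention, and
    [powR] is measurable. *)
Lemma measurable_inv_ge0 (r : T -> R) : (forall x, 0 <= r x) ->
  measurable_fun setT r -> measurable_fun setT (fun x => (r x)^-1).
Proof.
move=> r0 mr; under eq_fun do rewrite -powR_inv1//.
by apply: (measurableT_comp (measurable_powR (-1))).
Qed.

Lemma cmeasV f : cmeasurable f -> cmeasurable (fun x => (f x)^-1).
Proof.
move=> mf.
have -> : (fun x => (f x)^-1) = (fun x => ((normc (f x) ^+ 2)^-1)%:C * (f x)^*).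
  apply/funext => x; have [->|fx0] := eqVneq (f x) 0.
    by rewrite invr0 rmorph0 mulr0.
  apply: (mulfI fx0); rewrite divff// mulrCA.
  have -> : f x * (f x)^* = (normc (f x) ^+ 2)%:C.
    apply: complex_eq; rewrite ?ReM ?ImM Re_conj Im_conj ?normcE2/=; ring.
  by rewrite -rmorphM/= mulVf// expf_neq0// normc_eq0.
apply: cmeasM; last exact: cmeas_conj.
apply: cmeas_real; apply: measurable_inv_ge0; last exact: measurable_sqnormc.
by move=> x; exact: sqr_ge0.
Qed.

Lemma measurable_sqnormE f : cmeasurable f ->
  measurable_fun setT (fun x => (normc (f x) ^+ 2)%:E).
Proof. by move=> mf; apply/measurable_EFinP; exact: measurable_sqnormc. Qed.

Lemma sqnormE_ge0 z : (0 <= (normc z ^+ 2)%:E)%E.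
Proof. by rewrite lee_fin sqr_ge0. Qed.

Lemma sqnorm_ge0 f : (0 <= sqnormL2 mu f)%E.
Proof. by apply: integral_ge0 => x _; exact: sqnormE_ge0. Qed.

Lemma le_sqnorm f g : cmeasurable f -> cmeasurable g ->
  (forall x, normc (f x) <= normc (g x)) -> (sqnormL2 mu f <= sqnormL2 mu g)%E.
Proof.
move=> mf mg fg; apply: ge0_le_integral => //.
- by move=> x _; exact: sqnormE_ge0.
- exact: measurable_sqnormE.
- exact: measurable_sqnormE.
- move=> x _; rewrite lee_fin ler_sqr ?nnegrE ?normcr_ge0//.
Qed.

Lemma sqnormZ z f : cmeasurable f ->
  sqnormL2 mu (fun x => (z * f x)%R) = ((normc z ^+ 2)%:E * sqnormL2 mu f)%E.
Proof.
move=> mf; rewrite /sqnormL2.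
under eq_integral do rewrite normc_mul exprMn EFinM.
rewrite ge0_integralZl_EFin ?sqr_ge0//; last exact: measurable_sqnormE.
by move=> x _; exact: sqnormE_ge0.
Qed.

Lemma sqnormN f : sqnormL2 mu (fun x => (- f x)%R) = sqnormL2 mu f.
Proof. by rewrite /sqnormL2; under eq_integral do rewrite normc_opp. Qed.

Lemma sqnormC f g : sqnormL2 mu (fun x => (f x - g x)%R) =
  sqnormL2 mu (fun x => (g x - f x)%R).
Proof. by rewrite -sqnormN; congr sqnormL2; apply/funext=> x; rewrite opprB. Qed.

Lemma sqnormD f g : cmeasurable f -> cmeasurable g ->
  (sqnormL2 mu (fun x => (f x + g x)%R) <=
   2%:E * sqnormL2 mu f + 2%:E * sqnormL2 mu g)%E.
Proof.
move=> mf mg.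
rewrite -!ge0_integralZl_EFin//; try exact: measurable_sqnormE;
  try (by move=> x _; exact: sqnormE_ge0).
rewrite -ge0_integralD//; first last.
- by apply: emeasurable_funM => //; exact: measurable_sqnormE.
- by move=> x _; rewrite mule_ge0 ?sqnormE_ge0.
- by apply: emeasurable_funM => //; exact: measurable_sqnormE.
- by move=> x _; rewrite mule_ge0 ?sqnormE_ge0.
apply: ge0_le_integral => //.
- by move=> x _; exact: sqnormE_ge0.
- by apply: measurable_sqnormE; exact: cmeasD.
- by apply: emeasurable_funD; apply: emeasurable_funM => //;
    exact: measurable_sqnormE.
- by move=> x _; rewrite -!EFinM -EFinD lee_fin sqnormcD.
Qed.

Lemma sqnormB f g h : cmeasurable f -> cmeasurable g -> cmeasurable h ->
  (sqnormL2 mu (fun x => (f x - h x)%R) <=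
   2%:E * sqnormL2 mu (fun x => (f x - g x)%R) +
   2%:E * sqnormL2 mu (fun x => (g x - h x)%R))%E.
Proof.
move=> mf mg mh.
have -> : (fun x => f x - h x) = (fun x => (f x - g x) + (g x - h x)).
  by apply/funext => x; rewrite addrA subrK.
by apply: sqnormD; exact: cmeasB.
Qed.

Lemma L2_cmeas f : L2 mu f -> cmeasurable f. Proof. by case. Qed.

Lemma L2D f g : L2 mu f -> L2 mu g -> L2 mu (fun x => f x + g x).
Proof.
move=> [mf lf] [mg lg]; split; first exact: cmeasD.
apply: le_lt_trans (sqnormD mf mg) _.
by rewrite lte_add_pinfty// lte_mul_pinfty.
Qed.

Lemma L2Z z f : L2 mu f -> L2 mu (fun x => z * f x).
Proof.
move=> [mf lf]; split; first exact: cmeasZ.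
by rewrite sqnormZ// lte_mul_pinfty// lee_fin sqr_ge0.
Qed.

Lemma L2N f : L2 mu f -> L2 mu (fun x => - f x).
Proof. by move=> [mf lf]; split; [exact: cmeasN|rewrite sqnormN]. Qed.

Lemma L2B f g : L2 mu f -> L2 mu g -> L2 mu (fun x => f x - g x).
Proof. by move=> Lf Lg; apply: L2D => //; exact: L2N. Qed.

Lemma L2_0 : L2 mu (fun=> 0).
Proof.
split; first exact: cmeas_cst.
by rewrite /sqnormL2 integral0_eq// => x _; rewrite normc0 expr0n.
Qed.

Lemma eqL2_sqnorm f g : cmeasurable f -> cmeasurable g -> eqL2 mu f g ->
  sqnormL2 mu f = sqnormL2 mu g.
Proof.
move=> mf mg fg; apply: ge0_ae_eq_integral => //.
- exact: measurable_sqnormE.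
- exact: measurable_sqnormE.
- by move=> x _; exact: sqnormE_ge0.
- by move=> x _; exact: sqnormE_ge0.
- by apply: filterS fg => x -> .
Qed.

Lemma sqnorm_eq0 f : cmeasurable f -> sqnormL2 mu f = 0%E ->
  eqL2 mu f (fun=> 0).
Proof.
move=> mf f0.
have : (\int[mu]_x `|(normc (f x) ^+ 2)%:E| = 0)%E.
  rewrite -[RHS]f0; apply: eq_integral => x _.
  by rewrite gee0_abs// sqnormE_ge0.
move/(ae_eq_integral_abs mu measurableT (measurable_sqnormE mf)).
apply: filterS => x /(_ I) /=; case => /eqP.
by rewrite sqrf_eq0 normc_eq0 => /eqP.
Qed.

Lemma sqnormB_eq0 f g : cmeasurable f -> cmeasurable g ->
  sqnormL2 mu (fun x => (f x - g x)%R) = 0%E <-> eqL2 mu f g.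
Proof.
move=> mf mg; split=> [/sqnorm_eq0 h|fg].
  by apply: filterS (h (cmeasB mf mg)) => x /eqP; rewrite subr_eq0 => /eqP.
rewrite (@eqL2_sqnorm _ (fun=> 0)) ?(L2_0).
- by rewrite /sqnormL2 integral0_eq// => x _; rewrite normc0 expr0n.
- exact: cmeasB.
- exact: cmeas_cst.
- by apply: filterS fg => x ->; rewrite subrr.
Qed.

Lemma cvgL2P (u : nat -> T -> R[i]) f : cvgL2 mu u f <->
  forall e : R, 0 < e -> exists N, forall n, (N <= n)%N ->
    (sqnormL2 mu (fun x => (u n x - f x)%R)  <= e%:E)%E.
Proof.
split=> [/fine_cvgP[fu] /cvgrPdist_le cu e e0|H].
  have := cu _ e0; case: fu => N1 _ h1 [N2 _ h2].
  exists (maxn N1 N2) => n; rewrite geq_max => /andP[n1 n2].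
  rewrite -(fineK (h1 n n1)) lee_fin.
  have /= := h2 n n2; rewrite sub0r normrN; apply: le_trans.
  by rewrite ler_norm.
apply/fine_cvgP; split.
  have [N hN] := H 1 ltr01; exists N => // n /= /hN.
  rewrite ge0_fin_numE ?sqnorm_ge0//.
  by move=> h; apply: le_lt_trans h _; rewrite ltry.
apply/cvgrPdist_le => e e0.
have [N hN] := H e e0; exists N => // n /= /hN h.
rewrite sub0r normrN ger0_norm ?fine_ge0 ?sqnorm_ge0//.
rewrite -lee_fin fineK// ge0_fin_numE ?sqnorm_ge0//.
by apply: le_lt_trans h _; rewrite ltry.
Qed.

Lemma cvgL2_invn (u : nat -> T -> R[i]) f :
  (forall n, (sqnormL2 mu (fun x => (u n x - f x)%R) <= n.+1%:R^-1%:E)%E) ->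
  cvgL2 mu u f.
Proof.
move=> h; apply/cvgL2P => e e0.
have [N hN] : exists N, N.+1%:R^-1 < e :> R.
  have /cvgrPdist_lt/(_ _ e0)[N _ hN] := @cvg_harmonic R.
  by exists N; have := hN N (leqnn N); rewrite /= sub0r normrN ger0_norm.
exists N => n Nn; apply: le_trans (h n) _.
rewrite lee_fin (le_trans _ (ltW hN))// lef_pV2 ?posrE ?ltr0n//.
by rewrite ler_nat ltnS.
Qed.

Lemma le_eps_eq0 (x : \bar R) : (0 <= x)%E ->
  (forall e : R, 0 < e -> (x <= e%:E)%E) -> x = 0%E.
Proof.
move=> x0 h; apply/eqP; rewrite eq_le x0 andbT.
by apply/lee_addgt0Pr => e e0; rewrite add0e h.
Qed.

(** Shifting the sequence by N keeps its limit, so Fatou's lemma only meets the integrals that are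
    bounded. *)
Lemma fatou_le (F : nat -> T -> \bar R) (f : T -> \bar R) (C : \bar R) N :
  (forall n, measurable_fun setT (F n)) -> (forall n x, (0 <= F n x)%E) ->
  (forall x, F^~ x @ \oo --> f x) ->
  (forall n, (N <= n)%N -> (\int[mu]_x F n x <= C)%E) ->
  (\int[mu]_x f x <= C)%E.
Proof.
move=> mF F0 Ff FC.
pose F' n := F (n + N)%N.
have -> : f = fun x => limn_einf (F'^~ x).
  apply/funext => x; apply/esym.
  have : F'^~ x @ \oo --> f x.
    by have := Ff x; rewrite -(cvg_shiftn N).
  by move/cvg_limn_einf_sup => [].
apply: le_trans (fatou mu measurableT _ _) _; rewrite /F' //.
rewrite limn_einf_lim; apply: lime_le; first exact: is_cvg_einfs.
near=> n; apply: le_trans (FC (n + N)%N (leq_addl _ _)).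
by apply: ereal_inf_lbound; exists n => /=.
Unshelve. all: by end_near. Qed.

Section riesz_fischer.
Variable u : nat -> T -> R[i].
Hypothesis Lu : forall n, L2 mu (u n).
Hypothesis Cu : forall e : R, 0 < e -> exists N, forall m n,
  (N <= m)%N -> (N <= n)%N -> (sqnormL2 mu (fun x => (u m x - u n x)%R) <= e%:E)%E.

(** Squared increments of size 8^-j leave room for a weight 4^j: the weighted squares have integrals
    at most 2^-j, while the weight forces the increments to decay like 2^-j pointwise. *)
Lemma L2_fast_subseq : exists k : nat -> nat,
  [/\ forall j, (j <= k j)%N & forall j m n, (k j <= m)%N -> (k j <= n)%N ->
  (sqnormL2 mu (fun x => (u m x - u n x)%R) <= ((8^-1) ^+ j)%:E)%E].
Proof.
have e0 j : 0 < (8^-1 : R) ^+ j by rewrite exprn_gt0// invr_gt0.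
have /choice[k hk] j := Cu (e0 j).
exists (fun j => maxn j (k j)); split=> [j|j m n]; first exact: leq_maxl.
by rewrite !geq_max => /andP[_ ?] /andP[_ ?]; exact: hk.
Qed.

(** A finite weighted sum S bounds each increment by sqrt S times 2^-j, so the real and imaginary
    parts are telescoping series dominated by a geometric one. *)
Lemma fast_cvg (z : nat -> R[i]) :
  (\sum_(0 <= j <oo) (4 ^+ j * normc (z j.+1 - z j) ^+ 2)%:E < +oo)%E ->
  cvgn (fun j => complex.Re (z j)) /\ cvgn (fun j => complex.Im (z j)).
Proof.
pose a j : \bar R := (4 ^+ j * normc (z j.+1 - z j) ^+ 2)%:E.
move=> hS0; have hS : (\sum_(0 <= j <oo) a j < +oo)%E := hS0.
have a0 j : (0 <= a j)%E.
  by rewrite lee_fin mulr_ge0 ?sqr_ge0 ?exprn_ge0.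
pose S := fine (\sum_(0 <= j <oo) a j)%E.
have SE : S%:E = (\sum_(0 <= j <oo) a j)%E.
  by rewrite fineK// ge0_fin_numE// nneseries_ge0.
have aS j : 4 ^+ j * normc (z j.+1 - z j) ^+ 2 <= S.
  rewrite -lee_fin SE.
  have := @nneseries_lim_ge R a xpredT 0%N j.+1 (fun n _ _ => a0 n).
  apply: le_trans; rewrite big_nat_recr//= leeDr//.
  by apply: sume_ge0.
have S0 : 0 <= S by rewrite fine_ge0// nneseries_ge0.
have dz j : normc (z j.+1 - z j) <= geometric (Num.sqrt S) 2^-1 j.
  have g0 : 0 <= geometric (Num.sqrt S) 2^-1 j.
    by rewrite /= mulr_ge0 ?sqrtr_ge0 ?exprn_ge0.
  rewrite -(@ler_sqr _ (normc _)) ?nnegrE ?normcr_ge0//.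
  rewrite /= exprMn sqr_sqrtr// -exprM mulnC exprM.
  have -> : (2^-1 : R) ^+ 2 = 4^-1 by field.
  by rewrite exprVn ler_pdivlMr ?exprn_gt0// mulrC.
have key (p : R[i] -> R) : (forall z w, p (z - w) = p z - p w) ->
    (forall z, `|p z| <= normc z) -> cvgn (fun j => p (z j)).
  move=> pB pn.
  have -> : (fun n => p (z n)) = (fun n => series (fun j => p (z j.+1 - z j)) n + p (z 0%N)).
    apply/funext => n /=; rewrite /series/=.
    under eq_bigr do rewrite pB.
    by rewrite telescope_sumr// subrK.
  apply: is_cvgD; last exact: is_cvg_cst.
  apply: normed_cvg.
  apply: (@series_le_cvg _ _ (geometric (Num.sqrt S) 2^-1)).
  - by move=> n /=; exact: normr_ge0.
  - by move=> n; rewrite mulr_ge0 ?sqrtr_ge0// exprn_ge0.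
  - by move=> n /=; apply: le_trans (pn _) (dz n).
  - by apply: is_cvg_geometric_series; rewrite ger0_norm// invf_lt1// ltr1n.
split; apply: key.
- by move=> ? ?; rewrite ReD ReN.
- exact: Re_le_normc.
- by move=> ? ?; rewrite ImD ImN.
- exact: Im_le_normc.
Qed.

Theorem riesz_fischer : exists2 g, L2 mu g & cvgL2 mu u g.
Proof.
have [k [jk hk]] := L2_fast_subseq.
(* Partial sums make the indices nondecreasing while keeping [k j <= l j]. *)
pose l j := (\sum_(i < j.+1) k i)%N.
have kl j : (k j <= l j)%N by rewrite /l big_ord_recr/= leq_addl.
have lS j : (l j <= l j.+1)%N by rewrite {2}/l big_ord_recr/= leq_addr.
have hl j : (sqnormL2 mu (fun x => (u (l j.+1) x - u (l j) x)%R) <=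
   ((8^-1) ^+ j)%:E)%E by apply: hk => //; apply: leq_trans (kl j) _.
pose w j := u (l j).
pose a j x := (4 ^+ j * normc (w j.+1 x - w j x) ^+ 2)%:E.
have mw j : cmeasurable (w j) by case: (Lu (l j)).
have ma j : measurable_fun setT (a j).
  apply/measurable_EFinP; apply: measurable_funM => //.
  by apply: measurable_sqnormc; exact: cmeasB.
have a0 j x : (0 <= a j x)%E by rewrite lee_fin mulr_ge0 ?sqr_ge0 ?exprn_ge0.
pose S x := (\sum_(0 <= j <oo) a j x)%E.
have mS : measurable_fun setT S.
  by apply: ge0_emeasurable_sum.
have iS : (\int[mu]_x S x < +oo)%E.
  rewrite integral_nneseries//.
  apply: (@le_lt_trans _ _ (\sum_(0 <= j <oo) ((2^-1 : R) ^+ j)%:E)%E).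
    apply: lee_nneseries => [j _ _|j _]; first by apply: integral_ge0.
    rewrite /a; under eq_integral do rewrite EFinM.
    rewrite ge0_integralZl_EFin ?exprn_ge0//; first last.
    - by apply: measurable_sqnormE; exact: cmeasB.
    - by move=> x _; exact: sqnormE_ge0.
    have -> : ((2^-1 : R) ^+ j)%:E = ((4 ^+ j)%:E * ((8^-1 : R) ^+ j)%:E)%E.
      by rewrite -EFinM -exprMn; congr ((_ ^+ _)%:E); lra.
    by apply: lee_wpmul2l; [rewrite lee_fin exprn_ge0|exact: hl].
  have -> : (\sum_(0 <= j <oo) ((2^-1 : R) ^+ j)%:E)%E = 2%:E.
    have := @cvg_geometric_eseries_half R 2 0.
    have := @cvg_geometric_series R 1 2^-1.
    rewrite ger0_norm// invf_lt1// ltr1n => /(_ isT) h _.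
    have e1 : (fun n => (\sum_(0 <= j < n) ((2^-1 : R) ^+ j)%:E)%E) =
       EFin \o series (geometric 1 2^-1).
      apply/funext => n /=; rewrite /series/= sumEFin; congr EFin.
      by apply: eq_bigr => i _; rewrite /= mul1r.
    rewrite e1; apply/cvg_lim => //.
    apply: cvg_EFin; first by near=> n.
    have -> : fine \o (EFin \o series (geometric 1 2^-1)) = series (geometric (1:R) 2^-1) by [].
    have e2 : 1 / (1 - 2^-1) = 2 :> R by field.
    by rewrite -[in X in _ --> X]e2.
  by rewrite ltry.
pose G := [set x | (S x < +oo)%E].
have mG : measurable G.
  by rewrite -[G]setTI; apply: emeasurable_fun_infty_o.
have aeG : {ae mu, forall x, G x}.
  have : mu.-integrable setT S.
    apply/integrableP; split => //.
    by under eq_integral do rewrite gee0_abs ?nneseries_ge0//.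
  move/(integrable_ae measurableT); apply: filterS => x /(_ I).
  by rewrite ge0_fin_numE// nneseries_ge0.
(* Outside the full-measure set where the weighted sum is finite the subsequence is replaced by 0,
   so that its limit exists everywhere and is measurable. *)
pose w' j x := (\1_G x)%:C * w j x.
have mw' j : cmeasurable (w' j).
  by apply: cmeasM => //; apply: cmeas_real; exact: measurable_indic.
have cw' x : cvgn (fun j => complex.Re (w' j x)) /\
             cvgn (fun j => complex.Im (w' j x)).
  have [Gx|nGx] := pselect (G x).
    have [h1 h2] := @fast_cvg (w^~ x) Gx.
    have E j : w' j x = w j x by rewrite /w' indicE mem_set// mul1r.
    by split; under eq_fun do rewrite E.
  have E j : w' j x = 0 by rewrite /w' indicE memNset// mul0r.
  by split; under eq_fun do rewrite E; exact: is_cvg_cst.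
pose g x : R[i] := limn (fun j => complex.Re (w' j x)) +i*
                   limn (fun j => complex.Im (w' j x)).
have mg : cmeasurable g.
  split.
    apply: (@measurable_fun_cvg _ _ _ _ (fun j x => complex.Re (w' j x))).
      by move=> j; case: (mw' j).
    by move=> x _; case: (cw' x).
  apply: (@measurable_fun_cvg _ _ _ _ (fun j x => complex.Im (w' j x))).
    by move=> j; case: (mw' j).
  by move=> x _; case: (cw' x).
(* Fatou in the second index carries the Cauchy bound on [u m - w n] to the limit in n; hence the
   whole sequence converges, not only the subsequence. *)
have key j m : (k j <= m)%N ->
    (sqnormL2 mu (fun x => (u m x - g x)%R) <= ((8^-1) ^+ j)%:E)%E.
  move=> jm.
  pose F n x : \bar R := (normc (u m x - w' n x) ^+ 2)%:E.
  have mF n : measurable_fun setT (F n).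
    by apply: measurable_sqnormE; apply: cmeasB => //; case: (Lu m).
  have cF x : F^~ x @ \oo --> (normc (u m x - g x) ^+ 2)%:E.
    have [c1 c2] := cw' x.
    apply: cvg_EFin; first by near=> n.
    have -> : fine \o F^~ x = fun n =>
      (complex.Re (u m x) - complex.Re (w' n x)) ^+ 2 +
      (complex.Im (u m x) - complex.Im (w' n x)) ^+ 2.
      by apply/funext => n /=; rewrite normcE2 ReD ImD ReN ImN.
    rewrite normcE2 ReD ImD ReN ImN /=.
    apply: cvgD; rewrite !expr2; apply: cvgM; apply: cvgB => //;
      exact: cvg_cst.
  have E n : (\int[mu]_x F n x)%E = sqnormL2 mu (fun x => (u m x - w n x)%R).
    apply: ge0_ae_eq_integral => //.
    - by apply: measurable_sqnormE; apply: cmeasB => //; case: (Lu m).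
    - by move=> x _; rewrite lee_fin sqr_ge0.
    - by move=> x _; rewrite lee_fin sqr_ge0.
    - apply: filterS aeG => x Gx _.
      by rewrite /F /w' indicE mem_set// mul1r.
  apply: (@fatou_le F _ _ j) => // [n x|n jn].
    by rewrite lee_fin sqr_ge0.
  rewrite E; apply: hk => //; apply: leq_trans (kl j) _.
  rewrite -(subnKC jn); elim: (n - j)%N => [|q IH]; first by rewrite addn0.
  by rewrite addnS; apply: leq_trans IH _.
exists g.
  split => //; have [k0 _] := (jk 0%N, I).
  have Lk := Lu (k 0%N).
  have -> : g = fun x => u (k 0%N) x - (u (k 0%N) x - g x).
    by apply/funext => x; rewrite opprB addrC subrK.
  suff : L2 mu (fun x => u (k 0%N) x - (u (k 0%N) x - g x)) by case.
  apply: L2B => //; split; first by apply: cmeasB => //; case: Lk.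
  by apply: le_lt_trans (key 0%N _ (leqnn _)) _; rewrite ltry.
apply/cvgL2P => e e0.
have [N hN] : exists N, (8^-1 : R) ^+ N <= e.
  have : (geometric 1 (8^-1 : R)) @ \oo --> (0:R).
    by apply: cvg_geometric; rewrite ger0_norm// invf_lt1// ltr1n.
  move=> /cvgrPdist_le/(_ _ e0)[N _ h].
  exists N; have := h N (leqnn N).
  by rewrite /= sub0r normrN mul1r ger0_norm// exprn_ge0.
exists (k N) => n kn; apply: le_trans (key N n kn) _.
by rewrite lee_fin.
Unshelve. all: by end_near. Qed.

End riesz_fischer.

End complex_L2.

Section complex_L1.
Context d (T : measurableType d) (R : realType).
Variable mu : {measure set T -> \bar R}.
Implicit Types (f g h : T -> R[i]) (z w : R[i]).

Lemma L1_cmeas f : L1 mu f -> cmeasurable f.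
Proof. by move=> [/integrableP[/measurable_EFinP ? _] /integrableP[/measurable_EFinP ? _]]. Qed.

Definition norm1 f : \bar R := (\int[mu]_x (normc (f x))%:E)%E.

Lemma norm1_ge0 f : (0 <= norm1 f)%E.
Proof. by apply: integral_ge0 => x _; rewrite lee_fin normcr_ge0. Qed.

Lemma measurable_normE f : cmeasurable f ->
  measurable_fun setT (fun x => (normc (f x))%:E).
Proof. by move=> mf; apply/measurable_EFinP; exact: measurable_normc. Qed.

Lemma L1P f : L1 mu f <-> cmeasurable f /\ (norm1 f < +oo)%E.
Proof.
split=> [Lf|[mf lf]].
  have mf := L1_cmeas Lf; split=> //.
  case: Lf => /integrableP[m1 l1] /integrableP[m2 l2].
  apply: (@le_lt_trans _ _ (\int[mu]_x (`|complex.Re (f x)|%:E + `|complex.Im (f x)|%:E))%E).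
    apply: ge0_le_integral => //.
    - by move=> x _; rewrite lee_fin normcr_ge0.
    - exact: measurable_normE.
    - apply: emeasurable_funD; apply/measurable_EFinP; apply: measurableT_comp => //;
        by case: mf.
    - by move=> x _; rewrite -EFinD lee_fin normc_leD.
  rewrite ge0_integralD//.
  - by rewrite lte_add_pinfty.
  - by apply/measurable_EFinP; apply: measurableT_comp => //; case: mf.
  - by apply/measurable_EFinP; apply: measurableT_comp => //; case: mf.
have [m1 m2] := mf.
split; apply/integrableP; split; try exact/measurable_EFinP;
  apply: le_lt_trans _ lf; apply: ge0_le_integral => //;
  try exact: measurable_normE; try (by move=> x _; rewrite lee_fin ?Re_le_normc ?Im_le_normc);
  by apply: measurableT_comp => //; exact/measurable_EFinP.
Qed.

Lemma L1_le f (r : T -> R) : cmeasurable f ->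
  mu.-integrable setT (EFin \o r) -> (forall x, normc (f x) <= r x) -> L1 mu f.
Proof.
move=> mf /integrableP[mr lr] fr; apply/L1P; split => //.
apply: le_lt_trans _ lr; apply: ge0_le_integral => //.
- by move=> x _; rewrite lee_fin normcr_ge0.
- exact: measurable_normE.
- exact: measurableT_comp.
- by move=> x _; rewrite lee_fin (le_trans (fr x)) ?ler_norm.
Qed.

Lemma L1_integrable_normc f : L1 mu f ->
  mu.-integrable setT (EFin \o (fun x => normc (f x))).
Proof.
move=> /L1P[mf lf]; apply/integrableP; split; first exact: measurable_normE.
apply: le_lt_trans lf; apply: ge0_le_integral => //.
- apply: measurableT_comp => //; exact: measurable_normE.
- exact: measurable_normE.
- by move=> x _ /=; rewrite ger0_norm// normcr_ge0.
Qed.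

Lemma L1D f g : L1 mu f -> L1 mu g -> L1 mu (fun x => f x + g x).
Proof.
move=> [f1 f2] [g1 g2]; split.
  by under eq_fun do rewrite ReD EFinD; exact: integrableD.
by under eq_fun do rewrite ImD EFinD; exact: integrableD.
Qed.

Lemma L1Z z f : L1 mu f -> L1 mu (fun x => z * f x).
Proof.
move=> [f1 f2]; split.
  under eq_fun do rewrite ReM EFinB !EFinM.
  by apply: integrableB => //; exact: integrableZl.
under eq_fun do rewrite ImM EFinD !EFinM.
by apply: integrableD => //; exact: integrableZl.
Qed.

Lemma L1N f : L1 mu f -> L1 mu (fun x => - f x).
Proof. by move/(L1Z (-1)); under eq_fun do rewrite mulN1r. Qed.

Lemma L1B f g : L1 mu f -> L1 mu g -> L1 mu (fun x => f x - g x).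
Proof. by move=> Lf Lg; apply: L1D => //; exact: L1N. Qed.

Lemma cintegralD f g : L1 mu f -> L1 mu g ->
  cintegral mu (fun x => f x + g x) = cintegral mu f + cintegral mu g.
Proof.
move=> [f1 f2] [g1 g2]; apply: complex_eq; rewrite ?ReD ?ImD /=.
  by rewrite -RintegralD//; congr Rintegral; apply/funext => x; rewrite ReD.
by rewrite -RintegralD//; congr Rintegral; apply/funext => x; rewrite ImD.
Qed.

Lemma integrableZ_EFin (k : R) (p : T -> R) : mu.-integrable setT (EFin \o p) ->
  mu.-integrable setT (EFin \o (fun x => k * p x)).
Proof.
move=> ip; rewrite (_ : _ \o _ = fun x => (k%:E * (p x)%:E)%E).
  exact: integrableZl.
by apply/funext => x; rewrite /= EFinM.
Qed.

Lemma cintegralZ z f : L1 mu f ->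
  cintegral mu (fun x => z * f x) = z * cintegral mu f.
Proof.
move=> [f1 f2]; apply: complex_eq; rewrite ?ReM ?ImM /=.
  rewrite -!RintegralZl// -RintegralB//; try exact: integrableZ_EFin.
  by congr Rintegral; apply/funext => x; rewrite ReM.
rewrite -!RintegralZl// -RintegralD//; try exact: integrableZ_EFin.
by congr Rintegral; apply/funext => x; rewrite ImM.
Qed.

Lemma cintegralN f : L1 mu f ->
  cintegral mu (fun x => - f x) = - cintegral mu f.
Proof.
move=> Lf; rewrite -mulN1r -cintegralZ//.
by congr cintegral; apply/funext => x; rewrite mulN1r.
Qed.

Lemma cintegral_conj f : L1 mu f ->
  cintegral mu (fun x => (f x)^*) = (cintegral mu f)^*.
Proof.
move=> [f1 f2]; apply: complex_eq; rewrite ?Re_conj ?Im_conj /=.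
  by congr Rintegral; apply/funext => x; rewrite Re_conj.
rewrite -mulN1r -RintegralZl//.
by congr Rintegral; apply/funext => x; rewrite Im_conj mulN1r.
Qed.

(** Real and imaginary parts are bounded separately, which costs the factor 2. The bound serves only
    for finiteness and for limits. *)
Lemma normc_cintegral_le f : L1 mu f ->
  ((normc (cintegral mu f))%:E <= 2%:E * norm1 f)%E.
Proof.
move=> Lf; have [f1 f2] := Lf; have /L1P[mf lf] := Lf.
have [m1 m2] := mf.
have key (p : T -> R) : measurable_fun setT p -> mu.-integrable setT (EFin \o p) ->
   (forall x, `|p x| <= normc (f x)) -> (`|Rintegral mu setT p|%:E <= norm1 f)%E.
  move=> mp ip pf.
  have := le_normr_Rintegral measurableT ip; rewrite -lee_fin => /le_trans; apply.
  rewrite fineK.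
    apply: ge0_le_integral => //.
    - by apply/measurable_EFinP; exact: measurableT_comp.
    - exact: measurable_normE.
    - by move=> x _; rewrite lee_fin.
  rewrite ge0_fin_numE; last by apply: integral_ge0.
  by have /integrableP[] := ip.
have h := normc_leD (cintegral mu f).
rewrite -lee_fin EFinD in h; apply: le_trans h _.
rewrite (_ : 2%:E = 1%:E + 1%:E)%E; last by rewrite -EFinD.
rewrite ge0_muleDl// mul1e.
by apply: leeD; apply: key => // x; [exact: Re_le_normc|exact: Im_le_normc].
Qed.

End complex_L1.

Section sigma_finite_copy.
Context d (T : measurableType d) (R : realType) (mu : {measure set T -> \bar R}).

(* An alias carrying the sigma-finite instance, which Fubini's theorem needs. *)
Definition sfm (smu : sigma_finite setT mu) : set T -> \bar R := mu.

Variable smu : sigma_finite setT mu.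
HB.instance Definition _ := Measure.copy (sfm smu) mu.
HB.instance Definition _ :=
  Measure_isSigmaFinite.Build d T R (sfm smu) smu.

End sigma_finite_copy.

(** * Invariant measures *)

Section invariance.
Context d (T : measurableType d) (R : realType).
Implicit Types (mu nu : {measure set T -> \bar R}).

Definition preserves mu (h : T -> T) :=
  measurable_fun setT h /\ forall A, measurable A -> mu (h @^-1` A) = mu A.

Lemma transport_integral mu nu h (f : T -> \bar R) : measurable_fun setT h ->
  (forall A, measurable A -> mu (h @^-1` A) = nu A) ->
  measurable_fun setT f -> (forall x, (0 <= f x)%E) ->
  (\int[mu]_x f (h x) = \int[nu]_x f x)%E.
Proof.
move=> mh hmu mf f0.
have -> : (\int[mu]_x f (h x) = \int[pushforward mu h]_x f x)%E.
  by rewrite ge0_integral_pushforward// preimage_setT.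
apply: eq_measure_integral => A mA _; exact: hmu.
Qed.

Lemma preserves_integral mu h (f : T -> \bar R) : preserves mu h ->
  measurable_fun setT f -> (forall x, (0 <= f x)%E) ->
  (\int[mu]_x f (h x) = \int[mu]_x f x)%E.
Proof. by move=> [mh hmu]; exact: transport_integral. Qed.

Lemma preserves_sqnorm mu h (f : T -> R[i]) : preserves mu h ->
  cmeasurable f -> sqnormL2 mu (f \o h) = sqnormL2 mu f.
Proof.
move=> ph mf.
apply: (@preserves_integral mu h (fun x => (normc (f x) ^+ 2)%:E)) => //.
- exact: measurable_sqnormE.
- by move=> x; exact: sqnormE_ge0.
Qed.

Lemma cmeas_comp (h : T -> T) (f : T -> R[i]) : measurable_fun setT h ->
  cmeasurable f -> cmeasurable (f \o h).
Proof. by move=> mh [f1 f2]; split; apply: (measurableT_comp (f := fun x => _ (f x))). Qed.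

Lemma preserves_L2 mu h (f : T -> R[i]) : preserves mu h ->
  L2 mu f -> L2 mu (f \o h).
Proof.
move=> ph [mf lf]; split; last by rewrite preserves_sqnorm.
by apply: cmeas_comp => //; case: ph.
Qed.

Lemma preserves_integrable mu h (p : T -> R) : preserves mu h ->
  mu.-integrable setT (EFin \o p) -> mu.-integrable setT (EFin \o (p \o h)).
Proof.
move=> ph /integrableP[mp lp]; apply/integrableP; split.
  by apply: (measurableT_comp mp); case: ph.
rewrite (@preserves_integral mu h (fun x => `|(EFin \o p) x|%E))//.
exact: measurableT_comp.
Qed.

Lemma preserves_Rintegral mu h (p : T -> R) : preserves mu h ->
  mu.-integrable setT (EFin \o p) ->
  Rintegral mu setT (p \o h) = Rintegral mu setT p.
Proof.
move=> ph /integrableP[mp lp]; rewrite /Rintegral integralE [in RHS]integralE; congr (fine (_ - _)%E).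
  rewrite -(preserves_integral ph (f := ((EFin \o p)^\+)%E))//.
  - by apply: eq_integral => x _; rewrite !funeposE.
  - exact: measurable_funepos.
rewrite -(preserves_integral ph (f := ((EFin \o p)^\-)%E))//.
- by apply: eq_integral => x _; rewrite !funenegE.
- exact: measurable_funeneg.
Qed.

Lemma preserves_L1 mu h (f : T -> R[i]) : preserves mu h ->
  L1 mu f -> L1 mu (f \o h).
Proof.
by move=> ph [f1 f2]; split;
  apply: (preserves_integrable (p := fun x => _ (f x)) ph).
Qed.

Lemma preserves_cintegral mu h (f : T -> R[i]) : preserves mu h ->
  L1 mu f -> cintegral mu (f \o h) = cintegral mu f.
Proof.
move=> ph [f1 f2]; rewrite /cintegral.
by congr (_ +i* _); apply: (preserves_Rintegral (p := fun x => _ (f x)) ph).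
Qed.

Lemma integral_indicT mu (A : set T) : measurable A ->
  (\int[mu]_x (\1_A x)%:E = mu A)%E.
Proof. by move=> mA; rewrite integral_indic// setIT. Qed.

Lemma integrable_indic_fin mu (A : set T) : measurable A -> (mu A < +oo)%E ->
  mu.-integrable setT (fun x => (\1_A x)%:E).
Proof.
move=> mA lA; apply/integrableP; split.
  by apply/measurable_EFinP; exact: measurable_indic.
under eq_integral do rewrite gee0_abs ?lee_fin//.
by rewrite integral_indicT.
Qed.

Lemma pushforward_measure mu h : measurable_fun setT h ->
  exists nu : {measure set T -> \bar R}, forall A, nu A = mu (h @^-1` A).
Proof. by move=> mh; unshelve eexists (pushforward mu h : {measure set T -> \bar R}). Qed.

(** * Comparison of two invariant measures by Tonelli's theorem *)

Section haar_swap.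
(** [G] is a group of full measure inside [T]: all of K for addition, the complement of 0 for
    multiplication, all of [Xnu] for characters. The identities assumed are the ones that the
    substitutions in the double integral produce. *)
Variables (mul : T -> T -> T) (inv : T -> T) (G : set T).
Hypothesis mmul : measurable_fun setT (fun p : T * T => mul p.1 p.2).
Hypothesis minv : measurable_fun setT inv.
Hypothesis mulC : forall x y, mul x y = mul y x.
Hypothesis mulVK : forall x y, G x -> mul x (mul (inv x) y) = y.
Hypothesis invMK : forall x y, G y -> mul (inv (mul y x)) y = inv x.
Hypothesis invG : forall x, G x -> G (inv x).
Variables mu nu : {measure set T -> \bar R}.
Hypotheses (smu : sigma_finite setT mu) (snu : sigma_finite setT nu).
Hypotheses (mu0 : {ae mu, forall x, G x}) (nu0 : {ae nu, forall x, G x}).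
Hypothesis imu : forall t, G t -> preserves mu (mul t).
Hypothesis inu : forall t, G t -> preserves nu (mul t).

(* Fubini for f(xy)g(y), translating first x and then y by each other. *)
Lemma haar_swap (f g : T -> \bar R) :
  measurable_fun setT f -> (forall x, (0 <= f x)%E) ->
  measurable_fun setT g -> (forall x, (0 <= g x)%E) ->
  (\int[mu]_x f x * \int[nu]_x g x =
   \int[nu]_x f x * \int[mu]_x g (inv x))%E.
Proof.
move=> mf f0 mg g0.
pose m1 : {sigma_finite_measure set T -> \bar R} := sfm smu.
pose m2 : {sigma_finite_measure set T -> \bar R} := sfm snu.
have mfst : measurable_fun setT (fst : T * T -> T) by exact: measurable_fst.
have msnd : measurable_fun setT (snd : T * T -> T) by exact: measurable_snd.
pose F1 (p : T * T) := (f (mul p.1 p.2) * g p.2)%E.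
have mF1 : measurable_fun setT F1.
  apply: emeasurable_funM; first exact: (measurableT_comp mf).
  exact: (measurableT_comp mg).
have F10 p : (0 <= F1 p)%E by rewrite mule_ge0.
pose F2 (p : T * T) := (f p.2 * g (mul (inv p.1) p.2))%E.
have mF2 : measurable_fun setT F2.
  apply: emeasurable_funM; first exact: (measurableT_comp mf).
  apply: (measurableT_comp mg).
  apply: (measurableT_comp mmul (g := fun p : T * T => (inv p.1, p.2))).
  apply: measurable_fun_pair => //; exact: (measurableT_comp minv).
have F20 p : (0 <= F2 p)%E by rewrite mule_ge0.
have mint (m : {sigma_finite_measure set T -> \bar R}) (F : T * T -> \bar R) :
   measurable_fun setT F -> (forall p, 0 <= F p)%E ->
   measurable_fun setT (fun y => \int[m]_x F (x, y))%E.
  by move=> mF F0; exact: (measurable_fun_fubini_tonelli_G (m1 := m)).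
have mint' (m : {sigma_finite_measure set T -> \bar R}) (F : T * T -> \bar R) :
   measurable_fun setT F -> (forall p, 0 <= F p)%E ->
   measurable_fun setT (fun x => \int[m]_y F (x, y))%E.
  by move=> mF F0; exact: (measurable_fun_fubini_tonelli_F (m2 := m)).
transitivity (\int[m2]_y \int[m1]_x F1 (x, y))%E.
  rewrite muleC -ge0_integralZr//; last exact: integral_ge0.
  apply: ge0_ae_eq_integral => //.
  - apply: emeasurable_funM => //; exact: measurable_cst.
  - exact: (mint m1).
  - by move=> y _; rewrite mule_ge0// integral_ge0.
  - by move=> y _; rewrite integral_ge0.
  apply: filterS nu0 => y Gy _.
  rewrite -(preserves_integral (imu Gy) mf f0) muleC -ge0_integralZr//.
    by apply: eq_integral => x _; rewrite /F1 /= mulC.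
  apply: (measurableT_comp mf); by case: (imu Gy).
rewrite -(fubini_tonelli (m1 := m1) (m2 := m2))//.
transitivity (\int[m1]_x \int[m2]_y F2 (x, y))%E.
  apply: ge0_ae_eq_integral => //.
  - exact: (mint' m2).
  - exact: (mint' m2).
  - by move=> y _; rewrite integral_ge0.
  - by move=> y _; rewrite integral_ge0.
  apply: filterS mu0 => x Gx _.
  rewrite -(preserves_integral (inu (invG Gx)) (f := fun y => F1 (x, y)))//.
    by apply: eq_integral => y _; rewrite /F1 /F2 /= mulVK.
  exact: (measurableT_comp mF1).
rewrite (fubini_tonelli (m1 := m1) (m2 := m2))//.
rewrite -ge0_integralZr//; last exact: integral_ge0.
apply: ge0_ae_eq_integral => //.
- exact: (mint m1).
- apply: emeasurable_funM => //; exact: measurable_cst.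
- by move=> y _; rewrite integral_ge0.
- by move=> y _; rewrite mule_ge0// integral_ge0.
apply: filterS nu0 => y Gy _.
have mgi : measurable_fun setT (fun x => g (inv x)) by exact: (measurableT_comp mg).
rewrite /F2 /= ge0_integralZl//.
- congr (_ * _)%E.
  rewrite -(preserves_integral (imu Gy) (f := fun x => g (mul (inv x) y)))//.
    by apply: eq_integral => x _; rewrite invMK.
  apply: (measurableT_comp mg).
  apply: (measurableT_comp mmul (g := fun x => (inv x, y))).
  by apply: measurable_fun_pair => //; exact: measurable_cst.
- apply: (measurableT_comp mg).
  apply: (measurableT_comp mmul (g := fun x => (inv x, y))).
  by apply: measurable_fun_pair => //; exact: measurable_cst.
Qed.

End haar_swap.
End invariance.

(** * Topology of the completion of a number field *)

Section valued_topology.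
Context (R : realType) (K0 : fieldType) (v : absolute_value R K0).
Local Notation K := (valued v).
Implicit Types (x y z t : K).

Lemma vballE x e y : ball x e y <-> v (x - y) < e.
Proof. by rewrite ballEmdist. Qed.

Lemma vdistC x y : v (x - y) = v (y - x).
Proof. by rewrite -absvN opprB. Qed.

Lemma vnbhsP x (A : set K) :
  nbhs x A <-> exists2 e : R, 0 < e & forall y, v (y - x) < e -> A y.
Proof.
rewrite -nbhs_ballE; split=> [[e /= e0 he]|[e e0 he]]; exists e => // y.
  by move=> xy; apply: he; apply/vballE; rewrite vdistC.
by move/vballE => xy; apply: he; rewrite vdistC.
Qed.

Lemma vD_le x y : v (x + y) <= v x + v y. Proof. exact: absvD. Qed.
Lemma vB_le x y : v (x - y) <= v x + v y.
Proof. by rewrite -(absvN v y) absvD. Qed.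
Lemma vM x y : v (x * y) = v x * v y. Proof. exact: absvM. Qed.
Lemma v_ge0 x : 0 <= v x. Proof. exact: absv_ge0. Qed.
Lemma v_gt0 x : (0 < v x) = (x != 0).
Proof. by rewrite lt_def v_ge0 andbT absv_eq0. Qed.
Lemma vX x n : v (x ^+ n) = v x ^+ n.
Proof. by elim: n => [|n IH]; rewrite ?expr0 ?absv1// !exprS vM IH. Qed.
Lemma vV x : v x^-1 = (v x)^-1.
Proof.
have [->|x0] := eqVneq x 0; first by rewrite invr0 absv0 invr0.
have vx0 : v x != 0 by rewrite absv_eq0.
by apply: (mulfI vx0); rewrite -vM !divff// absv1.
Qed.
Lemma v_dist x y : `|v x - v y| <= v (x - y).
Proof.
have h a b : v a - v b <= v (a - b).
  by rewrite lerBlDr -{1}(subrK b a) absvD.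
by rewrite ler_norml h andbT lerNl opprB vdistC h.
Qed.
Lemma v_nat (n : nat) : v (n%:R : K) <= n%:R.
Proof.
elim: n => [|n IH]; first by rewrite absv0.
by rewrite -!natr1; apply: le_trans (vD_le _ _) _; rewrite absv1 lerD2r.
Qed.
Lemma v_sum (I : Type) (r : seq I) (P : pred I) (f : I -> K) :
  v (\sum_(i <- r | P i) f i) <= \sum_(i <- r | P i) v (f i).
Proof.
elim/big_rec2: _ => [|i y z _ IH]; first by rewrite absv0.
by apply: le_trans (vD_le _ _) _; rewrite lerD2l.
Qed.

Lemma v_eq0_le x : (forall e : R, 0 < e -> v x <= e) -> x = 0.
Proof.
move=> h; apply/eqP; rewrite -(absv_eq0 v) eq_le v_ge0 andbT.
by apply/ler_addgt0Pr => e e0; rewrite add0r h.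
Qed.

Lemma vhausdorff : hausdorff_space K.
Proof.
move=> x y; rewrite /cluster /= => h.
apply/eqP; rewrite -subr_eq0; apply/eqP; apply: v_eq0_le => e e0.
have e2 : 0 < e / 2 by rewrite divr_gt0.
have := h [set z | v (z - x) < e / 2] [set z | v (z - y) < e / 2].
case.
- by apply/vnbhsP; exists (e / 2).
- by apply/vnbhsP; exists (e / 2).
move=> z [/= zx zy].
have -> : x - y = (z - y) - (z - x) by ring.
apply: le_trans (vB_le _ _) _.
by rewrite [leRHS](splitr e); apply: lerD; exact: ltW.
Qed.

Lemma vcontinuous : continuous (fun x : K => v x).
Proof.
move=> x; apply/(@cvgrPdist_lt _ _ _ (nbhs (x : K))) => e e0; apply/vnbhsP; exists e => // y xy.
by apply: le_lt_trans (v_dist _ _) _; rewrite vdistC.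
Qed.

Lemma vcontP (T : topologicalType) (f : T -> K) (x : T) :
  (f @ x --> f x) <-> forall e : R, 0 < e -> \forall y \near x, v (f y - f x) < e.
Proof.
split=> [h e e0|h A /vnbhsP[e e0 eA]].
  by apply: (h [set z | v (z - f x) < e]); apply/vnbhsP; exists e.
by apply: filterS (h e e0) => y; exact: eA.
Qed.

Lemma vadd_continuous : continuous (fun p : K * K => (p.1 : K) + p.2 : K).
Proof.
move=> [x y]; apply/vcontP => e e0 /=.
have e2 : 0 < e / 2 by rewrite divr_gt0.
exists ([set z | v (z - x) < e / 2], [set z | v (z - y) < e / 2]) => /=.
  by split; apply/vnbhsP; exists (e / 2).
move=> [a b] /= [ax b_y].
have -> : a + b - (x + y) = (a - x) + (b - y) by ring.
apply: le_lt_trans (vD_le _ _) _.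
by rewrite [ltRHS](splitr e) ltrD.
Qed.

Lemma vmul_continuous : continuous (fun p : K * K => (p.1 : K) * p.2 : K).
Proof.
move=> [x y]; apply/vcontP => e e0 /=.
pose M := 1 + v x + v y.
have M0 : 0 < M by rewrite /M -addrA ltr_pwDl// addr_ge0 ?v_ge0.
pose dl := Num.min 1 (e / 2 / M).
have dl0 : 0 < dl by rewrite lt_min ltr01 !divr_gt0.
exists ([set z | v (z - x) < dl], [set z | v (z - y) < dl]) => /=.
  by split; apply/vnbhsP; exists dl.
move=> [a b] /= [ax b_y].
have -> : a * b - x * y = (a - x) * (b - y) + ((a - x) * y + x * (b - y)).
  by ring.
apply: le_lt_trans (vD_le _ _) _.
apply: le_lt_trans (lerD (lexx _) (vD_le _ _)) _.
rewrite !vM.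
have dl1 : dl <= 1 by rewrite ge_min lexx.
have dl2 : dl * M <= e / 2 by rewrite -ler_pdivlMr// ge_min lexx orbT.
apply: (@le_lt_trans _ _ (dl * M)); last first.
  by apply: le_lt_trans dl2 _; rewrite ltr_pdivrMr// ltr_pMr// ltr1n.
rewrite /M -addrA !mulrDr mulr1; apply: lerD.
  by rewrite -[leRHS]mulr1; apply: ler_pM; rewrite ?v_ge0 ?ltW// (lt_le_trans b_y).
rewrite addrC [v x * _]mulrC; apply: lerD; apply: ler_wpM2r; rewrite ?v_ge0 ?ltW//.
Qed.

Lemma vinv_continuous x : x != 0 -> ((fun y : K => y^-1) : K -> K) @ x --> x^-1.
Proof.
move=> x0; apply/vcontP => e e0.
have vx0 : 0 < v x by rewrite v_gt0.
pose dl := Num.min (v x / 2) (e * v x * v x / 2).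
have dl0 : 0 < dl by rewrite lt_min !divr_gt0// !mulr_gt0.
apply/vnbhsP; exists dl => // y; rewrite lt_min => /andP[y1 y2].
have vy : v x / 2 < v y.
  have := v_dist x y; rewrite vdistC => /(le_lt_trans)/(_ y1).
  by rewrite ltr_norml => /andP[_]; rewrite ltrBlDr -ltrBlDl {1}[v x]splitr addrK.
have y0 : y != 0 by rewrite -(v_gt0 y); apply: le_lt_trans vy; rewrite divr_ge0 ?v_ge0.
have -> : y^-1 - x^-1 = (x - y) / (x * y) by field; rewrite x0 y0.
rewrite vM vV vM ltr_pdivrMr ?mulr_gt0 ?v_gt0// vdistC.
apply: lt_le_trans y2 _.
rewrite -!mulrA ler_pM2l// ler_pM2l//.
exact: ltW.
Qed.

Lemma vcompact_bounded (A : set K) : compact A -> exists M : R, forall x, A x -> v x <= M.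
Proof.
move=> cA.
have := @continuous_compact _ _ (fun x : K => v x) A (continuous_subspaceT vcontinuous) cA.
move/compact_bounded => [M [_ hM]]; exists (M + 1) => x Ax.
have := hM (M + 1) _ (v x) _; rewrite /= ger0_norm ?v_ge0//; apply.
  by rewrite ltrDl.
by exists x.
Qed.

Lemma vclosed_ball (r : R) : closed [set x : K | v x <= r].
Proof.
apply: (@closed_comp _ _ (fun x : K => v x) [set s | s <= r]).
  by move=> x _; exact: vcontinuous.
exact: closed_le.
Qed.

Lemma vopen_ball x (r : R) : open [set y : K | v (y - x) < r].
Proof.
rewrite openE => y /= yr; apply/vnbhsP; exists (r - v (y - x)).
  by rewrite subr_gt0.
move=> z zy /=.
have -> : z - x = (z - y) + (y - x) by ring.
by apply: le_lt_trans (vD_le _ _) _; rewrite -ltrBrDr.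
Qed.

Lemma closureKP (A : set K) x : closure A x <->
  forall e : R, 0 < e -> exists2 y, A y & v (x - y) < e.
Proof.
split=> [h e e0|h B /vnbhsP[e e0 eB]].
  have [y [Ay /= xy]] : A `&` [set y | v (y - x) < e] !=set0.
    by apply: h; apply/vnbhsP; exists e.
  by exists y => //; rewrite vdistC.
have [y Ay xy] := h _ e0.
by exists y; split=> //; apply: eB; rewrite vdistC.
Qed.

Lemma vclosed_limP (A : set K) : closed A <->
  forall x, (forall e : R, 0 < e -> exists2 y, A y & v (x - y) < e) -> A x.
Proof. by split=> h x; [move/closureKP/h|move/closureKP/h]. Qed.

End valued_topology.

Section real_powers.
Variable R : realType.
Implicit Types a C e M : R.

Lemma pow_small a e : 0 <= a -> a < 1 -> 0 < e -> exists k, a ^+ k < e.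
Proof.
move=> a0 a1 e0.
have : (geometric 1 a) @ \oo --> (0:R) by apply: cvg_geometric; rewrite ger0_norm.
move=> /cvgrPdist_lt/(_ _ e0)[N _ h].
exists N; have := h N (leqnn N).
by rewrite /= sub0r normrN mul1r ger0_norm// exprn_ge0.
Qed.

Lemma pow_large a M : 1 < a -> exists k, M < a ^+ k.
Proof.
move=> a1; have a0 : 0 < a by exact: lt_trans a1.
have M0 : 0 < (1 + `|M|)^-1 by rewrite invr_gt0 ltr_pwDl.
have ai0 : 0 <= a^-1 by rewrite invr_ge0 ltW.
have ai1 : a^-1 < 1 by rewrite invf_lt1.
have [k hk] := pow_small ai0 ai1 M0.
exists k; apply: le_lt_trans (ler_norm M) _.
rewrite exprVn ltf_pV2 ?posrE ?exprn_gt0 ?ltr_pwDl// in hk.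
by apply: lt_trans hk; rewrite ltrDr.
Qed.

(** If a > 1, Bernoulli's inequality makes a^n at least linear and, by squaring, a^(2n) at least
    quadratic, which no linear bound allows. This removes the subexponential factors from the power
    tricks below. *)
Lemma exp_linear_le1 a C : 0 <= a -> (forall n, a ^+ n <= C * n.+1%:R) -> a <= 1.
Proof.
move=> a0 h; rewrite leNgt; apply/negP => a1.
pose b := a - 1; have b0 : 0 < b by rewrite subr_gt0.
have bern n : n%:R * b <= a ^+ n.
  elim: n => [|n IH]; first by rewrite mul0r expr0.
  rewrite exprS -(subrK 1 a) -/b mulrDl mul1r -natr1 mulrDl mul1r.
  rewrite addrC; apply: lerD; last by rewrite subrK.
  rewrite ler_peMr ?(ltW b0)// subrK; exact/exprn_ege1/ltW.
have C0 : 0 <= C by have := h 0%N; rewrite expr0 mulr1; apply: le_trans.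
(* With exponent 2(n+1): (n+1)^2 b^2 <= C (2(n+1) + 1) <= 3 C (n+1), and one factor n+1 cancels. *)
have h2 n : n.+1%:R * b ^+ 2 <= C * 3.
  have n0 : 0 < n.+1%:R :> R by rewrite ltr0n.
  rewrite -(ler_pM2l n0).
  have := h (n.+1 * 2)%N; rewrite exprM.
  have : (n.+1%:R * b) ^+ 2 <= (a ^+ n.+1) ^+ 2.
    by rewrite ler_sqr ?nnegrE ?bern// ?exprn_ge0// mulr_ge0// ltW.
  move=> /le_trans/[apply].
  rewrite exprMn expr2 -mulrA => /le_trans; apply.
  rewrite [leRHS]mulrCA; apply: ler_wpM2l => //.
  by rewrite -natrM ler_nat; lia.
have := h2 (Num.truncn (C * 3 / b ^+ 2)); rewrite -ler_pdivlMr ?exprn_gt0//.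
by rewrite leNgt truncnS_gt.
Qed.

End real_powers.

(** * Rational numbers under a non-archimedean absolute value *)

Section rational_values.
Context (R : realType) (K0 : fieldType) (v : absolute_value R K0).
Local Notation K := (valued v).
Variables (j : {rmorphism rat -> K}).
Implicit Types (p m n : nat) (q r : rat).

Lemma jnat n : j n%:R = n%:R. Proof. exact: rmorph_nat. Qed.

(** Total boundedness of the bounded sets of rationals: together with the completeness of K it gives
    compact balls in the base field. It is the only fact on which the two kinds of places need
    different proofs before compactness. *)
Definition rat_totally_bounded := forall M e : R, 0 < e -> exists L : seq rat,
  forall q, v (j q) <= M -> exists2 l, l \in L & v (j q - j l) < e.

Section ultra.
Hypothesis um : ultrametric v.

Lemma v_nat_le1 n : v (n%:R : K) <= 1.
Proof.
elim: n => [|n IH]; first by rewrite absv0.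
rewrite -natr1; apply: le_trans (um _ _) _.
by rewrite ge_max IH absv1 lexx.
Qed.

Lemma v_int_le1 (z : int) : v (z%:~R : K) <= 1.
Proof.
case: z => n; first exact: v_nat_le1.
by rewrite NegzE mulrNz absvN; exact: v_nat_le1.
Qed.

(** Bezout: if v m were below 1 as well, then 1 = x p + y m would have absolute value below 1. *)
Lemma v_coprimez (p m : int) : v (p%:~R : K) < 1 -> coprimez p m ->
  v (m%:~R : K) = 1.
Proof.
move=> vp /coprimezP[[x y] /= E].
apply/eqP; rewrite eq_le v_int_le1 leNgt; apply/negP => vm.
have : v (1 : K) < 1.
  have -> : (1 : K) = x%:~R * p%:~R + y%:~R * m%:~R.
    by rewrite -!intrM -intrD E.
  apply: le_lt_trans (um _ _) _; rewrite gt_max !vM.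
  by apply/andP; split; apply: le_lt_trans (ler_wpM2r (v_ge0 _) (v_int_le1 _)) _;
    rewrite mul1r.
by rewrite absv1 ltxx.
Qed.

Lemma j_int (m : int) : j m%:~R = m%:~R. Proof. exact: rmorph_int. Qed.

Lemma j_numden r : j r = (numq r)%:~R / (denq r)%:~R.
Proof. by rewrite -{1}(divq_num_den r) fmorph_div !j_int. Qed.

Section prime.
Variable p : nat.
Hypotheses (pp : prime p) (vp : v (p%:R : K) < 1).

Lemma denq_coprime r : v (j r) <= 1 -> coprimez p (denq r).
Proof.
move=> r1; apply/negPn/negP => ncp.
have pd : (p%:Z %| denq r)%Z.
  by move: ncp; rewrite coprimezE /= prime_coprime// negbK.
have pn : coprimez p (numq r).
  rewrite coprimezE /= (coprime_dvdl _ (_ : coprime `|denq r| `|numq r|))//.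
  by rewrite coprime_sym; exact: coprime_num_den.
have va : v ((numq r)%:~R : K) = 1 by apply: v_coprimez pn.
have vb : v ((denq r)%:~R : K) < 1.
  case/dvdzP : pd => y ->; rewrite intrM vM.
  by apply: le_lt_trans (ler_wpM2r (v_ge0 _) (v_int_le1 _)) _; rewrite mul1r.
move: r1; rewrite j_numden vM vV va mul1r leNgt invf_gt1 ?vb//.
rewrite v_gt0; apply/eqP => d0; move: vb; rewrite d0.
have := congr1 v (j_int (denq r)); rewrite d0.
move=> /eqP; rewrite absv0 absv_eq0 fmorph_eq0 intr_eq0.
by rewrite denq_eq0.
Qed.

(** The integer c is the numerator times the inverse y of the denominator modulo p^k, reduced modulo
    p^k. The error is then p^k times an integer over a denominator that is a unit. *)
Lemma rat_approx1 r k : v (j r) <= 1 ->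
  exists2 c : nat, (c < p ^ k)%N & v (j r - c%:R) <= v (p%:R : K) ^+ k.
Proof.
move=> r1; have cpd := denq_coprime r1.
have vd : v ((denq r)%:~R : K) = 1 by apply: v_coprimez cpd.
have /coprimezP[[x y] /= E] : coprimez (p%:Z ^+ k) (denq r) by apply: coprimezXl.
have pk0 : (0 < p%:Z ^+ k)%R by rewrite exprn_gt0// ltz_nat prime_gt0.
pose t := ((numq r * y) %/ (p%:Z ^+ k))%Z.
pose c := ((numq r * y) %% (p%:Z ^+ k))%Z.
have c0 : 0 <= c by rewrite modz_ge0// gt_eqF.
have cE : numq r * y = t * p%:Z ^+ k + c by exact: divz_eq.
have cp : c < p%:Z ^+ k by rewrite ltz_pmod.
exists `|c|%N.
  by rewrite -ltz_nat gez0_abs// -[(p ^ k)%N%:Z]natz natrX natz.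
have -> : (`|c|%N)%:R = c%:~R :> K by rewrite -[in RHS](gez0_abs c0).
have d0 : (denq r)%:~R != 0 :> K.
  by rewrite -(absv_eq0 v) vd oner_eq0.
have -> : j r - c%:~R = (p%:~R ^+ k) * (numq r * x + denq r * t)%:~R / (denq r)%:~R.
  apply: (mulIf d0); rewrite mulfVK// mulrBl j_numden mulfVK//.
  rewrite -!intrM -intrB -[in RHS]rmorphXn/= -intrM; congr (_%:~R).
  have -> : c = numq r * y - t * p%:Z ^+ k by rewrite cE addrC addKr.
  transitivity (numq r * (1 - y * denq r) + t * p%:Z ^+ k * denq r); first by ring.
  have -> : 1 - y * denq r = x * p%:Z ^+ k by rewrite -E addrK.
  ring.
rewrite vM vV vd invr1 mulr1 vM vX.
by rewrite ler_piMr ?v_int_le1// exprn_ge0 ?v_ge0.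
Qed.

Lemma rat_approx r e k : v (j r) * v (p%:R : K) ^+ e <= 1 ->
  exists2 c : nat, (c < p ^ k)%N &
    v (j r - j (c%:R / (p ^ e)%:R)) <= v (p%:R : K) ^+ k / v (p%:R : K) ^+ e.
Proof.
move=> re.
have p0 : (p ^ e)%:R != 0 :> rat by rewrite pnatr_eq0 -lt0n expn_gt0 prime_gt0.
have [|c cp hc] := @rat_approx1 (r * (p ^ e)%:R) k.
  by rewrite rmorphM/= jnat natrX vM vX.
exists c => //.
have -> : j r - j (c%:R / (p ^ e)%:R) = (j (r * (p ^ e)%:R) - c%:R) / j (p ^ e)%:R.
  by rewrite mulrBl !rmorphM/= fmorphV !jnat mulfK// -jnat fmorph_eq0.
have vpe : v (j (p ^ e)%:R) = v (p%:R : K) ^+ e by rewrite jnat natrX vX.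
by rewrite vM vV vpe ler_wpM2r// invr_ge0 exprn_ge0 ?v_ge0.
Qed.

Lemma v_prime_gt0 : 0 < v (p%:R : K).
Proof.
by rewrite v_gt0 -jnat fmorph_eq0 pnatr_eq0 -lt0n prime_gt0.
Qed.

Lemma ultra_totally_bounded : rat_totally_bounded.
Proof.
move=> M e e0; have vp0 := v_prime_gt0.
(* p^s clears the poles of every q with v q <= M, and k is chosen so that precision e remains after
   dividing by p^s again. *)
have [s hs] : exists s, v (p%:R : K) ^+ s < (`|M| + 1)^-1.
  by apply: pow_small => //; rewrite ?ltW// invr_gt0 ltr_wpDl.
have [k hk] : exists k, v (p%:R : K) ^+ k < e * v (p%:R : K) ^+ s.
  by apply: pow_small => //; rewrite ?ltW// mulr_gt0// exprn_gt0.
exists [seq (c%:R / (p ^ s)%:R : rat) | c <- iota 0 (p ^ k)] => q qM.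
have [|c cp hc] := @rat_approx q s k.
  apply: (@le_trans _ _ ((`|M| + 1) * (`|M| + 1)^-1)); last first.
    by rewrite divff// gt_eqF// ltr_wpDl.
  apply: ler_pM; rewrite ?v_ge0 ?exprn_ge0 ?v_ge0 ?ltW//.
  apply: le_lt_trans qM _; apply: le_lt_trans (ler_norm M) _.
  by rewrite ltrDl.
exists (c%:R / (p ^ s)%:R); first by apply/mapP; exists c; rewrite ?mem_iota.
by apply: le_lt_trans hc _; rewrite ltr_pdivrMr// exprn_gt0.
Qed.

End prime.

(** Integers have v at most 1, so v q > 1 forces v < 1 on the denominator. Stripping from it the
    prime factors with v = 1 must stop at a prime with v < 1. *)
Lemma prime_v_lt1 : (exists q, 1 < v (j q)) ->
  exists2 p, prime p & v (p%:R : K) < 1.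
Proof.
move=> [q]; rewrite j_numden vM vV.
have : (0 < `|denq q|)%N by rewrite absz_gt0 denq_eq0.
have E : (denq q)%:~R = (`|denq q|%N)%:R :> K by rewrite -{1}(gez0_abs (ltW (denq_gt0 q))).
rewrite E; set n := `|denq q|%N => n0 h.
have vn : v (n%:R : K) < 1.
  rewrite ltNge; apply/negP => n1.
  have vn1 : v (n%:R : K) = 1 by apply/eqP; rewrite eq_le v_nat_le1 n1.
  by move: h; rewrite vn1 invr1 mulr1 ltNge v_int_le1.
move: n0 vn; elim/ltn_ind : n {E h} => n IH n0 vn.
have [n1|n1] := leqP n 1.
  have E : n = 1%N by apply/eqP; rewrite eqn_leq n1.
  by move: vn; rewrite E absv1 ltxx.
have pr := pdiv_prime n1.
have [pv|pv] := ltP (v ((pdiv n)%:R : K)) 1; first by exists (pdiv n).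
have vpd : v ((pdiv n)%:R : K) = 1 by apply/eqP; rewrite eq_le v_nat_le1 pv.
have /dvdnP[m E] := pdiv_dvd n.
have m0 : (0 < m)%N by move: n0; rewrite E muln_gt0 => /andP[].
apply: (IH m) => //.
  by rewrite [ltnRHS]E ltn_Pmulr// prime_gt1.
by move: vn; rewrite {1}E natrM vM vpd mulr1.
Qed.

End ultra.

End rational_values.

(** * Rational numbers under an archimedean absolute value *)

Section archimedean_values.
Context (R : realType) (K0 : fieldType) (v : absolute_value R K0).
Local Notation K := (valued v).
Variables (j : {rmorphism rat -> K}).
Implicit Types (m n : nat) (q r : rat).

(** In the expansion of (x + y)^n all binomial coefficients have v at most 1, so v(x + y)^n <= (n +
    1) max^n, and the factor n + 1 does not survive the passage to large n. *)
Lemma ultrametric_of_nat : (forall n, v (n%:R : K) <= 1) -> ultrametric v.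
Proof.
move=> h x y.
set m := Num.max _ _.
have xm : v x <= m by rewrite le_max lexx.
have ym : v y <= m by rewrite le_max lexx orbT.
have m0 : 0 <= m by apply: le_trans xm; exact: v_ge0.
have [E|mn0] := eqVneq m 0.
  rewrite E in xm ym *.
  by apply: le_trans (vD_le _ _) _; rewrite -[leRHS]addr0 lerD.
have mp : 0 < m by rewrite lt_def mn0.
rewrite -(mul1r m) -ler_pdivrMr//.
apply: (@exp_linear_le1 _ _ 1) => [|n]; first by rewrite divr_ge0 ?v_ge0.
rewrite mul1r expr_div_n ler_pdivrMr ?exprn_gt0// -vX.
rewrite (exprDn (x : K0) y).
apply: le_trans (v_sum _ _ _) _.
apply: (@le_trans _ _ (\sum_(i < n.+1) m ^+ n)); last first.
  by rewrite sumr_const card_ord mulr_natl.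
apply: ler_sum => i _; rewrite -mulr_natr vM -[leRHS]mulr1.
apply: ler_pM; [exact: v_ge0|exact: v_ge0| |exact: h].
have -> : m ^+ n = m ^+ (n - i) * m ^+ i by rewrite -exprD subnK// -ltnS.
rewrite vM !vX.
by apply: ler_pM; rewrite ?exprn_ge0 ?v_ge0// lerXn2r ?nnegrE ?v_ge0.
Qed.

Hypothesis num : ~ ultrametric v.
Let w := v (2%:R : K).

Lemma v_nat_binary n m : (n < 2 ^ m)%N -> v (n%:R : K) <= \sum_(i < m) w ^+ i.
Proof.
elim: m n => [|m IH] n.
  by rewrite expn0 ltnS leqn0 => /eqP ->; rewrite absv0 big_ord0.
move=> nm; rewrite big_ord_recl expr0.
have -> : \sum_(i < m) w ^+ (bump 0 i) = w * \sum_(i < m) w ^+ i.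
  by rewrite mulr_sumr; apply: eq_bigr => i _; rewrite -exprS.
rewrite -(odd_double_half n) natrD -mul2n natrM.
apply: le_trans (vD_le _ _) _; apply: lerD.
  by case: (odd n); rewrite ?absv1// absv0 ler01.
rewrite vM ler_wpM2l ?v_ge0//; apply: IH.
by rewrite -(ltn_pmul2l (_ : 0 < 2)%N)// -expnS mul2n (leq_ltn_trans _ nm)//
  -{2}(odd_double_half n) leq_addl.
Qed.

(** N^n has at most (N+1)(n+1) binary digits. If w <= 1 this bounds v(N)^n linearly in n, so v N <=
    1 for every N, which is the ultrametric case. *)
Lemma v2_gt1 : 1 < w.
Proof.
rewrite ltNge; apply/negP => w1; apply: num; apply: ultrametric_of_nat => N.
apply: (@exp_linear_le1 _ _ N.+1%:R) => [|n]; first exact: v_ge0.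
rewrite -vX -natrX.
have Nn : (N ^ n < 2 ^ (N.+1 * n.+1))%N.
  rewrite expnM; apply: (@leq_ltn_trans (N.+1 ^ n.+1)).
    apply: (@leq_trans (N.+1 ^ n)); last by rewrite leq_pexp2l.
    by case: n => // n; rewrite leq_exp2r.
  by rewrite ltn_exp2r// ltn_expl.
apply: le_trans (v_nat_binary Nn) _.
have -> : N.+1%:R * n.+1%:R = \sum_(i < N.+1 * n.+1) (1 : R).
  by rewrite sumr_const card_ord natrM.
apply: ler_sum => i _.
by rewrite exprn_ile1 ?v_ge0.
Qed.

Let w1 : 0 < w - 1. Proof. by rewrite subr_gt0 v2_gt1. Qed.
Let w0 : 0 < w. Proof. exact: lt_trans v2_gt1. Qed.

Lemma v_nat_lt2 n m : (n < 2 ^ m)%N -> v (n%:R : K) <= w ^+ m / (w - 1).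
Proof.
move=> /v_nat_binary/le_trans; apply.
rewrite ler_pdivlMr// mulrC -subrX1; by rewrite gerBl.
Qed.

(** The binary expansion of q is cut after i digits: the integer part c < 2^i gives the bound, and
    the rest r / (d 2^i) tends to 0 with i. Scaled by powers of 2, this compares v with the usual
    absolute value coarsely but in both directions, without determining v. *)
Lemma v_lt1 q : `|q| < 1 -> v (j q) <= (w - 1)^-1.
Proof.
wlog q0 : q / 0 <= q.
  move=> h; have [q0|q0] := leP 0 q; first exact: h.
  move=> q1; rewrite -absvN -rmorphN; apply: h; last by rewrite normrN.
  by rewrite oppr_ge0 ltW.
rewrite ger0_norm// => q1.
pose n := `|numq q|%N; pose d := `|denq q|%N.
have d0 : (0 < d)%N by rewrite absz_gt0 denq_eq0.
have qE : q = n%:R / d%:R.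
  rewrite -{1}(divq_num_den q) -{1}(gez0_abs (_ : 0 <= numq q)) ?numq_ge0//.
  by rewrite -{1}(gez0_abs (ltW (denq_gt0 q))).
have dq0 : d%:R != 0 :> rat by rewrite pnatr_eq0 -lt0n.
have dK0 : d%:R != 0 :> K by rewrite -(jnat j) fmorph_eq0.
have nd : (n < d)%N.
  by move: q1; rewrite qE ltr_pdivrMr ?ltr0n// mul1r ltr_nat.
apply/ler_addgt0Pr => e e0.
have [i hi] : exists i, w^-1 ^+ i < e * v (d%:R : K) / d%:R.
  apply: pow_small; first by rewrite invr_ge0 ltW.
    by rewrite invf_lt1// v2_gt1.
  by rewrite divr_gt0 ?mulr_gt0 ?v_gt0 ?ltr0n.
pose c := (n * 2 ^ i %/ d)%N; pose r := (n * 2 ^ i %% d)%N.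
have cr : (n * 2 ^ i = c * d + r)%N by exact: divn_eq.
have c2 : (c < 2 ^ i)%N by rewrite ltn_divLR// mulnC ltn_pmul2l ?expn_gt0.
have rd : (r < d)%N by rewrite ltn_mod.
have k20 : (2%:R : K) ^+ i != 0.
  by rewrite expf_neq0// -(jnat j) fmorph_eq0 pnatr_eq0.
have -> : j q = c%:R / 2%:R ^+ i + r%:R / (d%:R * 2%:R ^+ i).
  rewrite qE fmorph_div !jnat.
  have E : n%:R * 2%:R ^+ i = c%:R * d%:R + r%:R :> K.
    by rewrite -natrX -!natrM -natrD cr.
  have -> : n%:R = (c%:R * d%:R + r%:R) / 2%:R ^+ i :> K by rewrite -E mulfK.
  by field; rewrite dK0 k20.
apply: le_trans (vD_le _ _) _; rewrite vM vV vX -/w; apply: lerD.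
  rewrite ler_pdivrMr ?exprn_gt0// mulrC; exact: v_nat_lt2.
rewrite vM vV vM vX -/w.
apply: (@le_trans _ _ (d%:R / (v (d%:R : K) * w ^+ i))).
  apply: ler_wpM2r; first by rewrite invr_ge0 mulr_ge0 ?v_ge0// exprn_ge0// ltW.
  by apply: le_trans (v_nat _ _) _; rewrite ler_nat ltnW.
rewrite invfM -exprVn mulrA.
rewrite ltW// -(ltr_pdivlMl _ _ (_ : 0 < d%:R / v (d%:R : K))); last first.
  by rewrite divr_gt0 ?v_gt0// ltr0n.
by rewrite invf_div mulrC mulrA.
Qed.

Lemma v_gt1 q : 1 < `|q| -> w - 1 <= v (j q).
Proof.
move=> q1; have q0 : q != 0.
  by apply: contraTneq q1 => ->; rewrite normr0 -leNgt ler01.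
have : v (j q^-1) <= (w - 1)^-1 by apply: v_lt1; rewrite normfV invf_lt1 ?normr_gt0.
by rewrite fmorphV vV lef_pV2 ?posrE// v_gt0 fmorph_eq0.
Qed.

Lemma j2X k : j (2%:R ^+ k) = 2%:R ^+ k. Proof. by rewrite rmorphXn/= jnat. Qed.

Lemma v_lt_2Xn q k : `|q| < 2%:R ^- k -> v (j q) <= w ^- k / (w - 1).
Proof.
move=> qk; have : v (j (q * 2%:R ^+ k)) <= (w - 1)^-1.
  by apply: v_lt1; rewrite normrM normrX (ger0_norm (ler0n _ 2)) -ltr_pdivlMr ?exprn_gt0// mul1r.
by rewrite rmorphM vM j2X vX -/w -ler_pdivlMr ?exprn_gt0// mulrC.
Qed.

Lemma v_gt_2Xn q k : 2%:R ^- k < `|q| -> (w - 1) / w ^+ k <= v (j q).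
Proof.
move=> qk; have : w - 1 <= v (j (q * 2%:R ^+ k)).
  by apply: v_gt1; rewrite normrM normrX (ger0_norm (ler0n _ 2)) -ltr_pdivrMr ?exprn_gt0// div1r.
by rewrite rmorphM vM j2X vX -/w -ler_pdivrMr ?exprn_gt0.
Qed.

Lemma v_gt_2X q k : 2%:R ^+ k < `|q| -> (w - 1) * w ^+ k <= v (j q).
Proof.
move=> qk; have : w - 1 <= v (j (q / 2%:R ^+ k)).
  by apply: v_gt1; rewrite normrM normfV normrX (ger0_norm (ler0n _ 2)) ltr_pdivlMr ?exprn_gt0// mul1r.
by rewrite fmorph_div vM vV j2X vX -/w ler_pdivlMr ?exprn_gt0.
Qed.

Lemma v_small (e : R) : 0 < e -> exists k, forall q, `|q| < 2%:R ^- k -> v (j q) < e.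
Proof.
move=> e0; have [k hk] : exists k, w^-1 ^+ k < e * (w - 1).
  by apply: pow_small; rewrite ?invr_ge0 ?(ltW w0)// ?invf_lt1 ?v2_gt1// mulr_gt0.
exists k => q /v_lt_2Xn/le_lt_trans; apply.
by rewrite ltr_pdivrMr// -exprVn.
Qed.

Lemma v_small_inv k : exists2 e : R, 0 < e & forall q, v (j q) < e -> `|q| <= 2%:R ^- k.
Proof.
exists ((w - 1) / w ^+ k); first by rewrite divr_gt0// exprn_gt0.
by move=> q; rewrite leNgt => h; apply/negP => /v_gt_2Xn; rewrite leNgt h.
Qed.

Lemma v_bounded_inv (M : R) : exists k, forall q, v (j q) <= M -> `|q| <= 2%:R ^+ k.
Proof.
have [k hk] := @pow_large R w (M / (w - 1)) v2_gt1.
exists k => q qM; rewrite leNgt; apply/negP => /v_gt_2X.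
rewrite mulrC -ler_pdivlMr// leNgt (le_lt_trans _ hk)//.
by rewrite ler_wpM2r// invr_ge0 ltW.
Qed.

Lemma arch_totally_bounded : rat_totally_bounded j.
Proof.
move=> M e e0.
have [l hl] := v_small e0; have [k hk] := v_bounded_inv M.
(* Grid points of step 2^-l in the box |q| <= 2^k have index at most 2^(k+l) in absolute value; the
   extra 1 accounts for the floor of a negative number. *)
pose B := (2 ^ (k + l)).+1.
exists [seq ((i%:Z - B%:Z)%:~R / 2%:R ^+ l : rat) | i <- iota 0 (B + B).+1] => q /hk qk.
have l0 : 0 < 2%:R ^+ l :> rat by rewrite exprn_gt0.
pose c := Num.floor (q * 2%:R ^+ l).
have /andP[c1 c2] : c%:~R <= q * 2%:R ^+ l < (c + 1)%:~R by exact: floor_itv.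
exists (c%:~R / 2%:R ^+ l); last first.
  rewrite -rmorphB; apply: hl.
  rewrite -(ltr_pM2r l0) mulVf ?gt_eqF//.
  rewrite -{2}(gtr0_norm l0) -normrM mulrBl divfK ?gt_eqF//.
  by rewrite ger0_norm ?subr_ge0// ltrBlDl -[X in _ + X](mulr1z 1) -intrD.
have cB : `|c| <= B%:Z.
  have : `|q * 2%:R ^+ l| <= 2%:R ^+ (k + l).
    by rewrite normrM exprD (gtr0_norm l0) ler_wpM2r// ltW.
  rewrite ler_norml => /andP[h1 h2].
  rewrite ler_norml; apply/andP; split.
    rewrite -ltzD1 -(ltr_int rat) (le_lt_trans _ c2)// (le_trans _ h1)//.
    rewrite rmorphN lerN2 /= -natrX ler_nat; exact: leqW.
  rewrite -(ler_int rat) (le_trans c1)// (le_trans h2)//.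
  by rewrite /= -natrX ler_nat; exact: leqW.
apply/mapP; exists `|(c + B%:Z)%R|%N; last first.
  rewrite gez0_abs ?addrK//; move: cB; rewrite ler_norml; lia.
rewrite mem_iota /= add0n; move: cB; rewrite ler_norml; lia.
Qed.

End archimedean_values.

(** * Local compactness of the base field and of its finite spans *)

Section base_field_theory.
Context (R : realType) (K0 : fieldType) (v : absolute_value R K0).
Local Notation K := (valued v).
Implicit Types (x y z a : K).
Local Notation B := (@base_field R K0 v).

Lemma base_fieldP a :
  B a <-> forall e : R, 0 < e -> exists q : rat, v (a - ratr q) < e.
Proof.
split=> [/closureKP h e /h[_ [q _ <-]]|h]; first by exists q.
by apply/closureKP => e /h[q hq]; exists (ratr q) => //; exists q.
Qed.

Lemma base_closed : closed B. Proof. exact: closed_closure. Qed.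

Lemma base_ratr q : B (ratr q).
Proof. by apply/base_fieldP => e e0; exists q; rewrite subrr absv0. Qed.

Variables (j : {rmorphism rat -> K}).
Hypothesis jE : forall q, ratr q = j q.

Lemma base0 : B 0.
Proof. by rewrite -(rmorph0 j) -jE; exact: base_ratr. Qed.
Lemma base1 : B 1.
Proof. by rewrite -(rmorph1 j) -jE; exact: base_ratr. Qed.

Lemma base_continuous2 (f : K * K -> K) : continuous f ->
  (forall p q, exists r, f (ratr p, ratr q) = ratr r) ->
  forall a b, B a -> B b -> B (f (a, b)).
Proof.
move=> fc fr a b /base_fieldP Ba /base_fieldP Bb; apply/base_fieldP => e e0.
have [] := (vcontP f (a, b)).1 (fc (a, b)) e e0.
case=> P Q /= [/vnbhsP[d1 d10 h1] /vnbhsP[d2 d20 h2]] h.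
have [p hp] := Ba _ d10; have [q hq] := Bb _ d20.
have [r hr] := fr p q; exists r; rewrite -hr vdistC.
by apply: (h (ratr p, ratr q)); split; [apply: h1|apply: h2]; rewrite vdistC.
Qed.

Lemma baseD a b : B a -> B b -> B (a + b).
Proof.
apply: (base_continuous2 (@vadd_continuous _ _ v)) => p q; exists (p + q).
by rewrite /= !jE rmorphD.
Qed.

Lemma baseM a b : B a -> B b -> B (a * b).
Proof.
apply: (base_continuous2 (@vmul_continuous _ _ v)) => p q; exists (p * q).
by rewrite /= !jE rmorphM.
Qed.

Lemma baseN a : B a -> B (- a).
Proof.
move=> Ba; rewrite -mulN1r; apply: baseM => //.
by rewrite -(rmorph1 j) -rmorphN -jE; exact: base_ratr.
Qed.

Lemma baseB a b : B a -> B b -> B (a - b).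
Proof. by move=> Ba Bb; apply: baseD => //; exact: baseN. Qed.

Lemma baseV a : B a -> B a^-1.
Proof.
have [->|a0 /base_fieldP Ba] := eqVneq a 0; first by rewrite invr0.
apply/base_fieldP => e e0.
have /(vcontP (fun y : K => y^-1 : K)) /(_ e e0) := vinv_continuous a0.
case/vnbhsP => d d0 hd; have [q hq] := Ba _ d0.
by exists q^-1; rewrite jE fmorphV -jE vdistC; apply: hd; rewrite vdistC.
Qed.

Lemma base_sum (I : Type) (r : seq I) (P : pred I) (f : I -> K) :
  (forall i, P i -> B (f i)) -> B (\sum_(i <- r | P i) f i).
Proof. by move=> h; apply: big_ind => //; [exact: base0|exact: baseD]. Qed.

Hypothesis tb : rat_totally_bounded j.
Hypothesis complete : forall G : set_system K, ProperFilter G -> cauchy G -> cvg G.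

Lemma ultra_seq (T : Type) (I : eqType) (U : set_system T) (A : I -> set T) (L : seq I) :
  UltraFilter U -> U [set x | exists2 l, l \in L & A l x] ->
  exists2 l, l \in L & U (A l).
Proof.
move=> UU; elim: L => [|l L IH] h.
  by have := @filter_ex _ _ _ _ h; case=> x [].
have [Ul|Ul] := in_ultra_setVsetC (A l) UU; first by exists l; rewrite ?mem_head.
have [|l' lL Ul'] := IH; last by exists l'; rewrite // inE lL orbT.
apply: filterS2 h Ul => x [l']; rewrite inE => /orP[/eqP ->//|lL] Ax _.
by exists l'.
Qed.

(** Total boundedness makes an ultrafilter on this set Cauchy, completeness of K makes it converge,
    and the set is closed. *)
Lemma base_ball_compact (M : R) : compact [set a : K | B a /\ v a <= M].
Proof.
rewrite compact_ultra => U UU UB.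
have cU : cauchy U.
  apply: cauchy_exP => e e0 /=.
  have e2 : 0 < e / 2 by rewrite divr_gt0.
  (* The rational approximant of a point of the ball may exceed the bound M by at most 1. *)
  have [L hL] := tb (M + 1) e2.
  have [|l lL Ul] := @ultra_seq K rat U (fun l => ball (ratr l : K) e) L UU.
    apply: filterS UB => a [/base_fieldP Ba aM].
    have [|q hq] := Ba (Num.min 1 (e / 2)); first by rewrite lt_min ltr01.
    move: hq; rewrite lt_min => /andP[q1 q2].
    have [|l lL ql] := hL q.
      have -> : j q = a - (a - ratr q) by rewrite jE; ring.
      by apply: le_trans (vB_le _ _) _; rewrite lerD// ltW.
    exists l => //; apply/vballE; rewrite vdistC.
    have -> : a - ratr l = (a - ratr q) + (j q - j l) by rewrite !jE; ring.
    by apply: le_lt_trans (vD_le _ _) _; rewrite [ltRHS](splitr e) ltrD.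
  by exists (ratr l).
have PU : ProperFilter U by exact: ultra_proper.
have /cvg_ex[a Ua] := complete PU cU.
exists a; split => //.
apply: (@closed_cvg _ _ U PU id [set a : K | B a /\ v a <= M]) => //.
by apply: closedI; [exact: base_closed|exact: vclosed_ball].
Qed.

Section span.
Implicit Types n : nat.

Definition lincomb n (b : 'I_n -> K) (c : 'I_n -> K) : K := \sum_i c i * b i.
Definition kspan n (b : 'I_n -> K) : set K :=
  [set lincomb b c | c in [set c | forall i, B (c i)]].
(* The coordinates are bounded linear functions; unlike mere linear independence this survives completion. *)
Definition coercive n (b : 'I_n -> K) := exists2 d : R, 0 < d &
  forall c, (forall i, B (c i)) -> forall i, d * v (c i) <= v (lincomb b c).

Lemma kspan_ball_compact n (b : 'I_n -> K) (M : R) :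
  compact [set lincomb b c | c in [set c | forall i, B (c i) /\ v (c i) <= M]].
Proof.
elim: n b => [|n IH] b.
  have -> : [set lincomb b c | c in [set c | forall i, B (c i) /\ v (c i) <= M]] = [set 0].
    apply/seteqP; split=> [_ [c _ <-]|_ ->]; first by rewrite /lincomb big_ord0.
    by exists (fun=> 0); [case|rewrite /lincomb big_ord0].
  exact: compact_set1.
pose b' i := b (lift ord0 i).
pose A := [set lincomb b' c | c in [set c | forall i, B (c i) /\ v (c i) <= M]].
pose f (p : K * K) : K := p.1 * b ord0 + p.2.
have fc : continuous f.
  move=> p; apply: (@continuous_comp _ _ _ (fun p : K * K => (p.1 * b ord0, p.2) : K * K)
    (fun p : K * K => p.1 + p.2 : K)); last exact: vadd_continuous.
  apply: (@cvg_pair _ _ _ _ (nbhs (p.1 * b ord0)) (nbhs p.2)); last exact: cvg_snd.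
  apply: (@continuous_comp _ _ _ (fun p : K * K => (p.1, b ord0) : K * K)
    (fun p : K * K => p.1 * p.2 : K)); last exact: vmul_continuous.
  by apply: (@cvg_pair _ _ _ _ (nbhs p.1) (nbhs (b ord0))); [exact: cvg_fst|exact: cvg_cst].
have := @continuous_compact _ _ f ([set a | B a /\ v a <= M] `*` A)
  (continuous_subspaceT fc) (compact_setX (base_ball_compact (M := M)) (IH b')).
congr compact; apply/seteqP; split=> [_ [[a _] [/= Ba [c hc <-]] <-]|_ [c hc <-]].
  exists (fun i => if unlift ord0 i is Some k then c k else a).
    by move=> i; case: unliftP => [k|] _; [exact: hc|exact: Ba].
  rewrite /lincomb big_ord_recl unlift_none; congr (_ + _).
  by apply: eq_bigr => i _; rewrite liftK.
exists (c ord0, lincomb b' (fun i => c (lift ord0 i))).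
  by split=> /=; [exact: hc|exists (fun i => c (lift ord0 i))].
by rewrite /f /lincomb big_ord_recl.
Qed.

(** Elements of the span at distance less than 1 from x have coordinates bounded by (v x + 1) / d,
    so x is a limit of points of a compact set. *)
Lemma kspan_closed n (b : 'I_n -> K) : coercive b -> closed (kspan b).
Proof.
move=> [d d0 hd]; apply/vclosed_limP => x hx.
pose M := (v x + 1) / d.
pose A := [set lincomb b c | c in [set c | forall i, B (c i) /\ v (c i) <= M]].
suff [c hc <-] : A x by exists c => // i; case: (hc i).
apply: (compact_closed (@vhausdorff _ _ v) (kspan_ball_compact (b := b) (M := M))).
apply/closureKP => e e0.
have e1 : 0 < Num.min e 1 by rewrite lt_min e0 ltr01.
have [y [c hc yE]] := hx _ e1; rewrite lt_min => /andP[xy xy1].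
exists y => //; exists c => // i; split; first exact: hc.
rewrite ler_pdivlMr// mulrC; apply: le_trans (hd c hc i) _.
rewrite yE; have -> : y = x - (x - y) by ring.
by apply: le_trans (vB_le _ _) _; rewrite lerD2l ltW.
Qed.

Lemma kspan_recl n (b : 'I_n.+1 -> K) x :
  kspan b x <-> exists a y, [/\ B a, kspan (fun i => b (lift ord0 i)) y & x = a * b ord0 + y].
Proof.
split=> [[c hc <-]|[a [_ [Ba [c hc <-] ->]]]].
  exists (c ord0), (lincomb (fun i => b (lift ord0 i)) (fun i => c (lift ord0 i))).
  by split=> //; [exists (fun i => c (lift ord0 i))|rewrite /lincomb big_ord_recl].
exists (fun i => if unlift ord0 i is Some k then c k else a).
  by move=> i; case: unliftP => [k|] _; [exact: hc|exact: Ba].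
rewrite /lincomb big_ord_recl unlift_none; congr (_ + _).
by apply: eq_bigr => i _; rewrite liftK.
Qed.

(** Generators are added one at a time. One that already lies in the span is dropped; any other is
    at a positive distance r from the span, because the span is closed, and r controls its
    coordinate. *)
Lemma coercive_basis n (b : 'I_n -> K) :
  exists m (b' : 'I_m -> K), coercive b' /\ kspan b `<=` kspan b'.
Proof.
elim: n b => [|n IH] b.
  by exists 0%N, b; split=> //; exists 1 => // c _; case.
have [m [b' [cb' sb']]] := IH (fun i => b (lift ord0 i)).
have [x|xn] := pselect (kspan b' (b ord0)).
  exists m, b'; split=> // z /kspan_recl[a [y [Ba /sb' [c hc <-] ->]]].
  case: x => c' hc' <-; exists (fun i => a * c' i + c i).
    by move=> i; apply: baseD => //; apply: baseM.
  rewrite /lincomb mulr_sumr -big_split; apply: eq_bigr => i _ /=.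
  by rewrite mulrDl mulrA.
have [r r0 hr] : exists2 r : R, 0 < r & forall y, kspan b' y -> r <= v (b ord0 - y).
  have /vclosed_limP := kspan_closed cb'.
  move=> /(_ (b ord0)); rewrite -[kspan b' _]/(_) => h.
  have /existsNP[r /not_implyP[r0 hr]] : ~ forall e : R, 0 < e ->
    exists2 y, kspan b' y & v (b ord0 - y) < e by move/h.
  exists r => // y hy; rewrite leNgt; apply/negP => hlt; apply: hr; by exists y.
have hr' a y : B a -> kspan b' y -> r * v a <= v (a * b ord0 + y).
  move=> Ba [c hc <-]; have [->|a0] := eqVneq a 0; first by rewrite absv0 mulr0 v_ge0.
  have -> : a * b ord0 + lincomb b' c = a * (b ord0 - lincomb b' (fun i => - a^-1 * c i)).
    rewrite mulrBr; congr (_ + _); rewrite /lincomb mulr_sumr -sumrN.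
    by apply: eq_bigr => i _; field.
  rewrite vM mulrC ler_wpM2l ?v_ge0// hr//.
  exists (fun i => - a^-1 * c i) => // i; apply: baseM => //; apply: baseN; exact: baseV.
pose b2 i := if unlift ord0 i is Some k then b' k else b ord0 : K.
have b20 : b2 ord0 = b ord0 by rewrite /b2 unlift_none.
have b2l : (fun i => b2 (lift ord0 i)) = b'.
  by apply/funext => i; rewrite /b2 liftK.
exists m.+1, b2; split; last first.
  move=> z /kspan_recl[a [y [Ba /sb' hy ->]]]; apply/kspan_recl.
  by exists a, y; split=> //; rewrite ?b2l// b20.
case: cb' => d d0 hd.
(* For x = a b0 + y one has v a <= v x / r, hence v y <= v x + v a v b0 <= D v x: the old
   coordinates of x stay bounded with constant d / D. *)
pose D := 1 + v (b ord0) / r.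
have D0 : 0 < D by rewrite ltr_pwDl// divr_ge0 ?v_ge0// ltW.
exists (Num.min r (d / D)); first by rewrite lt_min r0 divr_gt0.
move=> c hc i.
have E : lincomb b2 c = c ord0 * b ord0 + lincomb b' (fun i => c (lift ord0 i)).
  by rewrite /lincomb big_ord_recl b20 -b2l.
have h0 : r * v (c ord0) <= v (lincomb b2 c).
  by rewrite E; apply: hr' => //; exists (fun i => c (lift ord0 i)).
case: (unliftP ord0 i) => [k|] ->; last first.
  by apply: le_trans h0; rewrite ler_wpM2r ?v_ge0// ge_min lexx.
apply: (@le_trans _ _ (d / D * v (c (lift ord0 k)))).
  by rewrite ler_wpM2r ?v_ge0// ge_min lexx orbT.
rewrite mulrAC ler_pdivrMr//.
apply: le_trans (hd (fun i => c (lift ord0 i)) _ k) _ => //.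
have -> : lincomb b' (fun i => c (lift ord0 i)) = lincomb b2 c - c ord0 * b ord0.
  by rewrite E addrC addKr.
apply: le_trans (vB_le _ _) _; rewrite /D mulrDr mulr1 lerD2l vM.
rewrite mulrA mulrAC ler_wpM2r ?v_ge0//.
by rewrite ler_pdivlMr// mulrC.
Qed.

End span.
End base_field_theory.

Section completion.
Context (R : realType) (F : fieldExtType rat) (K0 : fieldType)
  (v : absolute_value R K0) (iota : {rmorphism F -> valued v}).
Local Notation K := (valued v).
Implicit Types (x y z a : K).

(** In a general field [ratr] need not be a morphism; passing through F gives one, and [rat_morphE]
    identifies the two. *)
Definition rat_morph : {rmorphism rat -> K} := iota \o GRing.in_alg F.
Local Notation j := rat_morph.

Lemma rat_morphE q : ratr q = j q.
Proof. by rewrite /= -[LHS]mulr1 -(rmorph1 iota) -rmorphZ_num. Qed.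

Let e := vbasis {:F}.

Lemma iota_coord (z : F) :
  iota z = \sum_(i < \dim {:F}) ratr (coord e i z) * iota e`_i.
Proof.
rewrite {1}(coord_vbasis (memvf z)) rmorph_sum; apply: eq_bigr => i _.
by rewrite rmorphZ_num.
Qed.

Hypothesis Hc : is_completion iota.

Let dense_iota x (r : R) : 0 < r -> exists z : F, v (x - iota z) < r.
Proof.
move=> r0; have [_ dn _] := Hc.
have [|w [/= h [z _ zw]]] := dn [set y : K | v (y - x) < r] _ (@vopen_ball _ _ _ x r).
  by exists x; rewrite /= subrr absv0.
by exists z; rewrite zw vdistC.
Qed.

Lemma exists_v_gt1 : exists x : K, 1 < v x.
Proof.
have [_ _ [z z0 vz]] := Hc; have [h|h] := ltP 1 (v (iota z)); first by exists (iota z).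
exists (iota z)^-1; rewrite vV invf_gt1; first by rewrite lt_neqAle vz.
by rewrite v_gt0 fmorph_eq0.
Qed.

Lemma exists_v_lt1 : exists2 x : K, 0 < v x & v x < 1.
Proof.
have [x x1] := exists_v_gt1; have x0 : 0 < v x by exact: lt_trans x1.
by exists x^-1; rewrite vV ?invr_gt0// invf_lt1.
Qed.

(** If v were at most 1 on the rationals, coordinates in a rational basis of F would bound v on F.
    By density F contains an element with v > 1, whose powers are unbounded. *)
Lemma rat_nontrivial : exists q, 1 < v (j q).
Proof.
apply/not_existsP => h.
have {}h q : v (j q) <= 1 by rewrite leNgt; apply/negP/h.
pose C := \sum_(i < \dim {:F}) v (iota e`_i).
have bd (z : F) : v (iota z) <= C.
  rewrite iota_coord; apply: le_trans (v_sum _ _ _) _.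
  apply: ler_sum => i _; rewrite vM rat_morphE ler_piMl ?v_ge0//.
have [x x1] := exists_v_gt1.
have x2 : 0 < v x - 1 by rewrite subr_gt0.
have [z hz] := dense_iota x x2.
have z1 : 1 < v (iota z).
  have := v_dist x (iota z) => /le_lt_trans/(_ hz); rewrite ltr_norml => /andP[_].
  by rewrite ltrBlDr -ltrBlDl opprB addrC subrK.
have [k hk] := pow_large C z1.
by have := bd (z ^+ k); rewrite rmorphXn/= vX leNgt hk.
Qed.

Lemma exists_prime_v_lt1 : ultrametric v -> exists2 p : nat, prime p & v (p%:R : K) < 1.
Proof. by move=> um; apply: (prime_v_lt1 (j := j) um); exact: rat_nontrivial. Qed.

Lemma rat_tb : rat_totally_bounded j.
Proof.
have [um|nu] := pselect (ultrametric v); last exact: arch_totally_bounded.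
have [p pp vp] := exists_prime_v_lt1 um.
exact: ultra_totally_bounded vp.
Qed.

Let complete : forall G : set_system K, ProperFilter G -> cauchy G -> cvg G.
Proof. by case: Hc. Qed.

(** The image of a rational basis of F has a dense span over the base field; after thinning to a
    coercive family the span is closed, hence all of K. *)
Lemma exists_basis : exists n (b : 'I_n -> K), coercive b /\ kspan b = setT.
Proof.
have [m [b [cb sb]]] := coercive_basis rat_morphE rat_tb complete
  (fun i : 'I_(\dim {:F}) => iota e`_i).
exists m, b; split=> //; apply/seteqP; split=> // x _.
have := kspan_closed rat_morphE rat_tb complete cb; apply.
apply/closureKP => r r0; have [z hz] := dense_iota x r0.
exists (iota z) => //; apply: sb; exists (fun i => ratr (coord e i z)).
  by move=> i; exact: base_ratr.
by rewrite iota_coord.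
Qed.

Lemma vball_compact (M : R) : compact [set x : K | v x <= M].
Proof.
have [n [b [[d d0 hd] sb]]] := exists_basis.
apply: (subclosed_compact (@vclosed_ball _ _ v M)
  (kspan_ball_compact rat_morphE rat_tb complete (b := b) (M := M / d))).
move=> x /= xM; have [c hc cE] : kspan b x by rewrite sb.
exists c => // i; split; first exact: hc.
rewrite ler_pdivlMr// mulrC; apply: le_trans (hd c hc i) _.
by rewrite cE.
Qed.

Lemma vbounded_compact (A : set K) (M : R) : closed A -> (forall x, A x -> v x <= M) ->
  compact A.
Proof. by move=> cA h; apply: subclosed_compact cA (@vball_compact M) _ => x /h. Qed.

Lemma separable : exists D : nat -> K, forall x (r : R), 0 < r -> exists n, v (x - D n) < r.
Proof.
pose f (c : 'rV[rat]_(\dim {:F})) : K := \sum_i ratr (c 0 i) * iota e`_i.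
exists (fun n => if unpickle n is Some c then f c else 0) => x r r0.
have [z hz] := dense_iota x r0.
exists (pickle (\row_i coord e i z)); rewrite pickleK /f.
rewrite iota_coord in hz.
by under eq_bigr do rewrite mxE.
Qed.

End completion.

(** * Trace and additive character *)

Section trace_theory.
Context (R : realType) (F : fieldExtType rat) (K0 : fieldType)
  (v : absolute_value R K0) (iota : {rmorphism F -> valued v}).
Local Notation K := (valued v).
Local Notation B := (@base_field R K0 v).
Implicit Types (x y z a : K).
Local Notation j := (rat_morph iota).
Local Notation jE := (rat_morphE iota).

Let B0 : B 0. Proof. exact: base0 jE. Qed.
Let B1 : B 1. Proof. exact: base1 jE. Qed.
Let BD a y : B a -> B y -> B (a + y). Proof. exact: (baseD jE). Qed.
Let BB a y : B a -> B y -> B (a - y). Proof. exact: (baseB jE). Qed.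
Let BM a y : B a -> B y -> B (a * y). Proof. exact: (baseM jE). Qed.
Let Bsum (I : Type) (r : seq I) (P : pred I) (f : I -> K) :
  (forall i, P i -> B (f i)) -> B (\sum_(i <- r | P i) f i).
Proof. exact: (base_sum jE). Qed.

Definition base_mx m n (X : 'M[K]_(m, n)) := forall i k, B (X i k).

Lemma base_mulmx m n p (X : 'M[K]_(m, n)) (Y : 'M[K]_(n, p)) :
  base_mx X -> base_mx Y -> base_mx (X *m Y).
Proof. by move=> hX hY i k; rewrite mxE; apply: Bsum => l _; apply: BM. Qed.

Lemma base_scalar n : base_mx (1%:M : 'M[K]_n).
Proof. by move=> i k; rewrite mxE; case: (i == k). Qed.

Lemma basis_inj n (b : 'I_n -> K) m (X Y : 'M[K]_(m, n)) : is_base_basis b ->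
  base_mx X -> base_mx Y -> X *m (\col_i b i) = Y *m (\col_i b i) -> X = Y.
Proof.
move=> hb hX hY E; apply/row_matrixP => i.
have [c [_ uc]] := hb ((X *m (\col_i b i)) i 0).
transitivity c.
  apply/esym/uc; split=> [k|]; first by rewrite mxE.
  by rewrite mxE; apply: eq_bigr => k _; rewrite !mxE.
apply/uc; split=> [k|]; first by rewrite mxE.
by rewrite E mxE; apply: eq_bigr => k _; rewrite !mxE.
Qed.

Lemma basis_coords n (b : 'I_n -> K) : is_base_basis b ->
  exists f : K -> 'rV[K]_n, forall x,
    (forall i, B (f x 0 i)) /\ x = \sum_i f x 0 i * b i.
Proof.
move=> hb.
have /choice[f hf] : forall x, exists c : 'rV[K]_n,
    (forall i, B (c 0 i)) /\ x = \sum_i c 0 i * b i.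
  by move=> x; have [c [h _]] := hb x; exists c.
by exists f.
Qed.

Lemma basis_mx n (b : 'I_n -> K) m (d : 'I_m -> K) : is_base_basis b ->
  exists2 P : 'M[K]_(m, n), base_mx P & \col_i d i = P *m \col_i b i.
Proof.
move=> /basis_coords[f hf].
exists (\matrix_(i, k) f (d i) 0 k) => [i k|].
  by rewrite mxE; case: (hf (d i)).
apply/colP => i; rewrite !mxE; have [_ {1}->] := hf (d i).
by apply: eq_bigr => k _; rewrite !mxE.
Qed.

Lemma trace_uniq n (b : 'I_n -> K) (M : 'M[K]_n) m (d : 'I_m -> K) (N : 'M[K]_m) x :
  is_base_basis b -> base_mx M -> (forall i, x * b i = \sum_k M i k * b k) ->
  is_base_basis d -> base_mx N -> (forall i, x * d i = \sum_k N i k * d k) ->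
  \tr M = \tr N.
Proof.
move=> hb BM' hM hd BN hN.
have [P BP EP] := basis_mx d hb; have [Q BQ EQ] := basis_mx b hd.
have EM : x *: (\col_i b i) = M *m \col_i b i.
  apply/colP => i; rewrite !mxE hM; by apply: eq_bigr => k _; rewrite mxE.
have EN : x *: (\col_i d i) = N *m \col_i d i.
  apply/colP => i; rewrite !mxE hN; by apply: eq_bigr => k _; rewrite mxE.
have PQ : P *m Q = 1%:M.
  apply: (basis_inj hd); [exact: base_mulmx|exact: base_scalar|].
  by rewrite mul1mx -mulmxA -EQ -EP.
have QP : Q *m P = 1%:M.
  apply: (basis_inj hb); [exact: base_mulmx|exact: base_scalar|].
  by rewrite mul1mx -mulmxA -EP -EQ.
have NP : N *m P = P *m M.
  apply: (basis_inj hb); [exact: base_mulmx|exact: base_mulmx|].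
  by rewrite -!mulmxA -EP -EN -EM EP scalemxAr.
by rewrite -[N]mulmx1 -PQ mulmxA NP -mulmxA mxtrace_mulC -mulmxA QP mulmx1.
Qed.

Lemma coercive_is_basis n (b : 'I_n -> K) : coercive b -> kspan b = setT ->
  is_base_basis b.
Proof.
move=> [d d0 hd] sb x; have [c hc cE] : kspan b x by rewrite sb.
exists (\row_i c i); split.
  split; first by move=> i; rewrite mxE.
  by rewrite -cE; apply: eq_bigr => i _; rewrite mxE.
move=> c' [hc' cE']; apply/rowP => i; rewrite mxE; apply/eqP.
rewrite -subr_eq0 -(absv_eq0 v); apply/eqP/le_anti; rewrite v_ge0 andbT.
rewrite -(pmulr_rle0 _ d0).
apply: le_trans (hd (fun i => c i - c' 0 i) _ i) _; first by move=> k; apply: BB.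
rewrite (_ : lincomb _ _ = 0) ?absv0//.
rewrite /lincomb; under eq_bigr do rewrite mulrBl.
by rewrite sumrB -/(lincomb b c) cE -cE' subrr.
Qed.

Hypothesis Hc : is_completion iota.

(** [trace] is chosen among the traces in all bases. Since they agree, it can be computed in one
    coercive basis, whose coordinates are linear over the base field and bounded; continuity and
    linearity of the trace are read off there. *)
Lemma trace_structure : exists n (b : 'I_n -> K) (co : 'I_n -> K -> K) (C : R), [/\ 0 <= C,
  forall i x, B (co i x), forall x, x = \sum_i co i x * b i,
  forall i x, v (co i x) <= C * v x &
  [/\ forall i x y, co i (x + y) = co i x + co i y,
   forall i a x, B a -> co i (a * x) = a * co i x,
   (0 < n)%N & forall x, trace x = \sum_i co i (x * b i)]].
Proof.
have [n [b [cb sb]]] := exists_basis Hc.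
have hb := coercive_is_basis cb sb.
have [d d0 hd] := cb.
have [f hf] := basis_coords hb.
have fu x (c : 'rV[K]_n) : (forall i, B (c 0 i)) -> x = \sum_i c 0 i * b i -> f x = c.
  move=> hc cE; have [c' [_ uc]] := hb x.
  by rewrite -(uc c)// -(uc (f x)).
exists n, b, (fun i x => f x 0 i), d^-1; split.
- by rewrite invr_ge0 ltW.
- by move=> i x; case: (hf x).
- by move=> x; case: (hf x).
- move=> i x; rewrite ler_pdivlMl//.
  have [h1 h2] := hf x; apply: le_trans (hd _ h1 i) _.
  by rewrite /lincomb -h2.
split.
- move=> i x y; rewrite (fu (x + y) (f x + f y)) ?mxE// => [k|].
    by rewrite mxE; apply: BD; [case: (hf x)|case: (hf y)].
  have [_ {1}->] := hf x; have [_ {1}->] := hf y.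
  by rewrite -big_split; apply: eq_bigr => k _; rewrite mxE mulrDl.
- move=> i a x Ba; rewrite (fu (a * x) (a *: f x)) ?mxE// => [k|].
    by rewrite mxE; apply: BM => //; case: (hf x).
  have [_ {1}->] := hf x; rewrite mulr_sumr.
  by apply: eq_bigr => k _; rewrite mxE mulrA.
- case: n b cb sb hb d d0 hd f hf fu => // b _ sb *.
  have : kspan b 1 by rewrite sb.
  move=> [c _]; rewrite /lincomb big_ord0 => /esym/eqP.
  by rewrite oner_eq0.
- move=> x; rewrite /trace; case: xgetP => [a _|/(_ (\sum_i f (x * b i) 0 i)) []].
    move=> [m [b' [M [hb' BM' hM ->]]]].
    have := @trace_uniq n b (\matrix_(i, k) f (x * b i) 0 k) m b' M x hb.
    move=> <-//.
    + by apply: eq_bigr => i _; rewrite mxE.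
    + by move=> i k; rewrite mxE; case: (hf (x * b i)).
    + move=> i; have [_ {1}->] := hf (x * b i).
      by apply: eq_bigr => k _; rewrite mxE.
  exists n, b, (\matrix_(i, k) f (x * b i) 0 k); split => //.
  + by move=> i k; rewrite mxE; case: (hf (x * b i)).
  + move=> i; have [_ {1}->] := hf (x * b i).
    by apply: eq_bigr => k _; rewrite mxE.
  + by apply: eq_bigr => i _; rewrite mxE.
Qed.

Lemma traceD x y : trace (x + y) = trace x + trace y.
Proof.
have [n [b [co [C [_ _ _ _ [coD coZ _ tE]]]]]] := trace_structure.
by rewrite !tE -big_split; apply: eq_bigr => i _; rewrite mulrDl coD.
Qed.

Lemma traceZ a x : B a -> trace (a * x) = a * trace x.
Proof.
move=> Ba; have [n [b [co [C [_ _ _ _ [coD coZ _ tE]]]]]] := trace_structure.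
by rewrite !tE mulr_sumr; apply: eq_bigr => i _; rewrite -mulrA coZ.
Qed.

Lemma base_trace x : B (trace x).
Proof.
have [n [b [co [C [_ hB _ _ [coD coZ _ tE]]]]]] := trace_structure.
by rewrite tE; apply: Bsum.
Qed.

Lemma v_trace_le : exists2 C : R, 0 < C & forall x, v (trace x) <= C * v x.
Proof.
have [n [b [co [C [C0 _ _ hC [coD coZ _ tE]]]]]] := trace_structure.
exists (1 + \sum_i C * v (b i)) => [|x].
  rewrite ltr_pwDl// sumr_ge0// => i _; by rewrite mulr_ge0// v_ge0.
rewrite tE; apply: le_trans (v_sum _ _ _) _.
rewrite mulrDl mul1r; apply: le_trans (_ : \sum_i C * v (b i) * v x <= _).
  apply: ler_sum => i _; apply: le_trans (hC _ _) _.
  by rewrite vM [v x * _]mulrC mulrA.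
by rewrite mulr_suml lerDr v_ge0.
Qed.

(** The trace of 1 is the degree of K over the base field, and K has characteristic 0. This is the
    source of the nondegeneracy of the trace form. *)
Lemma trace1_neq0 : trace (1 : K) != 0.
Proof.
have [n [b [co [C [_ hB hE _ [coD coZ n0 tE]]]]]] := trace_structure.
have [n' [b' [cb sb]]] := exists_basis Hc.
have hb := coercive_is_basis cb sb.
have E : trace (1 : K) = n'%:R.
  rewrite /trace; case: xgetP => [a _ [m [d [M [hd BM' hM ->]]]]|/(_ n'%:R)[]].
    rewrite -(mxtrace1 _ n'); apply: (@trace_uniq m d M n' b' 1%:M 1) => //.
    - exact: base_scalar.
    - move=> i; rewrite mul1r (bigD1 i)//= mxE eqxx mul1r big1 ?addr0// => k ki.
      by rewrite mxE eq_sym (negPf ki) mul0r.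
  exists n', b', 1%:M; split=> //.
  - exact: base_scalar.
  - move=> i; rewrite mul1r (bigD1 i)//= mxE eqxx mul1r big1 ?addr0// => k ki.
    by rewrite mxE eq_sym (negPf ki) mul0r.
  - by rewrite mxtrace1.
rewrite E -(jnat j) fmorph_eq0 pnatr_eq0.
apply/eqP => n'0; move: b' cb sb hb; rewrite n'0 => b' _ sb _.
have : kspan b' 1 by rewrite sb.
by move=> [c _]; rewrite /lincomb big_ord0 => /esym/eqP; rewrite oner_eq0.
Qed.

End trace_theory.

Section expi_theory.
Variable R : realType.
Implicit Types r s : R.

Lemma expiD r s : expi (r + s) = expi r * expi s.
Proof.
apply: complex_eq; rewrite ?ReM ?ImM /= ?cosD ?sinD//.
by rewrite addrC [in LHS]mulrC [X in _ + X]mulrC addrC mulrC [in X in _ + X]mulrC addrC.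
Qed.

Lemma expi0 : expi 0 = 1 :> R[i].
Proof. by rewrite /expi cos0 sin0. Qed.

Lemma normc_expi r : normc (expi r) = 1.
Proof. by rewrite /= cos2Dsin2 sqrtr1. Qed.

Lemma expiN r : expi (- r) = (expi r)^*.
Proof. by rewrite /expi cosN sinN. Qed.

Lemma expi_nat2pi (n : nat) : expi (2 * pi * n%:R) = 1 :> R[i].
Proof.
elim: n => [|n IH]; first by rewrite mulr0 expi0.
rewrite -[n.+1%:R]natr1 mulrDr expiD IH mul1r mulr1.
by rewrite /expi mulr_natl cos2pi sin2pi.
Qed.

Lemma expi_int2pi (z : int) : expi (2 * pi * z%:~R) = 1 :> R[i].
Proof.
case: z => n; first exact: expi_nat2pi.
rewrite NegzE mulrNz mulrN expiN -pmulrn expi_nat2pi.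
by apply: complex_eq; rewrite ?Re_conj ?Im_conj/= ?oppr0.
Qed.

End expi_theory.

(** * The additive character at a finite place *)

Section ultrametric_character.
Context (R : realType) (F : fieldExtType rat) (K0 : fieldType)
  (v : absolute_value R K0) (iota : {rmorphism F -> valued v}).
Local Notation K := (valued v).
Local Notation B := (@base_field R K0 v).
Implicit Types (x y z a b : K) (q r s : rat).
Local Notation j := (rat_morph iota).
Local Notation jE := (rat_morphE iota).
Hypothesis Hc : is_completion iota.
Hypothesis um : ultrametric v.

Definition is_polar_part a q := [/\ 0 <= q < 1, v (a - ratr q) <= 1 &
    exists (p n : nat) (m : int),
      [/\ prime p, v (p%:R : K) < 1 & q = m%:~R / (p ^ n)%:R]].

Variable p : nat.
Hypotheses (pp : prime p) (vp : v (p%:R : K) < 1).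

Let p0 n : (p ^ n)%:R != 0 :> rat.
Proof. by rewrite pnatr_eq0 -lt0n expn_gt0 prime_gt0. Qed.

(** Membership in Z[1/p]. Polar parts lie there, and the elements of Z[1/p] with v at most 1 are
    exactly the integers, which the exponential does not see. *)
Definition p_integer q := exists (n : nat) (m : int), q = m%:~R / (p ^ n)%:R.

Lemma p_integerD q r : p_integer q -> p_integer r -> p_integer (q + r).
Proof.
move=> [n [m ->]] [n' [m' ->]]; exists (n + n')%N, (m * (p ^ n')%N + m' * (p ^ n)%N).
rewrite expnD natrM intrD !intrM -!pmulrn.
by field; rewrite !p0.
Qed.

Lemma p_integerN q : p_integer q -> p_integer (- q).
Proof. by move=> [n [m ->]]; exists n, (- m); rewrite mulrNz mulNr. Qed.

Lemma p_integer_int q : p_integer q -> v (j q) <= 1 -> exists z : int, q = z%:~R.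
Proof.
move=> [n [m qE]] q1.
have cp := denq_coprime um pp vp q1.
have E : numq q * (p ^ n)%N%:Z = m * denq q.
  apply: (@intr_inj rat); rewrite !intrM numqE -!pmulrn {1}qE.
  by field; rewrite p0.
have dd : (denq q %| (p ^ n)%N%:Z)%Z.
  rewrite -(@Gauss_dvdzr _ (numq q)) ?E ?dvdz_mull//.
  rewrite coprimez_sym coprimezE; exact: coprime_num_den.
have : coprimez (denq q) (p ^ n)%N%:Z.
  by rewrite coprimez_sym -[(p ^ n)%N%:Z]natz natrX natz coprimezXl.
move=> c1.
have : `|denq q|%N = 1%N.
  move: c1 dd; rewrite coprimezE dvdzE /= => c1 dd.
  by apply/eqP; rewrite -dvdn1 -(Gauss_dvdr _ c1) muln1.
move=> dq; have {}dq : denq q = 1.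
  by rewrite -[denq q]gez0_abs ?(ltW (denq_gt0 q))// dq.
by exists (numq q); rewrite -[LHS]divq_num_den dq divr1.
Qed.

(** The prime in the definition of the polar part is existentially quantified. It must be p:
    distinct primes are coprime, and then they cannot both have v below 1. *)
Lemma is_polar_p a q : is_polar_part a q -> p_integer q.
Proof.
move=> [_ _ [p' [n [m [pp' vp' ->]]]]]; exists n, m.
have [->//|pp'n] := eqVneq p p'.
have : v (p'%:R : K) = 1.
  apply: (v_coprimez um (p := p) (m := p')) => //.
  rewrite coprimezE /= prime_coprime// dvdn_prime2//.
by move=> E; move: vp'; rewrite E ltxx.
Qed.

Lemma polar_part_exists a : B a -> exists q, is_polar_part a q.
Proof.
move=> /base_fieldP /(_ 1 ltr01) [r ar].
have [s hs] : exists s : nat, v (p%:R : K) ^+ s < (v (j r) + 1)^-1.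
  by apply: pow_small => //; rewrite ?v_ge0 ?invr_gt0 ?ltr_wpDl ?v_ge0.
(* The same s serves twice: p^s clears the pole of r, and precision p^s leaves an error of v at most
   v(p)^s / v(p)^s = 1, that is, an integral remainder. *)
have [|c cp hc] := @rat_approx _ _ _ j um p pp vp r s s.
  apply: (@le_trans _ _ ((v (j r) + 1) * (v (j r) + 1)^-1)); last first.
    by rewrite divff// gt_eqF// ltr_wpDl ?v_ge0.
  by apply: ler_pM; rewrite ?v_ge0 ?exprn_ge0 ?v_ge0 ?lerDl// ltW.
exists (c%:R / (p ^ s)%:R); split.
- by rewrite divr_ge0 ?ler0n//= ltr_pdivrMr ?ltr0n ?expn_gt0 ?prime_gt0// mul1r ltr_nat.
- have -> : a - ratr (c%:R / (p ^ s)%:R) = (a - ratr r) + (j r - j (c%:R / (p ^ s)%:R)).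
    by rewrite !jE addrA subrK.
  apply: le_trans (um _ _) _; rewrite ge_max ltW//=.
  apply: le_trans hc _; rewrite divff// expf_neq0// absv_eq0.
  by rewrite -(jnat j) fmorph_eq0 pnatr_eq0 -lt0n prime_gt0.
- by exists p, s, c.
Qed.

Lemma polar_partP a : B a -> is_polar_part a (polar_part a).
Proof.
move=> /polar_part_exists[q hq]; rewrite /polar_part.
by case: xgetP => [r _ //|/(_ q)]; case.
Qed.

(** Polar parts are additive only modulo integers: s - q - r lies in Z[1/p], and its v is at most 1
    because each part differs from its argument by an element with v at most 1. *)
Lemma is_polar_int a b c q r s : is_polar_part a q -> is_polar_part b r ->
  is_polar_part c s -> v (c - (a + b)) <= 1 -> exists z : int, s = q + r + z%:~R.
Proof.
move=> ha hb hc cab.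
have [||z zE] := @p_integer_int (s - (q + r)).
- apply: p_integerD; first exact: is_polar_p hc.
  by apply: p_integerN; apply: p_integerD; [exact: is_polar_p ha|exact: is_polar_p hb].
- have -> : j (s - (q + r)) = (c - (a + b)) + ((a - ratr q) + ((b - ratr r) - (c - ratr s))).
    by rewrite !jE rmorphB rmorphD; ring.
  case: ha hb hc => _ h1 _ [_ h2 _] [_ h3 _].
  apply: le_trans (um _ _) _; rewrite ge_max cab/=.
  apply: le_trans (um _ _) _; rewrite ge_max h1/=.
  by apply: le_trans (um _ _) _; rewrite ge_max h2/= absvN h3.
- by exists z; rewrite -zE addrC subrK.
Qed.

Let lE x : lambda x = expi (2 * pi * ratr (polar_part (trace x))).
Proof. by rewrite /lambda; case: asboolP. Qed.

Lemma ultra_lambdaD x y : lambda (x + y) = lambda x * lambda y.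
Proof.
rewrite !lE -expiD.
have Bt z : B (trace z) by exact: (base_trace Hc).
have [|z ->] := is_polar_int (polar_partP (Bt x)) (polar_partP (Bt y)) (polar_partP (Bt (x + y))).
  by rewrite (traceD Hc) subrr absv0 ler01.
set q := polar_part (trace x); set r := polar_part (trace y).
have -> : ratr (q + r + z%:~R) = ratr q + ratr r + z%:~R :> R.
  by rewrite !rmorphD/= ratr_int.
by rewrite mulrDr [in LHS]expiD expi_int2pi mulr1 mulrDr.
Qed.

Lemma ultra_lambda1 : exists2 d : R, 0 < d & forall x, v x < d -> lambda x = 1.
Proof.
have [C C0 hC] := v_trace_le Hc.
exists C^-1; first by rewrite invr_gt0.
move=> x xC; rewrite lE.
have h0 : is_polar_part 0 0.
  split; rewrite ?lexx ?ltr01// ?rmorph0 ?subrr ?absv0 ?ler01//.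
    by rewrite jE rmorph0 subrr absv0 ler01.
  by exists p, 0%N, 0; split=> //; rewrite mul0r.
have Btx : B (trace x) by exact: (base_trace Hc).
have [|z ->] := is_polar_int h0 h0 (polar_partP Btx).
  rewrite addr0 subr0; apply: le_trans (hC x) _.
  by rewrite -ler_pdivlMl// mulr1 ltW.
by rewrite !add0r ratr_int expi_int2pi.
Qed.

End ultrametric_character.

(** * Identification of the base field with the reals at an archimedean place *)

Section real_embedding.
Context (R : realType) (F : fieldExtType rat) (K0 : fieldType)
  (v : absolute_value R K0) (iota : {rmorphism F -> valued v}).
Local Notation K := (valued v).
Local Notation B := (@base_field R K0 v).
Implicit Types (x y z a b : K) (q : rat) (r s : R).
Local Notation j := (rat_morph iota).
Local Notation jE := (rat_morphE iota).
Hypothesis Hc : is_completion iota.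
Hypothesis nu : ~ ultrametric v.

Lemma half_pow_small (e : R) : 0 < e -> exists k : nat, 2%:R ^- k < e.
Proof.
have h1 : (0 : R) <= 2%:R^-1 by rewrite invr_ge0.
have h2 : 2%:R^-1 < (1 : R) by rewrite invf_lt1// ltr1n.
by move=> e0; have [k hk] := pow_small h1 h2 e0; exists k; rewrite -exprVn.
Qed.

Lemma ratr_norm_le q (k : nat) : `|q| <= 2%:R ^- k -> `|ratr q : R| <= 2%:R ^- k.
Proof.
move=> h; rewrite -ratr_norm.
have -> : 2%:R ^- k = ratr (2%:R ^- k) :> R by rewrite fmorphV rmorphXn/= ratr_nat.
by rewrite ler_rat.
Qed.

Lemma ratr_norm_lt q (k : nat) : `|ratr q : R| < 2%:R ^- k -> `|q| < 2%:R ^- k.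
Proof.
rewrite -ratr_norm.
have -> : 2%:R ^- k = ratr (2%:R ^- k) :> R by rewrite fmorphV rmorphXn/= ratr_nat.
by rewrite ltr_rat.
Qed.

Lemma same_real_ratr q : same_real (ratr q : K) (ratr q : R).
Proof. by move=> e e0; exists q; rewrite !subrr absv0 normr0. Qed.

Lemma same_realD a b r s : same_real a r -> same_real b s -> same_real (a + b) (r + s).
Proof.
move=> h1 h2 e e0; have e2 : 0 < e / 2 by rewrite divr_gt0.
have [p [p1 p2]] := h1 _ e2; have [q [q1 q2]] := h2 _ e2.
exists (p + q); split.
  have -> : a + b - ratr (p + q) = (a - ratr p) + (b - ratr q).
    by rewrite !jE rmorphD; ring.
  by apply: le_lt_trans (vD_le _ _) _; rewrite [ltRHS](splitr e) ltrD.
have -> : r + s - ratr (p + q) = (r - ratr p) + (s - ratr q) :> R.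
  by rewrite rmorphD/=; ring.
by apply: le_lt_trans (ler_normD _ _) _; rewrite [ltRHS](splitr e) ltrD.
Qed.

Lemma same_realM a b r s : same_real a r -> same_real b s -> same_real (a * b) (r * s).
Proof.
move=> h1 h2 e e0.
have [] := (vcontP _ (a, b)).1 (@vmul_continuous _ _ v (a, b)) e e0.
case=> P Q /= [/vnbhsP[d1 d10 hP] /vnbhsP[d2 d20 hQ]] hPQ.
have /cvgrPdist_lt/(_ e e0) [] := @mul_continuous R (r, s).
case=> P' Q' /= [/nbhs_ballP[d3 d30 hP'] /nbhs_ballP[d4 d40 hQ']] hPQ'.
have m1 : 0 < Num.min d1 d3 by rewrite lt_min d10.
have m2 : 0 < Num.min d2 d4 by rewrite lt_min d20.
have [p []] := h1 _ m1; rewrite !lt_min => /andP[p1 _] /andP[_ p3].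
have [q []] := h2 _ m2; rewrite !lt_min => /andP[q1 _] /andP[_ q3].
exists (p * q); split.
  rewrite vdistC.
  have -> : ratr (p * q) = (ratr p : K) * ratr q by rewrite !jE rmorphM.
  by apply: (hPQ (ratr p, ratr q)); split; [apply: hP|apply: hQ]; rewrite vdistC.
have -> : ratr (p * q) = (ratr p : R) * ratr q by rewrite rmorphM.
by apply: (hPQ' (ratr p, ratr q)); split; [apply: hP'|apply: hQ'].
Qed.

Lemma same_realN a r : same_real a r -> same_real (- a) (- r).
Proof.
move=> /(same_realM (same_real_ratr (-1))).
by rewrite jE !rmorphN !rmorph1 !mulN1r.
Qed.

(** This lemma and its converse [real_same_small] express uniform continuity of the correspondence
    in both directions. Uniqueness follows by subtraction, and existence by sending a Cauchy
    sequence of rationals from one side to the other. *)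
Lemma same_real_small (e : R) : 0 < e -> exists2 d : R, 0 < d &
  forall a r, same_real a r -> v a < d -> `|r| < e.
Proof.
move=> e0; have e2 : 0 < e / 2 by rewrite divr_gt0.
have [k hk] := half_pow_small e2; have [d d0 hd] := v_small_inv j nu k.
exists (d / 2); first by rewrite divr_gt0.
move=> a r h ad.
have m0 : 0 < Num.min (d / 2) (e / 2) by rewrite lt_min divr_gt0.
have [q [q1 q2]] := h _ m0; rewrite !lt_min in q1 q2.
have qd : v (j q) < d.
  have -> : j q = a - (a - ratr q) by rewrite jE; ring.
  apply: le_lt_trans (vB_le _ _) _; rewrite [ltRHS](splitr d) ltrD//.
  by case/andP: q1.
have /ratr_norm_le qk := hd q qd.
have -> : r = (r - ratr q) + ratr q by rewrite subrK.
apply: le_lt_trans (ler_normD _ _) _; rewrite [ltRHS](splitr e) ltr_leD//.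
  by case/andP: q2.
by apply: le_trans qk _; exact: ltW.
Qed.

Lemma real_same_small (e : R) : 0 < e -> exists2 d : R, 0 < d &
  forall a r, same_real a r -> `|r| < d -> v a < e.
Proof.
move=> e0; have e2 : 0 < e / 2 by rewrite divr_gt0.
have [k hk] := v_small j nu e2.
pose d : R := 2%:R ^- k; have d0 : 0 < d by rewrite invr_gt0 exprn_gt0.
exists (d / 2); first by rewrite divr_gt0.
move=> a r h ad.
have m0 : 0 < Num.min (d / 2) (e / 2) by rewrite lt_min !divr_gt0.
have [q [q1 q2]] := h _ m0; rewrite !lt_min in q1 q2.
have qd : `|ratr q : R| < d.
  have -> : ratr q = r - (r - ratr q) by ring.
  apply: le_lt_trans (ler_normB _ _) _; rewrite [ltRHS](splitr d) ltrD//.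
  by case/andP: q2.
have qk := hk _ (ratr_norm_lt qd).
have -> : a = (a - ratr q) + j q by rewrite jE subrK.
apply: le_lt_trans (vD_le _ _) _; rewrite [ltRHS](splitr e) ltrD//.
by case/andP: q1.
Qed.

Lemma same_real_uniq a r s : same_real a r -> same_real a s -> r = s.
Proof.
move=> h1 h2; apply/eqP; rewrite -subr_eq0 -normr_eq0.
have h := same_realD h1 (same_realN h2); rewrite subrr in h.
rewrite eq_le normr_ge0 andbT; apply/ler_addgt0Pr => e e0; rewrite add0r ltW//.
have [d d0 hd] := same_real_small e0.
by apply: hd h _; rewrite absv0.
Qed.

Lemma same_real_uniq2 a b r : same_real a r -> same_real b r -> a = b.
Proof.
move=> h1 h2; apply/eqP; rewrite -subr_eq0; apply/eqP; apply: v_eq0_le => e e0.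
have h := same_realD h1 (same_realN h2); rewrite subrr in h.
have [d d0 hd] := real_same_small e0.
by apply/ltW/(hd _ _ h); rewrite normr0.
Qed.

Lemma same_real_exists a : B a -> exists r, same_real a r.
Proof.
move=> /base_fieldP Ba.
have /choice[q hq] : forall n, exists q, v (a - ratr q) < n.+1%:R^-1.
  by move=> n; apply: Ba; rewrite invr_gt0.
have small (e : R) : 0 < e -> exists N, forall n, (N <= n)%N -> n.+1%:R^-1 < e.
  move=> e0; have /cvgrPdist_lt/(_ _ e0)[N _ hN] := @cvg_harmonic R.
  by exists N => n Nn; have := hN n Nn; rewrite /= sub0r normrN ger0_norm.
have cq : cvgn (fun n => ratr (q n) : R).
  apply: cauchy_cvg; apply: cauchy_exP => e e0 /=.
  have [d d0 hd] := same_real_small e0.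
  have d2 : 0 < d / 2 by rewrite divr_gt0.
  have [N hN] := small _ d2.
  exists (ratr (q N)); exists N => // n Nn /=; rewrite /ball/= -rmorphB/=.
  apply: hd (same_real_ratr _) _.
  rewrite jE rmorphB -!jE.
  have -> : ratr (q N) - ratr (q n) = (a - ratr (q n)) - (a - ratr (q N)) :> K by ring.
  apply: le_lt_trans (vB_le _ _) _; rewrite [ltRHS](splitr d) ltrD//.
    exact: lt_trans (hq _) (hN _ Nn).
  exact: lt_trans (hq _) (hN _ (leqnn N)).
exists (limn (fun n => ratr (q n) : R)) => e e0.
have [N hN] := small _ e0.
have /cvgrPdist_lt/(_ _ e0)[M _ hM] := cq.
exists (q (maxn N M)); split; last by apply: hM; exact: leq_maxr.
by apply: lt_trans (hq _) (hN _ _); exact: leq_maxl.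
Qed.

Lemma same_real_exists2 r : exists a, same_real a r.
Proof.
have small (e : R) : 0 < e -> exists N, forall n, (N <= n)%N -> n.+1%:R^-1 < e.
  move=> e0; have /cvgrPdist_lt/(_ _ e0)[N _ hN] := @cvg_harmonic R.
  by exists N => n Nn; have := hN n Nn; rewrite /= sub0r normrN ger0_norm.
have /choice[q hq] : forall n : nat, exists q, `|r - ratr q| < n.+1%:R^-1.
  move=> n; have /rat_in_itvoo[q] : r - n.+1%:R^-1 < r + n.+1%:R^-1.
    by rewrite ltrBlDr -addrA ltrDl addr_gt0 ?invr_gt0.
  rewrite in_itv /= => /andP[h1 h2]; exists q.
  by rewrite distrC ltr_distl h1 h2.
have [complete _ _] := Hc.
pose G : set_system K := (fun n => ratr (q n) : K) @ \oo.
have PG : ProperFilter G by exact: fmap_proper_filter.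
have cG : cauchy G.
  apply: cauchy_exP => e e0 /=.
  have [d d0 hd] := real_same_small e0.
  have d2 : 0 < d / 2 by rewrite divr_gt0.
  have [N hN] := small _ d2.
  exists (ratr (q N)); exists N => // n Nn /=; apply/vballE.
  have -> : ratr (q N) - ratr (q n) = ratr (q N - q n) :> K by rewrite !jE rmorphB.
  apply: hd (same_real_ratr _) _.
  rewrite rmorphB /=.
  have -> : ratr (q N) - ratr (q n) = (r - ratr (q n)) - (r - ratr (q N)) :> R by ring.
  apply: le_lt_trans (ler_normB _ _) _; rewrite [ltRHS](splitr d) ltrD//.
    exact: lt_trans (hq _) (hN _ Nn).
  exact: lt_trans (hq _) (hN _ (leqnn N)).
have /cvg_ex[a Ga] := complete G PG cG.
exists a => e e0.
have [N hN] := small _ e0.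
have : G [set y | v (y - a) < e] by apply: Ga; apply/vnbhsP; exists e.
case=> M _ hM.
exists (q (maxn N M)); split.
  by rewrite vdistC; apply: (hM (maxn N M)); exact: leq_maxr.
by apply: lt_trans (hq _) (hN _ _); exact: leq_maxl.
Qed.

Lemma same_real_base a r : same_real a r -> B a.
Proof. by move=> h; apply/base_fieldP => e /h[q []]; exists q. Qed.

Lemma to_realP a : B a -> same_real a (to_real a).
Proof.
move=> /same_real_exists[r hr]; rewrite /to_real.
by case: xgetP => [s _ //|/(_ r)].
Qed.

Lemma of_realP r : same_real (of_real v r) r.
Proof.
have [a ha] := same_real_exists2 r; rewrite /of_real.
by case: xgetP => [s _ //|/(_ a)].
Qed.

Lemma of_realD r s : of_real v (r + s) = of_real v r + of_real v s.
Proof. by apply: same_real_uniq2 (of_realP _) _; apply: same_realD; exact: of_realP. Qed.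

Lemma of_real0 : of_real v 0 = 0.
Proof.
apply: same_real_uniq2 (of_realP _) _.
by have := same_real_ratr 0; rewrite jE !rmorph0.
Qed.

Lemma base_of_real r : B (of_real v r).
Proof. exact: same_real_base (of_realP r). Qed.

Lemma of_realK a : B a -> of_real v (to_real a) = a.
Proof. by move=> Ba; apply: same_real_uniq2 (of_realP _) (to_realP Ba). Qed.

Lemma v_of_real_small (e : R) : 0 < e -> exists2 d : R, 0 < d &
  forall r, `|r| < d -> v (of_real v r) < e.
Proof.
move=> /real_same_small[d d0 hd]; exists d => // r; exact/hd/of_realP.
Qed.

(** The real linear form attached to u by the trace pairing. These forms serve as real coordinates
    on K, both for cut-off functions and as the multipliers and frequencies of the Fourier
    transform. *)
Definition rlin (u x : K) : R := to_real (trace (u * x)).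

Let Bt x : B (trace x). Proof. exact: (base_trace Hc). Qed.

Lemma rlinD u x y : rlin u (x + y) = rlin u x + rlin u y.
Proof.
have E : trace (u * (x + y)) = trace (u * x) + trace (u * y).
  by rewrite mulrDr; exact: (traceD Hc).
rewrite /rlin E; apply: same_real_uniq (to_realP _) _.
  by apply: (baseD jE).
by apply: same_realD; exact: to_realP.
Qed.

Lemma rlinZ u r x : rlin u (of_real v r * x) = r * rlin u x.
Proof.
have Bo : B (of_real v r) by exact: base_of_real.
have E : trace (u * (of_real v r * x)) = of_real v r * trace (u * x).
  by rewrite mulrCA; exact: (traceZ Hc).
rewrite /rlin E.
apply: same_real_uniq (to_realP _) _.
  exact: (baseM jE).
by apply: same_realM; [exact: of_realP|exact: to_realP].
Qed.

Lemma rlin0 u : rlin u 0 = 0.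
Proof. by have := rlinZ u 0 0; rewrite mulr0 mul0r. Qed.

Lemma rlinN u x : rlin u (- x) = - rlin u x.
Proof. by apply/eqP; rewrite -subr_eq0 opprK -rlinD addNr rlin0. Qed.

Lemma rlinC u x : rlin u x = rlin x u. Proof. by rewrite /rlin mulrC. Qed.

Lemma rlin_small u (e : R) : 0 < e -> exists2 d : R, 0 < d &
  forall x, v x < d -> `|rlin u x| < e.
Proof.
move=> /same_real_small[d d0 hd]; have [C C0 hC] := v_trace_le Hc.
exists (d / (C * (v u + 1))).
  by rewrite divr_gt0// mulr_gt0// ltr_wpDl ?v_ge0.
move=> x; rewrite ltr_pdivlMr ?mulr_gt0 ?ltr_wpDl ?v_ge0// => xd.
have Btx : B (trace (u * x)) by [].
apply: hd (to_realP Btx) _; apply: le_lt_trans (hC _) _.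
apply: le_lt_trans xd; rewrite vM.
have -> : C * (v u * v x) = v x * (C * v u) by ring.
by rewrite ler_wpM2l ?v_ge0// ler_pM2l// lerDl.
Qed.

End real_embedding.

Section additive_character.
Context (R : realType) (F : fieldExtType rat) (K0 : fieldType)
  (v : absolute_value R K0) (iota : {rmorphism F -> valued v}).
Local Notation K := (valued v).
Implicit Types (x y z a b u : K) (r s : R).
Hypothesis Hc : is_completion iota.

Lemma arch_lambdaE x y : ~ ultrametric v ->
  lambda (x * y) = expi (- (2 * pi * rlin x y)).
Proof. by move=> nu; rewrite /lambda; case: asboolP. Qed.

Lemma lambdaD x y : lambda (x + y) = lambda x * lambda y.
Proof.
have [um|nu] := pselect (ultrametric v).
  have [p pp vp] := exists_prime_v_lt1 Hc um.
  exact: (ultra_lambdaD Hc um pp vp).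
rewrite -[x]mul1r -[y]mul1r -mulrDr !arch_lambdaE// (rlinD Hc nu) mulrDr opprD.
by rewrite expiD.
Qed.

Lemma lambda0 : lambda (0 : K) = 1.
Proof.
have [um|nu] := pselect (ultrametric v).
  have [p pp vp] := exists_prime_v_lt1 Hc um.
  by have [d d0 h] := ultra_lambda1 Hc um pp vp; apply: h; rewrite absv0.
by rewrite -[X in lambda X](mul1r 0) arch_lambdaE// (rlin0 Hc nu) mulr0 oppr0 expi0.
Qed.

Lemma normc_lambda x : normc (lambda x) = 1.
Proof. by rewrite /lambda; case: asboolP => _; exact: normc_expi. Qed.

Lemma lambdaN x : lambda (- x) = (lambda x)^*.
Proof.
have /(congr1 (fun w => w * (lambda x)^*)) : lambda x * lambda (- x) = 1.
  by rewrite -lambdaD subrr lambda0.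
rewrite mul1r mulrAC.
have -> : lambda x * (lambda x)^* = 1.
  have := normcE2 (lambda x); rewrite normc_lambda expr1n => E.
  by apply: complex_eq; rewrite ?ReM ?ImM Re_conj Im_conj /= ?[in RHS]E; ring.
by rewrite mul1r.
Qed.

Lemma lambda_small (e : R) : 0 < e -> exists2 d : R, 0 < d &
  forall x, v x < d -> normc (lambda x - 1) < e.
Proof.
move=> e0; have [um|nu] := pselect (ultrametric v).
  have [p pp vp] := exists_prime_v_lt1 Hc um.
  have [d d0 h] := ultra_lambda1 Hc um pp vp; exists d => // x /h ->.
  by rewrite subrr normc0.
have e2 : 0 < e / 2 by rewrite divr_gt0.
have [d1 /= d10 h1] : \forall r \near (0 : R), `|cos (0 : R) - cos r| < e / 2.
  by have /cvgrPdist_lt/(_ _ e2) := @continuous_cos R 0.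
have [d2 /= d20 h2] : \forall r \near (0 : R), `|sin (0 : R) - sin r| < e / 2.
  by have /cvgrPdist_lt/(_ _ e2) := @continuous_sin R 0.
pose d := Num.min d1 d2 / (2 * pi).
have pi20 : 0 < 2 * pi :> R by rewrite mulr_gt0 ?pi_gt0.
have d0 : 0 < d by rewrite divr_gt0// lt_min d10.
have [c c0 hc] := rlin_small Hc nu 1 d0.
exists c => // x /hc; rewrite ltr_pdivlMr// lt_min => /andP[l1 l2].
rewrite -[x]mul1r arch_lambdaE//; set t := 2 * pi * _.
have tE : `|t| = `|rlin 1 x| * (2 * pi) by rewrite normrM (gtr0_norm pi20) mulrC.
have b1 : `|cos (0:R) - cos (- t)| < e / 2.
  by apply: h1 => /=; rewrite sub0r opprK tE.
have b2 : `|sin (0:R) - sin (- t)| < e / 2.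
  by apply: h2 => /=; rewrite sub0r opprK tE.
apply: le_lt_trans (normc_leD _) _; rewrite ReD ImD ReN ImN /=.
rewrite cos0 in b1; rewrite sin0 in b2.
by rewrite [ltRHS](splitr e) ltrD// distrC.
Qed.

End additive_character.

Lemma continuous_bigsum (R : realType) (T : topologicalType) (I : Type) (r : seq I)
    (f : I -> T -> R) : (forall i, continuous (f i)) ->
  continuous (fun x => \sum_(i <- r) f i x).
Proof.
move=> fc x; elim: r => [|i r IH].
  by under eq_fun do rewrite big_nil; exact: cvg_cst.
by under eq_fun do rewrite big_cons; apply: cvgD; [exact: fc|exact: IH].
Qed.

Section real_functionals.
Context (R : realType) (F : fieldExtType rat) (K0 : fieldType)
  (v : absolute_value R K0) (iota : {rmorphism F -> valued v}).
Local Notation K := (valued v).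
Local Notation B := (@base_field R K0 v).
Implicit Types (x y z a b u : K) (r s : R).
Local Notation jE := (rat_morphE iota).
Hypothesis Hc : is_completion iota.
Hypothesis nu : ~ ultrametric v.

Lemma rlin_continuous u : continuous (fun x : K => rlin u x).
Proof.
move=> x; apply/(@cvgrPdist_lt _ _ _ (nbhs (x : K))) => e e0; apply/vnbhsP.
have [d d0 hd] := rlin_small Hc nu u e0.
exists d => // y xy; rewrite -(rlinN Hc nu) -(rlinD Hc nu).
by apply: hd; rewrite vdistC.
Qed.

Lemma of_real2X (k : nat) : of_real v (2%:R ^+ k) = 2%:R ^+ k.
Proof.
apply: (same_real_uniq2 iota nu) (of_realP Hc nu _) _.
have -> : 2%:R ^+ k = ratr (2%:R ^+ k) :> K by rewrite jE j2X.
have -> : (2%:R ^+ k : R) = ratr (2%:R ^+ k) by rewrite rmorphXn/= ratr_nat.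
exact: same_real_ratr.
Qed.

Lemma real_coordinates : exists n (b : 'I_n -> K) (c : 'I_n -> K -> R),
  (forall x, x = \sum_i of_real v (c i x) * b i) /\
  forall e : R, 0 < e -> exists2 d : R, 0 < d & forall i x, v x < d -> `|c i x| < e.
Proof.
have [n [b [co [C [C0 hB hE hC _]]]]] := trace_structure Hc.
exists n, b, (fun i x => to_real (co i x)); split => [x|e e0].
  rewrite [LHS]hE; apply: eq_bigr => i _; congr (_ * _).
  by apply/esym; exact: (of_realK Hc nu).
have [d d0 hd] := same_real_small iota nu e0.
exists (d / (C + 1)); first by rewrite divr_gt0// ltr_wpDl.
move=> i x; rewrite ltr_pdivlMr ?ltr_wpDl// => xd.
have Bc : B (co i x) by [].
apply: hd (to_realP iota nu Bc) _; apply: le_lt_trans (hC i x) _.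
by apply: le_lt_trans xd; rewrite mulrDr mulr1 mulrC lerDl v_ge0.
Qed.

(** If all traces of b_i y vanish with y nonzero, expanding y^-1 in the basis b gives Tr(y^-1 y) =
    0, against Tr(1) != 0. *)
Lemma rlin_nondegenerate : exists n (u : 'I_n -> K),
  forall y, (forall i, rlin (u i) y = 0) -> y = 0.
Proof.
have [n [b [co [C [C0 hB hE hC _]]]]] := trace_structure Hc.
exists n, b => y hy; apply/eqP; apply: contraT => y0.
have tb i : trace (b i * y) = 0.
  have Bt : B (trace (b i * y)) by exact: (base_trace Hc).
  rewrite -[LHS](of_realK Hc nu Bt); have := hy i; rewrite /rlin => ->.
  exact: (of_real0 Hc nu).
have : trace (1 : K) = 0.
  rewrite -(mulVf y0) (hE y^-1) mulr_suml.
  have tsum (r : seq 'I_n) : trace (\sum_(i <- r) co i y^-1 * b i * y) = 0.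
    elim: r => [|i r IH].
      rewrite big_nil; have := traceD Hc 0 0; rewrite addr0 => /eqP.
      by rewrite -subr_eq0 opprD addrA subrr sub0r oppr_eq0 => /eqP.
    rewrite big_cons (traceD Hc) IH addr0 -mulrA (traceZ Hc); last exact: hB.
    by rewrite tb mulr0.
  exact: tsum.
by move/eqP; rewrite (negPf (trace1_neq0 Hc)).
Qed.

(** By nondegeneracy g is continuous and positive off 0, hence bounded below on compact annuli;
    scaling by powers of 2 carries the bound on 1 <= v <= v(2) to every large y. Since v may be a
    power of the usual absolute value with exponent below 1, the comparison is affine, and a
    separate statement covers the neighbourhoods of 0. *)
Lemma rnorm_structure : exists n (u : 'I_n -> K), let g (y : K) : R := \sum_i `|rlin (u i) y| in
  [/\ exists2 C : R, 0 <= C & forall y, v y <= 1 + C * g y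
   & forall d : R, 0 < d -> exists2 e : R, 0 < e & forall y, g y < e -> v y < d].
Proof.
have [n [u hu]] := rlin_nondegenerate.
exists n, u => g.
have g0 y : 0 <= g y by rewrite sumr_ge0.
have gp y : y != 0 -> 0 < g y.
  move=> y0; rewrite lt_def g0 andbT; apply: contraNneq y0 => gy.
  apply/eqP/hu => i; apply/eqP; rewrite -normr_eq0.
  by have /eqP := gy; rewrite psumr_eq0// => /allP/(_ i); rewrite mem_index_enum => /(_ isT).
have gc : continuous g.
  apply: continuous_bigsum => i x.
  by apply: (@cvg_norm _ _ _ (nbhs (x : K))); exact: rlin_continuous.
have annulus (a M : R) : 0 < a -> exists2 m : R, 0 < m &
    forall y, a <= v y -> v y <= M -> m <= g y.
  move=> a0; pose A := [set y : K | a <= v y] `&` [set y : K | v y <= M].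
  have cA : compact A.
    apply: (vbounded_compact Hc (M := M)); last by move=> y [].
    apply: closedI; last exact: vclosed_ball.
    apply: (@closed_comp _ _ (fun x : K => v x) [set s | a <= s]).
      by move=> y _; exact: vcontinuous.
    exact: closed_ge.
  have [A0|/nonemptyPn A0] := pselect (A !=set0); last first.
    exists 1 => // y ay yM; have : A y by split.
    by rewrite A0.
  have [c cA' hc] := compact_EVT_min A0 cA (continuous_subspaceT gc).
  exists (g c).
    apply: gp; apply/eqP => c0; move: cA'; rewrite inE c0 => -[/= h _].
    by move: h; rewrite absv0 leNgt a0.
  by move=> y ay yM; apply: hc; rewrite inE; split.
have g2 k y : g (2%:R ^+ k * y) = 2%:R ^+ k * g y.
  rewrite /g mulr_sumr; apply: eq_bigr => i _.
  rewrite -of_real2X (rlinZ Hc nu) normrM ger0_norm//; exact: exprn_ge0.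
have w1 := v2_gt1 nu; set w := v (2%:R : K) in w1.
have w0 : 0 < w by exact: lt_trans w1.
have w2 : w <= 2 by exact: v_nat.
have [m m0 hm] := annulus 1 w ltr01.
have big y : 1 <= v y -> v y <= 2 / m * g y.
  move=> y1.
  have [k /andP[k1 k2]] : exists k : nat, w ^+ k <= v y < w ^+ k.+1.
    have [k hk] := pow_large (v y) w1.
    have ex : exists k, v y < w ^+ k by exists k.
    case: (ex_minnP ex) => -[|l] hl ml.
      by move: hl; rewrite expr0 ltNge y1.
    exists l; rewrite hl andbT leNgt; apply/negP => /ml.
    by rewrite ltnn.
  have w2k : (2%:R : K) ^+ k != 0.
    by rewrite expf_neq0// -(absv_eq0 v) gt_eqF.
  pose y' := y / 2%:R ^+ k.
  have yE : y = 2%:R ^+ k * y' by rewrite mulrC divfK.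
  have vy' : v y' = v y / w ^+ k by rewrite vM vV vX.
  have my' : m <= g y'.
    apply: hm; rewrite vy'; first by rewrite ler_pdivlMr ?exprn_gt0// mul1r.
    by rewrite ler_pdivrMr ?exprn_gt0// -exprS ltW.
  rewrite [in leRHS]yE g2.
  apply: le_trans (ltW k2) _; rewrite mulrAC ler_pdivlMr//.
  rewrite exprS -mulrA [2 * _]mulrC -mulrA mulrC [g y' * _]mulrC.
  have h : w ^+ k * m <= 2 ^+ k * g y'.
    apply: ler_pM; [exact/exprn_ge0/ltW|exact: ltW| |exact: my'].
    by rewrite lerXn2r ?nnegrE// ltW.
  have h2 : w * (w ^+ k * m) <= 2 * (2 ^+ k * g y').
    apply: ler_pM => //; first exact: ltW.
    by apply: mulr_ge0; [exact/exprn_ge0/ltW|exact: ltW].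
  by move: h2; nra.
split.
  exists (2 / m); first by rewrite divr_ge0// ltW.
  move=> y; have [/big h|/ltW h] := leP 1 (v y); first by rewrite (le_trans h)// lerDr.
  by rewrite (le_trans h)// lerDl mulr_ge0// divr_ge0// ltW.
move=> d d0; have [m' m'0 hm'] := annulus d 1 d0.
exists (Num.min m' (m / 2)); first by rewrite lt_min m'0 divr_gt0.
move=> y; rewrite lt_min => /andP[g1 g2'].
rewrite ltNge; apply/negP => dy.
have [y1|/ltW y1] := leP 1 (v y); last first.
  by have := hm' y dy y1; rewrite leNgt g1.
have := le_trans y1 (big y y1).
rewrite -ler_pdivrMl ?divr_gt0// mulr1 invf_div leNgt g2' //.
Qed.

End real_functionals.

(** * Borel structure, module and Haar integrals *)

Section borel_theory.
Context (R : realType) (T : ptopologicalType).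

Lemma borel_open (A : set T) : open A -> measurable (A : set (borel T)).
Proof. by move=> oA; apply: sub_sigma_algebra. Qed.

Lemma borel_closed (A : set T) : closed A -> measurable (A : set (borel T)).
Proof.
move=> cA; have /borel_open/measurableC : open (~` A) by rewrite openC.
by rewrite setCK.
Qed.

Lemma borel_measurable_fun d (S : measurableType d) (f : S -> borel T) :
  (forall A : set T, open A -> measurable (f @^-1` A)) -> measurable_fun setT f.
Proof.
move=> h; apply: (@measurability _ _ _ _ _ f (@open T)) => //.
by move=> _ [A oA <-]; rewrite setTI; exact: h.
Qed.

Lemma continuous_borel_measurable (f : T -> R) : continuous f ->
  measurable_fun setT (f : borel T -> R).
Proof.
move=> fc; apply: (measurability (RGenOpens.G (R := R))) => //.
  exact: RGenOpens.measurableE.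
move=> _ [_ [a [b ->] <-]]; rewrite setTI; apply: borel_open.
by apply: open_comp => [x _|]; [exact: fc|exact: interval_open].
Qed.

Lemma continuous_cmeasurable (f : T -> R[i]) :
  (forall x (e : R), 0 < e -> \forall y \near x, normc (f y - f x) < e) ->
  cmeasurable (f : borel T -> R[i]).
Proof.
move=> fc; split; apply: continuous_borel_measurable => x;
  apply/(@cvgrPdist_lt _ _ _ (nbhs (x : T))) => e e0; apply: filterS (fc x e e0) => y;
  apply: le_lt_trans; rewrite distrC.
  by have := Re_le_normc (f y - f x); rewrite ReD ReN.
by have := Im_le_normc (f y - f x); rewrite ImD ImN.
Qed.

End borel_theory.

Section borel_valued.
Context (R : realType) (K0 : fieldType) (v : absolute_value R K0).
Local Notation K := (valued v).
Variable D : nat -> K.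
Hypothesis hD : forall x (r : R), 0 < r -> exists n, v (x - D n) < r.

Let rad (k : nat) : R := k.+1%:R^-1.

(** The dense sequence gives a countable base of products of balls, so open sets of K x K belong to
    the product of the Borel sigma-algebras. This makes addition and multiplication jointly
    measurable, as Tonelli's theorem requires. *)
Lemma open2_measurable (U : set (K * K)) : open U ->
  measurable (U : set (borel K * borel K)%type).
Proof.
move=> oU.
pose Q (i : nat * nat * nat) : set (K * K) :=
  [set y : K | v (y - D i.1.1) < rad i.2] `*` [set y : K | v (y - D i.1.2) < rad i.2].
have -> : U = \bigcup_(i in [set i | Q i `<=` U]) Q i.
  apply/seteqP; split=> [[x y] Uxy|x [i /= h]]; last exact: h.
  have [[P P'] /= [/vnbhsP[d d0 hd] /vnbhsP[d' d'0 hd']] PU] :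
      nbhs (x, y) U by apply: open_nbhs_nbhs.
  have m0 : 0 < Num.min d d' by rewrite lt_min d0.
  have m2 : 0 < Num.min d d' / 2 by rewrite divr_gt0.
  have [k hk] : exists k, rad k < Num.min d d' / 2.
    have /cvgrPdist_lt/(_ _ m2)[N _ hN] := @cvg_harmonic R.
    by exists N; have := hN N (leqnn N); rewrite /= sub0r normrN ger0_norm.
  have rk : 0 < rad k by rewrite invr_gt0.
  have [n hn] := hD x rk; have [m hm] := hD y rk.
  exists (n, m, k); last by split.
  have key (a x' : K) n' : v (x' - D n') < rad k -> v (a - D n') < rad k ->
      v (a - x') < Num.min d d'.
    move=> h1 h2; have -> : a - x' = (a - D n') - (x' - D n') :> K by ring.
    apply: le_lt_trans (vB_le _ _) _; rewrite [ltRHS]splitr.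
    by apply: ltrD; [exact: lt_trans hk|exact: lt_trans hk].
  move=> [a b] [/= ha hb]; apply: PU; split => /=.
    by apply: hd; apply: lt_le_trans (key _ _ _ hn ha) _; rewrite ge_min lexx.
  by apply: hd'; apply: lt_le_trans (key _ _ _ hm hb) _; rewrite ge_min lexx orbT.
rewrite bigcup_mkcond; apply: countable_bigcupT_measurable => [|i].
  exact: countableP.
case: ifP => // _; apply: measurableX; apply: borel_open; exact: vopen_ball.
Qed.

Lemma continuous2_measurable (h : K * K -> K) : continuous h ->
  measurable_fun setT (h : borel K * borel K -> borel K).
Proof.
move=> hc; apply: borel_measurable_fun => A oA; apply: open2_measurable.
by apply: open_comp => // x _; exact: hc.
Qed.

End borel_valued.

(** * The module as a monotone function of the absolute value *)

Section modulus_theory.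
Context (R : realType) (F : fieldExtType rat) (K0 : fieldType)
  (v : absolute_value R K0) (iota : {rmorphism F -> valued v}).
Local Notation K := (valued v).
Implicit Types (x y z t u : K).
Hypothesis Hc : is_completion iota.
Variable dx : {measure set (borel K) -> \bar R}.
Hypothesis Hdx : @is_haar R K setT +%R dx.

Local Notation Ball r := ([set x : K | v x <= r] : set (borel K)).

Lemma measurable_vball r : measurable (Ball r).
Proof. by apply: borel_closed; exact: vclosed_ball. Qed.

Lemma dx_vball_lty r : (dx (Ball r) < +oo)%E.
Proof. by have [_ _ h _] := Hdx; apply: h => //; exact: (vball_compact Hc). Qed.

Lemma dx_open_gt0 (A : set K) : open A -> A !=set0 -> (0 < dx A)%E.
Proof. by move=> oA A0; have [_ _ _ h] := Hdx; apply: h. Qed.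

Lemma dx_vball_gt0 r : 0 < r -> (0 < dx (Ball r))%E.
Proof.
move=> r0; apply: lt_le_trans (dx_open_gt0 (@vopen_ball _ _ v 0 r) _) _.
  by exists 0; rewrite /= subrr absv0.
apply: le_measure; rewrite ?inE.
- by apply: borel_open; exact: vopen_ball.
- exact: measurable_vball.
- by move=> x /=; rewrite subr0 => /ltW.
Qed.

Lemma dx_sigma_finite : sigma_finite setT dx.
Proof.
exists (fun n : nat => Ball n%:R) => [|n].
  apply/seteqP; split=> // x _; exists (Num.truncn (v x)).+1 => //=.
  by apply/ltW/truncnS_gt.
by split; [exact: measurable_vball|exact: dx_vball_lty].
Qed.

Lemma measurable_vadd : measurable_fun setT (fun p : borel K * borel K => p.1 + p.2 : borel K).
Proof.
have [D hD] := separable Hc.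
exact: (continuous2_measurable hD (@vadd_continuous _ _ v)).
Qed.

Lemma measurable_vmul : measurable_fun setT (fun p : borel K * borel K => p.1 * p.2 : borel K).
Proof.
have [D hD] := separable Hc.
exact: (continuous2_measurable hD (@vmul_continuous _ _ v)).
Qed.

Lemma measurable_vmulr t : measurable_fun setT (fun x : borel K => t * x : borel K).
Proof.
apply: (measurableT_comp measurable_vmul (g := fun x : borel K => (t : borel K, x))).
by apply: measurable_fun_pair => //; exact: measurable_cst.
Qed.

Lemma measurable_vaddr t : measurable_fun setT (fun x : borel K => t + x : borel K).
Proof.
apply: (measurableT_comp measurable_vadd (g := fun x : borel K => (t : borel K, x))).
by apply: measurable_fun_pair => //; exact: measurable_cst.
Qed.

Lemma measurable_vopp : measurable_fun setT (fun x : borel K => - x : borel K).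
Proof. by under eq_fun do rewrite -mulN1r; exact: measurable_vmulr. Qed.

Lemma image_vmul t (A : set K) : t != 0 -> *%R t @` A = (fun x => t^-1 * x) @^-1` A.
Proof.
move=> t0; apply/seteqP; split=> [_ [x Ax <-] /=|x /= Ax]; first by rewrite mulKf.
by exists (t^-1 * x) => //; rewrite mulVKf.
Qed.

Lemma measurable_image_vmul t (A : set (borel K)) : measurable A ->
  measurable ( *%R t @` A : set (borel K)).
Proof.
move=> mA; have [->|t0] := eqVneq t 0.
  have [->|/set0P A0] := eqVneq A set0; first by rewrite image_set0.
  have -> : *%R 0 @` A = [set 0] :> set K.
    apply/seteqP; split=> [_ [x _ <-]|_ ->]; first by rewrite /= mul0r.
    by have [x Ax] := A0; exists x; rewrite // mul0r.
  by apply: borel_closed; apply: compact_closed; [exact: vhausdorff|exact: compact_set1].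
by rewrite image_vmul// -[X in measurable X]setTI; apply: measurable_vmulr.
Qed.

Lemma dx_translate t : preserves dx (fun x : borel K => t + x).
Proof.
split=> [|A mA]; first exact: measurable_vaddr.
have [_ h _ _] := Hdx; rewrite -(h (- t) A)//; congr (dx _).
apply/seteqP; split=> [x /= Ax|_ [x Ax <-] /=]; last by rewrite addrA subrr add0r.
by exists (t + x) => //; rewrite addKr.
Qed.

(* The Haar measures dx and dx(t.) are proportional by haar_swap. *)
Lemma modulus_exists t : t != 0 -> exists c : R, [/\ 0 < c,
   forall A : set (borel K), measurable A -> dx ( *%R t @` A) = (c%:E * dx A)%E &
   (c%:E * dx (Ball 1%R) = dx (Ball (v t)))%E].
Proof.
move=> t0; pose h (x : borel K) : borel K := t^-1 * x.
have mh : measurable_fun setT h by exact: measurable_vmulr.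
have [nu nuh] := pushforward_measure dx mh.
have nuE A : measurable A -> nu A = dx ( *%R t @` A) by move=> mA; rewrite image_vmul.
have BE : *%R t @` Ball 1 = Ball (v t).
  rewrite image_vmul//; apply/seteqP; split=> x /=; rewrite vM vV.
    by rewrite mulrC ler_pdivrMr ?v_gt0// mul1r.
  by rewrite mulrC ler_pdivrMr ?v_gt0// mul1r.
have snu : sigma_finite setT nu.
  exists (fun n : nat => Ball n%:R) => [|n].
    apply/seteqP; split=> // x _; exists (Num.truncn (v x)).+1 => //=.
    by apply/ltW/truncnS_gt.
  split; first exact: measurable_vball.
  rewrite nuh; apply: (le_lt_trans _ (dx_vball_lty (v t * n%:R))).
  apply: le_measure; rewrite ?inE; [|exact: measurable_vball|].
    by rewrite -[X in measurable X]setTI; apply: mh => //; exact: measurable_vball.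
  by move=> x /=; rewrite vM vV mulrC ler_pdivrMr ?v_gt0// mulrC.
have pnu s : preserves nu (+%R s : borel K -> borel K).
  split=> [|A mA]; first exact: measurable_vaddr.
  have [_ /(_ (h @^-1` A))] := dx_translate (t * s).
  rewrite !nuh => <-.
    by congr (dx _); apply/seteqP; split=> x /=; rewrite /h mulrDr mulKf.
  by rewrite -[X in measurable X]setTI; apply: mh.
have aeT (m : {measure set (borel K) -> \bar R}) : {ae m, forall x, [set: borel K] x}.
  by apply: aeW.
have mB := measurable_vball 1.
(* The unit ball is symmetric, so the inversion that [haar_swap] introduces disappears when g is its
   indicator. *)
have symB : (\int[dx]_x (\1_(Ball 1) (- x))%:E = dx (Ball 1%R))%E.
  rewrite -[RHS]integral_indicT//.
  apply: eq_integral => x _; congr (_%:E); rewrite !indicE; congr (_%:R).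
  by congr (nat_of_bool _); apply/idP/idP; rewrite !inE /= absvN.
have swap A : measurable A -> (dx A * nu (Ball 1%R) = nu A * dx (Ball 1%R))%E.
  move=> mA.
  have := @haar_swap _ (borel K) R +%R -%R setT measurable_vadd measurable_vopp
    (@addrC _) _ _ _ dx nu dx_sigma_finite snu (aeT dx) (aeT nu)
    (fun s _ => dx_translate s) (fun s _ => pnu s)
    (fun x => (\1_A x)%:E) (fun x => (\1_(Ball 1) x)%:E).
  rewrite symB !integral_indicT// => -> //.
  - by move=> x y _; rewrite addrA subrr add0r.
  - by move=> x y _; rewrite opprD addrC addrA subrr add0r.
  - by apply/measurable_EFinP; exact: measurable_indic.
  - by apply/measurable_EFinP; exact: measurable_indic.
have nuB : nu (Ball 1%R) = dx (Ball (v t)) by rewrite nuE// BE.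
have B1 : dx (Ball 1) \is a fin_num by rewrite ge0_fin_numE// dx_vball_lty.
have Bt : dx (Ball (v t)) \is a fin_num by rewrite ge0_fin_numE// dx_vball_lty.
have b1 : 0 < fine (dx (Ball 1)).
  by rewrite fine_gt0// dx_vball_gt0//= dx_vball_lty.
have bt : 0 < fine (dx (Ball (v t))).
  by rewrite fine_gt0// dx_vball_gt0 ?v_gt0//= dx_vball_lty.
exists (fine (dx (Ball (v t))) / fine (dx (Ball 1))); split.
- by rewrite divr_gt0.
- move=> A mA; have := swap A mA; rewrite nuB nuE// => E.
  have : (dx ( *%R t @` A) = dx ( *%R t @` A) * dx (Ball 1%R) * (fine (dx (Ball 1)))^-1%:E)%E.
    by rewrite -muleA -[X in (X * _%:E)%E]fineK// -EFinM divff ?gt_eqF// mule1.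
  by move=> ->; rewrite -E -[dx (Ball (v t))]fineK// -muleA -EFinM muleC.
- rewrite -[dx (Ball 1)]fineK// -EFinM divfK ?gt_eqF// fineK//.
Qed.

Local Notation md t := (modulus dx t).
Let vol r : R := fine (dx (Ball r)).

Lemma dx_volE r : dx (Ball r) = (vol r)%:E.
Proof. by rewrite fineK// ge0_fin_numE// dx_vball_lty. Qed.

Let vol1_gt0 : 0 < vol 1.
Proof. by rewrite fine_gt0// dx_vball_gt0//= dx_vball_lty. Qed.

Lemma modulus_neq0 t : t != 0 -> [/\ 0 < md t,
  forall A : set (borel K), measurable A -> dx ( *%R t @` A) = ((md t)%:E * dx A)%E &
  md t * vol 1 = vol (v t)].
Proof.
move=> /modulus_exists[c [c0 hc cB]].
suff -> : md t = c.
  by split=> //; apply: EFin_inj; rewrite EFinM -!dx_volE.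
rewrite /modulus; case: xgetP => [c' _ [c'0 hc']|/(_ c)[]]; last by split=> //; exact: ltW.
have v10 : vol 1 != 0 by rewrite gt_eqF.
apply: (mulIf v10).
apply: EFin_inj; rewrite !EFinM -!dx_volE -hc ?hc'//; exact: measurable_vball.
Qed.

(** For v t < 1/4 the sets t Ball 2 and the open ball of radius 1/2 about 1 are disjoint and both
    lie in Ball 2. The open ball has positive measure, so multiplication by t strictly shrinks the
    volume of Ball 2. *)
Lemma modulus_small : exists2 t, 0 < v t < 1 & 0 < md t < 1.
Proof.
have [x x0 x1] := exists_v_lt1 Hc.
have [k hk] : exists k, v x ^+ k < 4^-1 by apply: pow_small => //; rewrite ?ltW.
exists (x ^+ k).
  by rewrite vX exprn_gt0//= (lt_trans hk)// invf_lt1// ltr1n.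
have t0 : x ^+ k != 0 by rewrite -v_gt0 vX exprn_gt0.
have [m0 mE _] := modulus_neq0 t0; rewrite m0 /=.
set t := x ^+ k in t0 m0 mE *.
have vt : v t < 4^-1 by rewrite vX.
pose U := [set y : K | v (y - 1) < 2^-1] : set (borel K).
have mU : measurable U by apply: borel_open; exact: vopen_ball.
have U0 : (0 < dx U)%E.
  apply: dx_open_gt0; first exact: vopen_ball.
  by exists 1; rewrite /U /= subrr absv0 invr_gt0.
pose A : set (borel K) := *%R t @` Ball 2.
have mA : measurable A by apply: measurable_image_vmul; exact: measurable_vball.
have UA0 : U `&` A = set0.
  apply/seteqP; split=> // y [/= Uy [z z2 E]].
  have h1 : v y <= 2^-1.
    rewrite -E vM (@le_trans _ _ (4^-1 * 2))//; last by lra.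
    by apply: ler_pM; rewrite ?v_ge0// ltW.
  have : v (1 : K) < 1.
    have -> : (1 : K) = y - (y - 1) by ring.
    apply: le_lt_trans (vB_le _ _) _; apply: lt_le_trans (ler_ltD h1 Uy) _; lra.
  by rewrite absv1 ltxx.
have UAB : U `|` A `<=` Ball 2.
  move=> y [/= Uy|[z /= z2 <-]].
    have -> : y = (y - 1) + 1 :> K by ring.
    apply: le_trans (vD_le _ _) _; rewrite absv1.
    apply: le_trans (lerD (ltW Uy) (lexx 1)) _; lra.
  rewrite vM; apply: (@le_trans _ _ (1 * 2)); last by rewrite mul1r.
  by apply: ler_pM; rewrite ?v_ge0// ltW// (lt_trans vt)// invf_lt1// ltr1n.
have : (dx U + dx A <= dx (Ball 2%R))%E.
  rewrite -measureU//; apply: le_measure; rewrite ?inE//.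
    exact: measurableU.
  exact: measurable_vball.
rewrite /A mE; last exact: measurable_vball.
rewrite dx_volE => h; have v2 : 0 < vol 2.
  by rewrite fine_gt0// dx_vball_gt0//= dx_vball_lty.
rewrite -(ltr_pM2r v2) mul1r -lte_fin EFinM; apply: lt_le_trans h.
by rewrite lteDr.
Qed.

Lemma vol_mul t r : t != 0 -> vol (v t * r) = md t * vol r.
Proof.
move=> t0; have [m0 mE _] := modulus_neq0 t0.
apply: EFin_inj; rewrite EFinM -!dx_volE -mE; last exact: measurable_vball.
congr (dx _); rewrite image_vmul//; apply/seteqP; split=> x /=; rewrite vM vV;
  by rewrite ler_pdivrMl ?v_gt0.
Qed.

Lemma modulusX_neq0 t n : t != 0 -> md (t ^+ n) = md t ^+ n.
Proof.
move=> t0; have v10 : vol 1 != 0 by rewrite gt_eqF.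
have [_ _ h1] := modulus_neq0 (expf_neq0 n t0).
apply: (mulIf v10); rewrite h1 vX.
elim: n {h1} => [|n IH]; first by rewrite !expr0 mul1r.
by rewrite exprS vol_mul// IH exprS mulrA.
Qed.

Lemma dx_set0 : dx [set 0 : borel K] = 0%E.
Proof.
have [t /andP[v0 v1] /andP[m0 m1]] := modulus_small.
have t0 : t != 0 by rewrite -(v_gt0 (v := v)).
apply: le_eps_eq0 => // e e0.
have [n hn] : exists n, md t ^+ n < e / vol 1.
  by apply: pow_small; rewrite ?ltW// divr_gt0.
rewrite ltr_pdivlMr// in hn.
apply: (@le_trans _ _ (dx (Ball (v (t ^+ n))))).
  apply: le_measure; rewrite ?inE.
  - by apply: borel_closed; apply: compact_closed; [exact: vhausdorff|exact: compact_set1].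
  - exact: measurable_vball.
  - by move=> _ -> /=; rewrite absv0 v_ge0.
rewrite dx_volE lee_fin -[v _]mulr1 vol_mul ?expf_neq0//.
by rewrite modulusX_neq0// ltW.
Qed.

Lemma vball0 : Ball 0 = [set 0].
Proof.
apply/seteqP; split=> [x /= x0|_ -> /=]; last by rewrite absv0.
by apply/eqP; rewrite -(absv_eq0 v) eq_le x0 v_ge0.
Qed.

(** Multiplication by 0 maps every set into the null set {0}, so any admissible constant is 0; the
    default value of [xget] is 0 too. *)
Lemma modulus0 : md 0 = 0.
Proof.
have v10 : vol 1 != 0 by rewrite gt_eqF.
have image0 (A : set (borel K)) : dx ( *%R 0 @` A) = 0%E.
  have [->|/set0P[x Ax]] := eqVneq A set0; first by rewrite image_set0 measure0.
  have -> : *%R 0 @` A = [set 0] :> set K.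
    apply/seteqP; split=> [_ [y _ <-]|_ ->]; first by rewrite /= mul0r.
    by exists x; rewrite // mul0r.
  exact: dx_set0.
rewrite /modulus; case: xgetP => [c' _ [c'0 hc']|//].
apply: (mulIf v10); apply: EFin_inj; rewrite EFinM -dx_volE -hc'.
  by rewrite image0 mul0r.
exact: measurable_vball.
Qed.

(** Through volumes of balls the module depends on v t only and is nondecreasing in it; monotonicity
    and measurability of the module come from this formula. *)
Lemma modulusE t : md t = vol (v t) / vol 1.
Proof.
have v10 : vol 1 != 0 by rewrite gt_eqF.
apply: (mulIf v10); rewrite divfK//.
have [->|t0] := eqVneq t 0; last by have [] := modulus_neq0 t0.
by rewrite modulus0 mul0r absv0 /vol vball0 dx_set0.
Qed.

Lemma vol_nondecreasing : {homo vol : r s / r <= s}.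
Proof.
move=> r s rs; rewrite -lee_fin -!dx_volE; apply: le_measure; rewrite ?inE;
  try exact: measurable_vball.
by move=> x /= /le_trans; apply.
Qed.

Lemma modulus_ge0 t : 0 <= md t.
Proof. by rewrite modulusE divr_ge0 ?fine_ge0. Qed.

Lemma modulus_gt0 t : (0 < md t) = (t != 0).
Proof.
have [->|t0] := eqVneq t 0; first by rewrite modulus0 ltxx.
by have [] := modulus_neq0 t0.
Qed.

Lemma modulus_le s t : v s <= v t -> md s <= md t.
Proof.
move=> st; rewrite !modulusE; apply: ler_wpM2r; last exact: vol_nondecreasing.
by rewrite invr_ge0 ltW.
Qed.

Lemma modulusM s t : md (s * t) = md s * md t.
Proof.
have [->|s0] := eqVneq s 0; first by rewrite mul0r modulus0 mul0r.
by rewrite modulusE vM vol_mul// [md t]modulusE mulrA.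
Qed.

Lemma modulus1 : md 1 = 1.
Proof. by rewrite modulusE absv1 divff// gt_eqF. Qed.

Lemma modulusV t : md t^-1 = (md t)^-1.
Proof.
have [->|t0] := eqVneq t 0; first by rewrite invr0 modulus0 invr0.
have m0 : md t != 0 by rewrite gt_eqF// modulus_gt0.
by apply: (mulfI m0); rewrite -modulusM !divff// modulus1.
Qed.

Lemma modulusX t n : md (t ^+ n) = md t ^+ n.
Proof. by elim: n => [|n IH]; rewrite ?expr0 ?modulus1// !exprS modulusM IH. Qed.

Lemma modulusN t : md (- t) = md t.
Proof. by rewrite !modulusE absvN. Qed.

Lemma modulus_image t (A : set (borel K)) : t != 0 -> measurable A ->
  dx ( *%R t @` A) = ((md t)%:E * dx A)%E.
Proof. by move=> t0; have [_ h _] := modulus_neq0 t0; exact: h. Qed.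

Lemma measurable_v : measurable_fun setT (fun x : borel K => v x).
Proof. by apply: continuous_borel_measurable; exact: vcontinuous. Qed.

Lemma measurable_modulus : measurable_fun setT (fun x : borel K => md x).
Proof.
rewrite (_ : (fun x => md x) = (fun x : borel K => (vol 1)^-1 * vol (v x))).
  apply: measurable_funM; first exact: measurable_cst.
  apply: (measurableT_comp (f := vol)); last exact: measurable_v.
  apply: nondecreasing_measurable => //; last exact: vol_nondecreasing.
by apply/funext => x; rewrite modulusE mulrC.
Qed.

(** Powers of a small t reach all scales: if v x lies between two consecutive powers of v(t)^-1, its
    module is at most that of the larger one. The exponent A makes v(t)^-A exceed the module of
    t^-1. *)
Lemma modulus_le_vX : exists (C : R) (A : nat), 0 < C /\ forall x, 1 <= v x -> md x <= C * v x ^+ A.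
Proof.
have [t /andP[v0 v1] /andP[m0 m1]] := modulus_small.
have tn : t != 0 by rewrite -(v_gt0 (v := v)).
have w1 : 1 < (v t)^-1 by rewrite invf_gt1.
have w0 : 0 < (v t)^-1 by rewrite invr_gt0.
have [A hA] := pow_large (md t)^-1 w1.
exists (md t)^-1, A; split=> [|x x1]; first by rewrite invr_gt0.
have [k /andP[k1 k2]] : exists k : nat, (v t)^-1 ^+ k <= v x < (v t)^-1 ^+ k.+1.
  have [k hk] := pow_large (v x) w1.
  have ex : exists k, v x < (v t)^-1 ^+ k by exists k.
  case: (ex_minnP ex) => -[|l] hl ml.
    by move: hl; rewrite expr0 ltNge x1.
  exists l; rewrite hl andbT leNgt; apply/negP => /ml.
  by rewrite ltnn.
apply: (@le_trans _ _ (md (t^-1 ^+ k.+1))).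
  by apply: modulus_le; rewrite vX vV ltW.
rewrite modulusX modulusV exprS ler_wpM2l ?invr_ge0 ?modulus_ge0//.
apply: (@le_trans _ _ (((v t)^-1 ^+ A) ^+ k)).
  by apply: lerXn2r; rewrite ?nnegrE ?invr_ge0 ?modulus_ge0 ?exprn_ge0 ?invr_ge0 ?ltW.
rewrite -exprM mulnC exprM.
by apply: lerXn2r; rewrite ?nnegrE ?exprn_ge0 ?invr_ge0 ?v_ge0.
Qed.

End modulus_theory.

(** * Integrability of powers of the module *)

Section haar_integrals.
Context (R : realType) (F : fieldExtType rat) (K0 : fieldType)
  (v : absolute_value R K0) (iota : {rmorphism F -> valued v}).
Local Notation K := (valued v).
Implicit Types (x y z t u : K).
Hypothesis Hc : is_completion iota.
Variable dx : {measure set (borel K) -> \bar R}.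
Hypothesis Hdx : @is_haar R K setT +%R dx.
Local Notation md t := (modulus dx t).

Lemma preimage_vmul t (A : set (borel K)) : t != 0 ->
  (fun x : borel K => t * x : borel K) @^-1` A = *%R t^-1 @` A.
Proof.
by move=> t0; rewrite (image_vmul (v := v)) ?invr_eq0// invrK.
Qed.

Lemma dx_scale t (f : borel K -> \bar R) : t != 0 -> measurable_fun setT f ->
  (forall x, (0 <= f x)%E) ->
  (\int[dx]_x f (t * x)%R = (md t)^-1%:E * \int[dx]_x f x)%E.
Proof.
move=> t0 mf f0.
have mt : measurable_fun setT (fun x : borel K => t * x : borel K) := measurable_vmulr Hc t.
have m0 : 0 <= (md t)^-1 by rewrite invr_ge0 (modulus_ge0 Hc Hdx).
rewrite -[(md t)^-1]/((NngNum m0)%:num) -ge0_integral_mscale//.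
apply: (transport_integral mt) => // A mA.
rewrite preimage_vmul// (modulus_image Hc Hdx) ?invr_eq0//.
by rewrite (modulusV Hc Hdx).
Qed.

Lemma dx_opp : preserves dx (fun x : borel K => - x : borel K).
Proof.
split; first exact: measurable_vopp Hc.
move=> A mA; have n1 : -1 != 0 :> K by rewrite oppr_eq0 oner_eq0.
have -> : (fun x : borel K => - x : borel K) @^-1` A = *%R (-1 : K) @` A.
  apply/seteqP; split=> [x Ax|_ [x Ax <-]]; last by rewrite /= mulN1r opprK.
  by exists (- x); rewrite // mulN1r opprK.
by rewrite (modulus_image Hc Hdx)// (modulusN Hc Hdx) (modulus1 Hc Hdx) mul1e.
Qed.

Lemma measurable_modulus_powR a : measurable_fun setT (fun x : borel K => md x `^ a).
Proof.
by apply: (measurableT_comp (measurable_powR a)); exact: (measurable_modulus Hc Hdx).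
Qed.

Section geometric.
(** Common core of integrability near 0 and near infinity: [E 1] is one shell, multiplication by s
    moves each shell to the next, and [kap] is the factor by which this multiplies the integral of
    the power. *)
Variables (s : K) (a : R) (E : nat -> set (borel K)).
Hypothesis s0 : s != 0.
Hypothesis mE : forall n, measurable (E n).
Hypothesis E0 : E 0%N = set0.
Hypothesis ES : forall n, E n.+1 `<=` E 1%N `|` *%R s @` E n.
Hypothesis Ehomo : forall n m, (n <= m)%N -> E n `<=` E m.
Let kap := md s * md s `^ a.
Hypothesis kap1 : kap < 1.
Variable C : R.
Hypothesis C0 : 0 <= C.
Hypothesis hC : forall x, E 1%N x -> md x `^ a <= C.
Hypothesis Efin : (dx (E 1%N) < +oo)%E.

Let f (x : borel K) : R := md x `^ a.
Let I (A : set (borel K)) := (\int[dx]_x (f x * \1_A x)%:E)%E.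
Let mfA A : measurable A -> measurable_fun setT (fun x : borel K => (f x * \1_A x)%:E).
Proof.
move=> mA; apply/measurable_EFinP; apply: measurable_funM.
  exact: measurable_modulus_powR.
exact: measurable_indic.
Qed.
Let fA0 A x : (0 <= (f x * \1_A x)%:E)%E.
Proof. by rewrite lee_fin mulr_ge0// powR_ge0. Qed.

Let I_scale n : I ( *%R s @` E n) = (kap%:E * I (E n))%E.
Proof.
have mA : measurable ( *%R s @` E n : set (borel K)) by exact: (measurable_image_vmul Hc).
have := dx_scale s0 (mfA mA) (fA0 _).
have ms : 0 < md s by rewrite (modulus_gt0 Hc Hdx).
move=> /(congr1 (fun w : \bar R => ((md s)%:E * w)%E)).
rewrite muleA -EFinM divff ?gt_eqF// mul1e /I => <-.
rewrite /kap EFinM -muleA; congr (_ * _)%E.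
rewrite -ge0_integralZl_EFin ?powR_ge0//; last exact: mfA.
apply: eq_integral => x _; rewrite -EFinM; congr (_%:E).
rewrite /f (modulusM Hc Hdx) powRM ?(modulus_ge0 Hc Hdx)// -mulrA; congr (_ * (_ * _)).
rewrite !indicE; congr (nat_of_bool _)%:R.
apply/idP/idP; rewrite !inE; first by move=> [y Ey /(mulfI s0) <-].
by move=> Ex; exists x.
Qed.

(** By [ES] the integral over E (n+1) is at most that over E 1 plus [kap] times that over E n. The
    bound is the fixed point of this recursion, so induction preserves it. *)
Lemma geometric_bound n : (I (E n) <= (C * fine (dx (E 1%N)) / (1 - kap))%:E)%E.
Proof.
have kap0 : 0 <= kap by rewrite mulr_ge0 ?powR_ge0// (modulus_ge0 Hc Hdx).
have k1 : 0 < 1 - kap by rewrite subr_gt0.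
have dE : dx (E 1%N) = (fine (dx (E 1%N)))%:E by rewrite fineK// ge0_fin_numE.
have I1 : (I (E 1%N) <= (C * fine (dx (E 1%N)))%:E)%E.
  rewrite EFinM -dE -(integral_indicT dx (mE 1))  -ge0_integralZl_EFin//; last first.
    by apply/measurable_EFinP; exact: measurable_indic.
  apply: ge0_le_integral => //; [exact: mfA| |].
    apply: emeasurable_funM => //.
    by apply/measurable_EFinP; exact: measurable_indic.
  move=> x _; rewrite -EFinM lee_fin indicE.
  have [/set_mem Ex|_] := boolP (x \in E 1%N); last by rewrite !mulr0.
  by rewrite !mulr1 hC.
elim: n => [|n IH].
  rewrite E0 /I; under eq_integral do rewrite indic0 mulr0.
  by rewrite integral0 lee_fin mulr_ge0// ?mulr_ge0 ?fine_ge0// invr_ge0 ltW.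
have mA : measurable ( *%R s @` E n : set (borel K)) by exact: (measurable_image_vmul Hc).
apply: (@le_trans _ _ (I (E 1%N) + I ( *%R s @` E n))%E).
  rewrite -ge0_integralD//; [|exact: mfA|exact: mfA].
  apply: ge0_le_integral => //; [exact: mfA|apply: emeasurable_funD; exact: mfA|].
  move=> x _; rewrite -EFinD lee_fin -mulrDr ler_wpM2l ?powR_ge0// !indicE.
  have [/set_mem/ES Ex|_] := boolP (x \in E n.+1); last by rewrite addr_ge0.
  case: Ex => [Ex|Ex]; first by rewrite (mem_set Ex) lerDl.
  by rewrite (mem_set Ex) lerDr.
rewrite I_scale; apply: le_trans (leeD I1 (lee_wpmul2l _ IH)) _; first by rewrite lee_fin.
rewrite -EFinM -EFinD lee_fin.
rewrite le_eqVlt; apply/orP; left; apply/eqP; field.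
by rewrite gt_eqF.
Qed.

Lemma geometric_integrable :
  dx.-integrable setT (fun x : borel K => (f x * \1_(\bigcup_n E n) x)%:E).
Proof.
have mU : measurable (\bigcup_n E n) by exact: bigcup_measurable.
apply/integrableP; split; first exact: mfA.
apply: (@le_lt_trans _ _ (C * fine (dx (E 1%N)) / (1 - kap))%:E); last by rewrite ltry.
under eq_integral do rewrite gee0_abs ?fA0//.
apply: (@fatou_le _ _ _ dx (fun (n : nat) (x : borel K) => (f x * \1_(E n) x)%:E)
  (fun x : borel K => (f x * \1_(\bigcup_n E n) x)%:E) _ 0%N).
- by move=> n; exact: mfA.
- by move=> n x; exact: fA0.
- move=> x; have [[N _ EN]|nE] := pselect ((\bigcup_n E n) x).
    apply: cvg_near_cst; exists N => // n Nn.
    rewrite !indicE !mem_set//; first by exists N.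
    exact: Ehomo Nn _ EN.
  apply: cvg_near_cst; exists 0%N => // n _.
  rewrite !indicE !memNset// => Ex; apply: nE; by exists n.
- by move=> n _; exact: geometric_bound.
Qed.

End geometric.

Lemma powR_bound (m y a : R) : 0 < m -> m <= y -> y <= m^-1 ->
  y `^ a <= expR (`|a| * `|ln m|).
Proof.
move=> m0 my ym; have y0 : 0 < y by exact: lt_le_trans my.
rewrite /powR gt_eqF// ler_expR.
apply: le_trans (ler_norm _) _; rewrite normrM ler_wpM2l//.
have l1 : ln m <= ln y by rewrite ler_ln.
have l2 : ln y <= - ln m by rewrite -lnV// ler_ln ?posrE// invr_gt0.
rewrite ler_norml; apply/andP; split.
  by apply: le_trans l1; rewrite lerNl -normrN ler_norm.
by apply: le_trans l2 _; rewrite -normrN ler_norm.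
Qed.

Lemma powR_lt1r (m b : R) : 0 < m -> m < 1 -> -1 < b -> m * m `^ b < 1.
Proof.
move=> m0 m1 b1; rewrite -{1}(powRr1 (ltW m0)) -powRD; last by rewrite (gt_eqF m0) implybT.
have b0 : 0 < 1 + b by rewrite -ltrBlDl sub0r.
by rewrite /powR gt_eqF// expR_lt1 pmulr_rlt0// ln_lt0// m0.
Qed.

Local Notation Ball r := ([set x : K | v x <= r] : set (borel K)).

Lemma modulus_powR_integrable0 a : -1 < a ->
  dx.-integrable setT (fun x : borel K => (md x `^ a * \1_(Ball 1) x)%:E).
Proof.
move=> a1; have [t /andP[v0 v1] /andP[m0 m1]] := modulus_small Hc Hdx.
have t0 : t != 0 by rewrite -(v_gt0 (v := v)).
(* These sets stay away from 0, and multiplication by t reaches one step closer; the exponent a > -1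
   makes the ratio |t|^(1+a) smaller than 1. *)
pose E n : set (borel K) := [set x : K | v t ^+ n < v x] `&` Ball 1.
have mE n : measurable (E n).
  apply: measurableI; last exact: measurable_vball.
  have -> : [set x : K | v t ^+ n < v x] = ~` Ball (v t ^+ n).
    by apply/seteqP; split=> x /=; rewrite ltNge => /negP.
  by apply: measurableC; exact: measurable_vball.
have E0 : E 0%N = set0.
  by apply/seteqP; split=> // x [/=]; rewrite expr0 ltNge => /negP.
have ES n : E n.+1 `<=` E 1%N `|` *%R t @` E n.
  move=> x [/= h1 h2]; have [h|h] := ltP (v t) (v x).
    by left; split=> //=; rewrite expr1.
  right; exists (t^-1 * x); last by rewrite mulVKf.
  split=> /=; rewrite vM vV; first by rewrite ltr_pdivlMl// -exprS.
  by rewrite ler_pdivrMl// mulr1.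
have Ehomo n m : (n <= m)%N -> E n `<=` E m.
  move=> nm x [/= h1 h2]; split=> //=; apply: le_lt_trans h1.
  by apply: ler_wiXn2l => //; exact: ltW.
have kap1 : md t * md t `^ a < 1 by exact: powR_lt1r.
have hC x : E 1%N x -> md x `^ a <= expR (`|a| * `|ln (md t)|).
  move=> [/=]; rewrite expr1 => h1 h2; apply: powR_bound => //.
    by apply: (modulus_le Hc Hdx); exact: ltW.
  apply: (@le_trans _ _ 1); last by rewrite invf_ge1// ltW.
  by rewrite -(modulus1 Hc Hdx); apply: (modulus_le Hc Hdx); rewrite absv1.
have Efin : (dx (E 1%N) < +oo)%E.
  apply: le_lt_trans (dx_vball_lty Hc Hdx 1).
  apply: le_measure; rewrite ?inE//; first exact: measurable_vball.
  by move=> x [].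
have := geometric_integrable t0 mE E0 ES Ehomo kap1 (expR_ge0 _) hC Efin.
have -> : \bigcup_n E n = Ball 1 `\` [set 0].
  apply/seteqP; split=> [x [n _ [/= h1 h2]]|x [/= x1 /eqP x0]].
    split=> //= x0; move: h1; rewrite x0 absv0 ltNge.
    by rewrite exprn_ge0 ?v_ge0.
  have vx : 0 < v x by rewrite v_gt0.
  have [n hn] := pow_small (ltW v0) v1 vx.
  by exists n.
have mS0 : measurable ([set 0] : set (borel K)).
  by apply: borel_closed; apply: compact_closed; [exact: vhausdorff|exact: compact_set1].
(* The union of the E n misses 0, where [powR] is 1 when a = 0. Adding the indicator of the null set
   {0} restores the domination there. *)
move=> H; have I0 : dx.-integrable setT (fun x => (\1_[set (0 : borel K)] x : R)%:E).
  by apply: integrable_indic_fin => //; rewrite (dx_set0 Hc Hdx) ltry.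
apply: (le_integrable measurableT _ _ (integrableD measurableT H I0)).
  apply/measurable_EFinP; apply: measurable_funM.
    exact: measurable_modulus_powR.
  apply: measurable_indic; exact: measurable_vball.
move=> x _ /=; rewrite lee_fin !ger0_norm ?addr_ge0 ?mulr_ge0 ?powR_ge0//.
rewrite !indicE; have [->|x0] := eqVneq x 0.
  rewrite (modulus0 Hc Hdx) (mem_set (_ : [set 0] (0 : K)))//.
  apply: (@le_trans _ _ (1 * 1)); last by rewrite mulr1 lerDr mulr_ge0 ?powR_ge0.
  apply: ler_pM; rewrite ?powR_ge0//; last by rewrite lern1 leq_b1.
  by rewrite /powR eqxx; case: (a == 0).
apply: (@le_trans _ _ (md x `^ a * (x \in Ball 1 `\` [set 0])%:R)); last by rewrite lerDl.
rewrite ler_wpM2l ?powR_ge0// ler_nat.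
have [/set_mem xB|//] := boolP (x \in Ball 1).
by rewrite mem_set//; split => // x00; move: x0; rewrite x00 eqxx.
Qed.

Lemma powR_lt1l (m b : R) : 1 < m -> b < -1 -> m * m `^ b < 1.
Proof.
move=> m1 b1; have m0 : 0 < m by exact: lt_trans m1.
rewrite -{1}(powRr1 (ltW m0)) -powRD; last by rewrite (gt_eqF m0) implybT.
have b0 : 1 + b < 0 by rewrite -ltrBrDl sub0r.
by rewrite /powR gt_eqF// expR_lt1 nmulr_rlt0// ln_gt0.
Qed.

Lemma modulus_powR_integrable1 a : a < -1 ->
  dx.-integrable setT (fun x : borel K => (md x `^ a * \1_(~` Ball 1) x)%:E).
Proof.
move=> a1; have [t /andP[v0 v1] /andP[m0 m1]] := modulus_small Hc Hdx.
have t0 : t != 0 by rewrite -(v_gt0 (v := v)).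
have s0 : t^-1 != 0 by rewrite invr_eq0.
pose s := t^-1; have vs1 : 1 < v s by rewrite vV invf_gt1.
have vs0 : 0 < v s by exact: lt_trans vs1.
have ms1 : 1 < md s by rewrite (modulusV Hc Hdx) invf_gt1.
have ms0 : 0 < md s by exact: lt_trans ms1.
pose E n : set (borel K) := (~` Ball 1) `&` Ball (v s ^+ n).
have mE n : measurable (E n).
  by apply: measurableI; [apply: measurableC|]; exact: measurable_vball.
have E0 : E 0%N = set0.
  by apply/seteqP; split=> // x [/=]; rewrite expr0.
have ES n : E n.+1 `<=` E 1%N `|` *%R s @` E n.
  move=> x [/= h1 h2]; have [h|h] := leP (v x) (v s).
    by left; split=> //=; rewrite expr1.
  right; exists (s^-1 * x); last by rewrite mulVKf.
  split=> /=; rewrite vM vV; last by rewrite ler_pdivrMl// -exprS.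
  by apply/negP; rewrite -ltNge ltr_pdivlMl// mulr1.
have Ehomo n m : (n <= m)%N -> E n `<=` E m.
  move=> nm x [/= h1 h2]; split=> //=; apply: le_trans h2 _.
  by apply: ler_weXn2l => //; exact: ltW.
have kap1 : md s * md s `^ a < 1 by exact: powR_lt1l.
have hC x : E 1%N x -> md x `^ a <= expR (`|a| * `|ln (md s)^-1|).
  move=> [/= /negP]; rewrite -ltNge expr1 => h1 h2; apply: powR_bound => //.
  - by rewrite invr_gt0.
  - apply: (@le_trans _ _ 1); first by rewrite invf_le1// ltW.
    by rewrite -(modulus1 Hc Hdx); apply: (modulus_le Hc Hdx); rewrite absv1 ltW.
  - by rewrite invrK; apply: (modulus_le Hc Hdx).
have Efin : (dx (E 1%N) < +oo)%E.
  apply: le_lt_trans (dx_vball_lty Hc Hdx (v s ^+ 1)).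
  by apply: le_measure; rewrite ?inE//; [exact: measurable_vball|move=> x []].
have := geometric_integrable s0 mE E0 ES Ehomo kap1 (expR_ge0 _) hC Efin.
have -> // : \bigcup_n E n = ~` Ball 1.
apply/seteqP; split=> [x [n _ [/= h1 h2]] //|x /= x1].
have [n hn] := pow_large (v x) vs1.
by exists n => //; split=> //=; exact: ltW.
Qed.

(** In the unit ball phi is bounded and a > -1 suffices; outside it, decay of order 3 lowers the
    exponent to a - 3, which is below -1 because a < 2. *)
Lemma L1_modulus_powR (a M : R) (phi : borel K -> R[i]) : -1 < a -> a < 2 ->
  cmeasurable phi -> (forall x, normc (phi x) <= M) ->
  (forall x, md x ^+ 3 * normc (phi x) <= M) ->
  L1 dx (fun x => (md x `^ a)%:C * phi x).
Proof.
move=> a1 a2 mphi h1 h2.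
have M0 : 0 <= M by apply: le_trans (h1 0); exact: normcr_ge0.
have a3 : a - 3 < -1 by rewrite ltrBlDr; apply: lt_le_trans a2 _; lra.
have I0 := modulus_powR_integrable0 a1.
have I1 := modulus_powR_integrable1 a3.
have I := integrableD measurableT (integrableZ_EFin M I0) (integrableZ_EFin M I1).
apply: (@L1_le _ _ _ dx _ (fun x : borel K => M * (md x `^ a * \1_(Ball 1) x) + M * (md x `^ (a - 3) * \1_(~` Ball 1) x))).
- by apply: cmeasM => //; apply: cmeas_real; exact: measurable_modulus_powR.
- exact: I.
move=> x; rewrite normc_mul normc_real ger0_norm ?powR_ge0//.
have [x1|x1] := leP (v x) 1.
  rewrite !indicE mem_set// memNset; last by move=> /=; apply.
  by rewrite mulr1 !mulr0 addr0 mulrC ler_wpM2r// powR_ge0.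
rewrite !indicE memNset; last by move=> /=; apply/negP; rewrite -ltNge.
rewrite mem_set; last by move=> /=; apply/negP; rewrite -ltNge.
rewrite mulr1 !mulr0 add0r.
have m0 : 0 < md x.
  by rewrite (modulus_gt0 Hc Hdx) -(v_gt0 (v := v)) (lt_trans _ x1).
have -> : md x `^ a = md x `^ (a - 3) * md x ^+ 3.
  rewrite -powR_mulrn ?ltW// -powRD ?subrK//.
  by rewrite (gt_eqF m0) implybT.
by rewrite -mulrA mulrC ler_wpM2r// powR_ge0.
Qed.

End haar_integrals.

(** * Integration against a measure given by a density *)

Section density.
Context d (T : measurableType d) (R : realType).
Variables (mu nu : {measure set T -> \bar R}) (w : T -> R).
Hypotheses (mw : measurable_fun setT w) (w0 : forall x, 0 <= w x).
Hypothesis nuE : forall A, measurable A -> nu A = (\int[mu]_(x in A) (w x)%:E)%E.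
Import HBNNSimple.

Let density_indic A : measurable A ->
  (\int[mu]_x ((w x)%:E * (\1_A x)%:E) = nu A)%E.
Proof.
move=> mA; rewrite nuE// [RHS]integral_mkcond; apply: eq_integral => x _.
rewrite patchE indicE; case: ifPn => _; first by rewrite mule1.
by rewrite mule0.
Qed.

Let density_nnsfun (h : {nnsfun T >-> R}) :
  (\int[nu]_x (h x)%:E = \int[mu]_x ((w x)%:E * (h x)%:E))%E.
Proof.
have mi r : measurable_fun setT (fun x => (r * \1_(h @^-1` [set r]) x)%:E).
  by apply/measurable_EFinP; apply: measurable_funM => //; exact: measurable_cst.
transitivity (\int[nu]_x (\sum_(y \in range h) (y * \1_(h @^-1` [set y]) x)%:E))%E.
  by apply: eq_integral => t _; rewrite /= fimfunE -fsumEFin.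
rewrite ge0_integral_fsum//; last by move=> y x _; rewrite EFinM nnfun_muleindic_ge0.
transitivity (\int[mu]_x (\sum_(y \in range h) (w x)%:E * (y * \1_(h @^-1` [set y]) x)%:E))%E; last first.
  apply: eq_integral => t _; rewrite /= [in RHS]fimfunE -fsumEFin// ge0_mule_fsumr//.
  by move=> y; rewrite EFinM nnfun_muleindic_ge0.
rewrite ge0_integral_fsum//; first last.
- by move=> y x _; apply: mule_ge0; rewrite ?lee_fin// -lee_fin EFinM nnfun_muleindic_ge0.
- by move=> y; apply: emeasurable_funM => //; exact/measurable_EFinP.
apply: eq_fsbigr => r; rewrite inE => -[z _ zr].
have r0 : 0 <= r by rewrite -zr.
have mS : measurable (h @^-1` [set r]) by rewrite -[X in measurable X]setTI; exact: measurable_funP.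
transitivity (r%:E * nu (h @^-1` [set r]))%E.
  rewrite -(integral_indicT nu mS) -ge0_integralZl_EFin//.
  by apply/measurable_EFinP; exact: measurable_indic.
rewrite -(density_indic mS) -ge0_integralZl_EFin//.
- by apply: eq_integral => x _; rewrite EFinM muleCA.
- by move=> x _; apply: mule_ge0; rewrite lee_fin.
- apply: emeasurable_funM; apply/measurable_EFinP => //; exact: measurable_indic.
Qed.

Lemma integral_density (f : T -> \bar R) : measurable_fun setT f ->
  (forall x, (0 <= f x)%E) ->
  (\int[nu]_x f x = \int[mu]_x ((w x)%:E * f x))%E.
Proof.
move=> mf f0; pose h := nnsfun_approx measurableT mf.
have hf x : (h n x)%:E @[n --> \oo] --> f x by exact: cvg_nnsfun_approx.
have nd x : {homo (fun n => (h n x)%:E) : a b / (a <= b)%N >-> (a <= b)%E}.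
  by move=> a b ab; rewrite lee_fin; exact/lefP/nd_nnsfun_approx.
have mh n : measurable_fun setT (fun x => (h n x)%:E) by exact/measurable_EFinP.
transitivity (limn (fun n => \int[nu]_x (h n x)%:E))%E.
  rewrite -monotone_convergence//; last by move=> n x _; rewrite lee_fin.
  by apply: eq_integral => x _; apply/esym/cvg_lim => //.
transitivity (limn (fun n => \int[mu]_x ((w x)%:E * (h n x)%:E)))%E.
  by congr (limn _); apply/funext => n; exact: density_nnsfun.
rewrite -monotone_convergence//; first last.
- by move=> x _ a b ab; rewrite lee_wpmul2l ?lee_fin//; exact: nd.
- by move=> n x _; rewrite mule_ge0 ?lee_fin.
- by move=> n; apply: emeasurable_funM => //; exact/measurable_EFinP.
by apply: eq_integral => x _; apply/cvg_lim => //; exact: cvgeZl.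
Qed.

Lemma density_L1 (f : T -> R[i]) : cmeasurable f ->
  (L1 nu f <-> L1 mu (fun x => (w x)%:C * f x)).
Proof.
move=> mf; have mwf : cmeasurable (fun x => (w x)%:C * f x).
  by apply: cmeasM => //; exact: cmeas_real.
have E : norm1 nu f = norm1 mu (fun x => (w x)%:C * f x).
  rewrite /norm1 (integral_density (measurable_normE mf)).
    by apply: eq_integral => x _; rewrite normc_mul normc_real ger0_norm.
  by move=> x; rewrite lee_fin normcr_ge0.
by split=> /L1P[_ h]; apply/L1P; split=> //; [rewrite -E|rewrite E].
Qed.

Lemma density_cintegral (f : T -> R[i]) : cmeasurable f -> L1 nu f ->
  cintegral nu f = cintegral mu (fun x => (w x)%:C * f x).
Proof.
move=> mf Lf; have [m1 m2] := mf.
have key (p : T -> R) (q : T -> R) : measurable_fun setT p ->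
   nu.-integrable setT (EFin \o p) -> (forall x, q x = w x * p x) ->
   Rintegral nu setT p = Rintegral mu setT q.
  move=> mp ip qE; rewrite /Rintegral integralE [in RHS]integralE; congr (fine (_ - _)%E).
    rewrite integral_density//; last by apply: measurable_funepos; exact/measurable_EFinP.
    apply: eq_integral => x _; rewrite !funeposE qE EFinM.
    by rewrite maxe_pMr ?lee_fin// mule0.
  rewrite integral_density//; last by apply: measurable_funeneg; exact/measurable_EFinP.
  apply: eq_integral => x _; rewrite !funenegE qE EFinM -muleN.
  by rewrite maxe_pMr ?lee_fin// mule0.
case: Lf => l1 l2; rewrite /cintegral; congr (_ +i* _); apply: key => // x.
  by rewrite ReM /= mul0r subr0.
by rewrite ImM /= mul0r addr0.
Qed.

End density.

(** * The multiplicative Haar measure and the first isometry *)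

Section multiplicative_haar.
Context (R : realType) (F : fieldExtType rat) (K0 : fieldType)
  (v : absolute_value R K0) (iota : {rmorphism F -> valued v}).
Local Notation K := (valued v).
Implicit Types (x y z t u : K).
Hypothesis Hc : is_completion iota.
Variables (dx dt : {measure set (borel K) -> \bar R}) (alpha : R).
Hypothesis Hdx : @is_haar R K setT +%R dx.
Hypothesis Hdt : @is_haar R K [set t | t != 0] *%R dt.
Hypothesis Ha : is_alpha dx dt alpha.
Local Notation md t := (modulus dx t).
Local Notation Ball r := ([set x : K | v x <= r] : set (borel K)).
Implicit Types phi psi : borel K -> R[i].

Lemma measurable_zero : measurable ([set 0] : set (borel K)).
Proof. by rewrite -(vball0 v); exact: measurable_vball. Qed.

Lemma dt_zero : dt [set (0 : borel K)] = 0%E.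
Proof.
have [h _ _ _] := Hdt; rewrite -h; congr (dt _).
apply/seteqP; split=> [x -> /=|x /=]; first by rewrite eqxx.
by move=> /negP; rewrite negbK => /eqP.
Qed.

Lemma dt_setD0 (A : set (borel K)) : measurable A -> dt (A `\` [set 0]) = dt A.
Proof.
move=> mA; rewrite (measureDI dt mA measurable_zero) [X in (_ + X)%E](_ : _ = 0%E) ?adde0//.
apply: (subset_measure0 _ measurable_zero _ dt_zero) => //.
exact: measurableI measurable_zero.
Qed.

Lemma dx_ae_neq0 : {ae dx, forall x : borel K, x != 0}.
Proof.
exists [set 0]; split; [exact: measurable_zero|exact: (dx_set0 Hc Hdx)|].
by move=> x /= /negP; rewrite negbK => /eqP.
Qed.

Lemma dt_ae_neq0 : {ae dt, forall x : borel K, x != 0}.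
Proof.
exists [set 0]; split; [exact: measurable_zero|exact: dt_zero|].
by move=> x /= /negP; rewrite negbK => /eqP.
Qed.

Definition dt_weight (x : borel K) : R := alpha ^- 2 / md x.
Local Notation w := dt_weight.

Let a0 : 0 < alpha. Proof. by case: Ha. Qed.

Lemma dt_weight_ge0 x : 0 <= w x.
Proof.
by rewrite divr_ge0 ?invr_ge0 ?exprn_ge0 ?(modulus_ge0 Hc Hdx)// ltW.
Qed.

Lemma measurable_dt_weight : measurable_fun setT w.
Proof.
apply: measurable_funM; first exact: measurable_cst.
apply: measurable_inv_ge0; first by move=> x; exact: (modulus_ge0 Hc Hdx).
exact: (measurable_modulus Hc Hdx).
Qed.

(** [is_alpha] speaks of sets that avoid 0. The formula extends because {0} is null for dt and the
    weight at 0 is 0, the inverse of 0 being 0. *)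
Lemma dtE (A : set (borel K)) : measurable A -> dt A = (\int[dx]_(x in A) (w x)%:E)%E.
Proof.
move=> mA; have m0 := measurable_zero.
have mA' : measurable (A `\` [set 0]) by exact: measurableD.
have [_ h] := Ha.
rewrite -dt_setD0//.
rewrite h//; last by move=> x [_ /eqP].
rewrite [LHS]integral_mkcond [RHS]integral_mkcond; apply: eq_integral => x _.
rewrite !patchE; have [->|x0] := eqVneq x 0.
  rewrite /w (modulus0 Hc Hdx) invr0 mulr0.
  by case: ifP; case: ifP.
congr (if _ then _ else _); apply/idP/idP; rewrite !inE; first by case.
by move=> Ax; split=> //; exact/eqP.
Qed.

Lemma dt_integral (f : borel K -> \bar R) : measurable_fun setT f ->
  (forall x, (0 <= f x)%E) -> (\int[dt]_x f x = \int[dx]_x ((w x)%:E * f x))%E.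
Proof. exact: (integral_density measurable_dt_weight dt_weight_ge0 dtE). Qed.

Local Notation fi := (first_isometry dx alpha).

Lemma measurable_sqrt_modulus : measurable_fun setT (fun x : borel K => Num.sqrt (md x)).
Proof.
have ms : measurable_fun setT (fun x : R => Num.sqrt x).
  by apply: continuous_measurable_fun; exact: sqrt_continuous.
exact: (measurableT_comp ms (measurable_modulus Hc Hdx)).
Qed.

Lemma cmeas_first_isometry phi : cmeasurable phi -> cmeasurable (fi phi : borel K -> R[i]).
Proof.
move=> mphi; apply: cmeasM => //; apply: cmeas_real; apply: measurable_funM.
  exact: measurable_cst.
exact: measurable_sqrt_modulus.
Qed.

Lemma sqnorm_first_isometry phi : cmeasurable phi ->
  sqnormL2 dt (fi phi : borel K -> R[i]) = sqnormL2 dx phi.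
Proof.
move=> mphi; have mf := cmeas_first_isometry mphi.
rewrite /sqnormL2 dt_integral; [|exact: measurable_sqnormE|by move=> x; exact: sqnormE_ge0].
apply: ge0_ae_eq_integral => //.
- apply: emeasurable_funM; last exact: measurable_sqnormE.
  by apply/measurable_EFinP; exact: measurable_dt_weight.
- exact: measurable_sqnormE.
- by move=> x _; rewrite mule_ge0 ?sqnormE_ge0// lee_fin dt_weight_ge0.
- by move=> x _; exact: sqnormE_ge0.
apply: filterS dx_ae_neq0 => x x0 _.
have mx : 0 < md x by rewrite (modulus_gt0 Hc Hdx).
rewrite -EFinM; congr (_%:E).
rewrite /first_isometry normc_mul normc_real exprMn ger0_norm ?mulr_ge0 ?sqrtr_ge0 ?ltW//.
rewrite exprMn sqr_sqrtr ?ltW// /w.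
by field; rewrite !gt_eqF.
Qed.

Lemma L2_first_isometry phi : L2 dx phi -> L2 dt (fi phi : borel K -> R[i]).
Proof.
move=> [mphi lphi]; split; first exact: cmeas_first_isometry.
by rewrite sqnorm_first_isometry.
Qed.

Lemma first_isometryB phi psi x : fi (fun x => phi x - psi x) x = fi phi x - fi psi x.
Proof. by rewrite /first_isometry mulrBr. Qed.

(** The density of dt times the factor of the first isometry: this is where the exponent -1/2, that
    is s - 1 at s = 1/2, enters. At 0 both sides vanish by convention. *)
Lemma dt_weight_sqrt x : w x * (alpha * Num.sqrt (md x)) = alpha^-1 * md x `^ (- 2^-1).
Proof.
have [->|x0] := eqVneq x 0.
  rewrite /w (modulus0 Hc Hdx) sqrtr0 invr0 mulr0 mul0r /powR eqxx.
  by rewrite oppr_eq0 invr_eq0 pnatr_eq0 mulr0.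
have mx : 0 < md x by rewrite (modulus_gt0 Hc Hdx).
have sx : 0 < Num.sqrt (md x) by rewrite sqrtr_gt0.
rewrite powRN powR12_sqrt ?ltW// /w.
have -> : md x = Num.sqrt (md x) ^+ 2 by rewrite sqr_sqrtr// ltW.
rewrite sqrtr_sqr ger0_norm ?ltW//.
by field; rewrite !gt_eqF.
Qed.

Lemma L1_first_isometry phi : cmeasurable phi ->
  L1 dx (fun x : borel K => (md x `^ (- 2^-1))%:C * phi x) ->
  L1 dt (fi phi : borel K -> R[i]).
Proof.
move=> mphi Lphi; have mf := cmeas_first_isometry mphi.
apply/(density_L1 measurable_dt_weight dt_weight_ge0 dtE mf).
have := L1Z (alpha^-1)%:C Lphi; congr (L1 dx _); apply/funext => x.
by rewrite /first_isometry !mulrA -!rmorphM/= dt_weight_sqrt.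
Qed.

Lemma cintegral_first_isometry phi (chi : borel K -> R[i]) : cmeasurable phi ->
  cmeasurable chi -> L1 dx (fun x : borel K => (md x `^ (- 2^-1))%:C * (phi x * chi x)) ->
  cintegral dt (fun t : borel K => fi phi t * chi t) =
  (alpha^-1)%:C * cintegral dx (fun x : borel K => (md x `^ (- 2^-1))%:C * (phi x * chi x)).
Proof.
move=> mphi mchi L.
have E : (fun t : borel K => fi phi t * chi t) = fi (fun x => phi x * chi x).
  by apply/funext => t; rewrite /first_isometry mulrA.
have mf := cmeas_first_isometry (cmeasM mphi mchi).
rewrite E (density_cintegral measurable_dt_weight dt_weight_ge0 dtE mf); last first.
  by apply: L1_first_isometry => //; exact: cmeasM.
rewrite -cintegralZ//; congr (cintegral dx _); apply/funext => x.
by rewrite /first_isometry !mulrA -!rmorphM/= dt_weight_sqrt.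
Qed.

(** The inverse is not continuous at 0, so the preimage of an open set is split into its open part
    off 0 and a possible point 0. *)
Lemma measurable_vinv : measurable_fun setT (fun x : borel K => x^-1 : borel K).
Proof.
apply: borel_measurable_fun => A oA.
have -> : (fun x : borel K => x^-1 : borel K) @^-1` A =
   ([set x : K | x != 0] `&` [set x : K | A x^-1]) `|` ([set 0] `&` [set x : K | A 0]).
  apply/seteqP; split=> [x /= Ax|x [[/= _ Ax]|[/= -> A0]]] //=; last by rewrite invr0.
  have [x0|x0] := eqVneq x 0; last by left.
  by right; rewrite x0 invr0 in Ax *; split.
apply: measurableU; last first.
  have [A0|A0] := pselect (A 0).
    have -> : [set x : K | A 0] = setT by apply/seteqP; split.
    by rewrite setIT; exact: measurable_zero.
  have -> : [set x : K | A 0] = set0 by apply/seteqP; split.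
  by rewrite setI0.
apply: borel_open; rewrite openE => x [/= x0 Ax].
have oA' : nbhs x^-1 A by apply: open_nbhs_nbhs.
have /= h1 := vinv_continuous x0 oA'.
apply: filterI => //.
apply/vnbhsP; exists (v x); first by rewrite v_gt0.
move=> y yx; apply/negP => /eqP y0.
by move: yx; rewrite y0 sub0r absvN ltxx.
Qed.

Lemma dt_mul t : t != 0 -> preserves dt (fun x : borel K => t * x : borel K).
Proof.
move=> t0; split=> [|A mA]; first exact: measurable_vmulr Hc t.
have mP : measurable ((fun x : borel K => t * x : borel K) @^-1` A).
  by rewrite -[X in measurable X]setTI; exact: (measurable_vmulr Hc t).
rewrite -dt_setD0// -[RHS]dt_setD0//.
have [_ h _ _] := Hdt.
rewrite -(h t^-1 (A `\` [set 0])); first last.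
- by move=> x [_ /eqP].
- exact: measurableD measurable_zero.
- by rewrite /= invr_eq0.
congr (dt _); apply/seteqP; split=> [x [/= Ax x0]|_ [x [Ax x0] <-] /=].
  exists (t * x); last by rewrite mulKf.
  by split=> //; apply/eqP; rewrite mulf_neq0//; exact/eqP.
by rewrite mulVKf//; split=> //; apply/eqP; rewrite mulf_neq0 ?invr_eq0//; exact/eqP.
Qed.

Let ann (n : nat) : set (borel K) := Ball n.+1%:R `&` [set x : K | n.+1%:R^-1 <= v x].

Lemma closed_annulus (r s : R) : closed ([set x : K | v x <= r] `&` [set x : K | s <= v x] : set K).
Proof.
apply: closedI; first exact: vclosed_ball.
apply: (@closed_comp _ _ (fun x : K => v x) [set y | s <= y]).
  by move=> y _; exact: vcontinuous.
exact: closed_ge.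
Qed.

Lemma compact_annulus (r s : R) :
  compact ([set x : K | v x <= r] `&` [set x : K | s <= v x] : set K).
Proof. by apply: (vbounded_compact Hc (@closed_annulus r s) (M := r)) => x []. Qed.

Lemma dt_annulus_lty (r s : R) : 0 < s ->
  (dt ([set x : K | v x <= r] `&` [set x : K | s <= v x] : set K)%R < +oo)%E.
Proof.
move=> s0; have [_ _ h _] := Hdt; apply: h; first exact: compact_annulus.
move=> x [_ /= sx]; apply/eqP => x0; move: sx; rewrite x0 absv0.
by rewrite leNgt s0.
Qed.

Lemma dt_sigma_finite : sigma_finite setT dt.
Proof.
exists (fun n => [set 0] `|` ann n) => [|n].
  apply/seteqP; split=> // x _; have [->|x0] := eqVneq x 0; first by exists 0%N => //; left.
  have vx : 0 < v x by rewrite v_gt0.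
  exists (maxn (Num.truncn (v x)) (Num.truncn (v x)^-1)) => //; right; split=> /=.
    apply/ltW/(lt_le_trans (truncnS_gt _)); rewrite ler_nat ltnS; exact: leq_maxl.
  rewrite invf_ple ?posrE//; apply/ltW/(lt_le_trans (truncnS_gt _)).
  rewrite ler_nat ltnS; exact: leq_maxr.
have mann : measurable (ann n) by apply: borel_closed; exact: closed_annulus.
split; first exact: measurableU measurable_zero mann.
apply: le_lt_trans (measureU2 _ _ _) _ => //; first exact: measurable_zero.
by rewrite [X in (X + _)%E]dt_zero add0e dt_annulus_lty.
Qed.

(** [haar_swap] for dt against itself, with the indicators of B and A, reads dt B dt A = dt B dt
    A^-1. The annulus B around 1 has finite positive measure, so it can be cancelled. *)
Lemma dt_inv : preserves dt (fun x : borel K => x^-1 : borel K).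
Proof.
split=> [|A mA]; first exact: measurable_vinv.
pose B : set (borel K) := [set x : K | v x <= 2] `&` [set x : K | 2^-1 <= v x].
have mB : measurable B by apply: borel_closed; exact: closed_annulus.
have lB : (dt B < +oo)%E by apply: dt_annulus_lty; rewrite invr_gt0.
have sB : ([set x : K | v (x - 1) < 2^-1] : set (borel K)) `<=` B.
  move=> x /= x1; have v1 : v 1 = 1 := absv1 v; split => /=.
    rewrite -[x](subrK 1); apply: le_trans (vD_le _ _) _.
    have := x1; rewrite v1; lra.
  have : v 1 <= v (x - 1) + v x.
    by rewrite -[v (x - 1)]absvN opprB -{1}[1](subrK x); exact: vD_le.
  rewrite v1; lra.
have pB : (0 < dt B)%E.
  have [_ _ _ h] := Hdt.
  apply: lt_le_trans (h [set x : K | v (x - 1) < 2^-1] _ _ _) _.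
  - rewrite openE => x /= x1; apply/vnbhsP; exists (2^-1 - v (x - 1)); first by rewrite subr_gt0.
    move=> y yx /=; rewrite -[y](subrK x) -addrA.
    by apply: le_lt_trans (vD_le _ _) _; rewrite -ltrBrDr.
  - by move=> x /sB [_ /= sx]; apply/eqP => x0; move: sx; rewrite x0 absv0; lra.
  - by exists 1; rewrite /= subrr absv0 invr_gt0.
  apply: le_measure => //; rewrite inE //; apply: borel_open.
  rewrite openE => x /= x1; apply/vnbhsP; exists (2^-1 - v (x - 1)); first by rewrite subr_gt0.
  move=> y yx /=; rewrite -[y](subrK x) -addrA.
  by apply: le_lt_trans (vD_le _ _) _; rewrite -ltrBrDr.
have mE (E : set (borel K)) : measurable E ->
    measurable_fun setT (fun x : borel K => (\1_E x : R)%:E).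
  by move=> mE; apply/measurable_EFinP; exact: measurable_indic.
have h1 (x y : K) : x != 0 -> x * (x^-1 * y) = y by move=> x0; rewrite mulVKf.
have h3 (x y : K) : y != 0 -> (y * x)^-1 * y = x^-1.
  by move=> y0; rewrite invfM mulrAC mulVf// mul1r.
have h4 (x : K) : x != 0 -> x^-1 != 0 by rewrite invr_eq0.
have i0 (E : set (borel K)) x : (0 <= (\1_E x : R)%:E)%E by rewrite lee_fin.
have := haar_swap (mul := fun x y : borel K => x * y : borel K)
  (inv := fun x : borel K => x^-1 : borel K) (G := [set x : borel K | x != 0])
  (measurable_vmul Hc) measurable_vinv (@mulrC K0) h1 h3 h4
  dt_sigma_finite dt_sigma_finite dt_ae_neq0 dt_ae_neq0 dt_mul dt_mul
  (mE B mB) (i0 B) (mE A mA) (i0 A).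
have mA' : measurable ((fun x : borel K => x^-1 : borel K) @^-1` A).
  by rewrite -[X in measurable X]setTI; exact: measurable_vinv.
rewrite !integral_indicT//.
have [b bE] : exists b, dt B = b%:E by exists (fine (dt B)); rewrite fineK// ge0_fin_numE.
rewrite bE in pB *; rewrite lte_fin in pB.
move/(congr1 (mule b^-1%:E)).
by rewrite !muleA -!EFinM mulVf ?gt_eqF// !mul1e => ->.
Qed.

End multiplicative_haar.

(** The norm on [R[i]] takes values in [R[i]]; a positive bound there is real, so limits can be
    tested with the real-valued [normc]. *)
Lemma cvg_normcP (R : realType) (T : Type) (F : set_system T) (FF : Filter F)
    (f : T -> R[i]) (l : R[i]) :
  f @ F --> l <-> forall e : R, 0 < e -> \forall x \near F, normc (f x - l) < e.
Proof.
split=> [/cvgrPdist_lt h e e0|h].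
  have e0' : 0 < e%:C :> R[i] by rewrite ltcR.
  apply: filterS (h _ e0') => x.
  by rewrite normr_normc ltcR -normc_opp opprB.
apply/cvgrPdist_lt => e; rewrite ltcE => /andP[/eqP/= ie re].
have -> : e = (complex.Re e)%:C by apply: complex_eq.
apply: filterS (h _ re) => x.
by rewrite normr_normc ltcR -[normc (l - _)]normc_opp opprB.
Qed.

Lemma normc00 (R : realType) : normc (0 : R[i]) = 0.
Proof. by apply/eqP; rewrite normc_eq0. Qed.

Lemma ccontinuousD (R : realType) (T : topologicalType) (f g : T -> R[i]) :
  continuous f -> continuous g -> continuous (fun x => f x + g x).
Proof. by move=> cf cg x; apply: cvgD; [exact: cf|exact: cg]. Qed.

Lemma ccontinuousM (R : realType) (T : topologicalType) (f g : T -> R[i]) :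
  continuous f -> continuous g -> continuous (fun x => f x * g x).
Proof. by move=> cf cg x; apply: cvgM; [exact: cf|exact: cg]. Qed.

Lemma ccontinuous_cst (R : realType) (T : topologicalType) (z : R[i]) :
  continuous (fun _ : T => z).
Proof. by move=> x; exact: cvg_cst. Qed.

(** * Test functions *)

Section smooth_functions.
Context (R : realType) (F : fieldExtType rat) (K0 : fieldType)
  (v : absolute_value R K0) (iota : {rmorphism F -> valued v}).
Local Notation K := (valued v).
Implicit Types (x y z a b u w : K) (r s h : R) (phi psi f g : K -> R[i]).
Hypothesis Hc : is_completion iota.
Hypothesis nu : ~ ultrametric v.
Local Notation of_r := (of_real v).
Local Notation dd := (@directional_derivative R K0 v).

Lemma ddP u phi psi : dd u phi psi <-> forall x (e : R), 0 < e -> exists2 d : R, 0 < d &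
  forall h, h != 0 -> `|h| < d -> normc ((phi (x + of_r h * u) - phi x) / h%:C - psi x) < e.
Proof.
split=> [H x e e0|H x].
  have /cvg_normcP /(_ e e0) := H x.
  rewrite near_withinE => /nbhs_ballP[d /= d0 hd]; exists d => // h h0 hd'.
  by apply: (hd h) => //=; rewrite -ball_normE /= sub0r normrN.
apply/cvg_normcP => e e0; have [d d0 hd] := H x e e0.
rewrite near_withinE; apply/nbhs_ballP; exists d => //= h.
by rewrite -ball_normE /= sub0r normrN => hd' h0; exact: hd.
Qed.

Lemma ccontP f : continuous f <-> forall x (e : R), 0 < e -> exists2 d : R, 0 < d &
  forall y, v (y - x) < d -> normc (f y - f x) < e.
Proof.
split=> [cf x e e0|H x].
  have /(@cvg_normcP _ _ _ (nbhs_filter x)) /(_ e e0) := cf x.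
  by move=> /vnbhsP[d d0 hd]; exists d.
apply/(@cvg_normcP _ _ _ (nbhs_filter x)) => e e0.
by have [d d0 hd] := H x e e0; apply/vnbhsP; exists d.
Qed.

Lemma dd_uniq u phi psi psi' : dd u phi psi -> dd u phi psi' -> psi = psi'.
Proof.
move=> /ddP h /ddP h'; apply/funext => x; apply: normc_sub0.
apply/eqP; rewrite eq_le normcr_ge0 andbT; apply/ler_addgt0Pr => e e0; rewrite add0r.
have e2 : 0 < e / 2 by rewrite divr_gt0.
have [d d0 hd] := h x _ e2; have [d' d0' hd'] := h' x _ e2.
pose k := Num.min d d' / 2.
have m0 : 0 < Num.min d d' by rewrite lt_min d0.
have k0 : 0 < k by rewrite divr_gt0.
have kE : `|k| < Num.min d d' by rewrite gtr0_norm// /k; lra.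
move: kE; rewrite lt_min => /andP[kd kd'].
have := hd k (lt0r_neq0 k0) kd; have := hd' k (lt0r_neq0 k0) kd'.
set q := _ / _ => h1 h2.
have -> : psi x - psi' x = - (q - psi x) + (q - psi' x) by rewrite opprB addrA subrK.
apply: le_trans (normc_add _ _) _; rewrite normc_opp; lra.
Qed.

(* Smoothness of order infinity, with the iterated derivatives given as a family as in [schwartz_arch]. *)
Definition csmooth phi := exists D : seq K -> K -> R[i],
  [/\ D [::] = phi, forall us u, dd u (D us) (D (u :: us))
    & forall us, continuous (D us)].

(** A class closed under directional derivatives provides the whole tree of iterated derivatives,
    one choice at each node. Smoothness proofs thus reduce to exhibiting a closed class. *)
Lemma dd_family (C : set (K -> R[i])) :
  (forall phi u, C phi -> exists2 psi, C psi & dd u phi psi) ->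
  forall phi, C phi -> exists D : seq K -> K -> R[i],
  [/\ D [::] = phi, forall us u, dd u (D us) (D (u :: us)) & forall us, C (D us)].
Proof.
move=> hd phi Cphi.
pose d u f := xget f [set psi | C psi /\ dd u f psi].
have dP u f : C f -> C (d u f) /\ dd u f (d u f).
  move=> Cf; rewrite /d; have [psi Cpsi dpsi] := hd f u Cf.
  exact: (@xgetPex _ f [set psi | C psi /\ dd u f psi] (ex_intro _ psi (conj Cpsi dpsi))).
pose D := foldr d phi.
have CD us : C (D us) by elim: us => [//|u us IH] /=; have [] := dP u _ IH.
by exists D; split=> // us u; have [] := dP u _ (CD us).
Qed.

Lemma csmooth_coind (C : set (K -> R[i])) : (forall phi, C phi -> continuous phi) ->
  (forall phi u, C phi -> exists2 psi, C psi & dd u phi psi) ->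
  forall phi, C phi -> csmooth phi.
Proof.
move=> hc hd phi /(dd_family hd)[D [D0 hD CD]]; exists D; split=> // us.
exact/hc/CD.
Qed.

Lemma csmooth_continuous phi : csmooth phi -> continuous phi.
Proof. by move=> [D [<- _ hD]]; exact: hD. Qed.

Lemma csmooth_dd phi u : csmooth phi -> exists2 psi, csmooth psi & dd u phi psi.
Proof.
move=> [D [<- h1 h2]]; exists (D [:: u]); last exact: h1.
exists (fun us => D (us ++ [:: u])); split; first by [].
  by move=> us w; exact: (h1 (us ++ [:: u]) w).
by move=> us; exact: h2.
Qed.

Lemma of_real_mul_small u (e : R) : 0 < e -> exists2 d : R, 0 < d &
  forall h, `|h| < d -> v (of_r h * u) < e.
Proof.
move=> e0; have vu : 0 < v u + 1 by rewrite ltr_pwDr// v_ge0.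
have [d d0 hd] := v_of_real_small Hc nu (divr_gt0 e0 vu).
exists d => // h /hd; rewrite ltr_pdivlMr// vM => H.
by apply: le_lt_trans H; rewrite ler_wpM2l ?v_ge0// lerDl.
Qed.

Lemma cvg_dd0 u phi x : continuous phi -> phi (x + of_r h * u) @[h --> 0^'] --> phi x.
Proof.
move=> cphi A /(cphi x) /vnbhsP[e e0 hA].
have [d d0 hd] := of_real_mul_small u e0.
apply: (@nbhs_dnbhs _ 0); apply/nbhs_ballP; exists d => //= h.
rewrite -ball_normE /= sub0r normrN => /hd H; apply: hA.
by rewrite addrC addKr.
Qed.

Lemma ddD u f g f' g' : dd u f f' -> dd u g g' ->
  dd u (fun x => f x + g x) (fun x => f' x + g' x).
Proof.
move=> hf hg x; apply: cvg_trans (cvgD (hf x) (hg x)).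
apply: near_eq_cvg; apply: nearW => h /=.
by rewrite -mulrDl opprD addrACA.
Qed.

Lemma ddM u f g f' g' : continuous g -> dd u f f' -> dd u g g' ->
  dd u (fun x => f x * g x) (fun x => f' x * g x + f x * g' x).
Proof.
move=> cg hf hg x.
apply: cvg_trans (cvgD (cvgM (hf x) (cvg_dd0 u (x := x) cg)) (cvgM (cvg_cst (f x)) (hg x))).
apply: near_eq_cvg; apply: nearW => h /=.
transitivity ((f (x + of_r h * u) - f x) / h%:C * g (x + of_r h * u) +
  f x * ((g (x + of_r h * u) - g x) / h%:C)); first by [].
ring.
Qed.

Lemma dd_cst u (z : R[i]) : dd u (fun=> z) (fun=> 0).
Proof.
apply/ddP => x e e0; exists 1 => // h _ _.
by rewrite subrr mul0r subrr normc00.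
Qed.

Lemma csmooth_cst (z : R[i]) : csmooth (fun=> z).
Proof.
apply: (csmooth_coind (C := [set f | exists z : R[i], f = fun=> z])); last by exists z.
  by move=> _ [w ->]; exact: ccontinuous_cst.
by move=> _ u [w ->]; exists (fun=> 0); [exists 0|exact: dd_cst].
Qed.

(** Leibniz's rule turns a product into a sum of products. The generated algebra contains these, so
    it is closed under derivation where the mere set of products is not. *)
Inductive algebra_of (C : set (K -> R[i])) : set (K -> R[i]) :=
| algebra_gen f : C f -> algebra_of C f
| algebra_add f g : algebra_of C f -> algebra_of C g -> algebra_of C (fun x => f x + g x)
| algebra_mul f g : algebra_of C f -> algebra_of C g -> algebra_of C (fun x => f x * g x).

Lemma algebra_continuous (C : set (K -> R[i])) :
  (forall phi, C phi -> continuous phi) -> forall phi, algebra_of C phi -> continuous phi.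
Proof.
move=> hC phi; elim=> [f Cf|f g _ hf _ hg|f g _ hf _ hg]; [exact: hC|exact: (@ccontinuousD R K f g hf hg)|exact: (@ccontinuousM R K f g hf hg)].
Qed.

Lemma algebra_dd (C : set (K -> R[i])) : (forall phi, C phi -> continuous phi) ->
  (forall phi u, C phi -> exists2 psi, C psi & dd u phi psi) ->
  forall phi u, algebra_of C phi -> exists2 psi, algebra_of C psi & dd u phi psi.
Proof.
move=> hC hd phi u; elim=> [f /(hd _ u)[psi]|f g _ [f' Cf df] _ [g' Cg dg]|f g Cf [f' Cf' df] Cg [g' Cg' dg]].
- by move=> Cpsi dpsi; exists psi => //; exact: algebra_gen.
- by exists (fun x => f' x + g' x); [exact: algebra_add|exact: ddD].
exists (fun x => f' x * g x + f x * g' x).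
  by apply: algebra_add; exact: algebra_mul.
exact: (ddM (algebra_continuous hC Cg) df dg).
Qed.

Lemma csmooth_algebra phi : algebra_of csmooth phi -> csmooth phi.
Proof.
apply: csmooth_coind.
  by apply: algebra_continuous => f; exact: csmooth_continuous.
by move=> psi u; apply: algebra_dd => [f|f w]; [exact: csmooth_continuous|exact: csmooth_dd].
Qed.

Lemma csmoothD f g : csmooth f -> csmooth g -> csmooth (fun x => f x + g x).
Proof. by move=> hf hg; apply: csmooth_algebra; apply: algebra_add; exact: algebra_gen. Qed.

Lemma csmoothM f g : csmooth f -> csmooth g -> csmooth (fun x => f x * g x).
Proof. by move=> hf hg; apply: csmooth_algebra; apply: algebra_mul; exact: algebra_gen. Qed.

Lemma vcontinuous_affine (f : K -> R[i]) (c : K) : continuous f ->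
  continuous (fun x => f (x + c)) /\ continuous (fun x => f (- x)).
Proof.
move=> cf; split=> x A.
  move=> /(cf (x + c)) /vnbhsP[e e0 hA]; apply/vnbhsP; exists e => // y yx.
  by apply: hA; rewrite opprD addrACA subrr addr0.
move=> /(cf (- x)) /vnbhsP[e e0 hA]; apply/vnbhsP; exists e => // y yx.
by apply: hA; rewrite -opprD absvN.
Qed.

Lemma csmooth_translate f0 c : csmooth f0 -> csmooth (fun x => f0 (x + c)).
Proof.
move=> hf; apply: (csmooth_coind (C := [set g | exists2 f, csmooth f & g = fun x => f (x + c)]));
  last by exists f0.
  by move=> _ [f /csmooth_continuous cf ->]; have [] := vcontinuous_affine c cf.
move=> _ u [f sf ->]; have [f' sf' df'] := csmooth_dd u sf.
exists (fun x => f' (x + c)); first by exists f'.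
move=> x; apply: cvg_trans (df' (x + c)); apply: near_eq_cvg; apply: nearW => h /=.
by rewrite addrAC.
Qed.

Lemma csmooth_reflect f0 : csmooth f0 -> csmooth (fun x => f0 (- x)).
Proof.
move=> hf; apply: (csmooth_coind (C := [set g | exists2 f, csmooth f & g = fun x => f (- x)]));
  last by exists f0.
  by move=> _ [f /csmooth_continuous cf ->]; have [] := vcontinuous_affine 0 cf.
move=> _ u [f sf ->]; have [f' sf' df'] := csmooth_dd (- u) sf.
exists (fun x => f' (- x)); first by exists f'.
move=> x; apply: cvg_trans (df' (- x)); apply: near_eq_cvg; apply: nearW => h /=.
by rewrite opprD mulrN.
Qed.

Lemma dd_rlin u w : dd u (fun x => (rlin w x)%:C) (fun=> (rlin w u)%:C).
Proof.
apply/ddP => x e e0; exists 1 => // h h0 _.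
have -> : (rlin w (x + of_r h * u))%:C - (rlin w x)%:C = h%:C * (rlin w u)%:C :> R[i].
  by rewrite (rlinD Hc nu) (rlinZ Hc nu) rmorphD rmorphM /=; ring.
have h0' : h%:C != 0 :> R[i] by rewrite -(inj_eq (@complexI R)) in h0.
by rewrite mulrAC divff// mul1r subrr normc00.
Qed.

Lemma continuous_real_complex (f : K -> R) : continuous f -> continuous (fun x => (f x)%:C).
Proof.
move=> cf; apply/ccontP => x e e0.
have /(@cvgrPdist_lt _ _ _ (nbhs x)) /(_ e e0) := cf x.
move=> /vnbhsP[d d0 hd]; exists d => // y /hd.
by rewrite -rmorphB normc_real distrC.
Qed.

Lemma csmooth_rlin w : csmooth (fun x => (rlin w x)%:C).
Proof.
apply: (csmooth_coind (C := [set g | g = (fun x => (rlin w x)%:C) \/ exists z : R[i], g = fun=> z]));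
  last by left.
  move=> _ [->|[z ->]]; last exact: ccontinuous_cst.
  exact: (continuous_real_complex (@rlin_continuous _ _ _ _ _ Hc nu w)).
move=> _ u [->|[z ->]].
  by exists (fun=> (rlin w u)%:C); [right; exists (rlin w u)%:C|exact: dd_rlin].
by exists (fun=> 0); [right; exists 0|exact: dd_cst].
Qed.

End smooth_functions.

(** * Real difference quotients and the flat functions *)

Section difference_quotients.
Context (R : realType).
Implicit Types (f g : R -> R) (x r s h : R) (p : {poly R}).

Definition rdiff f x l := forall e : R, 0 < e -> exists2 d : R, 0 < d &
  forall h, h != 0 -> `|h| < d -> `|(f (x + h) - f x) / h - l| < e.

Lemma rdiffP f x l : rdiff f x l <-> is_derive x 1 f l.
Proof.
have E h : h^-1 *: ((f \o shift x) (h *: 1) - f x) = (f (x + h) - f x) / h.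
  by rewrite /= /GRing.scale/= mulr1 [h + x]addrC mulrC.
split=> [H|H].
  have c : h^-1 *: ((f \o shift x) (h *: 1) - f x) @[h --> 0^'] --> l.
    apply/cvgrPdist_lt => e e0; have [d d0 hd] := H e e0.
    rewrite near_withinE; apply/nbhs_ballP; exists d => //= h.
    rewrite -ball_normE /= sub0r normrN => hd' h0; rewrite distrC.
    by have := hd h h0 hd'; rewrite -E.
  by apply: DeriveDef; [apply/cvg_ex; exists l|exact: cvg_lim c].
have c : h^-1 *: ((f \o shift x) (h *: 1) - f x) @[h --> 0^'] --> l.
  by rewrite -(@derive_val _ _ _ _ _ _ _ H); exact: ex_derive.
move=> e e0; have /cvgrPdist_lt/(_ e e0) := c.
rewrite near_withinE => /nbhs_ballP[d /= d0 hd]; exists d => // h h0 hh.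
have := hd h; rewrite -ball_normE /= sub0r normrN distrC => /(_ hh h0).
by rewrite -/(shift x) -E.
Qed.

Lemma rdiff_eq f g x l (d : R) : 0 < d -> (forall h, `|h| < d -> f (x + h) = g (x + h)) ->
  rdiff g x l -> rdiff f x l.
Proof.
move=> d0 E H e e0; have [d' d0' hd] := H e e0.
exists (Num.min d d'); first by rewrite lt_min d0.
move=> h h0; rewrite lt_min => /andP[h1 h2].
have := E 0; rewrite normr0 addr0 => /(_ d0) ->.
by rewrite E//; exact: hd.
Qed.

Lemma rdiff_mvt f (df : R -> R) (M : R) x y : (forall x, rdiff f x (df x)) ->
  (forall x, `|df x| <= M) -> `|f y - f x| <= M * `|y - x|.
Proof.
move=> H hM; wlog xy : x y / x <= y.
  move=> W; have [|/ltW] := leP x y; first exact: W.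
  by move/W; rewrite distrC [`|x - y|]distrC.
have H' (z : R) : is_derive z (1 : R) f (df z) by apply/rdiffP.
have [|c _ ->] := MVT_segment xy (fun z _ => H' z).
  by apply: derivable_within_continuous => z _; exact: ex_derive.
by rewrite normrM ler_wpM2r.
Qed.

(* The functions p(1/r) exp(-1/r), extended by 0: a family closed under derivation that contains the smooth cut-off exp(-1/r). *)
Definition flat p r : R := if 0 < r then p.[r^-1] * expR (- r^-1) else 0.
Definition flat' p : {poly R} := 'X^2 * (p - p^`()).

Lemma horner_le p : exists2 A : R, 0 <= A & forall s, 1 <= s -> `|p.[s]| <= A * s ^+ size p.
Proof.
exists (\sum_(i < size p) `|p`_i|); first exact: sumr_ge0.
move=> s s1; rewrite horner_coef; apply: le_trans (ler_norm_sum _ _ _) _.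
rewrite mulr_suml; apply: ler_sum => i _; rewrite normrM ler_wpM2l// ger0_norm ?exprn_ge0//; last lra.
by rewrite ler_weXn2l// ltnW.
Qed.

(** With n the size of p, exp(s) dominates s^(n+2) / (n+2)!: n powers absorb the polynomial, and the
    other two give r^2, which is what differentiability at 0 requires. *)
Lemma flat_small p : exists2 C : R, 0 <= C & forall r, r <= 1 -> `|flat p r| <= C * r ^+ 2.
Proof.
have [A A0 hA] := horner_le p.
pose n := size p; exists (A * (n.+2)`!%:R); first by rewrite mulr_ge0.
move=> r r1; rewrite /flat; case: ifPn => [r0|_]; last first.
  by rewrite normr0 mulr_ge0 ?sqr_ge0// mulr_ge0.
have s1 : 1 <= r^-1 by rewrite invf_ge1.
have s0 : 0 < r^-1 by rewrite invr_gt0.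
rewrite normrM [`|expR _|]ger0_norm ?expR_ge0// expRN.
have f0 : 0 < (n.+2)`!%:R :> R by rewrite ltr0n fact_gt0.
have E : (expR r^-1)^-1 <= (n.+2)`!%:R * r ^+ n.+2.
  rewrite -[r ^+ _]invrK -exprVn -[X in X / _]invrK -invfM lef_pV2 ?posrE ?expR_gt0//.
    by rewrite mulrC; apply: le_trans (expR_ge1Dxn n.+1 (ltW s0)); rewrite lerDr.
  by rewrite mulr_gt0 ?exprn_gt0// invr_gt0.
apply: le_trans (ler_pM _ _ (hA _ s1) E) _ => //.
rewrite -/n exprVn -[n.+2]addn2 exprD le_eqVlt; apply/orP; left; apply/eqP.
by field; rewrite expf_neq0// gt_eqF.
Qed.

(** For r > 0 the derivative of p(1/r) exp(-1/r) is r^-2 (p - p')(1/r) exp(-1/r), whence [flat']. At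
    0 the quadratic bound gives the derivative 0. *)
Lemma flat_diff p r : rdiff (flat p) r (flat (flat' p) r).
Proof.
case: (ltrgtP 0 r) => [r0|r0|<-]; last first.
- have [C C0 hC] := flat_small p => e e0.
  have C1 : 0 < C + 1 by rewrite ltr_wpDl.
  exists (Num.min 1 (e / (C + 1))); first by rewrite lt_min ltr01 divr_gt0.
  move=> h h0; rewrite lt_min ltr_pdivlMr// => /andP[h1 h2].
  rewrite add0r /flat ltxx !subr0 -/(flat p h) normrM normfV ltr_pdivrMr ?normr_gt0//.
  apply: le_lt_trans (hC h _) _; first by apply: le_trans (ler_norm _) (ltW h1).
  have hh : 0 < `|h| by rewrite normr_gt0.
  rewrite -[h ^+ 2]ger0_norm ?sqr_ge0// normrX expr2 mulrA ltr_pM2r//.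
  by apply: le_lt_trans h2; rewrite mulrDr mulr1 mulrC lerDl ltW.
- apply: (@rdiff_eq _ (fun=> 0) _ _ (- r)); rewrite ?oppr_gt0//.
    move=> h; rewrite ltr_norml opprK /flat => /andP[_ h2].
    by rewrite ltNge (_ : r + h <= 0)//; lra.
  move=> e e0; exists 1 => // h _ _; rewrite /flat (lt_gtF r0).
  by rewrite !subrr mul0r subrr normr0.
apply: (@rdiff_eq _ (fun r => p.[r^-1] * expR (- r^-1)) _ _ r) => //.
  move=> h; rewrite ltr_norml => /andP[h1 _]; rewrite /flat (_ : 0 < r + h)//; lra.
apply/rdiffP.
have rn : r != 0 by rewrite gt_eqF.
have D1 : is_derive r 1 (fun y : R => y^-1) (- r ^- 2).
  have := @is_deriveV _ (@id R) r 1 1 rn (is_derive_id _ _).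
  by rewrite /GRing.scale/= mulr1.
have D2 := is_derive1_comp (is_derive_poly p r^-1) D1.
have D3 := @is_derive1_comp R expR (fun y : R => - y^-1) r _ _ (is_derive_expR (- r^-1)) (is_deriveN D1).
have := is_deriveM D2 D3.
rewrite (_ : _ *: _ + _ = flat (flat' p) r)//.
rewrite /flat r0 /flat' !hornerE /GRing.scale/=.
by field.
Qed.

Lemma flat1_ge0 r : 0 <= flat 1 r <= 1.
Proof.
rewrite /flat; case: ifP => [r0|_]; rewrite ?lexx ?ler01//.
rewrite hornerC mul1r expR_ge0/= -expR0 ler_expR oppr_le0 invr_ge0 ltW//.
Qed.

Lemma flat1_gt0 r : (0 < flat 1 r) = (0 < r).
Proof. by rewrite /flat; case: ifP; rewrite ?ltxx// hornerC mul1r expR_gt0. Qed.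

End difference_quotients.

Lemma rcontinuousM (R : realType) (T : topologicalType) (f g : T -> R) :
  continuous f -> continuous g -> continuous (fun x => f x * g x).
Proof. by move=> cf cg x; apply: cvgM; [exact: cf|exact: cg]. Qed.

Lemma rcontinuous_cst (R : realType) (T : topologicalType) (k : R) :
  continuous (fun _ : T => k).
Proof. by move=> x; exact: cvg_cst. Qed.

Lemma rcontinuousX (R : realType) (T : topologicalType) (f : T -> R) N :
  continuous f -> continuous (fun x => f x ^+ N).
Proof.
move=> cf; elim: N => [|N IH]; first exact: rcontinuous_cst.
have -> : (fun x => f x ^+ N.+1) = fun x => f x * f x ^+ N.
  by apply/funext => x; rewrite exprS.
exact: rcontinuousM.
Qed.

(** * Bump functions and continuity at an archimedean place *)

Section arch_test_functions.
Context (R : realType) (F : fieldExtType rat) (K0 : fieldType)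
  (v : absolute_value R K0) (iota : {rmorphism F -> valued v}).
Local Notation K := (valued v).
Implicit Types (x y a b u w : K) (r s h : R) (phi psi f g : K -> R[i]).
Hypothesis Hc : is_completion iota.
Hypothesis nu : ~ ultrametric v.
Local Notation of_r := (of_real v).
Local Notation dd := (@directional_derivative R K0 v).

Lemma rdiff_continuous (f : R -> R) (x l e : R) : rdiff f x l -> 0 < e ->
  exists2 d : R, 0 < d & forall h, `|h| < d -> `|f (x + h) - f x| < e.
Proof.
move=> H e0; have [d d0 hd] := H 1 ltr01.
have l0 : 0 < `|l| + 1 by rewrite ltr_wpDl.
exists (Num.min d (e / (`|l| + 1))); first by rewrite lt_min d0 divr_gt0.
move=> h; rewrite lt_min ltr_pdivlMr// => /andP[h1 h2].
have [->|h0] := eqVneq h 0; first by rewrite addr0 subrr normr0.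
have := hd h h0 h1; set q := _ / h => hq.
have -> : f (x + h) - f x = q * h by rewrite /q mulfVK.
rewrite normrM mulrC; apply: le_lt_trans h2; rewrite ler_wpM2l//.
rewrite -[q](subrK l); apply: le_trans (ler_normD _ _) _; rewrite addrC lerD2l; exact: ltW.
Qed.

Lemma csmooth_flat (p : {poly R}) (c : R) u : csmooth (fun x => (flat p (c + rlin u x))%:C).
Proof.
apply: (csmooth_coind (C := [set g | exists p k, g = fun x => (k * flat p (c + rlin u x))%:C])).
- move=> _ [q [k ->]]; apply: continuous_real_complex.
  apply: (@rcontinuousM R K (fun=> k) (fun x => flat q (c + rlin u x)) (@rcontinuous_cst R K k)) => x.
  apply/(@cvgrPdist_lt _ _ _ (nbhs (x : K))) => e e0.
  have [d d0 hd] := rdiff_continuous (flat_diff q (c + rlin u x)) e0.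
  have /(@cvgrPdist_lt _ _ _ (nbhs (x : K))) /(_ d d0) := @rlin_continuous _ _ _ _ _ Hc nu u x.
  apply: filterS => y hy; rewrite distrC.
  have -> : c + rlin u y = (c + rlin u x) + (rlin u y - rlin u x) by ring.
  by apply: hd; rewrite distrC.
- move=> _ w [q [k ->]].
  exists (fun x => (k * rlin u w * flat (flat' q) (c + rlin u x))%:C); first by exists (flat' q), (k * rlin u w).
  apply/ddP => x e e0.
  have [kw0|kw0] := eqVneq (k * rlin u w) 0.
    exists 1 => // h h0 _; rewrite kw0 mul0r subr0 (rlinD Hc nu) (rlinZ Hc nu).
    move/eqP: kw0; rewrite mulf_eq0 => /orP[/eqP ->|/eqP ->].
      by rewrite !mul0r subrr mul0r normc00.
    by rewrite mulr0 addr0 subrr mul0r normc00.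
  have w0 : rlin u w != 0 by apply: contraNneq kw0 => ->; rewrite mulr0.
  have kp : 0 < `|k * rlin u w| by rewrite normr_gt0.
  have wp : 0 < `|rlin u w| by rewrite normr_gt0.
  have [d d0 hd] := flat_diff q (c + rlin u x) (divr_gt0 e0 kp).
  exists (d / `|rlin u w|); first exact: divr_gt0.
  move=> h h0; rewrite ltr_pdivlMr// -normrM => hh.
  have hw0 : h * rlin u w != 0 by rewrite mulf_neq0.
  have := hd _ hw0 hh; rewrite ltr_pdivlMr// -normrM.
  rewrite -fmorphV -!rmorphB -rmorphM -rmorphB normc_real => hq.
  rewrite (rlinD Hc nu) (rlinZ Hc nu) addrA; apply: le_lt_trans hq.
  rewrite le_eqVlt; apply/orP; left; apply/eqP; congr `|_|.
  by field; rewrite w0.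
- exists p, 1; apply/funext => x; by rewrite mul1r.
Qed.

Lemma csmooth_bigprod (I : Type) (s : seq I) (f : I -> K -> R[i]) :
  (forall i, csmooth (f i)) -> csmooth (fun x => \prod_(i <- s) f i x).
Proof.
move=> hf; elim: s => [|i s IH].
  have -> : (fun x : K => \prod_(i <- [::]) f i x) = fun=> 1.
    by apply/funext => x; rewrite big_nil.
  exact: csmooth_cst.
have -> : (fun x : K => \prod_(j <- i :: s) f j x) = fun x => f i x * \prod_(j <- s) f j x.
  by apply/funext => x; rewrite big_cons.
exact: (csmoothM Hc nu).
Qed.

(** A product of one-sided cut-offs in d + Tr(u_i x) and d - Tr(u_i x): it is nonzero only where
    every |Tr(u_i x)| is at most d, and by [rnorm_structure] such x are small. *)
Lemma csmooth_bump (rho : R) : 0 < rho -> exists b : K -> R,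
  [/\ csmooth (fun x => (b x)%:C), forall x, 0 <= b x <= 1,
      forall x, b x != 0 -> v x < rho
    & 0 < b 0].
Proof.
move=> rho0; have [n [u [_ hs]]] := rnorm_structure Hc nu.
have [e e0 he] := hs _ rho0.
(* Dividing by n + 1 makes the sum of the n bounds strictly smaller than e. *)
pose d : R := e / n.+1%:R.
have d0 : 0 < d by rewrite divr_gt0.
pose b x := \prod_(i < n) (flat 1 (d + rlin (u i) x) * flat 1 (d + rlin (- u i) x)).
have rN i x : rlin (- u i) x = - rlin (u i) x.
  by rewrite rlinC (rlinN Hc nu) rlinC.
have f0 r : 0 <= flat 1 r by have /andP[] := flat1_ge0 r.
exists b; split.
- have -> : (fun x => (b x)%:C) = fun x => \prod_(i < n)
      ((flat 1 (d + rlin (u i) x))%:C * (flat 1 (d + rlin (- u i) x))%:C).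
    by apply/funext => x; rewrite rmorph_prod; apply: eq_bigr => i _; rewrite rmorphM.
  apply: csmooth_bigprod => i; apply: (csmoothM Hc nu); exact: csmooth_flat.
- move=> x; rewrite /b; elim/big_rec: _ => [|i y _ /andP[y0 y1]]; first by rewrite ler01 lexx.
  have /andP[a0 a1] := flat1_ge0 (d + rlin (u i) x).
  have /andP[c0 c1] := flat1_ge0 (d + rlin (- u i) x).
  have m0 : 0 <= flat 1 (d + rlin (u i) x) * flat 1 (d + rlin (- u i) x) by rewrite mulr_ge0.
  by rewrite mulr_ge0//= mulr_ile1// mulr_ile1.
- move=> x /prodf_neq0 h; apply: he.
  have hi i : `|rlin (u i) x| <= d.
    have := h i isT; rewrite mulf_eq0 negb_or.
    have /andP[a0 _] := flat1_ge0 (d + rlin (u i) x).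
    have /andP[c0 _] := flat1_ge0 (d + rlin (- u i) x).
    have pos r : flat 1 r != 0 -> 0 < r by move=> r0; rewrite -flat1_gt0 lt_def r0 f0.
    move=> /andP[/pos p /pos]; rewrite rN ler_norml => q.
    apply/andP; split; lra.
  apply: le_lt_trans (ler_sum _ (fun i _ => hi i)) _.
  rewrite sumr_const card_ord -[_ *+ n]mulr_natr /d -mulrA [_^-1 * _]mulrC mulrA ltr_pdivrMr//.
  by rewrite ltr_pM2l// ltr_nat.
- apply: prodr_gt0 => i _; rewrite rN (rlin0 Hc nu) oppr0 addr0.
  by rewrite mulr_gt0// flat1_gt0.
Qed.

Lemma dd_outside_compact u phi psi (C : set K) : compact C -> dd u phi psi ->
  (forall x, ~ C x -> phi x = 0) -> forall x, ~ C x -> psi x = 0.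
Proof.
move=> cC /ddP hd h x Cx.
have oC : nbhs x (~` C).
  have : open (~` C) by apply/closed_openC/(compact_closed (@vhausdorff _ _ v)).
  by rewrite openE; exact.
have /vnbhsP[d d0 hd'] := oC.
have [d1 d10 hd1] := of_real_mul_small Hc nu u d0.
apply/eqP; rewrite -normc_eq0 eq_le normcr_ge0 andbT.
apply/ler_addgt0Pr => e e0; rewrite add0r; have [d2 d20 hd2] := hd x e e0.
have m0 : 0 < Num.min d1 d2 by rewrite lt_min d10.
pose k := Num.min d1 d2 / 2.
have k0 : 0 < k by rewrite divr_gt0.
have : `|k| < Num.min d1 d2 by rewrite gtr0_norm// /k; lra.
rewrite lt_min => /andP[k1 k2].
have := hd2 k (lt0r_neq0 k0) k2.
rewrite (h x Cx) h ?subr0 ?mul0r ?sub0r ?normc_opp; first exact: ltW.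
by apply: hd'; rewrite addrC addKr; exact: hd1.
Qed.

Lemma continuous_compact_bounded (C : set K) (f : K -> R) : compact C -> continuous f ->
  exists M : R, forall x, C x -> f x <= M.
Proof.
move=> cC cf; have [[x0 Cx0]|C0] := pselect (C !=set0); last first.
  by exists 0 => x Cx; case: C0; exists x.
have [|c _ hc] := compact_EVT_max (f := f) (ex_intro _ x0 Cx0) cC.
  exact: continuous_subspaceT.
by exists (f c) => x Cx; apply: hc; rewrite inE.
Qed.

Lemma continuous_weighted phi (N : nat) : continuous phi ->
  continuous (fun x => v x ^+ N * normc (phi x)).
Proof.
move=> cphi.
have c2 : continuous (fun x : K => normc (phi x)); last first.
  have c1 := @rcontinuousX R K (fun x : K => v x) N (@vcontinuous _ _ v).
  by move=> x; exact: (@rcontinuousM R K _ _ c1 c2 x).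
move=> x.
apply/(@cvgrPdist_lt _ _ _ (nbhs (x : K))) => e e0.
have [d d0 hd] := (ccontP phi).1 cphi x e e0.
apply/vnbhsP; exists d => // y /hd; apply: le_lt_trans.
have h1 : normc (phi x) <= normc (phi y - phi x) + normc (phi y).
  by rewrite -[normc (phi y - phi x)]normc_opp opprB -{1}[phi x](subrK (phi y)); exact: normc_add.
have h2 : normc (phi y) <= normc (phi y - phi x) + normc (phi x).
  by rewrite -{1}[phi y](subrK (phi x)); exact: normc_add.
rewrite distrC ler_norml; apply/andP; split; lra.
Qed.

Lemma csmooth_compact_schwartz phi : csmooth phi -> compact_support phi -> schwartz_arch phi.
Proof.
move=> [D [D0 hD cD]] [C cC hC]; exists D; split=> // us N.
have out : forall x, ~ C x -> D us x = 0.
  elim: us => [|u us IH]; first by rewrite D0.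
  exact: dd_outside_compact cC (hD us u) IH.
have [M hM] := continuous_compact_bounded cC (@continuous_weighted _ N (cD us)).
exists (Num.max M 0) => x; have [Cx|Cx] := pselect (C x).
  by rewrite le_max hM.
by rewrite out// normc00 mulr0 le_max lexx orbT.
Qed.

(** The mean value theorem along t -> x + t u is applied to the real and the imaginary part, hence
    the factor 2. *)
Lemma dd_line_bound u phi psi (M : R) : dd u phi psi -> (forall x, normc (psi x) <= M) ->
  forall x h, normc (phi (x + of_r h * u) - phi x) <= 2 * M * `|h|.
Proof.
move=> /ddP hd hM x h.
have line (p : R[i] -> R) : (forall z w : R[i], p (z - w) = p z - p w) ->
    (forall (z : R[i]) k, p (z / k%:C) = p z / k) -> (forall z, `|p z| <= normc z) ->
    `|p (phi (x + of_r h * u)) - p (phi x)| <= M * `|h|.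
  move=> pB pD pn.
  have H t : rdiff (fun t => p (phi (x + of_r t * u))) t (p (psi (x + of_r t * u))).
    move=> e e0; have [d d0 hd'] := hd (x + of_r t * u) e e0; exists d => // k k0 kd.
    apply: le_lt_trans (hd' k k0 kd); rewrite -pB -pD -pB.
    have -> : x + of_r (t + k) * u = x + of_r t * u + of_r k * u.
      by rewrite (of_realD Hc nu); ring.
    exact: pn.
  have := rdiff_mvt 0 h H (fun t => le_trans (pn _) (hM _)).
  by rewrite (of_real0 Hc nu) mul0r addr0 subr0.
have h1 := line (@complex.Re R) _ _ (@Re_le_normc R).
have h2 := line (@complex.Im R) _ _ (@Im_le_normc R).
apply: le_trans (normc_leD _) _; rewrite ReD ReN ImD ImN.
have -> : 2 * M * `|h| = M * `|h| + M * `|h| by ring.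
apply: lerD.
  by apply: h1 => [z w|z k]; rewrite ?ReD ?ReN// -fmorphV ReM /= mulr0 subr0.
by apply: h2 => [z w|z k]; rewrite ?ImD ?ImN// -fmorphV ImM /= mulr0 add0r.
Qed.

Lemma lipschitz_combination phi (L : K -> R) :
  (forall u x h, normc (phi (x + of_r h * u) - phi x) <= L u * `|h|) ->
  forall (s : seq (R * K)) x, normc (phi (x + \sum_(p <- s) of_r p.1 * p.2) - phi x) <=
    \sum_(p <- s) L p.2 * `|p.1|.
Proof.
move=> hL; elim=> [|p s IH] x; first by rewrite !big_nil addr0 subrr normc00.
rewrite !big_cons addrA.
set y := x + _; rewrite -[_ - phi x](subrKA (phi y)).
rewrite [leRHS]addrC; apply: le_trans (normc_add _ _) (lerD _ _); [exact: IH|exact: hL].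
Qed.

(** [schwartz_arch] provides bounded directional derivatives without mentioning continuity. Moving
    from x to y along the vectors of a real basis, with a mean value bound in each direction,
    recovers it for every derivative. *)
Lemma schwartz_csmooth phi : schwartz_arch phi -> csmooth phi.
Proof.
move=> [D [D0 hD bD]]; exists D; split=> // us.
have bd0 u : exists M : R, forall x, normc (D (u :: us) x) <= M.
  have [M hM] := bD (u :: us) 0%N; exists M => x.
  by have := hM x; rewrite expr0 mul1r.
have [M hM] := choice bd0.
have hL u x h := dd_line_bound (hD us u) (hM u) x h.
have [n [b [c [cE cs]]]] := real_coordinates Hc nu.
pose T := \sum_(i < n) `|2 * M (b i)| + 1.
have T0 : 0 < T by rewrite ltr_wpDl// sumr_ge0.
apply/ccontP => x e e0.
have [d d0 hd] := cs _ (divr_gt0 e0 T0); exists d => // y yx.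
have -> : y = x + \sum_(p <- [seq (c i (y - x), b i) | i <- index_enum 'I_n]) of_r p.1 * p.2.
  by rewrite big_map/= -cE addrC subrK.
apply: le_lt_trans (lipschitz_combination hL _ _) _; rewrite big_map/=.
apply: (@le_lt_trans _ _ (\sum_(i < n) `|2 * M (b i)| * (e / T))).
  apply: ler_sum => i _; apply: le_trans (ler_wpM2r _ (ler_norm _)) _ => //.
  by rewrite ler_wpM2l// ltW// hd.
rewrite -mulr_suml mulrA ltr_pdivrMr// mulrC ltr_pM2l// /T ltrDl//.
Qed.

End arch_test_functions.

Lemma bounded_L1_L2 (R : realType) d (T : measurableType d) (m : {measure set T -> \bar R}) (f : T -> R[i]) (M : R) :
  L1 m f -> (forall x, normc (f x) <= M) -> L2 m f.
Proof.
move=> /L1P[mf lf] hM; split=> //.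
have M0 : 0 <= `|M| by [].
apply: (@le_lt_trans _ _ (`|M|%:E * norm1 m f)%E); last by rewrite lte_mul_pinfty.
rewrite /norm1 -ge0_integralZl//.
- apply: ge0_le_integral => //.
  + by move=> x _; exact: sqnormE_ge0.
  + exact: measurable_sqnormE.
  + by apply: emeasurable_funM => //; exact: measurable_normE.
  + move=> x _; rewrite -EFinM lee_fin expr2 ler_wpM2r ?normcr_ge0//.
    exact: le_trans (hM x) (ler_norm _).
- exact: measurable_normE.
- by move=> x _; rewrite lee_fin normcr_ge0.
Qed.

Section test_functions.
Context (R : realType) (F : fieldExtType rat) (K0 : fieldType)
  (v : absolute_value R K0) (iota : {rmorphism F -> valued v}).
Local Notation K := (valued v).
Implicit Types (x y u w : K) (r s h : R) (phi psi f g : K -> R[i]).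
Hypothesis Hc : is_completion iota.

(** Compactly supported Schwartz-Bruhat functions. Unlike [schwartz_bruhat0] this class is stable
    under translation, and the Fourier transform sends it into the Schwartz-Bruhat functions. *)
Definition test phi := schwartz_bruhat phi /\ compact_support phi.

Lemma compact_supportP phi : compact_support phi <->
  exists r : R, forall x, r < v x -> phi x = 0.
Proof.
split=> [[C cC hC]|[r hr]].
  have [M hM] := vcompact_bounded cC; exists M => x; rewrite ltNge => xM.
  by apply: hC => Cx; move: xM; rewrite hM.
exists [set x : K | v x <= r]; first exact: (@vball_compact _ _ _ _ _ Hc).
by move=> x /= /negP; rewrite -ltNge; exact: hr.
Qed.

Lemma schwartz_arch_test phi : ~ ultrametric v -> test phi <-> csmooth phi /\ compact_support phi.
Proof.
move=> nu; rewrite /test /schwartz_bruhat; case: asboolP => // _.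
split=> -[h1 h2]; split=> //; first exact: (schwartz_csmooth Hc nu).
exact: (csmooth_compact_schwartz Hc nu).
Qed.

Lemma schwartz_ultra phi : ultrametric v -> schwartz_bruhat phi <->
  (forall x, exists2 d : R, 0 < d & forall y, v (y - x) < d -> phi y = phi x) /\
  compact_support phi.
Proof.
move=> um; rewrite /schwartz_bruhat; case: asboolP => // _.
split=> -[h1 h2]; split=> // x; first by have /vnbhsP[d d0 hd] := h1 x; exists d.
by have [d d0 hd] := h1 x; apply/vnbhsP; exists d.
Qed.

Lemma test_ultra phi : ultrametric v -> test phi <->
  (forall x, exists2 d : R, 0 < d & forall y, v (y - x) < d -> phi y = phi x) /\
  compact_support phi.
Proof. by move=> um; split=> [[/(schwartz_ultra phi um)]//|h]; split; [exact/(schwartz_ultra phi um)|case: h]. Qed.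

Lemma test_op2 (op : R[i] -> R[i] -> R[i]) phi psi : op 0 0 = 0 ->
  (~ ultrametric v -> csmooth phi -> csmooth psi -> csmooth (fun x => op (phi x) (psi x))) ->
  test phi -> test psi -> test (fun x => op (phi x) (psi x)).
Proof.
move=> op0 hs tphi tpsi.
have cs : compact_support (fun x => op (phi x) (psi x)).
  have /compact_supportP[r hr] := tphi.2; have /compact_supportP[s hs'] := tpsi.2.
  apply/compact_supportP; exists (Num.max r s) => x; rewrite gt_max => /andP[xr xs].
  by rewrite hr// hs'.
have [um|nu] := pselect (ultrametric v).
  move/(test_ultra phi um): tphi => [h1 _]; move/(test_ultra psi um): tpsi => [h2 _].
  apply/(test_ultra _ um); split=> // x.
  have [d d0 hd] := h1 x; have [e e0 he] := h2 x.
  exists (Num.min d e); first by rewrite lt_min d0.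
  by move=> y; rewrite lt_min => /andP[yd ye]; rewrite hd// he.
move/(schwartz_arch_test phi nu): tphi => [h1 _]; move/(schwartz_arch_test psi nu): tpsi => [h2 _].
by apply/(schwartz_arch_test _ nu); split=> //; exact: hs.
Qed.

Lemma testD phi psi : test phi -> test psi -> test (fun x => phi x + psi x).
Proof. by apply: (test_op2 (op := +%R)) => [|nu]; [rewrite addr0|exact: (csmoothD Hc nu)]. Qed.

Lemma testM phi psi : test phi -> test psi -> test (fun x => phi x * psi x).
Proof. by apply: (test_op2 (op := *%R)) => [|nu]; [rewrite mulr0|exact: (csmoothM Hc nu)]. Qed.

Lemma testZ (z : R[i]) phi : test phi -> test (fun x => z * phi x).
Proof.
move=> tphi; have h : ~ ultrametric v -> csmooth phi -> csmooth phi -> csmooth (fun x => z * phi x).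
  by move=> nu h _; apply: (csmoothM Hc nu) => //; exact: csmooth_cst.
exact: (@test_op2 (fun p _ => z * p) phi phi (mulr0 z) h tphi tphi).
Qed.

Lemma test_affine phi (c e : K) : v e = 1 -> (~ ultrametric v -> csmooth phi -> csmooth (fun x => phi (e * x + c))) ->
  test phi -> test (fun x => phi (e * x + c)).
Proof.
move=> e1 hs tphi.
have cs : compact_support (fun x => phi (e * x + c)).
  have /compact_supportP[r hr] := tphi.2.
  apply/compact_supportP; exists (r + v c) => x xr; apply: hr.
  rewrite -(ltrD2r (v c)); apply: lt_le_trans xr _.
  have -> : v x = v (e * x) by rewrite vM e1 mul1r.
  by rewrite -{1}[e * x](addrK c); exact: vB_le.
have [um|nu] := pselect (ultrametric v).
  move/(test_ultra phi um): tphi => [h1 _].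
  apply/(test_ultra _ um); split=> // x; have [d d0 hd] := h1 (e * x + c).
  exists d => // y yx; apply: hd.
  have -> : e * y + c - (e * x + c) = e * (y - x) by ring.
  rewrite vM e1 mul1r; exact: yx.
move/(schwartz_arch_test phi nu): tphi => [h1 _].
by apply/(schwartz_arch_test _ nu); split=> //; exact: hs.
Qed.

Lemma test_translate phi c : test phi -> test (fun x => phi (x + c)).
Proof.
move=> tphi; have -> : (fun x => phi (x + c)) = fun x => phi (1 * x + c).
  by apply/funext => x; rewrite mul1r.
apply: test_affine => //; first exact: absv1.
move=> nu h; have := csmooth_translate c h; congr (csmooth _).
by apply/funext => x; rewrite mul1r.
Qed.

Lemma test_reflect phi : test phi -> test (fun x => phi (- x)).
Proof.
move=> tphi; have -> : (fun x => phi (- x)) = fun x => phi (-1 * x + 0).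
  by apply/funext => x; rewrite mulN1r addr0.
apply: test_affine => //; first by rewrite absvN absv1.
move=> nu h; have := csmooth_reflect h; congr (csmooth _).
by apply/funext => x; rewrite mulN1r addr0.
Qed.

Lemma schwartz_continuous phi : schwartz_bruhat phi -> continuous phi.
Proof.
have [um|nu] := pselect (ultrametric v).
  move/(schwartz_ultra phi um) => [h _]; apply/ccontP => x e e0.
  by have [d d0 hd] := h x; exists d => // y /hd ->; rewrite subrr normc00.
rewrite /schwartz_bruhat; case: asboolP => // _ h.
by apply: csmooth_continuous; exact: (schwartz_csmooth Hc nu).
Qed.

Lemma schwartz_cmeas phi : schwartz_bruhat phi -> cmeasurable (phi : borel K -> R[i]).
Proof.
move=> /schwartz_continuous /ccontP h; apply: continuous_cmeasurable => x e e0.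
by have [d d0 hd] := h x e e0; apply/vnbhsP; exists d.
Qed.

Lemma schwartz_decay phi (N : nat) : schwartz_bruhat phi ->
  exists2 M : R, 0 <= M & forall x, v x ^+ N * normc (phi x) <= M.
Proof.
move=> sphi; suff [M hM] : exists M : R, forall x, v x ^+ N * normc (phi x) <= M.
  by exists M => //; apply: le_trans (hM 0); rewrite mulr_ge0 ?exprn_ge0 ?v_ge0 ?normcr_ge0.
have cphi := schwartz_continuous sphi.
have [um|nu] := pselect (ultrametric v).
  move/(schwartz_ultra phi um): sphi => [_ [C cC hC]].
  have [M hM] := continuous_compact_bounded cC (@continuous_weighted R K0 v phi N cphi).
  exists (Num.max M 0) => x; have [Cx|Cx] := pselect (C x).
    by rewrite le_max hM.
  by rewrite hC// normc00 mulr0 le_max lexx orbT.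
move: sphi; rewrite /schwartz_bruhat; case: asboolP => // _ [D [<- _]].
by move/(_ [::] N).
Qed.

Lemma test_bump (rho : R) : 0 < rho -> exists b : K -> R,
  [/\ test (fun x => (b x)%:C), forall x, 0 <= b x <= 1,
      forall x, b x != 0 -> v x < rho & 0 < b 0].
Proof.
move=> rho0.
have cs (b : K -> R) : (forall x, b x != 0 -> v x < rho) -> compact_support (fun x => (b x)%:C).
  move=> hb; apply/compact_supportP; exists rho => x rx.
  have [->//|/hb] := eqVneq (b x) 0; by rewrite ltNge (ltW rx).
have [um|nu] := pselect (ultrametric v); last first.
  have [b [sb b01 bs b0]] := csmooth_bump Hc nu rho0; exists b; split=> //.
  by apply/(schwartz_arch_test _ nu); split=> //; exact: cs.
pose b (x : K) : R := if v x < rho then 1 else 0.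
have bs x : b x != 0 -> v x < rho by rewrite /b; case: ltP => //; rewrite eqxx.
exists b; split=> //; last by rewrite /b absv0 rho0 ltr01.
- apply/(test_ultra _ um); split; last exact: cs.
  have key x y : v (y - x) < rho -> v x < rho -> v y < rho.
    by move=> h1 h2; rewrite -[y](subrK x); apply: le_lt_trans (um _ _) _; rewrite gt_max h1.
  move=> x; exists rho => // y yx; congr (_%:C); rewrite /b; rewrite (_ : (v y < rho) = (v x < rho))//.
  by apply/idP/idP; apply: key => //; rewrite vdistC.
- by move=> x; rewrite /b; case: (v x < rho); rewrite /= ?lexx ?ler01.
Qed.

Variable dx : {measure set (borel K) -> \bar R}.
Hypothesis Hdx : @is_haar R K setT +%R dx.
Local Notation md t := (modulus dx t).

(* Decay of order 3 in the module is what makes |x|^a phi integrable for -1 < a < 2. *)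
Definition rapid phi := cmeasurable (phi : borel K -> R[i]) /\
  exists2 M : R, 0 <= M & forall x, normc (phi x) <= M /\ md x ^+ 3 * normc (phi x) <= M.

(** For v x >= 1 the module is at most C v(x)^A, so decay of order 3A in v gives decay of order 3 in
    the module; in the unit ball the module is at most 1. *)
Lemma schwartz_rapid phi : schwartz_bruhat phi -> rapid phi.
Proof.
move=> sphi; split; first exact: schwartz_cmeas.
have [C [A [C0 hC]]] := modulus_le_vX Hc Hdx.
have [M M0 hM] := schwartz_decay 0 sphi.
have [M' M'0 hM'] := schwartz_decay (A * 3) sphi.
exists (M + C ^+ 3 * M'); first by rewrite addr_ge0// mulr_ge0// exprn_ge0// ltW.
have C3 : 0 <= C ^+ 3 by rewrite exprn_ge0// ltW.
have CM : 0 <= C ^+ 3 * M' by rewrite mulr_ge0.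
have M0' x : normc (phi x) <= M by have := hM x; rewrite expr0 mul1r.
move=> x; split; first by apply: le_trans (M0' x) _; rewrite lerDl.
have m0 := modulus_ge0 Hc Hdx x.
have [x1|x1] := leP 1 (v x).
  apply: (@le_trans _ _ (C ^+ 3 * M')); last by rewrite lerDr.
  apply: (@le_trans _ _ ((C * v x ^+ A) ^+ 3 * normc (phi x))).
    by rewrite ler_wpM2r ?normcr_ge0// lerXn2r ?nnegrE ?hC// mulr_ge0 ?exprn_ge0 ?v_ge0// ltW.
  by rewrite exprMn -exprM -mulrA ler_wpM2l.
apply: (@le_trans _ _ M); last by rewrite lerDl.
apply: le_trans (M0' x); rewrite ler_piMl ?normcr_ge0// exprn_ile1//.
rewrite -(modulus1 Hc Hdx); apply: (modulus_le Hc Hdx).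
by rewrite absv1 ltW.
Qed.

Lemma rapid_L1 phi (a : R) : rapid phi -> -1 < a < 2 ->
  L1 dx (fun x : borel K => (md x `^ a)%:C * phi x).
Proof.
move=> [mphi [M M0 hM]] /andP[a1 a2].
by apply: (L1_modulus_powR Hc Hdx a1 a2 mphi (M := M)) => x; have [] := hM x.
Qed.

Lemma rapid_L10 phi : rapid phi -> L1 dx (phi : borel K -> R[i]).
Proof.
move=> rphi; have := @rapid_L1 phi 0 rphi; rewrite ltrN10 ltr0n => /(_ isT).
by congr (L1 _ _); apply/funext => x; rewrite powRr0 mul1r.
Qed.

Lemma rapid_L2 phi : rapid phi -> L2 dx (phi : borel K -> R[i]).
Proof.
move=> rphi; have [_ [M _ hM]] := rphi.
by apply: (bounded_L1_L2 (rapid_L10 rphi) (M := M)) => x; have [] := hM x.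
Qed.

End test_functions.

Section exponential_bounds.
Context (R : realType).
Implicit Types (t : R).

Lemma rdiff_mvt0 (f df : R -> R) (M t : R) : (forall x, rdiff f x (df x)) ->
  (forall x, `|x| <= `|t| -> `|df x| <= M) -> `|f t - f 0| <= M * `|t|.
Proof.
move=> H hM.
have H' (z : R) : is_derive z (1 : R) f (df z) by apply/rdiffP.
have cf (a b : R) : {within `[a, b], continuous f}.
  by apply: derivable_within_continuous => z _; exact: ex_derive.
have [t0|/ltW t0] := leP 0 t.
  have [c] := MVT_segment t0 (fun z _ => H' z) (@cf _ _).
  rewrite in_itv/= => /andP[c0 ct] ->; rewrite subr0 normrM ler_wpM2r//.
  by apply: hM; rewrite !ger0_norm.
have [c] := MVT_segment t0 (fun z _ => H' z) (@cf _ _).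
rewrite in_itv/= => /andP[c0 ct] E; rewrite distrC E sub0r normrM normrN ler_wpM2r//.
by apply: hM; rewrite !ler0_norm// lerN2.
Qed.

Lemma sin_le_norm t : `|sin t| <= `|t|.
Proof.
have := @rdiff_mvt0 sin cos 1 t; rewrite sin0 subr0 mul1r; apply.
  by move=> x; apply/rdiffP; exact: is_derive_sin.
by move=> x _; rewrite ler_norml cos_geN1 cos_le1.
Qed.

Lemma cosB1_le_norm t : `|cos t - 1| <= `|t|.
Proof.
have := @rdiff_mvt0 cos (fun x => - sin x) 1 t; rewrite cos0 mul1r; apply.
  by move=> x; apply/rdiffP; exact: is_derive_cos.
by move=> x _; rewrite normrN ler_norml sin_geN1 sin_le1.
Qed.

Lemma expi_taylor1 t : normc (expi t - 1) <= 2 * `|t|.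
Proof.
apply: le_trans (normc_leD _) _; rewrite ReD ReN ImD ImN /= oppr0 addr0.
have := sin_le_norm t; have := cosB1_le_norm t; lra.
Qed.

Lemma expi_taylor2 t : normc (expi t - 1 - (0 +i* t)) <= 2 * t ^+ 2.
Proof.
have h1 : `|cos t - 1| <= t ^+ 2.
  have := @rdiff_mvt0 cos (fun x => - sin x) `|t| t.
  rewrite cos0 -expr2 real_normK ?num_real//; apply.
    by move=> x; apply/rdiffP; exact: is_derive_cos.
  by move=> x xt; rewrite normrN; apply: le_trans (sin_le_norm x) xt.
have h2 : `|sin t - t| <= t ^+ 2.
  have := @rdiff_mvt0 (fun x => sin x - x) (fun x => cos x - 1) `|t| t.
  rewrite -expr2 real_normK ?num_real// sin0 !subr0; apply.
    move=> x; apply/rdiffP; exact: (is_deriveB (is_derive_sin x) (is_derive_id x (1 : R))).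
  by move=> x xt; apply: le_trans (cosB1_le_norm x) xt.
apply: le_trans (normc_leD _) _.
have -> : complex.Re (expi t - 1 - (0 +i* t)) = cos t - 1.
  by rewrite !ReD !ReN /=; ring.
have -> : complex.Im (expi t - 1 - (0 +i* t)) = sin t - t.
  by rewrite !ImD !ImN /=; ring.
lra.
Qed.

End exponential_bounds.

(** * Additive Fourier transform *)

Section fourier_transform.
Context (R : realType) (F : fieldExtType rat) (K0 : fieldType)
  (v : absolute_value R K0) (iota : {rmorphism F -> valued v}).
Local Notation K := (valued v).
Implicit Types (x y u w : K) (r s h : R) (phi psi f g : K -> R[i]).
Hypothesis Hc : is_completion iota.
Variable dx : {measure set (borel K) -> \bar R}.
Hypothesis Hdx : @is_haar R K setT +%R dx.
Local Notation of_r := (of_real v).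
Local Notation dd := (@directional_derivative R K0 v).
Local Notation FT := (@fourier R K0 v dx).

Lemma lambda_cmeas c : cmeasurable (fun x : borel K => lambda (x * c : K) : R[i]).
Proof.
apply: continuous_cmeasurable => x e e0.
have [d d0 hd] := lambda_small Hc e0.
have c1 : 0 < v c + 1 by rewrite ltr_wpDl// v_ge0.
apply/vnbhsP; exists (d / (v c + 1)); first exact: divr_gt0.
move=> y; rewrite ltr_pdivlMr// => yx.
have -> : lambda (y * c) - lambda (x * c) = lambda (x * c) * (lambda ((y - x) * c) - 1) :> R[i].
  by rewrite mulrBr mulr1 -(lambdaD Hc); congr (lambda _ - _); ring.
rewrite normc_mul normc_lambda mul1r; apply: hd; apply: le_lt_trans yx.
by rewrite vM ler_wpM2l ?v_ge0// lerDl.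
Qed.

Lemma L1_lambda f c : L1 dx (f : borel K -> R[i]) ->
  L1 dx (fun x : borel K => f x * lambda (x * c : K)) /\
  norm1 dx (fun x : borel K => f x * lambda (x * c : K)) = norm1 dx (f : borel K -> R[i]).
Proof.
move=> /L1P[mf lf].
have E : norm1 dx (fun x : borel K => f x * lambda (x * c : K)) = norm1 dx (f : borel K -> R[i]).
  by apply: eq_integral => x _; rewrite normc_mul normc_lambda mulr1.
split=> //; apply/L1P; split; last by rewrite E.
by apply: cmeasM => //; exact: lambda_cmeas.
Qed.

Lemma L1_fourier f y : L1 dx (f : borel K -> R[i]) ->
  L1 dx (fun x : borel K => f x * lambda (- (x * y) : K)).
Proof.
move=> /(L1_lambda (- y))[h _]; move: h; congr (L1 _ _); apply/funext => x.
by rewrite mulrN.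
Qed.

Lemma fourier_bound f y : L1 dx (f : borel K -> R[i]) ->
  ((normc (FT f y))%:E <= 2%:E * norm1 dx (f : borel K -> R[i]))%E.
Proof.
move=> Lf; apply: le_trans (normc_cintegral_le (L1_fourier y Lf)) _.
have [_ <-] := L1_lambda (- y) Lf.
rewrite (_ : (fun x : borel K => f x * lambda (- (x * y) : K)) = fun x : borel K => f x * lambda (x * - y : K))//.
by apply/funext => x; rewrite mulrN.
Qed.

Lemma fourierD f g y : L1 dx (f : borel K -> R[i]) -> L1 dx (g : borel K -> R[i]) ->
  FT (fun x => f x + g x) y = FT f y + FT g y.
Proof.
move=> Lf Lg; rewrite /fourier -cintegralD; [|exact: L1_fourier|exact: L1_fourier].
by congr cintegral; apply/funext => x; rewrite mulrDl.
Qed.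

Lemma fourierZ (z : R[i]) f y : L1 dx (f : borel K -> R[i]) -> FT (fun x => z * f x) y = z * FT f y.
Proof.
move=> Lf; rewrite /fourier -cintegralZ; last exact: L1_fourier.
by congr cintegral; apply/funext => x; rewrite mulrA.
Qed.

Lemma fourierB f g y : L1 dx (f : borel K -> R[i]) -> L1 dx (g : borel K -> R[i]) ->
  FT (fun x => f x - g x) y = FT f y - FT g y.
Proof.
move=> Lf Lg; rewrite -[- FT g y]mulN1r -fourierZ// -fourierD//; last exact: L1Z.
by congr (FT _ y); apply/funext => x; rewrite mulN1r.
Qed.

Lemma fourier_translate f u y : L1 dx (f : borel K -> R[i]) ->
  FT (fun x => f (x + u)) y = lambda (u * y) * FT f y.
Proof.
move=> Lf; rewrite /fourier -cintegralZ; last exact: L1_fourier.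
have Lg := L1Z (lambda (u * y)) (L1_fourier y Lf).
rewrite -(preserves_cintegral (dx_translate Hc Hdx u) Lg); congr cintegral.
apply/funext => x /=; rewrite mulrCA -(lambdaD Hc) addrC; congr (_ * lambda _); ring.
Qed.

Lemma fourier_opp f y : L1 dx (f : borel K -> R[i]) ->
  FT (fun x => f (- x)) y = FT f (- y).
Proof.
move=> Lf; rewrite /fourier.
rewrite -(preserves_cintegral (dx_opp Hc Hdx) (L1_fourier (- y) Lf)); congr cintegral.
by apply/funext => x /=; rewrite mulrNN.
Qed.

Lemma fourier_invE f y : fourier_inv dx f y = FT f (- y).
Proof. by congr cintegral; apply/funext => x; rewrite mulrN opprK. Qed.

Lemma fourier_conj f y : L1 dx (f : borel K -> R[i]) ->
  (FT f y)^* = FT (fun x => (f x)^*) (- y).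
Proof.
move=> Lf; rewrite /fourier -cintegral_conj; last exact: L1_fourier.
congr cintegral; apply/funext => x.
have -> : lambda (- (x * - y)) = conjc (lambda (- (x * y))) :> R[i].
  by rewrite mulrN; exact: (lambdaN Hc).
by apply: complex_eq; rewrite ?Re_conj ?Im_conj ?ReM ?ImM ?Re_conj ?Im_conj; ring.
Qed.

Lemma test_L1 phi : test phi -> L1 dx (phi : borel K -> R[i]).
Proof. by move=> [sphi _]; exact: (rapid_L10 Hc Hdx (schwartz_rapid Hc Hdx sphi)). Qed.

Section ultrametric_case.
Hypothesis um : ultrametric v.
Hypothesis Hself : is_self_dual_haar dx.

(* If lambda were trivial, F phi would be constant, against the inversion formula. *)
Lemma lambda_nontrivial : exists x : K, lambda x != 1 :> R[i].
Proof.
apply: contrapT => /forallNP h.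
have l1 (x : K) : lambda x = 1 :> R[i] by apply/eqP; rewrite -[_ == _]negbK; exact/negP/h.
have [b [tb _ bs b0]] := test_bump Hc (@ltr01 R).
have [_ /(_ _ tb.1) inv] := Hself.
have [x x1] := exists_v_gt1 Hc.
have bx : b x = 0.
  by have [//|/bs] := eqVneq (b x) 0; rewrite ltNge (ltW x1).
have E : fourier_inv dx (FT (fun x => (b x)%:C)) 0 = fourier_inv dx (FT (fun x => (b x)%:C)) x.
  by congr cintegral; apply/funext => z; rewrite !l1.
by move: E; rewrite !inv bx => -[] E; move: b0; rewrite E ltxx.
Qed.

(** Local constancy becomes uniform on a compact ball that contains the support. As the radius is at
    least 1 and d < 1, the ultrametric inequality prevents a shift by u from crossing its
    boundary. *)
Lemma test_uniformly_constant phi : test phi -> exists2 d : R, 0 < d &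
  forall x u, v u < d -> phi (x + u) = phi x.
Proof.
move=> tphi; have /(test_ultra phi um)[h _] := tphi.
have /(compact_supportP Hc)[r hr] := tphi.2.
pose r1 := Num.max r 1.
have r11 : 1 <= r1 by rewrite le_max lexx orbT.
have rr1 : r <= r1 by rewrite le_max lexx.
have nc := (compact_near_coveringP _).1 (@vball_compact _ _ _ _ _ Hc r1).
have H : \forall d \near (0 : R)^'+, [set x : K | v x <= r1] `<=`
    (fun x : K => forall u, v u < d -> phi (x + u) = phi x).
  apply: (nc R (0^'+) (fun d x => forall u, v u < d -> phi (x + u) = phi x)) => x _.
  have [d d0 hd] := h x.
  exists ([set y : K | v (y - x) < d], [set e | e < d]) => /=.
    by split; [apply/vnbhsP; exists d|exact: nbhs_right_lt].
  move=> [y e] /= [yx ed] u ue; rewrite (hd y)//; apply: hd.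
  have -> : y + u - x = (y - x) + u by ring.
  by apply: le_lt_trans (um _ _) _; rewrite gt_max yx (lt_trans ue ed).
have H1 : \forall d \near (0 : R)^'+, 0 < d < 1 /\ [set x : K | v x <= r1] `<=`
    (fun x : K => forall u, v u < d -> phi (x + u) = phi x).
  near=> d; split; last by near: d; exact: H.
  by apply/andP; split; near: d; [exact: nbhs_right_gt|exact: nbhs_right_lt].
have [d [/andP[d0 d1] hd]] := filter_ex H1.
exists d => // x u ud; have [xr|xr] := leP (v x) r1; first exact: hd.
rewrite (hr x); last exact: le_lt_trans xr.
apply: hr; apply: (le_lt_trans rr1); rewrite ltNge; apply/negP => xu.
have : v x <= r1.
  rewrite -[x](addrK u); apply: le_trans (um _ _) _; rewrite ge_max xu absvN.
  by apply: le_trans (ltW ud) _; apply: le_trans (ltW d1) _.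
by rewrite leNgt xr.
Unshelve. all: by end_near.
Qed.

(** F phi is locally constant because phi lives in a ball and lambda is 1 near 0. It has compact
    support because, for large y, phi is invariant under translation by x0 / y while F phi(y) picks
    up the factor lambda(x0) != 1. *)
Lemma fourier_test_ultra phi : test phi -> schwartz_bruhat (FT phi).
Proof.
move=> tphi; apply/(schwartz_ultra _ um).
have L := test_L1 tphi; split.
  have /(compact_supportP Hc)[r hr] := tphi.2.
  have [p pp vp] := exists_prime_v_lt1 Hc um.
  have [d d0 hd] := ultra_lambda1 Hc um pp vp.
  pose r1 := `|r| + 1.
  have r10 : 0 < r1 by rewrite ltr_wpDl.
  move=> y; exists (d / r1); first exact: divr_gt0.
  move=> z; rewrite (ltr_pdivlMr _ _ r10) => zy.
  suff E : (fun x : borel K => phi x * lambda (- (x * z) : K)) = fun x => phi x * lambda (- (x * y) : K).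
    by rewrite /fourier E.
  apply/funext => x.
  have [xr|xr] := leP (v x) r1; last first.
    by rewrite hr ?mul0r//; apply: le_lt_trans xr; rewrite /r1; have := ler_norm r; lra.
  congr (_ * _); have -> : - (x * z) = - (x * y) + - (x * (z - y)) by ring.
  rewrite (lambdaD Hc) (hd (- (x * (z - y)))) ?mulr1//.
  rewrite absvN vM mulrC; apply: le_lt_trans zy.
  by rewrite ler_wpM2l ?v_ge0.
have [x0 l0] := lambda_nontrivial.
have [d d0 hd] := test_uniformly_constant tphi.
apply/(compact_supportP Hc); exists (v x0 / d) => y yd.
have y0 : y != 0.
  rewrite -(v_gt0 (v := v)); apply: le_lt_trans yd.
  by rewrite divr_ge0 ?v_ge0// ltW.
have ud : v (x0 / y) < d.
  by rewrite vM vV ltr_pdivrMr ?v_gt0// mulrC -ltr_pdivrMr.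
have E := fourier_translate (x0 / y) y L.
have E2 : FT (fun x => phi (x + x0 / y)) y = FT phi y.
  by congr (FT _ y); apply/funext => x; exact: hd.
move: E; rewrite E2 divfK// => /eqP; rewrite eq_sym -subr_eq0.
rewrite -{2}[FT phi y]mul1r -mulrBl mulf_eq0 subr_eq0 (negPf l0)/= => /eqP; exact.
Qed.

End ultrametric_case.

Section archimedean_case.
Hypothesis nu : ~ ultrametric v.

(** The factor 2 pi i Tr(ux) that differentiation of F in the direction u brings down. *)
Definition rlin_mult u x : R[i] := 0 +i* (2 * pi * rlin u x).

Lemma csmooth_rlin_mult u : csmooth (rlin_mult u).
Proof.
have -> : rlin_mult u = fun x => (0 +i* (2 * pi)) * (rlin u x)%:C.
  by apply/funext => x; apply: complex_eq; rewrite ?ReM ?ImM /=; ring.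
by apply: (csmoothM Hc nu); [exact: csmooth_cst|exact: csmooth_rlin Hc nu u].
Qed.

Lemma test_rlin_mult u phi : test phi -> test (fun x => rlin_mult u x * phi x).
Proof.
move/(schwartz_arch_test Hc phi nu) => [h cs]; apply/(schwartz_arch_test Hc _ nu); split.
  by apply: (csmoothM Hc nu) => //; exact: csmooth_rlin_mult.
have /(compact_supportP Hc)[r hr] := cs.
by apply/(compact_supportP Hc); exists r => x /hr ->; rewrite mulr0.
Qed.

Lemma lambda_shift u x y h :
  lambda (- (x * (y + of_r h * u))) = lambda (- (x * y)) * expi (2 * pi * rlin u x * h) :> R[i].
Proof.
have -> : - (x * (y + of_r h * u)) = - (x * y) + x * - (of_r h * u) by ring.
rewrite (lambdaD Hc); congr (_ * _); rewrite (arch_lambdaE _ _ nu); congr expi.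
by rewrite (rlinN Hc nu) (rlinZ Hc nu) rlinC; ring.
Qed.

(** The second-order Taylor bound for exp(it), integrated against phi, makes the error of the
    difference quotient at most 4N|h|, with N the L1 norm of the twice multiplied phi; N is finite
    because that function is again a test function. *)
Lemma dd_fourier u phi : test phi -> dd u (FT phi) (FT (fun x => rlin_mult u x * phi x)).
Proof.
move=> tphi; apply/ddP => y e e0.
have L0 := test_L1 tphi.
have t1 := test_rlin_mult u tphi; have L1' := test_L1 t1.
have L2' := test_L1 (test_rlin_mult u t1).
pose N := fine (norm1 dx (fun x : borel K => rlin_mult u x * (rlin_mult u x * phi x))).
have NE : norm1 dx (fun x : borel K => rlin_mult u x * (rlin_mult u x * phi x)) = N%:E.
  by rewrite fineK// ge0_fin_numE ?norm1_ge0//; have /L1P[] := L2'.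
have N0 : 0 <= N by rewrite fine_ge0// norm1_ge0.
have N1 : 0 < 4 * N + 1 by rewrite ltr_wpDl// mulr_ge0.
exists (e / (4 * N + 1)); first exact: divr_gt0.
move=> h h0; rewrite ltr_pdivlMr// => hh.
have hC : h%:C != 0 :> R[i] by rewrite -(inj_eq (@complexI R)) in h0.
pose E (x : borel K) : R[i] := phi x * lambda (- (x * (y + of_r h * u))) +
   - (phi x * lambda (- (x * y))) + - (h%:C * (rlin_mult u x * phi x * lambda (- (x * y)))).
have LA := L1_fourier (y + of_r h * u) L0.
have LB := L1N (L1_fourier y L0).
have LC := L1N (L1Z h%:C (L1_fourier y L1')).
have LE : L1 dx E by apply: L1D => //; exact: L1D.
have EE : cintegral dx E = FT phi (y + of_r h * u) - FT phi y - h%:C * FT (fun x => rlin_mult u x * phi x) y.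
  rewrite /E cintegralD//; last exact: L1D.
  rewrite cintegralD// cintegralN; last exact: L1_fourier.
  rewrite cintegralN; last by apply: L1Z; exact: L1_fourier.
  by rewrite cintegralZ//; exact: L1_fourier.
have -> : (FT phi (y + of_r h * u) - FT phi y) / h%:C - FT (fun x => rlin_mult u x * phi x) y =
    cintegral dx E / h%:C.
  by rewrite EE [in RHS]mulrBl; congr (_ - _); rewrite mulrAC divff// mul1r.
rewrite normc_mul -fmorphV normc_real normfV ltr_pdivrMr ?normr_gt0//.
have : ((normc (cintegral dx E))%:E <= 2%:E * ((2 * h ^+ 2)%:E * N%:E))%E.
  apply: le_trans (normc_cintegral_le LE) _.
  rewrite lee_pmul2l// -NE /norm1 -ge0_integralZl//.
  - apply: ge0_le_integral => //.
    + by move=> x _; rewrite lee_fin normcr_ge0.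
    + by apply: measurable_normE; exact: L1_cmeas LE.
    + by apply: emeasurable_funM => //; apply: measurable_normE; exact: L1_cmeas L2'.
    + move=> x _; rewrite -EFinM lee_fin.
      have -> : E x = phi x * lambda (- (x * y)) *
          (expi (2 * pi * rlin u x * h) - 1 - (0 +i* (2 * pi * rlin u x * h))).
        rewrite /E lambda_shift.
        have -> : 0 +i* (2 * pi * rlin u x * h) = h%:C * rlin_mult u x.
          by apply: complex_eq; rewrite ?ReM ?ImM /=; ring.
        by ring.
      rewrite !normc_mul normc_lambda mulr1.
      apply: le_trans (ler_wpM2l (normcr_ge0 _) (expi_taylor2 _)) _.
      have -> : normc (rlin_mult u x) = `|2 * pi * rlin u x|.
        have -> : rlin_mult u x = (0 +i* 1) * (2 * pi * rlin u x)%:C.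
          by apply: complex_eq; rewrite ?ReM ?ImM /=; ring.
        rewrite normc_mul normc_real (_ : normc (0 +i* 1) = 1) ?mul1r//.
        by rewrite /normc expr0n expr1n add0r sqrtr1.
      rewrite mulrA -[`|_| * `|_|]expr2 real_normK ?num_real//.
      by rewrite le_eqVlt; apply/orP; left; apply/eqP; ring.
  - by apply: measurable_normE; exact: L1_cmeas L2'.
  - by move=> x _; rewrite lee_fin normcr_ge0.
  - by rewrite lee_fin mulr_ge0// sqr_ge0.
rewrite -!EFinM lee_fin => /le_lt_trans; apply.
rewrite -[h ^+ 2]real_normK ?num_real//.
have hp : 0 < `|h| by rewrite normr_gt0.
have -> : 2 * (2 * `|h| ^+ 2 * N) = (`|h| * (4 * N)) * `|h| by ring.
rewrite ltr_pM2r//; apply: le_lt_trans hh; rewrite ler_pM2l//; lra.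
Qed.

(* Turns two directional derivatives into a quadratic error bound uniform in x, so that difference quotients can be integrated. *)
Lemma dd_taylor u f f' f'' (M : R) : dd u f f' -> dd u f' f'' ->
  (forall x, normc (f'' x) <= M) ->
  forall x h, normc (f (x + of_r h * u) - f x - h%:C * f' x) <= 4 * M * h ^+ 2.
Proof.
move=> /ddP hd hd' hM x h.
have lb := dd_line_bound Hc nu hd' hM.
have line (p : R[i] -> R) : (forall z w : R[i], p (z - w) = p z - p w) ->
    (forall (z : R[i]) k, p (z / k%:C) = p z / k) ->
    (forall (z : R[i]) k, p (k%:C * z) = k * p z) -> (forall z, `|p z| <= normc z) ->
    `|p (f (x + of_r h * u)) - p (f x) - h * p (f' x)| <= 2 * M * h ^+ 2.
  move=> pB pD pZ pn.
  have H t : rdiff (fun t => p (f (x + of_r t * u)) - t * p (f' x)) t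
      (p (f' (x + of_r t * u)) - p (f' x)).
    move=> e e0; have [d d0 hd1] := hd (x + of_r t * u) e e0; exists d => // k k0 kd.
    apply: le_lt_trans (hd1 k k0 kd).
    have -> : x + of_r (t + k) * u = x + of_r t * u + of_r k * u.
      by rewrite (of_realD Hc nu); ring.
    set A := f (_ + _); set B := f (_ + _); set C := f' (_ + _).
    have -> : (p A - (t + k) * p (f' x) - (p B - t * p (f' x))) / k - (p C - p (f' x)) =
        p ((A - B) / k%:C - C) by rewrite pB pD pB; field.
    exact: pn.
  have := @rdiff_mvt0 _ _ _ (2 * M * `|h|) h H.
  rewrite (of_real0 Hc nu) !mul0r addr0 subr0.
  have -> : 2 * M * `|h| * `|h| = 2 * M * h ^+ 2.
    by rewrite -[in RHS]real_normK ?num_real//; ring.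
  have -> : p (f (x + of_r h * u)) - h * p (f' x) - p (f x) =
    p (f (x + of_r h * u)) - p (f x) - h * p (f' x) by ring.
  apply=> t th; rewrite -pB; apply: le_trans (pn _) _; apply: le_trans (lb x t) _.
  have M0 : 0 <= M by apply: le_trans (hM 0); exact: normcr_ge0.
  by rewrite ler_wpM2l// mulr_ge0.
have h1 := line (@complex.Re R) _ _ _ (@Re_le_normc R).
have h2 := line (@complex.Im R) _ _ _ (@Im_le_normc R).
apply: le_trans (normc_leD _) _.
have -> : 4 * M * h ^+ 2 = 2 * M * h ^+ 2 + 2 * M * h ^+ 2 by ring.
rewrite !ReD !ReN !ImD !ImN ReM ImM /= !mul0r subr0 addr0.
apply: lerD.
  by apply: h1 => [z w|z k|z k]; rewrite ?ReD ?ReN// -?fmorphV ReM /= ?mul0r ?mulr0 subr0.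
by apply: h2 => [z w|z k|z k]; rewrite ?ImD ?ImN// -?fmorphV ImM /= ?mul0r ?mulr0 ?add0r ?addr0.
Qed.

Lemma test_dd u phi : test phi -> exists2 psi, test psi & dd u phi psi.
Proof.
move/(schwartz_arch_test Hc phi nu) => [h cs]; have [psi spsi dpsi] := csmooth_dd u h.
exists psi => //; apply/(schwartz_arch_test Hc _ nu); split=> //.
have [C cC hC] := cs; exists C => //; exact: (dd_outside_compact Hc nu cC dpsi hC).
Qed.

Lemma test_bounded phi : test phi -> exists2 M : R, 0 <= M & forall x, normc (phi x) <= M.
Proof.
move=> [/(schwartz_decay Hc 0)[M M0 hM] _]; exists M => // x.
by have := hM x; rewrite expr0 mul1r.
Qed.

(** There is no integration by parts: translating phi by hu multiplies F phi by a character value,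
    and both the translate and that value are expanded in h with quadratic errors. The error of the
    translate is integrable since it vanishes off the ball of radius [rho], whose extra 1 absorbs
    the shift. *)
Lemma fourier_dd u phi psi : test phi -> dd u phi psi -> forall y,
  FT psi y = (0 +i* (- (2 * pi * rlin u y))) * FT phi y.
Proof.
move=> tphi dpsi y.
have [psi' tpsi dpsi'] := test_dd u tphi.
have Epsi : psi' = psi by exact: (dd_uniq dpsi' dpsi).
rewrite Epsi in tpsi; have [psi2 tpsi2 dpsi2] := test_dd u tpsi.
have [M M0 hM] := test_bounded tpsi2.
have /(compact_supportP Hc)[r hr] := tphi.2; have /(compact_supportP Hc)[r' hr'] := tpsi.2.
pose rho := Num.max r r' + 1; pose Bl : set (borel K) := [set x : K | v x <= rho].
have mB : measurable Bl by exact: measurable_vball.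
pose m := fine (dx Bl).
have mE : dx Bl = m%:E by rewrite fineK// ge0_fin_numE// (dx_vball_lty Hc Hdx).
have m0 : 0 <= m by exact: fine_ge0.
set k := 2 * pi * rlin u y.
(* 8 is the 4 of [dd_taylor] times the 2 of [fourier_bound], m the volume of the ball; the second
   term is the remainder of [expi_taylor2]. *)
pose C := 8 * M * m + 2 * k ^+ 2 * normc (FT phi y).
have C0 : 0 <= C.
  apply: addr_ge0; first by rewrite !mulr_ge0.
  by apply: mulr_ge0; rewrite ?normcr_ge0// mulr_ge0 ?sqr_ge0.
have [d d0 hd] := of_real_mul_small Hc nu u (@ltr01 R).
have L0 := test_L1 tphi; have L1' := test_L1 tpsi.
have key h : 0 < h -> h < d -> normc ((0 +i* (- k)) * FT phi y - FT psi y) * h <= C * h ^+ 2.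
  move=> h0 hhd.
  have vhu : v (of_r h * u) < 1 by apply: hd; rewrite gtr0_norm.
  have Lt : L1 dx (fun x : borel K => phi (x + of_r h * u)).
    exact: (test_L1 (test_translate Hc (of_r h * u) tphi)).
  pose E (x : borel K) : R[i] := phi (x + of_r h * u) - phi x - h%:C * psi x.
  have LE : L1 dx E by apply: L1B; [exact: L1B|exact: L1Z].
  have FE : FT E y = (expi (h * k * -1) - 1) * FT phi y - h%:C * FT psi y.
    rewrite /E fourierB; [|exact: L1B|exact: L1Z].
    rewrite fourierB// fourierZ// fourier_translate// mulrBl mul1r; congr (_ * _ - _ - _).
    have -> : of_r h * u * y = u * (of_r h * y) by ring.
    by rewrite (arch_lambdaE _ _ nu) (rlinZ Hc nu); congr expi; rewrite /k; ring.
  have n1 : (norm1 dx E <= (4 * M * h ^+ 2 * m)%:E)%E.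
    rewrite EFinM -mE -integral_indicT// -ge0_integralZl//; first last.
    - by rewrite lee_fin; apply: mulr_ge0; [exact: mulr_ge0|exact: sqr_ge0].
    - by apply/measurable_EFinP; exact: measurable_indic.
    apply: ge0_le_integral => //.
    - by move=> x _; rewrite lee_fin normcr_ge0.
    - by apply: measurable_normE; exact: L1_cmeas LE.
    - by apply: emeasurable_funM => //; apply/measurable_EFinP; exact: measurable_indic.
    move=> x _; rewrite -EFinM lee_fin indicE.
    have [xB|xB] := boolP (x \in Bl); first by rewrite mulr1; exact: dd_taylor dpsi dpsi2 hM x h.
    rewrite mulr0 /E.
    have : rho < v (x : K) by rewrite ltNge; move: xB; rewrite notin_setE => /negP.
    rewrite /rho -ltrBrDr gt_max => /andP[xr xr'].
    have xh : r < v (x + of_r h * u).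
      rewrite -(ltrD2r 1); apply: lt_le_trans (_ : v (x : K) <= _); first by rewrite -ltrBrDr.
      rewrite -[x in v x <= _](addrK (of_r h * u)); apply: le_trans (vB_le _ _) _.
      by rewrite lerD2l ltW.
    have xr0 : r < v (x : K) by lra.
    have xr0' : r' < v (x : K) by lra.
    by rewrite (hr _ xh) (hr _ xr0) (hr' _ xr0') mulr0 !subr0 normc00.
  have n2 : normc (FT E y) <= 8 * M * h ^+ 2 * m.
    have H0 : (0 <= 2%:E :> \bar R)%E by rewrite lee_fin.
    have := le_trans (fourier_bound y LE) (lee_wpmul2l H0 n1).
    rewrite -EFinM lee_fin => /le_trans; apply.
    by rewrite le_eqVlt; apply/orP; left; apply/eqP; ring.
  have n3 := expi_taylor2 (h * k * -1).
  have -> : normc ((0 +i* (- k)) * FT phi y - FT psi y) * h =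
      normc (FT E y - (expi (h * k * -1) - 1 - (0 +i* (h * k * -1))) * FT phi y).
    rewrite -[in LHS](ger0_norm (ltW h0)) -normc_real -normc_mul; congr normc.
    rewrite FE (_ : 0 +i* (h * k * -1) = h%:C * (0 +i* (- k))); first by ring.
    by apply: complex_eq; rewrite ?ReM ?ImM /=; ring.
  apply: le_trans (normc_add _ _) _; rewrite normc_opp normc_mul.
  apply: le_trans (lerD n2 (ler_wpM2r (normcr_ge0 _) n3)) _.
  by rewrite le_eqVlt; apply/orP; left; apply/eqP; rewrite /C; ring.
apply/esym/normc_sub0; apply/eqP; rewrite eq_le normcr_ge0 andbT.
apply/ler_addgt0Pr => e e0; rewrite add0r.
have C1 : 0 < C + 1 by rewrite ltr_wpDl.
pose h := Num.min d (e / (C + 1)) / 2.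
have mi0 : 0 < Num.min d (e / (C + 1)) by rewrite lt_min d0 divr_gt0.
have h0 : 0 < h by rewrite divr_gt0.
have : h < Num.min d (e / (C + 1)) by rewrite /h; lra.
rewrite lt_min ltr_pdivlMr// => /andP[h1 h2].
have := key h h0 h1; rewrite expr2 mulrA ler_pM2r// => /le_trans; apply.
by rewrite mulrC; nra.
Qed.

(** One power of v y costs 1 + C sum |Tr(u_i y)|, and each factor Tr(u_i y) is absorbed by replacing
    phi with its derivative along u_i, again a test function. *)
Lemma fourier_decay (N : nat) : forall phi, test phi ->
  exists M : R, forall y, v y ^+ N * normc (FT phi y) <= M.
Proof.
have [n [u [[C C0 hC] _]]] := rnorm_structure Hc nu.
elim: N => [|N IH] phi tphi.
  have L := test_L1 tphi; have /L1P[_ l1] := L.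
  exists (2 * fine (norm1 dx (phi : borel K -> R[i]))) => y.
  rewrite expr0 mul1r -lee_fin EFinM fineK ?ge0_fin_numE ?norm1_ge0//.
  exact: fourier_bound.
have [M0 hM0] := IH phi tphi.
have hd i : exists M : R, forall y, v y ^+ N * (`|rlin (u i) y| * normc (FT phi y)) <= M.
  have [psi tpsi dpsi] := test_dd (u i) tphi; have [M hM] := IH psi tpsi.
  exists M => y; apply: le_trans (hM y); rewrite ler_wpM2l ?exprn_ge0 ?v_ge0//.
  rewrite (fourier_dd tphi dpsi) normc_mul ler_wpM2r ?normcr_ge0//.
  have -> : 0 +i* (- (2 * pi * rlin (u i) y)) = (0 +i* (-1)) * (2 * pi * rlin (u i) y)%:C.
    by apply: complex_eq; rewrite ?ReM ?ImM /=; ring.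
  rewrite normc_mul normc_real (_ : normc (0 +i* (-1)) = 1); last first.
    by rewrite /normc expr0n sqrrN expr1n add0r sqrtr1.
  rewrite mul1r normrM ler_peMl//.
  have := @pi_ge2 R; have := @pi_gt0 R => p0 p2; rewrite ger0_norm; nra.
have [M hM] := choice hd.
exists (M0 + C * \sum_i M i) => y; rewrite exprS mulrAC.
have nn : 0 <= v y ^+ N * normc (FT phi y) by rewrite mulr_ge0 ?exprn_ge0 ?v_ge0 ?normcr_ge0.
rewrite -mulrA; apply: le_trans (ler_wpM2r _ (hC y)) _; first by rewrite mulrC.
rewrite mulrDl mul1r [normc _ * _]mulrC lerD// -mulrA ler_wpM2l// mulr_suml.
by apply: ler_sum => i _; rewrite mulrCA.
Qed.

Lemma fourier_test_arch phi : test phi -> schwartz_arch (FT phi).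
Proof.
move=> tphi; pose C := [set f | exists2 psi, test psi & f = FT psi].
have [D [D0 hD CD]] : exists D : seq K -> K -> R[i],
    [/\ D [::] = FT phi, forall us u, dd u (D us) (D (u :: us)) & forall us, C (D us)].
  apply: (dd_family (C := C)); last by exists phi.
  move=> _ u [psi tpsi ->]; exists (FT (fun x => rlin_mult u x * psi x)).
    by exists (fun x => rlin_mult u x * psi x) => //; exact: test_rlin_mult.
  exact: dd_fourier.
exists D; split=> // us N; have [psi tpsi ->] := CD us.
exact: fourier_decay.
Qed.

End archimedean_case.

Lemma fourier_test phi : is_self_dual_haar dx -> test phi -> schwartz_bruhat (FT phi).
Proof.
move=> Hself tphi; have [um|nu] := pselect (ultrametric v).
  exact: fourier_test_ultra.
rewrite /schwartz_bruhat; case: asboolP => // _; exact: fourier_test_arch.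
Qed.

Lemma fourier_fourier phi x : is_self_dual_haar dx -> schwartz_bruhat phi ->
  FT (FT phi) x = phi (- x).
Proof. by move=> [_ h] /h <-; rewrite fourier_invE opprK. Qed.
End fourier_transform.

Import HBNNSimple.

(** * Density of test functions in L1 and L2 simultaneously *)

Section simultaneous_approximation.
Context d (T : measurableType d) (R : realType).
Variable mu : {measure set T -> \bar R}.
Implicit Types (f g h : T -> R[i]) (z : R[i]).

(** One quantity dominating both the L1 norm and the squared L2 norm: a sequence that converges for
    it converges in both senses at once. F needs this, being given by an integral for L1 functions
    while its estimates are in L2. *)
Definition norm12 f : \bar R := (\int[mu]_x (normc (f x) + normc (f x) ^+ 2)%:E)%E.

Lemma measurable_norm12 f : cmeasurable f ->
  measurable_fun setT (fun x => (normc (f x) + normc (f x) ^+ 2)%:E).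
Proof.
move=> mf; apply/measurable_EFinP; apply: measurable_funD.
  exact: measurable_normc.
exact: measurable_sqnormc.
Qed.

Lemma n12_ge0 z : 0 <= normc z + normc z ^+ 2 :> R.
Proof. by rewrite addr_ge0 ?sqr_ge0 ?normcr_ge0. Qed.

Lemma norm1_le12 f : cmeasurable f -> (norm1 mu f <= norm12 f)%E.
Proof.
move=> mf; apply: ge0_le_integral => //.
- by move=> x _; rewrite lee_fin normcr_ge0.
- exact: measurable_normE.
- exact: measurable_norm12.
- by move=> x _; rewrite lee_fin lerDl sqr_ge0.
Qed.

Lemma sqnorm_le12 f : cmeasurable f -> (sqnormL2 mu f <= norm12 f)%E.
Proof.
move=> mf; apply: ge0_le_integral => //.
- by move=> x _; exact: sqnormE_ge0.
- exact: measurable_sqnormE.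
- exact: measurable_norm12.
- by move=> x _; rewrite lee_fin lerDr normcr_ge0.
Qed.

Lemma norm12_le (k l : R) f g h : 0 <= k -> 0 <= l -> cmeasurable f -> cmeasurable g -> cmeasurable h ->
  (forall x, normc (f x) + normc (f x) ^+ 2 <= k * (normc (g x) + normc (g x) ^+ 2) +
     l * (normc (h x) + normc (h x) ^+ 2)) ->
  (norm12 f <= k%:E * norm12 g + l%:E * norm12 h)%E.
Proof.
move=> k0 l0 mf mg mh H.
have mk q (c : R) : cmeasurable q ->
    measurable_fun setT (fun x : T => (c%:E * (normc (q x) + normc (q x) ^+ 2)%:E)%E).
  by move=> mq; apply: emeasurable_funM => //; exact: measurable_norm12.
rewrite /norm12 -!ge0_integralZl// -?ge0_integralD//.
- apply: ge0_le_integral => //.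
  + by move=> x _; rewrite lee_fin n12_ge0.
  + exact: measurable_norm12.
  + by apply: emeasurable_funD; exact: mk.
  + by move=> x _; rewrite -!EFinM -EFinD lee_fin.
all: try exact: mk.
all: try exact: measurable_norm12.
all: by move=> x _; rewrite -?EFinM lee_fin ?mulr_ge0 ?n12_ge0.
Qed.

Lemma norm12D f g : cmeasurable f -> cmeasurable g ->
  (norm12 (fun x => f x + g x)%R <= 2%:E * norm12 f + 2%:E * norm12 g)%E.
Proof.
move=> mf mg; apply: norm12_le => //; first exact: cmeasD.
move=> x; have := normc_add (f x) (g x); have := sqnormcD (f x) (g x).
have := normcr_ge0 (f x); have := normcr_ge0 (g x); lra.
Qed.

Lemma norm12Z z f : cmeasurable f ->
  (norm12 (fun x => z * f x)%R <= (normc z + normc z ^+ 2)%:E * norm12 f)%E.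
Proof.
move=> mf; have := @norm12_le (normc z + normc z ^+ 2) 0 (fun x => z * f x) f f.
rewrite mul0e adde0; apply=> //; [exact: n12_ge0|exact: cmeasZ|].
move=> x; rewrite normc_mul mul0r addr0.
have := normcr_ge0 (f x); have := normcr_ge0 z; nra.
Qed.

Variable S : set (T -> R[i]).
Hypothesis SD : forall f g, S f -> S g -> S (fun x => f x + g x).
Hypothesis SZ : forall z f, S f -> S (fun x => z * f x).
Hypothesis Sm : forall f, S f -> cmeasurable f.

Definition approximable f := cmeasurable f /\ forall e : R, 0 < e ->
  exists2 phi, S phi & (norm12 (fun x => f x - phi x)%R <= e%:E)%E.

Lemma approximable_gen f : S f -> approximable f.
Proof.
move=> Sf; split; first exact: Sm.
move=> e e0; exists f => //; rewrite /norm12.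
under eq_integral => x _ do rewrite subrr normc00 expr0n addr0.
by rewrite integral0 lee_fin ltW.
Qed.

Lemma approximable_lim f : cmeasurable f -> (forall e : R, 0 < e ->
  exists2 g, approximable g & (norm12 (fun x => f x - g x)%R <= e%:E)%E) -> approximable f.
Proof.
move=> mf H; split=> // e e0; have e4 : 0 < e / 4 by rewrite divr_gt0.
have [g [mg ag] fg] := H _ e4; have [phi Sphi gphi] := ag _ e4.
exists phi => //.
have -> : (fun x => f x - phi x) = fun x => (f x - g x) + (g x - phi x).
  by apply/funext => x; rewrite addrA subrK.
apply: le_trans (norm12D (cmeasB mf mg) (cmeasB mg (Sm Sphi))) _.
have H2 : (0 <= 2%:E :> \bar R)%E by rewrite lee_fin.
apply: le_trans (leeD (lee_wpmul2l H2 fg) (lee_wpmul2l H2 gphi)) _.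
by rewrite -!EFinM -EFinD lee_fin; lra.
Qed.

Lemma approximableD f g : approximable f -> approximable g ->
  approximable (fun x => f x + g x).
Proof.
move=> [mf af] [mg ag]; split; first exact: cmeasD.
move=> e e0; have e4 : 0 < e / 4 by rewrite divr_gt0.
have [phi Sphi fphi] := af _ e4; have [psi Spsi gpsi] := ag _ e4.
exists (fun x => phi x + psi x); first exact: SD.
have -> : (fun x => f x + g x - (phi x + psi x)) = fun x => (f x - phi x) + (g x - psi x).
  by apply/funext => x; ring.
apply: le_trans (norm12D (cmeasB mf (Sm Sphi)) (cmeasB mg (Sm Spsi))) _.
have H2 : (0 <= 2%:E :> \bar R)%E by rewrite lee_fin.
apply: le_trans (leeD (lee_wpmul2l H2 fphi) (lee_wpmul2l H2 gpsi)) _.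
by rewrite -!EFinM -EFinD lee_fin; lra.
Qed.

Lemma approximableZ z f : approximable f -> approximable (fun x => z * f x).
Proof.
move=> [mf af]; split; first exact: cmeasZ.
move=> e e0; pose k := normc z + normc z ^+ 2 + 1.
have k0 : 0 < k by rewrite ltr_wpDl// n12_ge0.
have [phi Sphi fphi] := af _ (divr_gt0 e0 k0).
exists (fun x => z * phi x); first exact: SZ.
have -> : (fun x => z * f x - z * phi x) = fun x => z * (f x - phi x).
  by apply/funext => x; rewrite mulrBr.
apply: le_trans (norm12Z z (cmeasB mf (Sm Sphi))) _.
have H2 : (0 <= (normc z + normc z ^+ 2)%:E :> \bar R)%E by rewrite lee_fin n12_ge0.
apply: le_trans (lee_wpmul2l H2 fphi) _.
rewrite -EFinM lee_fin mulrCA ler_piMr ?(ltW e0)// ler_pdivrMr// mul1r /k lerDl.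
exact: ler01.
Qed.

Lemma approximable_seq (f_ : nat -> T -> R[i]) f (g : T -> R) : (forall n, approximable (f_ n)) ->
  cmeasurable f -> mu.-integrable setT (fun x => (g x + g x ^+ 2)%:E) ->
  (forall n x, normc (f x - f_ n x) <= g x) ->
  {ae mu, forall x, (fun n => normc (f x - f_ n x)) @ \oo --> 0} -> approximable f.
Proof.
move=> af mf ig fg cf; apply: approximable_lim => // e e0.
pose h n x : \bar R := (normc (f x - f_ n x) + normc (f x - f_ n x) ^+ 2)%:E.
have mh n : measurable_fun setT (h n).
  by apply: measurable_norm12; apply: cmeasB => //; have [] := af n.
have H1 : {ae mu, forall x, setT x -> h ^~ x @ \oo --> 0%E}.
  apply: filterS cf => x cx _; apply/fine_cvgP; split; first exact: nearW.
  have -> : fine \o h^~ x = fun n => normc (f x - f_ n x) + normc (f x - f_ n x) * normc (f x - f_ n x).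
    by apply/funext => n /=; rewrite expr2.
  rewrite (_ : 0 = 0 + 0 * 0 :> R); last by rewrite mulr0 addr0.
  exact: (cvgD cx (cvgM cx cx)).
have H2 : {ae mu, forall x n, setT x -> (`|h n x| <= (g x + g x ^+ 2)%:E)%E}.
  apply: aeW => x n _; rewrite /h gee0_abs ?lee_fin ?n12_ge0//.
  by rewrite lerD// lerXn2r ?nnegrE ?normcr_ge0//; apply: le_trans (fg n x); rewrite normcr_ge0.
have [_ + _] := dominated_convergence measurableT mh (measurable_cst 0%E) H1 ig H2.
move=> /fine_cvgP[[N1 _ h1] /cvgrPdist_le/(_ e e0)[N2 _ h2]].
pose n := maxn N1 N2; exists (f_ n) => //.
have := h2 n (leq_maxr _ _); have := h1 n (leq_maxl _ _) => /= h3 h4.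
have E : norm12 (fun x => f x - f_ n x) = (\int[mu]_x `|h n x - 0|)%E.
  by apply: eq_integral => x _; rewrite sube0 gee0_abs// lee_fin n12_ge0.
rewrite E -(fineK h3) lee_fin; apply: le_trans h4; rewrite sub0r normrN.
exact: ler_norm.
Qed.

Variable P : nat -> set T.
Hypothesis mP : forall n, measurable (P n).
Hypothesis Pae : {ae mu, forall x, exists N, forall n, (N <= n)%N -> P n x}.
Hypothesis aP : forall n (A : set T), measurable A ->
  approximable (fun x => (\1_(A `&` P n) x : R)%:C).

Lemma approximable_sum (I : Type) (s : seq I) (F : I -> T -> R[i]) : approximable (fun=> 0) ->
  (forall i, approximable (F i)) -> approximable (fun x => \sum_(i <- s) F i x).
Proof.
move=> a0 aF; elim: s => [|i s IH].
  by move: a0; congr approximable; apply/funext => x; rewrite big_nil.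
have -> : (fun x => \sum_(j <- i :: s) F j x) = fun x => F i x + \sum_(j <- s) F j x.
  by apply/funext => x; rewrite big_cons.
exact: approximableD.
Qed.

Lemma approximable_simple (g : {nnsfun T >-> R}) n :
  approximable (fun x => (g x * \1_(P n) x)%:C).
Proof.
have a0 : approximable (fun=> 0).
  have := aP n measurable0; congr approximable; apply/funext => x.
  by rewrite set0I indic0.
have fr : finite_set (range g) by exact: fimfunP.
have [s sE] : exists s : seq R, forall x, g x = \sum_(y <- s) y * \1_(g @^-1` [set y]) x.
  by eexists => x; rewrite {1}(fimfunE g x) fsbig_finite//=.
have -> : (fun x => (g x * \1_(P n) x)%:C) = fun x =>
    \sum_(y <- s) y%:C * (\1_((g @^-1` [set y]) `&` P n) x : R)%:C.
  apply/funext => x; rewrite {1}sE mulr_suml rmorph_sum.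
  apply: eq_bigr => y _; rewrite /= -rmorphM/=; congr (_%:C).
  by rewrite indicI /= mulrA.
apply: approximable_sum => // y; apply: approximableZ; apply: aP.
exact: measurable_sfunP.
Qed.

(** Simple functions increasing to r are cut off to [P n], so that each is a combination of
    indicators covered by [aP]. All errors stay below r, which dominates. *)
Lemma approximable_nonneg (r : T -> R) : measurable_fun setT r -> (forall x, 0 <= r x) ->
  mu.-integrable setT (fun x => (r x + r x ^+ 2)%:E) -> approximable (fun x => (r x)%:C).
Proof.
move=> mr r0 ir.
have mre : measurable_fun setT (EFin \o r) by apply/measurable_EFinP.
pose g n := nnsfun_approx measurableT mre n.
have cg x : (fun n => g n x) @ \oo --> r x.
  have /fine_cvgP[_] := @cvg_nnsfun_approx _ _ _ _ measurableT _ mre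
    (fun x _ => r0 x : (0 <= (EFin \o r) x)%E) x I.
  by apply: cvg_trans; exact: cvg_refl.
have ndg x : nondecreasing_seq (fun n => g n x).
  move=> m n mn; have := @nd_nnsfun_approx _ _ _ _ measurableT _ mre _ _ mn.
  by move=> /lefP; exact.
have gr n x : g n x <= r x.
  rewrite -(cvg_lim (@Rhausdorff R) (cg x)).
  apply: (nondecreasing_cvgn_le (ndg x)); apply/cvg_ex; exists (r x); exact: cg.
have g0 n x : 0 <= g n x by exact: fun_ge0.
apply: (@approximable_seq (fun n x => (g n x * \1_(P n) x)%:C) _ r) => //.
- by move=> n; exact: approximable_simple.
- move=> n x; rewrite -rmorphB normc_real indicE; case: (x \in P n) => /=.
    by rewrite mulr1 ger0_norm ?subr_ge0// lerBlDr lerDl.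
  by rewrite mulr0 subr0 ger0_norm.
apply: filterS Pae => x [N hN].
have c0 : (fun n => `|r x - g n x|) @ \oo --> 0.
  have c1 : (fun n => r x - g n x) @ \oo --> (0 : R).
    by rewrite -(subrr (r x)); apply: cvgB; [exact: cvg_cst|exact: cg].
  by have := cvg_norm c1; rewrite normr0; apply.
apply: cvg_trans c0; apply: near_eq_cvg; exists N => // n Nn; have Pn := hN n Nn.
by rewrite indicE mem_set// mulr1 -rmorphB normc_real.
Qed.

Lemma approximable_L12 f : L1 mu f -> L2 mu f -> approximable f.
Proof.
move=> /L1P[mf lf] [_ l2f].
have [mre mim] := mf.
have fin : (norm12 f < +oo)%E.
  rewrite /norm12; under eq_integral do rewrite EFinD.
  rewrite ge0_integralD//; [exact: lte_add_pinfty| | | |].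
  - by move=> x _; rewrite lee_fin normcr_ge0.
  - exact: measurable_normE.
  - by move=> x _; exact: sqnormE_ge0.
  - exact: measurable_sqnormE.
have key (r : T -> R) : measurable_fun setT r -> (forall x, `|r x| <= normc (f x)) ->
    approximable (fun x => (Num.max (r x) 0)%:C).
  move=> mr rf.
  have rm x : Num.max (r x) 0 <= normc (f x).
    by rewrite ge_max normcr_ge0 andbT; apply: le_trans (ler_norm _) (rf x).
  have mr0 : measurable_fun setT (fun x => Num.max (r x) 0).
    by apply: measurable_maxr => //; exact: measurable_cst.
  have r0 x : 0 <= Num.max (r x) 0 by rewrite le_max lexx orbT.
  apply: approximable_nonneg => //; apply/integrableP; split.
    by apply/measurable_EFinP; apply: measurable_funD => //; exact: measurable_funX.
  apply: le_lt_trans fin; apply: ge0_le_integral => //.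
  - apply: measurableT_comp => //; apply/measurable_EFinP.
    by apply: measurable_funD => //; exact: measurable_funX.
  - exact: measurable_norm12.
  - move=> x _; rewrite gee0_abs ?lee_fin ?addr_ge0 ?sqr_ge0//.
    by rewrite lerD// lerXn2r ?nnegrE ?normcr_ge0.
have -> : f = fun x => ((Num.max (complex.Re (f x)) 0)%:C + (-1) * (Num.max (- complex.Re (f x)) 0)%:C)
    + ((0 +i* 1) * (Num.max (complex.Im (f x)) 0)%:C + (0 +i* (-1)) * (Num.max (- complex.Im (f x)) 0)%:C).
  have E (r : R) : r = Num.max r 0 - Num.max (- r) 0.
    by rewrite !maxEle oppr_le0; case: (ltgtP r 0) => h; lra.
  apply/funext => x; apply: complex_eq; rewrite ?(ReD, ImD, ReM, ImM) /=.
    by rewrite {1}(E (complex.Re (f x))); ring.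
  by rewrite {1}(E (complex.Im (f x))); ring.
apply: approximableD; apply: approximableD; try apply: approximableZ; apply: key => //.
- by move=> x; exact: Re_le_normc.
- exact: measurable_funN.
- by move=> x; rewrite normrN; exact: Re_le_normc.
- by move=> x; exact: Im_le_normc.
- exact: measurable_funN.
- by move=> x; rewrite normrN; exact: Im_le_normc.
Qed.

End simultaneous_approximation.

Section density.
Context (R : realType) (F : fieldExtType rat) (K0 : fieldType)
  (v : absolute_value R K0) (iota : {rmorphism F -> valued v}).
Local Notation K := (valued v).
Implicit Types (x y u w : K) (phi psi : K -> R[i]).
Hypothesis Hc : is_completion iota.
Variable dx : {measure set (borel K) -> \bar R}.
Hypothesis Hdx : @is_haar R K setT +%R dx.
Local Notation sb0 := (@schwartz_bruhat0 R K0 v).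

Lemma sb0P phi : sb0 phi <-> test phi /\ exists2 d : R, 0 < d & forall x, v x < d -> phi x = 0.
Proof.
split=> [[h1 h2 /vnbhsP[d d0 hd]]|[[h1 h2] [d d0 hd]]].
  by split=> //; exists d => // x xd; apply: hd; rewrite subr0.
by split=> //; apply/vnbhsP; exists d => // x; rewrite subr0; exact: hd.
Qed.

Lemma sb0D phi psi : sb0 phi -> sb0 psi -> sb0 (fun x => phi x + psi x).
Proof.
move=> /sb0P[t1 [d d0 hd]] /sb0P[t2 [e e0 he]]; apply/sb0P; split; first exact: (testD Hc).
exists (Num.min d e); first by rewrite lt_min d0.
by move=> x; rewrite lt_min => /andP[xd xe]; rewrite hd// he// addr0.
Qed.

Lemma sb0Z (z : R[i]) phi : sb0 phi -> sb0 (fun x => z * phi x).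
Proof.
move=> /sb0P[t1 [d d0 hd]]; apply/sb0P; split; first exact: (testZ Hc).
by exists d => // x xd; rewrite hd// mulr0.
Qed.

Lemma sb0M phi psi : sb0 phi -> sb0 psi -> sb0 (fun x => phi x * psi x).
Proof.
move=> /sb0P[t1 [d d0 hd]] /sb0P[t2 _]; apply/sb0P; split; first exact: (testM Hc).
by exists d => // x xd; rewrite hd// mul0r.
Qed.

Lemma sb0_cmeas phi : sb0 phi -> cmeasurable (phi : borel K -> R[i]).
Proof. by move=> [h _ _]; exact: (schwartz_cmeas Hc). Qed.

Lemma sb0_exists : exists phi, sb0 phi.
Proof.
have [b [tb _ _ _]] := test_bump Hc (@ltr01 R).
exists (fun x => 0 * (b x)%:C); apply/sb0P; split; first exact: (testZ Hc).
by exists 1 => // x _; rewrite mul0r.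
Qed.

(** Shells exhaust the complement of 0. Each has finite measure and stays away from 0, as the
    functions of S_0 must. *)
Definition shell (n : nat) : set (borel K) := [set x : K | n.+1%:R^-1 < v x < n.+1%:R].

Lemma open_shell n : open (shell n : set K).
Proof.
have -> : (shell n : set K) = (fun x : K => v x) @^-1` [set` `]n.+1%:R^-1, n.+1%:R[].
  by apply/seteqP; split=> x; rewrite /shell /= in_itv.
by apply: open_comp => [x _|]; [exact: vcontinuous|exact: interval_open].
Qed.

Lemma measurable_shell n : measurable (shell n).
Proof. by apply: borel_open; exact: open_shell. Qed.

Lemma shell_lty n : (dx (shell n) < +oo)%E.
Proof.
have h := dx_vball_lty Hc Hdx n.+1%:R; apply: le_lt_trans h.
apply: le_measure; rewrite ?inE; [exact: measurable_shell|exact: measurable_vball|].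
by move=> x /= /andP[_ /ltW].
Qed.

Let S : set (borel K -> R[i]) := fun phi => sb0 phi.
Local Notation approx := (approximable dx S).
Let sD (f g : borel K -> R[i]) : S f -> S g -> S (fun x => f x + g x). Proof. exact: sb0D. Qed.
Let sZ (z : R[i]) (f : borel K -> R[i]) : S f -> S (fun x => z * f x). Proof. exact: sb0Z. Qed.
Let sm (f : borel K -> R[i]) : S f -> cmeasurable f. Proof. exact: sb0_cmeas. Qed.

Section open_sets.
Variables (W : set K) (n0 : nat).
Hypothesis oW : open W.
Hypothesis Wn0 : W `<=` shell n0.

(** The bumps have radius 1/(k+1) and centres in a dense sequence, and are kept only if the whole
    ball lies in W; they vanish near 0 because W lies in a shell. *)
Lemma bump_cover : exists b : nat -> K -> R,
  [/\ forall n, sb0 (fun x => (b n x)%:C), forall n x, 0 <= b n x <= 1,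
      forall n x, ~ W x -> b n x = 0 & forall x, W x -> exists n, 0 < b n x].
Proof.
have [D hD] := separable Hc.
have hb k : exists b : (K -> R) * R, [/\ test (fun x => (b.1 x)%:C), forall x, 0 <= b.1 x <= 1,
      forall x, b.1 x != 0 -> v x < k.+1%:R^-1 & 0 < b.2 /\ forall x, v x < b.2 -> 0 < b.1 x].
  have k0 : 0 < k.+1%:R^-1 :> R by rewrite invr_gt0.
  have [b [tb b01 bs b0]] := test_bump Hc k0.
  have /ccontP/(_ 0 _ b0)[d d0 hd] := schwartz_continuous Hc tb.1.
  exists (b, d); split=> //; split=> // x xd.
  have := hd x; rewrite subr0 => /(_ xd); rewrite -rmorphB normc_real ltr_norml => /andP[h _] /=.
  lra.
have [b hb'] := choice hb.
pose good i k := forall y, v (y - D i) < k.+1%:R^-1 -> W y.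
pose B i k x := if `[< good i k >] then (b k).1 (x - D i) else 0.
pose C n x := let p := odflt (0, 0)%N (unpickle n) in B p.1 p.2 x.
have W0 : ~ W 0 by move=> /Wn0 /= /andP[+ _]; rewrite absv0 ltNge invr_ge0 ler0n.
have BW i k x : ~ W x -> B i k x = 0.
  rewrite /B; case: asboolP => // g Wx; have [_ _ hs _] := hb' k.
  have [//|/hs] := eqVneq ((b k).1 (x - D i)) 0.
  by move=> /g.
exists C; split.
- move=> n; rewrite /C; set p := odflt _ _; case: p => i k /=; apply/sb0P; split.
    rewrite /B; case: asboolP => _.
      by have [tb _ _ _] := hb' k; exact: (test_translate Hc (- D i) tb).
    by have [phi /sb0P[t _]] := sb0_exists; have := testZ Hc 0 t; congr test; apply/funext => x; rewrite mul0r.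
  exists (n0.+1%:R^-1); first by rewrite invr_gt0.
  move=> x xn; rewrite BW// => /Wn0 /= /andP[+ _]; by rewrite ltNge (ltW xn).
- move=> n x; rewrite /C /B; case: asboolP => _; last by rewrite lexx ler01.
  by have [_ h _ _] := hb' (odflt (0, 0)%N (unpickle n)).2.
- by move=> n x Wx; exact: BW.
move=> x Wx; have /vnbhsP[r r0 hr] : nbhs x W by apply: open_nbhs_nbhs.
have [k hk] : exists k, k.+1%:R^-1 < r / 2 :> R.
  have r2 : 0 < r / 2 by rewrite divr_gt0.
  have /cvgrPdist_lt/(_ _ r2)[N _ hN] := @cvg_harmonic R.
  by exists N; have := hN N (leqnn N); rewrite /= sub0r normrN ger0_norm.
have [_ _ hs [e0 he]] := hb' k.
(* The centre must be so close to x that x falls where the bump is known to be positive, and close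
   enough for the supporting ball to stay in W. *)
have m0 : 0 < Num.min (b k).2 (r / 2) by rewrite lt_min e0 divr_gt0.
have [i hi] := hD x _ m0; move: hi; rewrite lt_min => /andP[h1 h2].
exists (pickle (i, k)); rewrite /C pickleK /= /B; case: asboolP => [_|[]]; first exact: he.
move=> y yD; apply: hr; rewrite -[y](subrK (D i)) -addrA.
apply: le_lt_trans (vD_le _ _) _; rewrite [r]splitr ltrD//; first exact: lt_trans hk.
by rewrite -absvN opprB.
Qed.

(** The functions 1 - prod (1 - b_m)^n over m < n vanish off W. On W some b_m x is positive, and the
    growing exponent drives its factor, hence the product, to 0. *)
Lemma approx_open : approx (fun x => (\1_(W : set (borel K)) x : R)%:C).
Proof.
have [b [sb b01 bW bpos]] := bump_cover.
have mW : measurable (W : set (borel K)) by exact: borel_open.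
pose w n x : R := 1 - \prod_(m < n) (1 - b m x) ^+ n.
have w01 n x : 0 <= w n x <= 1.
  have f01 (m : 'I_n) : 0 <= (1 - b m x) ^+ n <= 1.
    have /andP[h1 h2] := b01 m x.
    by rewrite exprn_ge0 ?exprn_ile1//; lra.
  have p0 : 0 <= \prod_(m < n) (1 - b m x) ^+ n by apply: prodr_ge0 => m _; have /andP[] := f01 m.
  have p1 : \prod_(m < n) (1 - b m x) ^+ n <= 1.
    elim/big_rec: _ => // m y _ hy.
    have /andP[q0 q1] := f01 m; nra.
  by rewrite /w; apply/andP; split; lra.
(* The constant 1 is not in S_0, but 1 - (1 - p)(1 - q) = p + q - pq is; powers and products of the
   factors 1 - b_m are built with this operation only. *)
have sop (p q : K -> R) : sb0 (fun x => (p x)%:C) -> sb0 (fun x => (q x)%:C) ->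
    sb0 (fun x => (1 - (1 - p x) * (1 - q x))%:C).
  move=> sp sq; have -> : (fun x => (1 - (1 - p x) * (1 - q x))%:C) = fun x =>
      ((p x)%:C + (q x)%:C) + (-1) * ((p x)%:C * (q x)%:C).
    by apply/funext => x; apply: complex_eq; rewrite ?(ReD, ImD, ReM, ImM) /=; ring.
  by apply: sb0D; [exact: sb0D|apply: sb0Z; exact: sb0M].
have s0 : sb0 (fun x => 0%:C).
  have [phi sphi] := sb0_exists; have := sb0Z 0 sphi; congr (schwartz_bruhat0 _).
  by apply/funext => x; rewrite mul0r.
have spow (p : K -> R) k : sb0 (fun x => (p x)%:C) -> sb0 (fun x => (1 - (1 - p x) ^+ k)%:C).
  move=> sp; elim: k => [|k IH].
    by move: s0; congr (schwartz_bruhat0 _); apply/funext => x; rewrite expr0 subrr.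
  have := sop _ _ sp IH; congr (schwartz_bruhat0 _); apply/funext => x.
  by rewrite exprS; congr (_%:C); ring.
have sprod k (s : seq nat) : sb0 (fun x => (1 - \prod_(m <- s) (1 - b m x) ^+ k)%:C).
  elim: s => [|m s IH].
    by move: s0; congr (schwartz_bruhat0 _); apply/funext => x; rewrite big_nil subrr.
  have := sop _ _ (spow _ k (sb m)) IH; congr (schwartz_bruhat0 _); apply/funext => x.
  by rewrite big_cons; congr (_%:C); ring.
have sw n : sb0 (fun x => (w n x)%:C).
  have := sprod n (index_iota 0 n); congr (schwartz_bruhat0 _); apply/funext => x.
  by rewrite big_mkord.
have w0 n x : ~ W x -> w n x = 0.
  move=> Wx; rewrite /w big1 ?subrr// => m _; by rewrite bW// subr0 expr1n.
apply: (approximable_seq (@sm) (f_ := fun n (x : borel K) => (w n x)%:C) (g := fun x => \1_(W : set (borel K)) x)).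
- by move=> n; apply: (approximable_gen _ (@sm)); exact: sw.
- by apply: cmeas_real; exact: measurable_indic.
- have fW : (dx (W : set (borel K)) < +oo)%E.
    apply: le_lt_trans (shell_lty n0); apply: le_measure; rewrite ?inE//; exact: measurable_shell.
  have := integrableZ_EFin 2 (integrable_indic_fin mW fW); rewrite /comp; congr (integrable _ _).
  by apply/funext => x /=; rewrite indicE; case: (_ \in _) => /=; congr EFin; ring.
- move=> n x; rewrite -rmorphB normc_real indicE.
  have [xW|xW] := boolP (x \in (W : set (borel K))).
    by have := w01 n x; rewrite /= ler_norml => /andP[h1 h2]; apply/andP; split; lra.
  by rewrite w0 ?subrr ?normr0//; move: xW; rewrite notin_setE.
apply: aeW => x; have [xW|xW] := pselect (W x); last first.
  have E : (fun n => normc ((\1_(W : set (borel K)) x : R)%:C - (w n x)%:C)) = fun=> 0.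
    apply/funext => n; rewrite w0// indicE memNset//.
    by rewrite (_ : (false%:R : R) = 0)// subrr normc00.
  by rewrite E; exact: cvg_cst.
have [m bm] := bpos x xW; have /andP[b0 b1] := b01 m x.
have q1 : `|1 - b m x| < 1 by rewrite ger0_norm; lra.
apply: (@squeeze_cvgr _ _ _ _ (fun=> 0) (fun n => (1 - b m x) ^+ n)); [|exact: cvg_cst|exact: cvg_expr].
exists m.+1 => // n mn'; have mn : (m < n)%N := mn'.
have p0 : 0 <= \prod_(m < n) (1 - b m x) ^+ n.
  by apply: prodr_ge0 => i _; apply: exprn_ge0; have /andP[] := b01 i x; lra.
have E2 : normc ((\1_(W : set (borel K)) x : R)%:C - (w n x)%:C) = \prod_(m < n) (1 - b m x) ^+ n.
  rewrite indicE mem_set// -rmorphB normc_real.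
  have -> : 1%:R - w n x = \prod_(m < n) (1 - b m x) ^+ n by rewrite /w; ring.
  by rewrite ger0_norm.
apply/andP; split; first exact: normcr_ge0.
apply: (@le_trans _ _ (\prod_(m < n) (1 - b m x) ^+ n)); first by rewrite -E2.
rewrite (bigD1 (Ordinal mn))//= ler_piMr ?exprn_ge0//; first lra.
elim/big_rec: _ => // i y _ hy.
have /andP[h1 h2] := b01 i x.
have e0 : 0 <= (1 - b i x) ^+ n by apply: exprn_ge0; lra.
have e1 : (1 - b i x) ^+ n <= 1 by apply: exprn_ile1; lra.
nra.
Qed.

End open_sets.

(** Dynkin's theorem from the open sets: complements are taken inside the shell, and countable
    disjoint unions are limits of finite sums dominated by the indicator of the shell. *)
Lemma approx_borel n (A : set (borel K)) : measurable A ->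
  approx (fun x => (\1_(A `&` shell n) x : R)%:C).
Proof.
have I0 (B : set (borel K)) (x : borel K) : (\1_(B `&` shell n) x : R) = \1_B x * \1_(shell n) x.
  by rewrite indicI.
move=> mA.
have := @dynkin_induction _ (borel K) (@open K) (fun B : set (borel K) => approx (fun x => (\1_(B `&` shell n) x : R)%:C)) erefl.
move=> H; apply: (H _ _ _ _ _ A mA) => {H}.
- by move=> U V oU oV; exact: openI.
- by rewrite setTI; apply: (approx_open (n0 := n)) => //; exact: open_shell.
- move=> U oU; apply: (approx_open (W := U `&` shell n) (n0 := n)).
    by apply: openI => //; exact: open_shell.
  by move=> x [].
- move=> B mB aB.
  have aT : approx (fun x => (\1_(shell n) x : R)%:C).
    by apply: (approx_open (n0 := n)) => //; exact: open_shell.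
  have := approximableD (@sD) (@sm) aT (approximableZ (@sZ) (@sm) (-1) aB); congr (approx _).
  apply/funext => x; rewrite !I0 !indicE in_setC; apply: complex_eq; rewrite ?(ReD, ImD, ReM, ImM) /=.
    by case: (x \in B) => /=; ring.
  by ring.
move=> B mB tB aB.
pose U (k : nat) : set (borel K) := \big[setU/set0]_(i < k) B i.
have mU k : measurable (U k) by apply: bigsetU_measurable.
have aU k : approx (fun x => (\1_(U k `&` shell n) x : R)%:C).
  elim: k => [|k IH].
    have [phi sphi] := sb0_exists.
    have -> : (fun x : borel K => (\1_(U 0%N `&` shell n) x : R)%:C) = fun x => 0 * phi x.
      by apply/funext => x; rewrite /U big_ord0 set0I indic0 mul0r.
    by apply: (approximable_gen _ (@sm)); exact: sb0Z.
  have := approximableD (@sD) (@sm) IH (aB k); congr (approx _); apply/funext => x.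
  rewrite -rmorphD /=; congr (_%:C); rewrite !I0 -mulrDl; congr (_ * _).
  rewrite /U big_ord_recr /= -/(U k) !indicE in_setU.
  have [xU|] := boolP (x \in U k); have [xB|] := boolP (x \in B k) => //=; rewrite ?addr0 ?add0r//.
  move: xU; rewrite inE /U -bigcup_mkord => -[i /= ik xi].
  move: xB; rewrite inE => xB; have := tB i k I I (ex_intro _ x (conj xi xB)) => E.
  by move: ik; rewrite E ltnn.
have mBn := measurable_shell n.
apply: (approximable_seq (@sm) (f_ := fun k (x : borel K) => (\1_(U k `&` shell n) x : R)%:C) (g := fun x => \1_(shell n) x)) => //.
- apply: cmeas_real; apply: measurable_indic; apply: measurableI => //.
  exact: bigcup_measurable.
- have := integrableZ_EFin 2 (integrable_indic_fin mBn (shell_lty n)); rewrite /comp; congr (integrable _ _).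
  by apply/funext => x /=; rewrite indicE; case: (_ \in _) => /=; congr EFin; ring.
- move=> k x; rewrite -rmorphB normc_real !I0 -mulrBl normrM [X in _ * X]ger0_norm ?indic_ge0// ler_piMl ?indic_ge0//.
  rewrite !indicE; case: (_ \in _); case: (_ \in _); rewrite /= ?subrr ?subr0 ?sub0r ?normrN ?normr1 ?normr0 ?ler01//.
apply: aeW => x; have [[i _ Bi]|nB] := pselect ((\bigcup_k B k) x).
  have E : \forall k \near \oo, normc ((\1_(\bigcup_k B k `&` shell n) x : R)%:C - (\1_(U k `&` shell n) x : R)%:C) = 0.
    exists i.+1 => // k ik; rewrite !I0 [\1_(\bigcup_k B k) x]indicE [\1_(U k) x]indicE !mem_set ?subrr ?normc00//.
      by rewrite /U -bigcup_mkord; exists i.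
    by exists i.
  by apply: cvg_near_cst.
have E : (fun k => normc ((\1_(\bigcup_k B k `&` shell n) x : R)%:C - (\1_(U k `&` shell n) x : R)%:C)) = fun=> 0.
  apply/funext => k; rewrite !I0 [\1_(\bigcup_k B k) x]indicE [\1_(U k) x]indicE !memNset ?subrr ?normc00//.
  by rewrite /U -bigcup_mkord => -[i _ Bi]; apply: nB; exists i.
by rewrite E; exact: cvg_cst.
Qed.

Lemma sb0_dense (f : borel K -> R[i]) : L1 dx f -> L2 dx f -> forall e : R, 0 < e ->
  exists2 phi : borel K -> R[i], sb0 phi & (norm12 dx (fun x => (f x - phi x)%R) <= e%:E)%E.
Proof.
move=> Lf L2f; have [|_] // := @approximable_L12 _ _ _ dx _ (@sD) (@sZ) (@sm) shell _ approx_borel f Lf L2f.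
apply: filterS (dx_ae_neq0 Hc Hdx) => x x0.
have vx : 0 < v x by rewrite v_gt0.
exists (maxn (Num.truncn (v x)) (Num.truncn (v x)^-1)).+1 => n; rewrite gtn_max => /andP[n1 n2].
apply/andP; split.
  rewrite invf_plt ?posrE//; apply/(lt_le_trans (truncnS_gt _)); rewrite ler_nat; exact: leqW.
by apply/(lt_le_trans (truncnS_gt _)); rewrite ler_nat; exact: leqW.
Qed.

End density.

(** * The space of characters and the Mellin transform *)

Section character_space.
Context (R : realType) (F : fieldExtType rat) (K0 : fieldType)
  (v : absolute_value R K0) (iota : {rmorphism F -> valued v}).
Local Notation K := (valued v).
Local Notation X := (Xnu v).
Implicit Types (x y t u : K) (chi eta : X).
Hypothesis Hc : is_completion iota.

Lemma char0 chi : chi 0 = 0.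
Proof. by have [] := set_valP chi. Qed.

Lemma charM chi x y : chi (x * y) = chi x * chi y.
Proof.
have [c0 cM _ _] := set_valP chi.
have [->|x0] := eqVneq x 0; first by rewrite mul0r char0 mul0r.
have [->|y0] := eqVneq y 0; first by rewrite mulr0 char0 mulr0.
exact: cM.
Qed.

Lemma normc_char chi x : x != 0 -> normc (chi x) = 1.
Proof.
move=> x0; have [_ _ c1 _] := set_valP chi.
by have := c1 x x0; rewrite normr_normc => /complexI.
Qed.

Lemma normc_char_le chi x : normc (chi x) <= 1.
Proof.
have [->|x0] := eqVneq x 0; first by rewrite char0 normc00.
by rewrite normc_char.
Qed.

Lemma char1 chi : chi 1 = 1.
Proof.
have c1 : chi 1 != 0 by rewrite -normc_eq0 normc_char ?oner_eq0.
by apply: (mulfI c1); rewrite -charM !mulr1.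
Qed.

Lemma char_conjE chi x : char_conj chi x = (chi x)^*.
Proof. by []. Qed.

Lemma char_conjK chi : char_conj (char_conj chi) = chi.
Proof. by apply: val_inj; apply/funext => x /=; rewrite conjcK. Qed.

Lemma conj_mul_unit (z : R[i]) : normc z = 1 -> z * z^* = 1.
Proof.
move=> z1; apply: complex_eq; rewrite ?ReM ?ImM ?Re_conj ?Im_conj /=.
  by rewrite mulrN opprK -!expr2 -normcE2 z1 expr1n.
by ring.
Qed.

Lemma char_conjV chi x : (chi x)^* = (chi x)^-1.
Proof.
have [->|x0] := eqVneq x 0; first by rewrite char0 invr0 conjc0.
have c0 : chi x != 0 by rewrite -normc_eq0 normc_char ?oner_eq0.
by apply: (mulfI c0); rewrite divff// conj_mul_unit// normc_char.
Qed.

Lemma char_mulC chi eta : char_mul chi eta = char_mul eta chi.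
Proof. by apply: val_inj; apply/funext => t; exact: mulrC. Qed.

Lemma char_conj_mulK chi eta : char_mul (char_conj chi) (char_mul chi eta) = eta.
Proof.
apply: val_inj; apply/funext => x; change ((chi x)^* * (chi x * eta x) = eta x).
have [->|x0] := eqVneq x 0; first by rewrite !char0 !mulr0.
by rewrite mulrA [_ * chi x]mulrC conj_mul_unit ?mul1r// normc_char.
Qed.

Lemma char_mul_conjK chi eta : char_mul chi (char_mul (char_conj chi) eta) = eta.
Proof. by rewrite -{1}[chi]char_conjK char_conj_mulK. Qed.

Lemma char_conjMK chi eta : char_mul (char_conj (char_mul eta chi)) eta = char_conj chi.
Proof.
have -> : char_conj (char_mul eta chi) = char_mul (char_conj eta) (char_conj chi).
  by apply: val_inj; apply/funext => t; exact: rmorphM.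
by rewrite char_mulC char_mul_conjK.
Qed.

Lemma charV chi x : chi x^-1 = (chi x)^*.
Proof.
have [->|x0] := eqVneq x 0; first by rewrite invr0 char0 conjc0.
have c0 : chi x != 0 by rewrite -normc_eq0 normc_char ?oner_eq0.
by rewrite char_conjV; apply: (mulfI c0); rewrite -charM !divff// char1.
Qed.

Lemma char_continuous chi x (e : R) : x != 0 -> 0 < e -> exists2 d : R, 0 < d &
  forall y, v (y - x) < d -> normc (chi y - chi x) < e.
Proof.
move=> x0 e0; have [_ _ _ cc] := set_valP chi.
have vx : 0 < v x by rewrite v_gt0.
have /subspace_continuousP/(_ x x0) := cc.
move=> /(@cvg_normcP _ _ _ _) /(_ e e0); rewrite near_withinE => /vnbhsP[d d0 hd].
exists (Num.min d (v x)); first by rewrite lt_min d0.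
move=> y; rewrite lt_min => /andP[yd yx]; apply: hd => //=.
by apply/eqP => y0; move: yx; rewrite y0 sub0r absvN ltxx.
Qed.

Lemma char_cmeas chi : cmeasurable (chi : borel K -> R[i]).
Proof.
suff h (p : R[i] -> R) : (forall z w, `|p z - p w| <= normc (z - w)) ->
    measurable_fun setT (fun x : borel K => p (chi x)).
  split; apply: h => z w.
    by rewrite -ReN -ReD; exact: Re_le_normc.
  by rewrite -ImN -ImD; exact: Im_le_normc.
move=> pn; have m0 : measurable ([set 0] : set (borel K)) by rewrite -(vball0 v); exact: measurable_vball.
apply: (measurability _ (RGenOInfty.measurableE R)) => //; move=> _ [_ [c ->] <-]; rewrite setTI.
have -> : (fun x : borel K => p (chi x)) @^-1` `]c, +oo[ =
   ([set x : K | x != 0 /\ c < p (chi x)] : set (borel K)) `|` ([set 0] `&` [set x : K | c < p 0]).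
  apply/seteqP; split => x /=; rewrite in_itv/= andbT.
    by move=> cx; have [x0|x0] := eqVneq x 0; [right; rewrite x0 char0 in cx *|left].
  by move=> [[]//|[-> ]]; rewrite char0.
apply: measurableU; last first.
  have [cp|cp] := pselect (c < p 0).
    have -> : [set x : K | c < p 0] = setT by apply/seteqP; split.
    by rewrite setIT.
  have -> : [set x : K | c < p 0] = set0 by apply/seteqP; split.
  by rewrite setI0.
apply: borel_open; rewrite openE => x [/= x0 cx].
have cpx : 0 < p (chi x) - c by rewrite subr_gt0.
have [d d0 hd] := char_continuous chi x0 cpx; have vx : 0 < v x by rewrite v_gt0.
apply/vnbhsP; exists (Num.min d (v x)); first by rewrite lt_min d0.
move=> y; rewrite lt_min => /andP[yd yx]; split.
  by apply/eqP => y0; move: yx; rewrite y0 sub0r absvN ltxx.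
have := le_lt_trans (pn _ _) (hd y yd); rewrite ltr_norml => /andP[h _]; lra.
Qed.

Lemma mul_compact0 : @mul_compact R K0 v set0.
Proof. by split; [exact: compact0|]. Qed.

(** The sets that contain such a uniform neighbourhood form a filter. It converges to chi uniformly
    on every admissible compact set, hence in the topology, so it contains every neighbourhood. *)
Lemma family_nbhs_basis chi (U : set {family (@mul_compact R K0 v), K -> R[i]}) :
  nbhs (val chi : {family (@mul_compact R K0 v), K -> R[i]}) U ->
  exists C : set K, @mul_compact R K0 v C /\ exists2 e : R, 0 < e &
    forall g : K -> R[i], (forall x, C x -> normc (g x - chi x) < e) -> U g.
Proof.
move=> hU.
pose G : set_system (K -> R[i]) := fun U => exists C : set K, @mul_compact R K0 v C /\
  exists2 e : R, 0 < e & forall g : K -> R[i], (forall x, C x -> normc (g x - chi x) < e) -> U g.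
have FG : Filter G.
  split.
  - by exists set0; split; [exact: mul_compact0|exists 1].
  - move=> A B [C [[cC C0] [e e0 hA]]] [C' [[cC' C0'] [e' e0' hB]]].
    exists (C `|` C'); split; first by split; [exact: compactU|case].
    exists (Num.min e e'); first by rewrite lt_min e0.
    move=> g hg; split; [apply: hA|apply: hB] => x Cx.
      by have := hg x (or_introl Cx); rewrite lt_min => /andP[].
    by have := hg x (or_intror Cx); rewrite lt_min => /andP[].
  - by move=> A B AB [C [cC [e e0 hA]]]; exists C; split=> //; exists e => // g /hA /AB.
apply: ((fam_cvgP (@mul_compact R K0 v) (val chi) FG).2 _ U hU) => A mA V.
move=> /uniform_nbhs[E [entE hE]].
move: entE; rewrite -(entourage_from_ballE (M := R[i])) => -[e /= e0 he].
exists A; split=> //; move: e0; rewrite ltcE => /andP[/eqP/= ie re].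
exists (complex.Re e) => // g hg; apply: hE => y Ay /=; apply: he => /=.
have -> : e = (complex.Re e)%:C by apply: complex_eq.
rewrite -ball_normE /= normr_normc ltcR -normc_opp opprB; exact: hg.
Qed.

Lemma Xnbhs_basis chi (U : set X) : open U -> U chi ->
  exists C : set K, @mul_compact R K0 v C /\ exists2 e : R, 0 < e &
    forall eta, (forall x, C x -> normc (eta x - chi x) < e) -> U eta.
Proof.
move=> [V oV <-] Vchi; have nV : nbhs (val chi : {family (@mul_compact R K0 v), K -> R[i]}) V.
  by apply: open_nbhs_nbhs.
have [C [mC [e e0 h]]] := family_nbhs_basis nV.
by exists C; split=> //; exists e => // eta /h.
Qed.

Lemma complex_rat_dense (z : R[i]) (e : R) : 0 < e ->
  exists q : rat * rat, normc (z - (ratr q.1 +i* ratr q.2)) < e.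
Proof.
move=> e0; have e2 : 0 < e / 2 by rewrite divr_gt0.
have h (r : R) : exists q : rat, `|r - ratr q| < e / 2.
  have [q] := rat_in_itvoo (ltr_pwDr e2 (lexx (r - e / 4))).
  rewrite in_itv/= => /andP[h1 h2]; exists q; rewrite ltr_norml; apply/andP; split; lra.
have [p hp] := h (complex.Re z); have [q hq] := h (complex.Im z).
exists (p, q); apply: le_lt_trans (normc_leD _) _; rewrite ReD ReN ImD ImN /= [e]splitr.
exact: ltrD.
Qed.

Section generators.
Variable D : nat -> K.
Hypothesis hD : forall x (r : R), 0 < r -> exists n, v (x - D n) < r.

Local Notation idx := (nat * nat * (rat * rat) * nat)%type.
Let cell (i : idx) : set K := [set x : K | v (x - D i.1.1.1) < i.1.1.2.+1%:R^-1].
Let box (i : idx) (f : K -> R[i]) := forall x, cell i x -> x != 0 ->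
  normc (f x - (ratr i.1.2.1 +i* ratr i.1.2.2)) <= i.2.+1%:R^-1.

Let open_cell i : open (cell i).
Proof. exact: vopen_ball. Qed.

(** The cell is open and the inequality is not strict, so continuity of chi off 0 lets it be tested
    on the dense sequence: a box is defined by countably many evaluations. *)
Lemma box_dense i chi : box i chi <-> forall n, cell i (D n) -> D n != 0 ->
  normc (chi (D n) - (ratr i.1.2.1 +i* ratr i.1.2.2)) <= i.2.+1%:R^-1.
Proof.
split=> [h n|h x cx x0]; first exact: h.
rewrite leNgt; apply/negP => lt.
set q := _ +i* _ in h lt; set e := _^-1 in h lt.
have e0 : 0 < normc (chi x - q) - e by rewrite subr_gt0.
have [d d0 hd] := char_continuous chi x0 e0; have vx : 0 < v x by rewrite v_gt0.
have /vnbhsP[r r0 hr] : nbhs x (cell i) by apply: open_nbhs_nbhs; split=> //; exact: open_cell.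
have m0 : 0 < Num.min (Num.min d (v x)) r by rewrite !lt_min d0 vx.
have [n hn] := hD x m0; move: hn; rewrite !lt_min vdistC => /andP[/andP[h1 h2] h3].
have Dn0 : D n != 0 by apply/eqP => E; move: h2; rewrite E sub0r absvN ltxx.
have := h n (hr _ h3) Dn0; have := hd _ h1.
have : normc (chi x - q) <= normc (chi (D n) - chi x) + normc (chi (D n) - q).
  rewrite -[normc (chi (D n) - chi x)]normc_opp opprB.
  have E : chi x - q = (chi x - chi (D n)) + (chi (D n) - q) by ring.
  by rewrite {1}E; exact: normc_add.
lra.
Qed.

(* An open set of characters is a union of finite intersections of countably many boxes, each defined by values at a dense sequence: the Borel sets are generated by evaluations. *)
Lemma open_box_cover (U : set X) chi : open U -> U chi -> exists s : seq idx,
  (forall i, i \in s -> box i chi) /\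
  forall eta, (forall i, i \in s -> box i eta) -> U eta.
Proof.
move=> oU Uchi; have [C [[cC C0] [e e0 hU]]] := Xnbhs_basis oU Uchi.
have [m hm] : exists m, m.+1%:R^-1 < e / 2 :> R.
  have r2 : 0 < e / 2 by rewrite divr_gt0.
  have /cvgrPdist_lt/(_ _ r2)[N _ hN] := @cvg_harmonic R.
  by exists N; have := hN N (leqnn N); rewrite /= sub0r normrN ger0_norm.
have m0 : 0 < m.+1%:R^-1 :> R by rewrite invr_gt0.
(* Only boxes of precision m that already contain chi are used. Their cells cover C, and finitely
   many suffice; a character in all these boxes is within 2/(m+1) < e of chi on C. *)
pose Dom : set idx := [set i | i.2 = m /\ box i chi].
have cov : C `<=` cover Dom cell.
  move=> x Cx; have x0 : x != 0 by apply/eqP => x0; apply: C0; rewrite -x0.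
  have m2 : 0 < m.+1%:R^-1 / 2 :> R by rewrite divr_gt0.
  have [d d0 hd] := char_continuous chi x0 m2.
  have [q hq] := complex_rat_dense (chi x) m2.
  have [k hk] : exists k, k.+1%:R^-1 < d / 2 :> R.
    have r2 : 0 < d / 2 by rewrite divr_gt0.
    have /cvgrPdist_lt/(_ _ r2)[N _ hN] := @cvg_harmonic R.
    by exists N; have := hN N (leqnn N); rewrite /= sub0r normrN ger0_norm.
  have k0 : 0 < k.+1%:R^-1 :> R by rewrite invr_gt0.
  have [i hi] := hD x k0.
  exists (i, k, q, m) => //; split=> // y /= cy y0.
  have yx : v (y - x) < d.
    rewrite -(subrKA (D i)) [d]splitr; apply: le_lt_trans (vD_le _ _) _.
    apply: ltrD; first exact: lt_trans hk.
    by rewrite vdistC; exact: lt_trans hk.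
  rewrite -(subrKA (chi x)); apply: le_trans (normc_add _ _) _.
  by rewrite [leRHS]splitr; apply: lerD; apply: ltW => //; exact: hd.
move: cC; rewrite compact_cover => /(_ _ Dom cell (fun i _ => @open_cell i) cov)[D' sD' cD'].
exists (finmap.enum_fset D'); split=> [i /sD'|eta heta].
  by rewrite inE => -[].
apply: hU => x Cx; have [i /= iD cx] := cD' x Cx.
have x0 : x != 0 by apply/eqP => x0; apply: C0; rewrite -x0.
have := sD' i iD; rewrite inE => -[im bi].
have h1 := heta i iD x cx x0; have h2 := bi x cx x0.
rewrite im in h1 h2.
set q := _ +i* _ in h1 h2.
have -> : eta x - chi x = (eta x - q) - (chi x - q) by ring.
apply: le_lt_trans (normc_add _ _) _; rewrite normc_opp.
by apply: le_lt_trans (lerD h1 h2) _; rewrite [ltRHS]splitr ltrD.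
Qed.

Lemma char_valued_measurable_aux d (S : measurableType d) (h : S -> borel X) :
  (forall t : K, cmeasurable (fun s => (h s : X) t)) -> measurable_fun setT h.
Proof.
move=> hm; apply: borel_measurable_fun => U oU.
pose V (s : seq idx) : set S := \bigcap_(i in [set` s]) \bigcap_(n in [set n | cell i (D n) /\ D n != 0])
  [set w | normc ((h w : X) (D n) - (ratr i.1.2.1 +i* ratr i.1.2.2)) <= i.2.+1%:R^-1].
pose G : set (seq idx) := fun s : seq idx => forall eta : X, (forall i : idx, i \in s -> box i eta) -> U eta.
have -> : h @^-1` U = \bigcup_(s in G) V s.
  apply/seteqP; split=> [w /= Uw|w [s Gs Vs] /=].
    have [s [bs hs]] := open_box_cover oU Uw; exists s => // i /= si n /= [cn n0].
    exact: bs i si (D n) cn n0.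
  by apply: Gs => i si; apply/box_dense => n cn n0; exact: Vs.
rewrite bigcup_mkcond; apply: countable_bigcupT_measurable; first exact: countableP.
move=> s; case: ifP => // _; apply: fin_bigcap_measurable; first exact: finite_seq.
move=> i _; apply: bigcap_measurableType => n _.
have mc : cmeasurable (fun _ : S => (ratr i.1.2.1 +i* ratr i.1.2.2) : R[i]) by exact: cmeas_cst.
have mn := measurable_normc (cmeasB (hm (D n)) mc).
 have := mn measurableT _ (measurable_itv `]-oo, i.2.+1%:R^-1]).
by rewrite setTI; congr measurable; apply/seteqP; split=> w /=; rewrite in_itv.
Qed.

End generators.

Lemma char_valued_measurable d (S : measurableType d) (h : S -> borel X) :
  (forall t : K, cmeasurable (fun s => (h s : X) t)) -> measurable_fun setT h.
Proof. by have [D hD] := separable Hc; exact: char_valued_measurable_aux hD _ _ _. Qed.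

Lemma eval_cmeas t : cmeasurable (fun chi : borel X => (chi : X) t).
Proof.
have [->|t0] := eqVneq t 0.
  have -> : (fun chi : borel X => (chi : X) 0) = fun=> 0 by apply/funext => chi; exact: char0.
  exact: cmeas_cst.
apply: continuous_cmeasurable => chi e e0.
have mC : @mul_compact R K0 v [set t] by split; [exact: compact_set1|move=> /eqP; rewrite eq_sym (negPf t0)].
have H : nbhs (val chi : {family (@mul_compact R K0 v), K -> R[i]})
    [set g : {family (@mul_compact R K0 v), K -> R[i]} | normc ((g : K -> R[i]) t - (chi : X) t) < e].
  have e0' : 0 < e%:C :> R[i] by rewrite ltcR.
  have := fam_nbhs (val chi) (entourage_ball (R[i] : pseudoMetricType R[i]) (PosNum e0')) mC.
  apply: filterS => g /= /(_ t erefl); rewrite -ball_normE /= normr_normc ltcR.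
  by rewrite -normc_opp opprB.
exact: (@initial_continuous _ _ _ chi _ H).
Qed.

Lemma measurable_char_conj : measurable_fun setT (fun chi : borel X => char_conj chi : borel X).
Proof. by apply: char_valued_measurable => t; apply: cmeas_conj; exact: eval_cmeas. Qed.

Lemma measurable_char_mul :
  measurable_fun setT (fun p : borel X * borel X => char_mul p.1 p.2 : borel X).
Proof.
have comp (h : borel X * borel X -> borel X) t : measurable_fun setT h ->
    cmeasurable (fun p => (h p : X) t).
  move=> mh; have [h1 h2] := eval_cmeas t; split.
    exact: (measurableT_comp h1 mh).
  exact: (measurableT_comp h2 mh).
by apply: char_valued_measurable => t; apply: cmeasM; apply: comp; [exact: measurable_fst|exact: measurable_snd].
Qed.

End character_space.

(** * Bumps at 1 and invariance of the Plancherel measure under conjugation *)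

Section plancherel.
Context (R : realType) (F : fieldExtType rat) (K0 : fieldType)
  (v : absolute_value R K0) (iota : {rmorphism F -> valued v}).
Local Notation K := (valued v).
Local Notation X := (Xnu v).
Implicit Types (x y t u : K) (chi eta : X).
Hypothesis Hc : is_completion iota.
Variables (dx dt : {measure set (borel K) -> \bar R}) (alpha : R).
Variable mu : {measure set (borel X) -> \bar R}.
Hypothesis Hdx : @is_haar R K setT +%R dx.
Hypothesis Hdt : @is_haar R K [set t | t != 0] *%R dt.
Hypothesis Ha : is_alpha dx dt alpha.
Hypothesis Hpl : is_plancherel dt mu.
Local Notation md t := (modulus dx t).
Local Notation fi := (first_isometry dx alpha).
Local Notation sb0 := (@schwartz_bruhat0 R K0 v).
Local Notation mel := (@mellin R K0 v dt).

Lemma L1_char chi (f : borel K -> R[i]) : L1 dt f -> L1 dt (fun x : borel K => f x * chi x).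
Proof.
move=> Lf; have Lr := L1_integrable_normc Lf.
apply: (L1_le _ Lr) => [|x].
  by apply: cmeasM; [exact: L1_cmeas Lf|exact: char_cmeas].
by rewrite normc_mul ler_piMr ?normcr_ge0// normc_char_le.
Qed.

Lemma mellinD (f g : borel K -> R[i]) chi : L1 dt f -> L1 dt g ->
  mel (fun x => f x + g x) chi = mel f chi + mel g chi.
Proof.
move=> Lf Lg; rewrite /mellin -cintegralD; [|exact: L1_char|exact: L1_char].
by congr (cintegral dt _); apply/funext => x; rewrite mulrDl.
Qed.

Lemma mellinZ (z : R[i]) (f : borel K -> R[i]) chi : L1 dt f ->
  mel (fun x => z * f x) chi = z * mel f chi.
Proof.
move=> Lf; rewrite /mellin -cintegralZ; last exact: L1_char.
by congr (cintegral dt _); apply/funext => x; rewrite mulrA.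
Qed.

Lemma rapid_first_isometry phi : rapid dx phi ->
  L1 dt (fi phi : borel K -> R[i]) /\ L2 dt (fi phi : borel K -> R[i]).
Proof.
move=> rphi; have [mphi _] := rphi; split.
  apply: (L1_first_isometry Hc Hdx Hdt Ha mphi); apply: (rapid_L1 Hc Hdx rphi).
  by apply/andP; split; lra.
by apply: (L2_first_isometry Hc Hdx Hdt Ha); exact: (rapid_L2 Hc Hdx).
Qed.

Lemma mellin_first_isometry phi chi : rapid dx phi ->
  mel (fi phi) chi = (alpha^-1)%:C * cintegral dx (fun x : borel K => (md x `^ (- 2^-1))%:C * (phi x * chi x)).
Proof.
move=> rphi; have [mphi [M M0 hM]] := rphi.
rewrite /mellin; apply: (cintegral_first_isometry Hc Hdx Hdt Ha mphi (char_cmeas chi)).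
apply: (rapid_L1 Hc Hdx (phi := fun x => phi x * chi x)); last by apply/andP; split; lra.
split; first by apply: cmeasM => //; exact: char_cmeas.
exists M => // x; have [h1 h2] := hM x; rewrite normc_mul.
have c1 := normc_char_le chi x; have n0 := normcr_ge0 (phi x); have c0 := normcr_ge0 (chi x).
have le : normc (phi x) * normc (chi x) <= normc (phi x) by rewrite ler_piMr.
split; first exact: le_trans h1.
by apply: le_trans h2; rewrite ler_wpM2l// exprn_ge0// (modulus_ge0 Hc Hdx).
Qed.

Lemma sb0_rapid phi : sb0 phi -> rapid dx phi.
Proof. by move=> [h _ _]; exact: (schwartz_rapid Hc Hdx). Qed.

(** The radii 1/(n+2) are at most 1/2, which keeps the bumps about 1 away from 0 and so in S_0. *)
Lemma bumps_at1 : exists b : nat -> K -> R, forall n, [/\ sb0 (fun x => (b n x)%:C),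
  forall x, 0 <= b n x <= 1, forall x, b n x != 0 -> v (x - 1) < n.+2%:R^-1 & 0 < b n 1].
Proof.
suff h n : exists b : K -> R, [/\ sb0 (fun x => (b x)%:C),
  forall x, 0 <= b x <= 1, forall x, b x != 0 -> v (x - 1) < n.+2%:R^-1 & 0 < b 1].
  by have [b hb] := choice h; exists b.
have n0 : 0 < n.+2%:R^-1 :> R by rewrite invr_gt0.
have [b [tb b01 bs b0]] := test_bump Hc n0.
exists (fun x => b (x - 1)); split=> //; last by rewrite subrr.
  apply/(sb0P _); split; first exact: (test_translate Hc (- 1) tb).
  exists 2^-1; first by rewrite invr_gt0.
  move=> x x2; have [-> //|/bs] := eqVneq (b (x - 1)) 0.
  have n2 : n.+2%:R^-1 <= 2^-1 :> R by rewrite lef_pV2 ?posrE// ler_nat.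
  have := vB_le x (x - 1); rewrite (_ : x - (x - 1) = 1); last by ring.
  rewrite absv1 => h1 h2; have := ltrD x2 (lt_le_trans h2 n2).
  rewrite (_ : 2^-1 + 2^-1 = 1 :> R); last by lra.
  by move/(le_lt_trans h1); rewrite ltxx.
by move=> x /bs.
Qed.

Lemma bump_not_ae0 (b : K -> R) : sb0 (fun x => (b x)%:C) -> 0 < b 1 ->
  ~ eqL2 dt (fi (fun x => (b x)%:C) : borel K -> R[i]) (fun=> 0).
Proof.
move=> sb b1 [N [mN N0 hN]].
have [sb1 _ _] := sb; have cb := schwartz_continuous Hc sb1.
have /ccontP/(_ 1 _ b1)[d d0 hd] := cb.
pose r := Num.min d 1; have r0 : 0 < r by rewrite lt_min d0 ltr01.
pose U : set (borel K) := [set x : K | v (x - 1) < r].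
have U0 x : U x -> x != 0.
  move=> Ux; apply/eqP => x0; move: Ux; rewrite /U /= x0 sub0r absvN absv1 lt_min ltxx andbF.
  by [].
have mU : measurable U by apply: borel_open; exact: vopen_ball.
have UN : U `<=` N.
  move=> x Ux; apply: hN => /= E.
  have : fi (fun x => (b x)%:C) x != 0.
    have bx : 0 < b x.
      have xd : v (x - 1) < d by move: Ux; rewrite /U /= lt_min => /andP[].
      by have := hd x xd; rewrite -rmorphB normc_real ltr_norml => /andP[h _]; lra.
    have a0 : 0 < alpha by case: Ha.
    have mx : 0 < md x by rewrite (modulus_gt0 Hc Hdx) U0.
    by rewrite -normc_eq0 normc_mul !normc_real !mulf_neq0// normr_eq0 ?mulf_neq0// ?gt_eqF// sqrtr_gt0.
  by rewrite E eqxx.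
have [_ _ _ pos] := Hdt.
have oU : open (U : set K) := @vopen_ball _ _ v 1 r.
have := pos U oU.
have : (dt U <= dt N)%E by apply: le_measure; rewrite ?inE.
rewrite N0 leNgt => /negP H1 H2; apply: H1; apply: H2; first by move=> x /U0.
by exists 1; rewrite /U /= subrr absv0.
Qed.

(** For large n the character is within 1/2 of 1 on the support, so the integrand has real part at
    least half of the nonnegative bump. A zero transform would make the bump vanish almost
    everywhere. *)
Lemma mellin_bump_neq0 (b : nat -> K -> R) : (forall n, [/\ sb0 (fun x => (b n x)%:C),
  forall x, 0 <= b n x <= 1, forall x, b n x != 0 -> v (x - 1) < n.+2%:R^-1 & 0 < b n 1]) ->
  forall chi, exists n, mel (fi (fun x => (b n x)%:C)) chi != 0.
Proof.
move=> hb chi.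
have h2 : 0 < 2^-1 :> R by rewrite invr_gt0.
have [d d0 hd] := char_continuous chi (oner_neq0 K0) h2.
have [n hn] : exists n, n.+1%:R^-1 < d :> R.
  have /cvgrPdist_lt/(_ _ d0)[N _ hN] := @cvg_harmonic R.
  by exists N; have := hN N (leqnn N); rewrite /= sub0r normrN ger0_norm.
exists n; have [sb b01 bs b1] := hb n; apply/negP => /eqP E.
apply: (bump_not_ae0 sb b1).
have rb := sb0_rapid sb; have [Lf _] := rapid_first_isometry rb.
have a0 : 0 < alpha by case: Ha.
pose r x := alpha * Num.sqrt (md x) * b n x.
have r0 x : 0 <= r x
  by apply: mulr_ge0; [apply: mulr_ge0; [exact: ltW|exact: sqrtr_ge0]|have /andP[] := b01 x].
have fE x : fi (fun x => (b n x)%:C) x = (r x)%:C by rewrite /first_isometry -rmorphM.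
have rchi x : r x / 2 <= complex.Re ((r x)%:C * chi x).
  rewrite ReM /= mul0r subr0.
  have [bx0|/bs xb] := eqVneq (b n x) 0; first by rewrite /r bx0 mulr0 !mul0r.
  rewrite ler_wpM2l//; have xd : v (x - 1) < d.
    apply: (lt_trans xb); apply: le_lt_trans hn.
    by rewrite lef_pV2 ?posrE// ler_nat.
  have := le_lt_trans (Re_le_normc _) (hd x xd).
  by rewrite char1 ReD ReN /= ltr_norml => /andP[h _]; lra.
pose g x := complex.Re ((r x)%:C * chi x).
have g0 x : 0 <= g x by apply: le_trans (rchi x); rewrite divr_ge0.
have Lfc : L1 dt (fun x : borel K => (r x)%:C * chi x).
  by have := L1_char chi Lf; congr (L1 dt _); apply/funext => x; rewrite fE.
have [ig _] := Lfc.
have I0 : (\int[dt]_x (g x)%:E = 0)%E.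
  have : complex.Re (mel (fi (fun x => (b n x)%:C)) chi) = 0 by rewrite E.
  rewrite /mellin /cintegral /= /Rintegral.
  under eq_integral => x _ do rewrite fE.
  have fin : (\int[dt]_x (g x)%:E)%E \is a fin_num by exact: integrable_fin_num.
  by move=> h; rewrite -(fineK fin) /g h.
have mg : measurable_fun setT (fun x : borel K => (g x)%:E) by exact: measurable_int ig.
have : ae_eq dt setT (fun x : borel K => (g x)%:E) (cst 0%E).
  apply/(ae_eq_integral_abs dt measurableT mg).
  by under eq_integral => x _ do rewrite gee0_abs ?lee_fin//.
apply: filterS => x /(_ I) [gx]; rewrite fE; apply: complex_eq => //=.
have := rchi x; have := r0 x; rewrite -/(g x) gx; lra.
Qed.

Lemma mellin_L2 f : L1 dt f -> L2 dt f -> L2 mu (mel f) /\ sqnormL2 mu (mel f) = sqnormL2 dt f.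
Proof. by have [_ _ h] := Hpl; exact: h. Qed.

(** By Plancherel each transform g_n of a bump is in L2, so the sets |g_n|^2 >= 1/(k+1) have finite
    measure by Chebyshev's inequality. They cover [Xnu] because no character is a common zero of the
    g_n. *)
Lemma mu_sigma_finite : sigma_finite setT mu.
Proof.
have [b hb] := bumps_at1.
pose g n := mel (fi (fun x => (b n x)%:C)).
have Lg n : L2 mu (g n).
  by have [sb _ _ _] := hb n; have [L1f L2f] := rapid_first_isometry (sb0_rapid sb); have [] := mellin_L2 L1f L2f.
pose A (p : nat * nat) : set (borel X) := [set chi | p.2.+1%:R^-1 <= normc (g p.1 chi) ^+ 2].
have mA p : measurable (A p).
  have := measurable_sqnormc (L2_cmeas (Lg p.1)) measurableT (measurable_itv `[p.2.+1%:R^-1, +oo[).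
  rewrite setTI; congr measurable; apply/seteqP; split=> chi /=; rewrite in_itv/= andbT//.
exists (fun n => if unpickle n is Some p then A p else set0).
  apply/seteqP; split=> // chi _; have [n gn] := mellin_bump_neq0 hb chi.
  have gp : 0 < normc (g n chi) ^+ 2 by rewrite exprn_gt0// lt_def normc_eq0 gn normcr_ge0.
  have [k hk] : exists k, k.+1%:R^-1 < normc (g n chi) ^+ 2 :> R.
    have /cvgrPdist_lt/(_ _ gp)[N _ hN] := @cvg_harmonic R.
    by exists N; have := hN N (leqnn N); rewrite /= sub0r normrN ger0_norm.
  by exists (pickle (n, k)) => //; rewrite pickleK; exact: ltW.
move=> n; case: unpickle => [p|]; last by split; [exact: measurable0|rewrite measure0].
split=> //; have [_ fin] := Lg p.1.
have k0 : 0 < p.2.+1%:R :> R by [].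
have le : (p.2.+1%:R^-1%:E * mu (A p) <= sqnormL2 mu (g p.1))%E.
  rewrite -integral_indicT// -ge0_integralZl//; first last.
  - by apply/measurable_EFinP; exact: measurable_indic.
  apply: ge0_le_integral => //.
  - by apply: emeasurable_funM => //; apply/measurable_EFinP; exact: measurable_indic.
  - by apply: measurable_sqnormE; exact: L2_cmeas.
  move=> chi _; rewrite -EFinM lee_fin indicE; have [cA|cA] := boolP (chi \in A p).
    by rewrite mulr1; move: cA; rewrite inE.
  by rewrite mulr0 sqr_ge0.
have -> : mu (A p) = (p.2.+1%:R%:E * (p.2.+1%:R^-1%:E * mu (A p)))%E.
  by rewrite muleA -EFinM mulfV ?mul1e.
by apply: le_lt_trans (lee_wpmul2l _ le) _; [rewrite lee_fin|rewrite lte_mul_pinfty].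
Qed.

Lemma mu_char_mul chi : preserves mu (fun eta : borel X => char_mul chi eta : borel X).
Proof.
have mm psi : measurable_fun setT (fun eta : borel X => char_mul psi eta : borel X).
  apply: (measurableT_comp (measurable_char_mul Hc) (g := fun eta : borel X => (psi : borel X, eta))).
  by apply: measurable_fun_pair => //; exact: measurable_cst.
have KK := @char_conj_mulK _ _ v.
split=> // A mA; have [[_ inv _ _] _ _] := Hpl.
rewrite -(inv (char_conj chi) A) //; congr (mu _); apply/seteqP; split=> [eta /= Aeta|_ [eta Aeta <-] /=].
  by exists (char_mul chi eta) => //; exact: KK.
by have := KK (char_conj chi) eta; rewrite char_conjK => ->.
Qed.

(** [haar_swap] for mu against itself, with f the squared modulus of the transform of a bump. Its
    integral is the squared norm of the bump by Plancherel, finite and nonzero, and can be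
    cancelled. *)
Lemma mu_conj : preserves mu (fun chi : borel X => char_conj chi : borel X).
Proof.
split=> [|A mA]; first exact: (measurable_char_conj Hc).
have [b hb] := bumps_at1; have [sb _ _ b1] := hb 0%N.
pose f := fi (fun x => (b 0%N x)%:C); have [L1f L2f] := rapid_first_isometry (sb0_rapid sb).
have [Lm sE] := mellin_L2 L1f L2f.
have [mA' mm] : measurable ((fun chi : borel X => char_conj chi : borel X) @^-1` A) /\ cmeasurable (mel f : borel X -> R[i]).
  split; last exact: (L2_cmeas Lm).
  by rewrite -[X in measurable X]setTI; exact: (measurable_char_conj Hc).
have aeT : {ae mu, forall x : borel X, setT x} by exact: aeW.
have i0 (x : borel X) : (0 <= (\1_A x : R)%:E)%E by rewrite lee_fin.
have mE : measurable_fun setT (fun x : borel X => (\1_A x : R)%:E).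
  by apply/measurable_EFinP; exact: measurable_indic.
have := haar_swap (mul := fun x y : borel X => char_mul x y : borel X)
  (inv := fun x : borel X => char_conj x : borel X) (G := setT)
  (measurable_char_mul Hc) (measurable_char_conj Hc) (@char_mulC _ _ v) (fun c e _ => char_mul_conjK c e) (fun c e _ => char_conjMK c e) (fun _ _ => I)
  mu_sigma_finite mu_sigma_finite aeT aeT (fun chi _ => mu_char_mul chi) (fun chi _ => mu_char_mul chi)
  (measurable_sqnormE mm) (fun c => sqnormE_ge0 _) mE i0.
rewrite !integral_indicT// -/(sqnormL2 mu (mel f)) sE.
have fin : sqnormL2 dt f \is a fin_num by rewrite ge0_fin_numE ?sqnorm_ge0//; case: L2f.
rewrite -(fineK fin); set c := fine _ => H.
have c0 : c != 0.
  apply/eqP => cz; apply: (bump_not_ae0 sb b1); apply: sqnorm_eq0; first exact: L2_cmeas L2f.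
  by rewrite -(fineK fin) -/c cz.
move: H => /(congr1 (mule c^-1%:E)).
by rewrite !muleA -!EFinM mulVf// !mul1e => ->.
Qed.

End plancherel.

(** * Zeta integrals and Gamma factor *)

Section log_bounds.
Context (R : realType).
Implicit Types (r x y : R) (h w : R[i]).

Lemma expR_taylor1 x : `|expR x - 1| <= expR `|x| * `|x|.
Proof.
have := @rdiff_mvt0 R expR expR (expR `|x|) x; rewrite expR0; apply.
  by move=> y; apply/rdiffP; exact: is_derive_expR.
by move=> y yx; rewrite ger0_norm ?expR_ge0// ler_expR; apply: le_trans (ler_norm _) yx.
Qed.

Lemma expR_taylor2 x : `|expR x - 1 - x| <= expR `|x| * x ^+ 2.
Proof.
have := @rdiff_mvt0 R (fun x => expR x - x) (fun x => expR x - 1) (expR `|x| * `|x|) x.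
rewrite expR0 subr0 -mulrA -expr2 real_normK ?num_real//.
have -> : expR x - x - 1 = expR x - 1 - x by ring.
apply.
  move=> y; apply/rdiffP; exact: (is_deriveB (is_derive_expR y) (is_derive_id y (1 : R))).
move=> y yx; apply: le_trans (expR_taylor1 y) _.
by apply: ler_pM => //; rewrite ?expR_ge0// ler_expR.
Qed.

(* exp(hL) for complex h and real L. *)
Definition cexp h r : R[i] := (expR (complex.Re h * r))%:C * expi (complex.Im h * r).

(** The remainder splits into that of the real exponential, that of exp(iy), and a cross term; their
    constants 1, 2 and 2 add up to 5. *)
Lemma cexp_taylor h r : normc (cexp h r - 1 - h * r%:C) <=
  5 * (normc h * `|r|) ^+ 2 * expR (normc h * `|r|).
Proof.
set x := complex.Re h * r; set y := complex.Im h * r; set m := normc h * `|r|.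
have xm : `|x| <= m by rewrite /x normrM ler_wpM2r// Re_le_normc.
have ym : `|y| <= m by rewrite /y normrM ler_wpM2r// Im_le_normc.
have m0 : 0 <= m by rewrite mulr_ge0 ?normcr_ge0.
have e1 : 1 <= expR m by rewrite -expR0 ler_expR.
have -> : cexp h r - 1 - h * r%:C =
    (expR x - 1 - x)%:C * expi y + (expi y - 1 - (0 +i* y)) + x%:C * (expi y - 1).
  apply: complex_eq; rewrite /cexp -/x -/y !(ReD, ImD, ReM, ImM, ReN, ImN) /=.
    by rewrite -/x; ring.
  by rewrite /y; ring.
apply: le_trans (normc_add _ _) _.
apply: le_trans (lerD (normc_add _ _) (lexx _)) _.
rewrite !normc_mul !normc_real normc_expi mulr1.
have h1 : `|expR x - 1 - x| <= m ^+ 2 * expR m.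
  apply: le_trans (expR_taylor2 x) _; rewrite mulrC -[x ^+ 2]real_normK ?num_real//.
  by apply: ler_pM; rewrite ?sqr_ge0 ?expR_ge0 ?ler_expR// lerXn2r ?nnegrE.
have h2 : normc (expi y - 1 - (0 +i* y)) <= 2 * m ^+ 2.
  apply: le_trans (expi_taylor2 y) _; rewrite -[y ^+ 2]real_normK ?num_real//.
  by rewrite ler_wpM2l// lerXn2r ?nnegrE.
have h3 : `|x| * normc (expi y - 1) <= 2 * m ^+ 2.
  have := expi_taylor1 y => h3; have n0 := normcr_ge0 (expi y - 1).
  have : `|x| * normc (expi y - 1) <= m * (2 * m).
    by apply: ler_pM => //; apply: le_trans h3 _; rewrite ler_wpM2l.
  by move=> h4; apply: le_trans h4 _; rewrite expr2; lra.
have m20 : 0 <= m ^+ 2 by exact: sqr_ge0.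
have h4 : m ^+ 2 <= m ^+ 2 * expR m by rewrite ler_peMr.
have -> : 5 * m ^+ 2 * expR m = 5 * (m ^+ 2 * expR m) by ring.
by move: h1 h2 h3 h4; set A := `|_|; set B := normc _; set C := _ * normc _; set D := m ^+ 2 * _; set E := m ^+ 2; lra.
Qed.

(** 128 = 2 * 8^2, from the quadratic term of exp(x/8). *)
Lemma sqr_le_expR x : 0 <= x -> x ^+ 2 <= 128 * expR (x / 8).
Proof.
move=> x0; have x8 : 0 <= x / 8 by rewrite divr_ge0.
have := @expR_ge1Dxn R (x / 8) 1 x8.
rewrite (_ : (2)`!%:R = 2 :> R) // => h.
have -> : x ^+ 2 = 128 * ((x / 8) ^+ 2 / 2) by field.
by rewrite ler_wpM2l//; apply: le_trans h; rewrite lerDr.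
Qed.

Lemma expR_norm_ln (c r : R) : 0 <= c -> 0 < r -> expR (c * `|ln r|) <= r `^ c + r `^ (- c).
Proof.
move=> c0 r0; rewrite /powR gt_eqF//.
have [l0|/ltW l0] := leP 0 (ln r).
  by rewrite ger0_norm// lerDl expR_ge0.
by rewrite ler0_norm// mulrN mulNr lerDr expR_ge0.
Qed.

Lemma sqr_ln_le r : 0 < r -> ln r ^+ 2 <= 128 * (r `^ 8^-1 + r `^ (- 8^-1)).
Proof.
move=> r0; rewrite -[ln r ^+ 2]real_normK ?num_real//.
apply: le_trans (sqr_le_expR (normr_ge0 _)) _; rewrite ler_wpM2l// mulrC.
by apply: expR_norm_ln => //; rewrite invr_ge0.
Qed.

Lemma norm_ln_le r : 0 < r -> `|ln r| <= 129 * (r `^ 8^-1 + r `^ (- 8^-1)).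
Proof.
move=> r0; have h1 := sqr_ln_le r0.
have h2 : `|ln r| <= ln r ^+ 2 + 1.
  by rewrite -[ln r ^+ 2]real_normK ?num_real//; have := sqr_ge0 (`|ln r| - 2^-1); nra.
have h3 : 1 <= r `^ 8^-1 + r `^ (- 8^-1).
  have c8 : 0 <= 8^-1 :> R by rewrite invr_ge0.
  by apply: le_trans (expR_norm_ln c8 r0); rewrite -expR0 ler_expR mulr_ge0.
lra.
Qed.

(** For |h| <= 1/8 the square of the logarithm and the factor exp(|h ln r|) each cost exp(|ln r|/8),
    together r^(1/4) + r^(-1/4). Against r^(-1/2) this gives the exponents -1/4 and -3/4, still
    above -1. The constant is 640 = 5 * 128. *)
Lemma cexp_taylor_powR h r : normc h <= 8^-1 -> 0 < r ->
  normc (cexp h (ln r) - 1 - h * (ln r)%:C) <= 640 * normc h ^+ 2 * (r `^ 4^-1 + r `^ (- 4^-1)).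
Proof.
move=> h8 r0; apply: le_trans (cexp_taylor _ _) _.
have l0 := normr_ge0 (ln r); have n0 := normcr_ge0 h.
have c4 : 0 <= 4^-1 :> R by rewrite invr_ge0.
have := expR_norm_ln c4 r0.
have -> : 4^-1 * `|ln r| = `|ln r| / 8 + `|ln r| / 8 by field.
rewrite expRD => h1.
have h2 := sqr_le_expR l0.
have h3 : expR (normc h * `|ln r|) <= expR (`|ln r| / 8).
  by rewrite ler_expR mulrC ler_wpM2l.
rewrite exprMn.
have e0 := expR_ge0 (`|ln r| / 8).
have -> : 5 * (normc h ^+ 2 * `|ln r| ^+ 2) * expR (normc h * `|ln r|) =
   5 * normc h ^+ 2 * (`|ln r| ^+ 2 * expR (normc h * `|ln r|)) by ring.
have -> : 640 * normc h ^+ 2 * (r `^ 4^-1 + r `^ (- 4^-1)) =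
   5 * normc h ^+ 2 * (128 * (r `^ 4^-1 + r `^ (- 4^-1))) by ring.
apply: ler_wpM2l; first by rewrite mulr_ge0// sqr_ge0.
apply: le_trans (ler_pM _ _ h2 h3) _ => //.
by rewrite -mulrA ler_wpM2l.
Qed.

End log_bounds.

Section zeta.
Context (R : realType) (F : fieldExtType rat) (K0 : fieldType)
  (v : absolute_value R K0) (iota : {rmorphism F -> valued v}).
Local Notation K := (valued v).
Local Notation X := (Xnu v).
Implicit Types (x y t u : K) (chi eta : X) (s h : R[i]) (phi psi : K -> R[i]).
Hypothesis Hc : is_completion iota.
Variable dx : {measure set (borel K) -> \bar R}.
Hypothesis Hdx : @is_haar R K setT +%R dx.
Local Notation md t := (modulus dx t).
Local Notation lmd x := (ln (md x))%:C.

Definition zeta phi chi s := cintegral dx (fun x : borel K => chi x * cpow (md x) (s - 1) * phi x).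
Definition zeta' phi chi := cintegral dx (fun x : borel K =>
  (md x `^ (- 2^-1))%:C * (lmd x * phi x * chi x)).

Lemma cpow_half_add (r : R) h : 0 < r -> cpow r (2^-1 + h - 1) = (r `^ (- 2^-1))%:C * cexp h (ln r).
Proof.
move=> r0; rewrite /cpow /cexp.
have e2 : 2^-1 = (2^-1)%:C :> R[i] by rewrite fmorphV/= rmorphD.
rewrite e2; have -> : complex.Re ((2^-1)%:C + h - 1) = - 2^-1 + complex.Re h by rewrite !(ReD, ReN) /=; lra.
have -> : complex.Im ((2^-1)%:C + h - 1) = complex.Im h by rewrite !(ImD, ImN) /=; ring.
rewrite mulrA -rmorphM/= /powR gt_eqF// -expRD; congr ((expR _)%:C * _); ring.
Qed.

Lemma measurable_ln_modulus : measurable_fun setT (fun x : borel K => ln (md x)).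
Proof. exact: (measurableT_comp (@measurable_ln R) (measurable_modulus Hc Hdx)). Qed.

Lemma cmeas_lmd : cmeasurable (fun x : borel K => lmd x : R[i]).
Proof. by apply: cmeas_real; exact: measurable_ln_modulus. Qed.

Lemma cmeas_cexp h : cmeasurable (fun x : borel K => cexp h (ln (md x))).
Proof.
have ml c : measurable_fun setT (fun x : borel K => c * ln (md x)).
  by apply: measurable_funM; [exact: measurable_cst|exact: measurable_ln_modulus].
apply: cmeasM; first by apply: cmeas_real; apply: measurableT_comp; [exact: measurable_expR|exact: ml].
split => /=.
  have mc : measurable_fun setT (@cos R) by apply: continuous_measurable_fun; exact: continuous_cos.
  exact: (measurableT_comp mc (ml _)).
have mc : measurable_fun setT (@sin R) by apply: continuous_measurable_fun; exact: continuous_sin.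
exact: (measurableT_comp mc (ml _)).
Qed.

(** The bound is asked off 0 only, since [ln] and [powR] take conventional values there; at 0 the
    function has to vanish. *)
Lemma L1_powR_dom phi (f : borel K -> R[i]) (a b k : R) : rapid dx phi -> -1 < a < 2 -> -1 < b < 2 ->
  cmeasurable f -> (forall x, x != 0 -> normc (f x) <= k * ((md x `^ a + md x `^ b) * normc (phi x))) ->
  (forall x, x = 0 -> f x = 0) -> 0 <= k ->
  L1 dx f /\ (norm1 dx f <= k%:E * (norm1 dx (fun x : borel K => (md x `^ a)%:C * phi x)%R +
     norm1 dx (fun x : borel K => (md x `^ b)%:C * phi x)%R))%E.
Proof.
move=> rphi ha hb mf hf f0 k0.
have /L1P[ma la] := rapid_L1 Hc Hdx rphi ha; have /L1P[mb lb] := rapid_L1 Hc Hdx rphi hb.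
have le : (norm1 dx f <= k%:E * (norm1 dx (fun x : borel K => (md x `^ a)%:C * phi x)%R +
     norm1 dx (fun x : borel K => (md x `^ b)%:C * phi x)%R))%E.
  rewrite /norm1 -ge0_integralD//; first last.
  - exact: measurable_normE.
  - by move=> x _; rewrite lee_fin normcr_ge0.
  - exact: measurable_normE.
  - by move=> x _; rewrite lee_fin normcr_ge0.
  have ms : measurable_fun setT (fun x : borel K => ((normc ((md x `^ a)%:C * phi x))%:E + (normc ((md x `^ b)%:C * phi x))%:E)%E).
    by apply: emeasurable_funD; exact: measurable_normE.
  rewrite -ge0_integralZl//; last by move=> x _; rewrite adde_ge0// lee_fin normcr_ge0.
  apply: ge0_le_integral => //.
  - by move=> x _; rewrite lee_fin normcr_ge0.
  - exact: measurable_normE.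
  - by apply: emeasurable_funM.
  move=> x _; rewrite -EFinD -EFinM lee_fin.
  have [x0|x0] := eqVneq (x : K) 0.
    by rewrite f0// normc00 mulr_ge0// addr_ge0 ?normcr_ge0.
  apply: le_trans (hf x x0) _; rewrite !normc_mul !normc_real !ger0_norm ?powR_ge0//.
  by rewrite -mulrDl.
split=> //; apply/L1P; split=> //; apply: le_lt_trans le _.
by rewrite lte_mul_pinfty// lte_add_pinfty.
Qed.

Lemma zeta_integrandE phi chi h x :
  chi x * cpow (md x) (2^-1 + h - 1) * phi x =
  (md x `^ (- 2^-1))%:C * (cexp h (ln (md x)) * phi x * chi x).
Proof.
have [->|x0] := eqVneq x 0; first by rewrite char0 !mulr0 !mul0r.
by rewrite cpow_half_add ?(modulus_gt0 Hc Hdx)//; ring.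
Qed.

Lemma powR_half (r c : R) : 0 < r -> r `^ (- 2^-1) * r `^ c = r `^ (c - 2^-1).
Proof. by move=> r0; rewrite -powRD ?(gt_eqF r0) ?implybT// addrC. Qed.

Lemma L1_log phi (a : R) (chi : borel K -> R[i]) : rapid dx phi -> -3/4 <= a <= 0 -> cmeasurable chi ->
  (forall x, normc (chi x) <= 1) ->
  L1 dx (fun x : borel K => (md x `^ a)%:C * (lmd x * phi x * chi x)).
Proof.
move=> rphi /andP[a1 a2] mchi chi1; have [mphi _] := rphi.
have [| |//|x x0|x -> |//|//] := @L1_powR_dom phi (fun x : borel K => (md x `^ a)%:C * (lmd x * phi x * chi x))
  (a + 8^-1) (a - 8^-1) 129 rphi.
- by apply/andP; split; lra.
- by apply/andP; split; lra.
- apply: cmeasM; first by apply: cmeas_real; exact: (measurable_modulus_powR Hc Hdx _).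
  by apply: cmeasM => //; apply: cmeasM => //; exact: cmeas_lmd.
- have m0 : 0 < md x by rewrite (modulus_gt0 Hc Hdx).
  rewrite !normc_mul !normc_real ger0_norm ?powR_ge0//.
  have h1 := norm_ln_le m0; have h2 := chi1 x.
  have n0 := normcr_ge0 (phi x); have n1 := normcr_ge0 (chi x); have p0 := powR_ge0 (md x) a.
  have -> : md x `^ (a + 8^-1) + md x `^ (a - 8^-1) = md x `^ a * (md x `^ 8^-1 + md x `^ (- 8^-1)).
    by rewrite mulrDr -!powRD ?(gt_eqF m0) ?implybT.
  have -> : 129 * (md x `^ a * (md x `^ 8^-1 + md x `^ (- 8^-1)) * normc (phi x)) =
    md x `^ a * (129 * (md x `^ 8^-1 + md x `^ (- 8^-1)) * normc (phi x)) by ring.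
  rewrite ler_wpM2l//; apply: (@le_trans _ _ (`|ln (md x)| * normc (phi x))).
    by rewrite ler_piMr// mulr_ge0.
  by rewrite ler_wpM2r.
- by rewrite (modulus0 Hc Hdx) ln0// !mul0r mulr0.
Qed.

(** The squared logarithm is bounded by powers with exponents 1/8 and -1/8; one factor phi is
    bounded by M and the other keeps the product integrable. *)
Lemma L2_log phi : rapid dx phi -> L2 dx (fun x : borel K => lmd x * phi x).
Proof.
move=> rphi; have [mphi [M M0 hM]] := rphi.
have mf : cmeasurable (fun x : borel K => lmd x * phi x) by apply: cmeasM => //; exact: cmeas_lmd.
have [| |//|x x0|x -> |//|] := @L1_powR_dom phi (fun x : borel K => (lmd x * phi x) * (lmd x * phi x))
  8^-1 (- 8^-1) (128 * M) rphi.
- by apply/andP; split; lra.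
- by apply/andP; split; lra.
- exact: cmeasM.
- have m0 : 0 < md x by rewrite (modulus_gt0 Hc Hdx).
  have [h1 _] := hM x; have h2 := sqr_ln_le m0; have n0 := normcr_ge0 (phi x).
  rewrite !normc_mul normc_real.
  have -> : `|ln (md x)| * normc (phi x) * (`|ln (md x)| * normc (phi x)) = ln (md x) ^+ 2 * (normc (phi x) * normc (phi x)).
    by rewrite -[ln _ ^+ 2]real_normK ?num_real//; ring.
  have q0 := sqr_ge0 (ln (md x)).
  have -> : 128 * M * ((md x `^ 8^-1 + md x `^ (- 8^-1)) * normc (phi x)) =
     (128 * (md x `^ 8^-1 + md x `^ (- 8^-1))) * (M * normc (phi x)) by ring.
  by apply: ler_pM => //; rewrite ?mulr_ge0// ler_wpM2r.
- by rewrite (modulus0 Hc Hdx) ln0// !mul0r.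
- by rewrite mulr_ge0.
move=> /L1P[_ l] _; split=> //; apply: le_lt_trans l.
rewrite /sqnormL2 /norm1 le_eqVlt; apply/orP; left; apply/eqP.
by apply: eq_integral => x _; rewrite [in RHS]normc_mul expr2.
Qed.

Lemma zeta_diff phi chi : rapid dx phi -> exists2 M : R, 0 <= M & forall h, normc h <= 8^-1 ->
  normc (zeta phi chi (2^-1 + h) - zeta phi chi 2^-1 - h * zeta' phi chi) <= M * normc h ^+ 2.
Proof.
move=> rphi; have [mphi _] := rphi.
have ha : -1 < (- 4^-1 : R) < 2 by apply/andP; split; lra.
have hb : -1 < (- (3 / 4) : R) < 2 by apply/andP; split; lra.
pose I := (norm1 dx (fun x : borel K => ((md x `^ (- 4^-1))%:C * phi x)%R) +
  norm1 dx (fun x : borel K => ((md x `^ (- (3 / 4)))%:C * phi x)%R))%E.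
have fI : I \is a fin_num.
  have /L1P[_ la] := rapid_L1 Hc Hdx rphi ha; have /L1P[_ lb] := rapid_L1 Hc Hdx rphi hb.
  have I0 : (0 <= I)%E by rewrite adde_ge0 ?norm1_ge0.
  by rewrite ge0_fin_numE//; exact: lte_add_pinfty.
have I0 : 0 <= fine I by rewrite fine_ge0// adde_ge0 ?norm1_ge0.
(* 1280 = 2 * 640: the factor of [normc_cintegral_le] and the constant of [cexp_taylor_powR]. I
   gathers the L1 norms with exponents -1/4 and -3/4. *)
exists (1280 * fine I); first exact: (mulr_ge0 (ler0n _ _) I0).
move=> h h8.
have mpow : cmeasurable (fun x : borel K => (md x `^ (- 2^-1))%:C : R[i]).
  by apply: cmeas_real; exact: (measurable_modulus_powR Hc Hdx _).
have Lz k : normc k <= 8^-1 -> L1 dx (fun x : borel K => (md x `^ (- 2^-1))%:C * ((cexp k (ln (md x)) - 1 - k * lmd x) * phi x * chi x)) /\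
  (norm1 dx (fun x : borel K => ((md x `^ (- 2^-1))%:C * ((cexp k (ln (md x)) - 1 - k * lmd x) * phi x * chi x))%R) <= (640 * normc k ^+ 2)%:E * I)%E.
  move=> k8; apply: (L1_powR_dom rphi ha hb).
  - apply: cmeasM => //; apply: cmeasM; last exact: char_cmeas.
    apply: cmeasM => //; apply: cmeasB; last by apply: cmeasZ; exact: cmeas_lmd.
    by apply: cmeasB; [exact: cmeas_cexp|exact: cmeas_cst].
  - move=> x x0; have m0 : 0 < md x by rewrite (modulus_gt0 Hc Hdx).
    rewrite !normc_mul normc_real ger0_norm ?powR_ge0// normc_char// mulr1.
    have := cexp_taylor_powR k8 m0 => H.
    have -> : md x `^ (- 4^-1) + md x `^ (- (3 / 4)) = md x `^ (- 2^-1) * (md x `^ 4^-1 + md x `^ (- 4^-1)).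
      by rewrite mulrDr !powR_half//; congr (_ `^ _ + _ `^ _); field.
    have -> : 640 * normc k ^+ 2 * (md x `^ (- 2^-1) * (md x `^ 4^-1 + md x `^ (- 4^-1)) * normc (phi x)) =
      md x `^ (- 2^-1) * (640 * normc k ^+ 2 * (md x `^ 4^-1 + md x `^ (- 4^-1)) * normc (phi x)) by ring.
    by rewrite ler_wpM2l ?powR_ge0// ler_wpM2r ?normcr_ge0.
  - by move=> x ->; rewrite char0 !mulr0.
  - by apply: mulr_ge0; [exact: ler0n|exact: sqr_ge0].
have L0 : L1 dx (fun x : borel K => (md x `^ (- 2^-1))%:C * (phi x * chi x)).
  apply: (rapid_L1 Hc Hdx (phi := fun x => phi x * chi x)); last by apply/andP; split; lra.
  have [_ [M M0 hM]] := rphi.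
  split; first by apply: cmeasM => //; exact: char_cmeas.
  exists M => // x; have [h1 h2] := hM x; rewrite normc_mul.
  have c1 := normc_char_le chi x; have n0 := normcr_ge0 (phi x); have c0 := normcr_ge0 (chi x).
  have le : normc (phi x) * normc (chi x) <= normc (phi x) by rewrite ler_piMr.
  split; first exact: le_trans h1.
  by apply: le_trans h2; rewrite ler_wpM2l// exprn_ge0// (modulus_ge0 Hc Hdx).
have a34 : -3/4 <= (- 2^-1 : R) <= 0 by apply/andP; split; lra.
have L1' := L1_log rphi a34 (char_cmeas chi) (normc_char_le chi).
have [LE nE] := Lz h h8.
have cexp0 r : cexp 0 r = 1 by rewrite /cexp !mul0r expR0 mul1r; apply: complex_eq; rewrite /= ?mul0r ?cos0 ?sin0.
have zE k : zeta phi chi (2^-1 + k) = cintegral dx (fun x : borel K =>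
    (md x `^ (- 2^-1))%:C * (cexp k (ln (md x)) * phi x * chi x)).
  by congr (cintegral dx _); apply/funext => x; exact: zeta_integrandE.
have z0 : zeta phi chi 2^-1 = cintegral dx (fun x : borel K => (md x `^ (- 2^-1))%:C * (phi x * chi x)).
  by rewrite -[2^-1 in LHS]addr0 zE; congr (cintegral dx _); apply/funext => x; rewrite cexp0 mul1r.
have -> : zeta phi chi (2^-1 + h) - zeta phi chi 2^-1 - h * zeta' phi chi =
   cintegral dx (fun x : borel K => (md x `^ (- 2^-1))%:C * ((cexp h (ln (md x)) - 1 - h * lmd x) * phi x * chi x)).
  rewrite zE z0 /zeta' -cintegralZ//.
  have E : (fun x : borel K => (md x `^ (- 2^-1))%:C * (cexp h (ln (md x)) * phi x * chi x)) =
      fun x : borel K => ((md x `^ (- 2^-1))%:C * ((cexp h (ln (md x)) - 1 - h * lmd x) * phi x * chi x)) +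
        ((md x `^ (- 2^-1))%:C * (phi x * chi x) + h * ((md x `^ (- 2^-1))%:C * (lmd x * phi x * chi x))).
    by apply/funext => x; ring.
  rewrite E cintegralD//; last by apply: L1D => //; exact: L1Z.
  rewrite cintegralD//; last exact: L1Z.
  by ring.
rewrite -lee_fin; apply: le_trans (normc_cintegral_le LE) _.
have H2 : (0 <= 2%:E :> \bar R)%E by rewrite lee_fin.
apply: le_trans (lee_wpmul2l H2 nE) _.
rewrite -(fineK fI) -!EFinM lee_fin le_eqVlt; apply/orP; left; apply/eqP; ring.
Qed.

End zeta.

Lemma near0c (R : realType) (d : R) : 0 < d -> \forall h \near (0 : R[i])^', normc h < d.
Proof.
move=> d0; apply: nbhs_dnbhs; have d0' : 0 < d%:C :> R[i] by rewrite ltcR.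
by apply/nbhs_ballP; exists d%:C => //= h; rewrite -ball_normE /= sub0r normr_normc ltcR normc_opp.
Qed.

(** * Rules for difference quotients of a complex variable *)

Section slopes.
Context (R : realType).
Implicit Types (f g : R[i] -> R[i]) (a b d e : R[i]).

Lemma ccvgD (T : Type) (A : set_system T) (FF : Filter A) (k l : T -> R[i]) a b :
  k @ A --> a -> l @ A --> b -> (fun x => k x + l x) @ A --> a + b.
Proof. exact: cvgD. Qed.

Lemma ccvgM (T : Type) (A : set_system T) (FF : Filter A) (k l : T -> R[i]) a b :
  k @ A --> a -> l @ A --> b -> (fun x => k x * l x) @ A --> a * b.
Proof. exact: cvgM. Qed.

Lemma ccvgV (T : Type) (A : set_system T) (FF : Filter A) (k : T -> R[i]) a :
  a != 0 -> k @ A --> a -> (fun x => (k x)^-1) @ A --> a^-1.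
Proof. exact: cvgV. Qed.

Lemma near_neq0 : \forall h \near (0 : R[i])^', h != 0.
Proof. by apply: filterS (nbhs_dnbhs_neq (0 : R[i])) => h. Qed.

Lemma slope_cvg0 f a d : (f h - a) / h @[h --> 0^'] --> d -> f h @[h --> 0^'] --> a.
Proof.
move=> H.
have id0 : (h : R[i]) @[h --> 0^'] --> (0 : R[i]).
  by apply/cvg_normcP => e e0; apply: filterS (near0c e0) => h; rewrite subr0.
have H2 : (f h - a) / h * h + a @[h --> 0^'] --> d * 0 + a.
  exact: (ccvgD _ (ccvgM _ H id0) (cvg_cst a)).
move: H2; rewrite mulr0 add0r; apply: cvg_trans; apply: near_eq_cvg.
by apply: filterS near_neq0 => h h0 /=; rewrite divfK// subrK.
Qed.

Lemma slope_mul f g a b d e : (f h - a) / h @[h --> 0^'] --> d -> (g h - b) / h @[h --> 0^'] --> e ->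
  (f h * g h - a * b) / h @[h --> 0^'] --> d * b + a * e.
Proof.
move=> Hf Hg; have g0 := slope_cvg0 Hg.
have H2 : (f h - a) / h * g h + a * ((g h - b) / h) @[h --> 0^'] --> d * b + a * e.
  exact: (ccvgD _ (ccvgM _ Hf g0) (ccvgM _ (cvg_cst a) Hg)).
apply: cvg_trans H2; apply: near_eq_cvg.
by apply: filterS near_neq0 => h h0 /=; field.
Qed.

Lemma slope_inv g b e : b != 0 -> (g h - b) / h @[h --> 0^'] --> e ->
  ((g h)^-1 - b^-1) / h @[h --> 0^'] --> e * (- b^-1) * b^-1.
Proof.
move=> b0 Hg; have g0 := slope_cvg0 Hg.
have H2 : (g h - b) / h * (- b^-1) * (g h)^-1 @[h --> 0^'] --> e * (- b^-1) * b^-1.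
  exact: (ccvgM _ (ccvgM _ Hg (cvg_cst (- b^-1))) (ccvgV _ b0 g0)).
apply: cvg_trans H2; apply: near_eq_cvg.
have n0 : 0 < normc b by rewrite lt_def normc_eq0 b0 normcr_ge0.
have /cvg_normcP/(_ _ n0) nb := g0.
have ng : \forall h \near (0 : R[i])^', g h != 0.
  by apply: filterS nb => h H; apply/negP => /eqP E; move: H; rewrite E sub0r normc_opp ltxx.
by apply: filterS2 near_neq0 ng => h h0 gh /=; field; rewrite h0 gh b0.
Qed.

Lemma slope_eq f g a b d : a = b -> (\forall h \near (0 : R[i])^', f h = g h) ->
  (f h - a) / h @[h --> 0^'] --> d -> (g h - b) / h @[h --> 0^'] --> d.
Proof.
move=> -> E; apply: cvg_trans; apply: near_eq_cvg.
by apply: filterS E => h ->.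
Qed.

End slopes.

(** * The Gamma factor on the critical line and its derivative at 1/2 *)

Section gamma_factor.
Context (R : realType) (F : fieldExtType rat) (K0 : fieldType)
  (v : absolute_value R K0) (iota : {rmorphism F -> valued v}).
Local Notation K := (valued v).
Local Notation X := (Xnu v).
Implicit Types (x y t u : K) (chi eta : X) (s h : R[i]) (phi psi : K -> R[i]).
Hypothesis Hc : is_completion iota.
Variables (dx dt : {measure set (borel K) -> \bar R}) (alpha : R).
Variable mu : {measure set (borel X) -> \bar R}.
Variable Gamma : X -> R[i] -> R[i].
Hypothesis Hself : is_self_dual_haar dx.
Hypothesis Hdt : @is_haar R K [set t | t != 0] *%R dt.
Hypothesis Ha : is_alpha dx dt alpha.
Hypothesis Hpl : is_plancherel dt mu.
Hypothesis Hgam : is_gamma dx Gamma.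
Local Notation md t := (modulus dx t).
Local Notation fi := (first_isometry dx alpha).
Local Notation sb0 := (@schwartz_bruhat0 R K0 v).
Local Notation mel := (@mellin R K0 v dt).
Local Notation FT := (@fourier R K0 v dx).
Let Hdx : @is_haar R K setT +%R dx. Proof. by case: Hself. Qed.

Lemma rapid_fourier phi : test phi -> rapid dx (FT phi).
Proof. by move=> h; apply: (schwartz_rapid Hc Hdx); exact: (fourier_test Hc Hdx). Qed.

Lemma Re_half (h : R[i]) : complex.Re (2^-1 + h) = 2^-1 + complex.Re h.
Proof.
have -> : 2^-1 = (2^-1)%:C :> R[i] by rewrite fmorphV/= rmorphD.
by rewrite ReD.
Qed.

Lemma zeta_functional chi s phi : 0 < complex.Re s < 1 -> schwartz_bruhat phi ->
  zeta dx (FT phi) chi s = Gamma chi s * zeta dx phi (char_conj chi) (1 - s).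
Proof.
move=> hs sphi; rewrite /zeta (Hgam chi hs sphi); congr (_ * cintegral dx _).
apply/funext => x; rewrite char_conjE char_conjV; congr (_ * cpow _ _ * _).
by ring.
Qed.

Lemma zeta_L1 phi chi h : rapid dx phi -> complex.Re h = 0 ->
  L1 dx (fun x : borel K => chi x * cpow (md x) (2^-1 + h - 1) * phi x).
Proof.
move=> rphi h0; have [mphi _] := rphi.
have a1 : -1 < (- 2^-1 : R) < 2 by apply/andP; split; lra.
have Lr := L1_integrable_normc (rapid_L1 Hc Hdx rphi a1).
have E : (fun x : borel K => chi x * cpow (md x) (2^-1 + h - 1) * phi x) =
    fun x : borel K => (md x `^ (- 2^-1))%:C * (cexp h (ln (md x)) * phi x * chi x).
  by apply/funext => x; exact: (zeta_integrandE Hc Hdx).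
rewrite E; apply: (L1_le _ Lr) => [|x].
  apply: cmeasM; first by apply: cmeas_real; exact: (measurable_modulus_powR Hc Hdx).
  by apply: cmeasM; [apply: cmeasM => //; exact: (cmeas_cexp Hc Hdx)|exact: char_cmeas].
have nce r : normc (cexp h r) = 1 by rewrite /cexp h0 mul0r expR0 mul1r normc_expi.
rewrite normc_mul [leRHS]normc_mul; apply: ler_wpM2l; first exact: normcr_ge0.
rewrite 2!normc_mul nce mul1r; apply: ler_piMr; first exact: normcr_ge0.
exact: normc_char_le.
Qed.

Lemma zeta_reflect phi chi h : rapid dx phi -> complex.Re h = 0 ->
  zeta dx (fun x => phi (- x)) chi (2^-1 + h) = chi (-1) * zeta dx phi chi (2^-1 + h).
Proof.
move=> rphi h0; have L := zeta_L1 chi rphi h0; rewrite /zeta.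
rewrite -cintegralZ//; rewrite -(preserves_cintegral (dx_opp Hc Hdx) (L1Z _ L)).
congr (cintegral dx _); apply/funext => x /=.
have -> : md (- x) = md x by rewrite (modulusN Hc Hdx).
have -> : chi (- x) = chi (-1) * chi x by rewrite -charM mulN1r.
have -> : chi (-1) * (chi (-1) * chi x * cpow (md x) (2^-1 + h - 1) * phi (- x)) =
  (chi (-1) * chi (-1)) * (chi x * cpow (md x) (2^-1 + h - 1) * phi (- x)) by ring.
by rewrite -charM mulrNN mulr1 char1 mul1r.
Qed.

Lemma zeta_conj phi chi h : rapid dx phi -> complex.Re h = 0 ->
  (zeta dx phi chi (2^-1 + h))^* = zeta dx (fun x => (phi x)^*) (char_conj chi) (2^-1 - h).
Proof.
move=> rphi h0; rewrite /zeta -cintegral_conj; last exact: zeta_L1.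
congr (cintegral dx _); apply/funext => x.
have hN : complex.Re (- h) = 0 by rewrite ReN h0 oppr0.
have -> := zeta_integrandE Hc Hdx phi chi h x.
have -> := zeta_integrandE Hc Hdx (fun x => (phi x)^*) (char_conj chi) (- h) x.
rewrite char_conjE.
have -> : cexp (- h) (ln (md x)) = (cexp h (ln (md x)))^*.
  rewrite /cexp h0 hN mul0r expR0 !mul1r ImN mulNr; apply: complex_eq.
    by rewrite Re_conj /= cosN.
  by rewrite Im_conj /= sinN.
by apply: complex_eq; rewrite ?(Re_conj, Im_conj, ReM, ImM) /= ?(Re_conj, Im_conj); ring.
Qed.

Lemma char_sign_sqr chi : chi (-1) * chi (-1) = 1.
Proof. by rewrite -charM mulrNN mulr1 char1. Qed.

Lemma char_sign_conj chi : (char_conj chi) (-1) = chi (-1).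
Proof.
rewrite char_conjE -charV; congr (chi _).
by rewrite invrN invr1.
Qed.

Lemma gamma_norm chi h (b : K -> R) : complex.Re h = 0 -> test (fun x => (b x)%:C) ->
  zeta dx (fun x => (b x)%:C) (char_conj chi) (2^-1 - h) != 0 ->
  Gamma chi (2^-1 + h) * (Gamma chi (2^-1 + h))^* = 1.
Proof.
move=> h0 tb z0; set phi := fun x => (b x)%:C in tb z0.
have hN : complex.Re (- h) = 0 by rewrite ReN h0 oppr0.
have half1 (k : R[i]) : 1 - (2^-1 + k) = 2^-1 - k :> R[i] by field.
have st (k : R[i]) : complex.Re k = 0 -> 0 < complex.Re (2^-1 + k) < 1.
  by move=> k0; rewrite Re_half k0 addr0; apply/andP; split; lra.
have sF := fourier_test Hc Hdx Hself tb; have rb := schwartz_rapid Hc Hdx tb.1.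
have rF := schwartz_rapid Hc Hdx sF.
have e1 := zeta_functional chi (st h h0) tb.1.
have e2 := zeta_functional (char_conj chi) (st (- h) hN) sF.
have e3 := zeta_functional (char_conj chi) (st (- h) hN) tb.1.
rewrite half1 in e1; rewrite half1 opprK char_conjK in e2; rewrite half1 opprK char_conjK in e3.
have FF : FT (FT phi) = fun x => phi (- x).
  by apply/funext => x; exact: (fourier_fourier _ Hself tb.1).
rewrite FF (zeta_reflect _ rb hN) char_sign_conj e1 mulrA in e2.
(* First relation: two applications of the functional equation give the reflection, which multiplies
   the zeta integral by chi(-1). *)
have g1 : chi (-1) = Gamma (char_conj chi) (2^-1 - h) * Gamma chi (2^-1 + h).
  exact: (mulIf z0 e2).
have phiR : (fun x => (phi x)^*) = phi.
  by apply/funext => x; apply: complex_eq; rewrite /= ?oppr0.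
(* Second relation: phi is real and Re h = 0, so conjugation replaces chi by its conjugate and h by
   -h. Compared with the functional equation at these parameters, it expresses the conjugate of
   Gamma(chi, 1/2 + h) as chi(-1) times Gamma of the conjugate character at 1/2 - h. *)
have c1 : (zeta dx (FT phi) chi (2^-1 + h))^* = chi (-1) * zeta dx (FT phi) (char_conj chi) (2^-1 - h).
  rewrite (zeta_conj _ rF h0).
  have -> : (fun x => (FT phi x)^*) = fun x => FT phi (- x).
    apply/funext => x; rewrite (fourier_conj Hc _ (test_L1 Hc Hdx tb)); congr (FT _ _).
    exact: phiR.
  by have := @zeta_reflect (FT phi) (char_conj chi) (- h) rF hN; rewrite char_sign_conj.
have c2 : (zeta dx phi (char_conj chi) (2^-1 - h))^* = zeta dx phi chi (2^-1 + h).
  by rewrite (zeta_conj _ rb hN) opprK char_conjK phiR.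
have z1 : zeta dx phi chi (2^-1 + h) != 0 by rewrite -c2 -normc_eq0 normc_conj normc_eq0.
move: c1; rewrite e1 e3.
have -> : (Gamma chi (2^-1 + h) * zeta dx phi (char_conj chi) (2^-1 - h))^* =
   (Gamma chi (2^-1 + h))^* * (zeta dx phi (char_conj chi) (2^-1 - h))^* by exact: rmorphM.
move=> c3; have : (Gamma chi (2^-1 + h))^* * zeta dx phi chi (2^-1 + h) = chi (-1) * Gamma (char_conj chi) (2^-1 - h) * zeta dx phi chi (2^-1 + h).
  by apply: (etrans _ (etrans c3 (mulrA _ _ _))); congr (_ * _); exact: esym c2.
move=> /(mulIf z1) ->.
by rewrite mulrCA [Gamma chi _ * _]mulrC -g1 char_sign_sqr.
Qed.

Lemma mellin_zeta phi chi : rapid dx phi -> mel (fi phi) chi = (alpha^-1)%:C * zeta dx phi chi 2^-1.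
Proof.
move=> rphi; rewrite (mellin_first_isometry Hc Hdx Hdt Ha _ rphi); congr (_ * cintegral dx _).
apply/funext => x; have := zeta_integrandE Hc Hdx phi chi 0 x; rewrite addr0 => ->.
by rewrite /cexp !mul0r expR0 mul1r (_ : expi 0 = 1) ?mul1r//; apply: complex_eq; rewrite /= ?cos0 ?sin0.
Qed.

Lemma zeta_bump chi : exists b : K -> R, sb0 (fun x => (b x)%:C) /\
  zeta dx (fun x => (b x)%:C) (char_conj chi) 2^-1 != 0.
Proof.
have [b hb] := bumps_at1 Hc; have [n] := mellin_bump_neq0 Hc Hdx Hdt Ha hb (char_conj chi).
have [sb _ _ _] := hb n; rewrite mellin_zeta; last exact: (sb0_rapid Hc Hdx).
by rewrite mulf_eq0 negb_or => /andP[_ z0]; exists (b n).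
Qed.

Lemma sb0_test phi : sb0 phi -> test phi.
Proof. by case. Qed.

(** The factor c is 1 or -1 in use: the functional equation pairs s = 1/2 + h with 1 - s = 1/2 -
    h. *)
Lemma zeta_cvg phi chi (c : R[i]) : rapid dx phi -> normc c = 1 ->
  (zeta dx phi chi (2^-1 + c * h) - zeta dx phi chi 2^-1) / h @[h --> 0^'] --> c * zeta' dx phi chi.
Proof.
move=> rphi c1; have [M M0 hM] := zeta_diff Hc Hdx chi rphi.
apply/cvg_normcP => e e0.
have M1 : 0 < M + 1 by rewrite ltr_wpDl.
have d0 : 0 < Num.min 8^-1 (e / (M + 1)) by rewrite lt_min invr_gt0 ltr0n divr_gt0.
have nz : \forall h \near (0 : R[i])^', h != 0 by exact: nbhs_dnbhs_neq.
near=> h.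
have h0 : h != 0 by near: h.
have : normc h < Num.min 8^-1 (e / (M + 1)) by near: h; exact: near0c.
rewrite lt_min ltr_pdivlMr// => /andP[h1 h2].
have nh : 0 < normc h by rewrite lt_def normc_eq0 h0 normcr_ge0.
have nch : normc (c * h) = normc h by rewrite normc_mul c1 mul1r.
have h1' : normc (c * h) <= 8^-1 by rewrite nch ltW.
have := hM _ h1'; rewrite nch => H.
have -> : (zeta dx phi chi (2^-1 + c * h) - zeta dx phi chi 2^-1) / h - c * zeta' dx phi chi =
   (zeta dx phi chi (2^-1 + c * h) - zeta dx phi chi 2^-1 - c * h * zeta' dx phi chi) / h.
  by rewrite [RHS]mulrBl; congr (_ - _); rewrite mulrAC mulfK//.
rewrite normc_mul.
have -> : normc h^-1 = (normc h)^-1.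
  apply: (mulfI (lt0r_neq0 nh)); rewrite -normc_mul divff// divff; last by rewrite gt_eqF.
  by have := normc_real (1 : R); rewrite normr1.
apply: (@le_lt_trans _ _ (M * normc h ^+ 2 * (normc h)^-1)).
  by apply: ler_wpM2r H; rewrite invr_ge0 ltW.
rewrite expr2 mulrA mulfK ?gt_eqF//.
by apply: le_lt_trans h2; rewrite mulrC; apply: ler_wpM2l; [exact: ltW|rewrite lerDl].
Unshelve. all: by end_near.
Qed.

Lemma zeta_cvg0 phi chi (c : R[i]) : rapid dx phi -> normc c = 1 ->
  zeta dx phi chi (2^-1 + c * h) @[h --> 0^'] --> zeta dx phi chi 2^-1.
Proof.
by move=> rphi c1; exact: (slope_cvg0 (f := fun h => zeta dx phi chi (2^-1 + c * h)) (@zeta_cvg phi chi c rphi c1)).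
Qed.

Lemma near_strip : \forall h \near (0 : R[i])^', 0 < complex.Re (2^-1 + h) < 1.
Proof.
have h4 : 0 < 4^-1 :> R by rewrite invr_gt0.
apply: filterS (near0c h4) => h hh; have := le_lt_trans (Re_le_normc h) hh.
by rewrite Re_half ltr_norml => /andP[h1 h2]; apply/andP; split; lra.
Qed.

Lemma normc1 : normc (1 : R[i]) = 1.
Proof. by have := normc_real (1 : R); rewrite normr1. Qed.

Lemma normcN1 : normc (- 1 : R[i]) = 1.
Proof. by rewrite normc_opp normc1. Qed.

Lemma gamma_zeta_near chi phi : schwartz_bruhat phi -> \forall h \near (0 : R[i])^',
  zeta dx (FT phi) chi (2^-1 + 1 * h) = Gamma chi (2^-1 + h) * zeta dx phi (char_conj chi) (2^-1 + -1 * h).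
Proof.
move=> sphi; apply: filterS near_strip => h /(zeta_functional chi) /(_ sphi).
by rewrite mul1r mulN1r => ->; congr (_ * zeta _ _ _ _); field.
Qed.

Lemma gamma_zeta_half chi phi : schwartz_bruhat phi ->
  zeta dx (FT phi) chi 2^-1 = Gamma chi 2^-1 * zeta dx phi (char_conj chi) 2^-1.
Proof.
move=> sphi; have hs : 0 < complex.Re (2^-1 : R[i]) < 1.
  by have := Re_half 0; rewrite addr0 /= addr0 => ->; apply/andP; split; lra.
by rewrite (zeta_functional chi hs sphi); congr (_ * zeta _ _ _ _); field.
Qed.

Definition gamma_slope chi h := (Gamma chi (2^-1 + h) - Gamma chi 2^-1) / h.

(** Near 1/2 Gamma is a quotient of two zeta integrals, both differentiable there by [zeta_diff]; a
    bump adapted to chi keeps the denominator away from 0. *)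
Lemma gamma_slope_cvg chi : exists G1 : R[i], gamma_slope chi h @[h --> 0^'] --> G1.
Proof.
have [b [sb z0]] := zeta_bump chi; set phi := fun x => (b x)%:C in sb z0.
have tb := sb0_test sb; have rb := sb0_rapid Hc Hdx sb; have rF := rapid_fourier tb.
have cQ := @zeta_cvg (FT phi) chi 1 rF normc1.
have cP := @zeta_cvg phi (char_conj chi) (-1) rb normcN1.
have cP0 := @zeta_cvg0 phi (char_conj chi) (-1) rb normcN1.
have E := @gamma_zeta_near chi phi tb.1.
have E0 := gamma_zeta_half chi tb.1.
move: (1 * zeta' dx (FT phi) chi) (-1 * zeta' dx phi (char_conj chi)) cQ cP => dQ dP.
pose Q h := zeta dx (FT phi) chi (2^-1 + 1 * h); pose P h := zeta dx phi (char_conj chi) (2^-1 + -1 * h).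
have {}E : \forall h \near (0 : R[i])^', Q h = Gamma chi (2^-1 + h) * P h by exact: E.
move: E0 z0 cP0.
move: (zeta dx (FT phi) chi 2^-1) (zeta dx phi (char_conj chi) 2^-1) => q p E0 z0 cP0 cQ cP.
exists (dQ * p^-1 + q * (dP * (- p^-1) * p^-1)).
have H := slope_mul (f := Q) cQ (slope_inv (g := P) z0 cP).
have p0 : 0 < normc p by rewrite lt_def normc_eq0 z0 normcr_ge0.
have /cvg_normcP/(_ _ p0) nP := cP0.
have e0 : q * p^-1 = Gamma chi 2^-1 by rewrite E0 mulfK.
have e1 : \forall h \near (0 : R[i])^', Q h * (P h)^-1 = Gamma chi (2^-1 + h); last exact: (slope_eq e0 e1 H).
near=> h.
have e : Q h = Gamma chi (2^-1 + h) * P h by near: h.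
have Ph : P h != 0.
  apply/negP => /eqP Eh; have : normc (P h - p) < normc p by near: h.
  by rewrite Eh sub0r normc_opp ltxx.
by rewrite e mulfK.
Unshelve. all: by end_near.
Qed.

Lemma gamma_slope_derive chi : gamma_slope chi h @[h --> 0^'] --> derive1 (Gamma chi) 2^-1.
Proof.
have [G1 hG] := gamma_slope_cvg chi.
rewrite (_ : derive1 (Gamma chi) 2^-1 = G1)//.
rewrite /derive1; apply: cvg_lim; first exact: norm_hausdorff.
apply: cvg_trans hG; apply: near_eq_cvg; apply: nearW => h /=.
by rewrite /gamma_slope [h + _]addrC mulrC.
Qed.

Lemma gamma_leibniz chi psi : schwartz_bruhat psi -> rapid dx (FT psi) ->
  zeta' dx (FT psi) chi = derive1 (Gamma chi) 2^-1 * zeta dx psi (char_conj chi) 2^-1 -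
    Gamma chi 2^-1 * zeta' dx psi (char_conj chi).
Proof.
move=> spsi rF; have rb := schwartz_rapid Hc Hdx spsi.
have cQ := @zeta_cvg (FT _) chi 1 rF normc1; have cP := @zeta_cvg _ (char_conj chi) (-1) rb normcN1.
have cP0 := @zeta_cvg0 _ (char_conj chi) (-1) rb normcN1.
have E1 := @gamma_zeta_near chi psi spsi; have E0 := gamma_zeta_half chi spsi.
have c2 := slope_mul (f := fun h => Gamma chi (2^-1 + h)) (@gamma_slope_derive chi) cP.
have hH : hausdorff_space R[i] by exact: norm_hausdorff.
have := cvg_unique hH (slope_eq E0 E1 cQ) c2; rewrite mul1r => ->.
by rewrite mulN1r mulrN.
Qed.

Lemma gamma_half_norm chi : Gamma chi 2^-1 * (Gamma chi 2^-1)^* = 1.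
Proof.
have [b [sb z0]] := zeta_bump chi.
have := @gamma_norm chi 0 b erefl (sb0_test sb); rewrite addr0 subr0; exact.
Qed.

Lemma normc_gamma_half chi : normc (Gamma chi 2^-1) = 1.
Proof.
have := congr1 (@normc R) (gamma_half_norm chi); rewrite normc_mul normc_conj normc1 -expr2.
by move/eqP; rewrite sqrf_eq1 => /orP[/eqP//|/eqP h]; have := normcr_ge0 (Gamma chi 2^-1); rewrite h; lra.
Qed.

(* Gamma(1/2+it)/Gamma(1/2) = 1 + it w lies on the unit circle, with w close to Gamma'/Gamma: so 2 Im w = t |w|^2 tends to 0. *)
Lemma Lambda_real chi : (Lambda Gamma chi 2^-1)^* = Lambda Gamma chi 2^-1.
Proof.
set L := derive1 (Gamma chi) 2^-1 / Gamma chi 2^-1.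
have g0 : Gamma chi 2^-1 != 0 by rewrite -normc_eq0 normc_gamma_half oner_eq0.
suff L0 : complex.Im L = 0.
  have -> : Lambda Gamma chi 2^-1 = - L by [].
  apply: complex_eq; first by rewrite Re_conj.
  by rewrite Im_conj ImN L0 !oppr0.
have [b [sb z0]] := zeta_bump chi; set phi := fun x => (b x)%:C in sb z0.
have rb := sb0_rapid Hc Hdx sb.
have cL : gamma_slope chi h / Gamma chi 2^-1 @[h --> 0^'] --> L.
  by apply: cvgM; [exact: gamma_slope_derive|exact: cvg_cst].
have p0 : 0 < normc (zeta dx phi (char_conj chi) 2^-1) by rewrite lt_def normc_eq0 z0 normcr_ge0.
have /cvg_normcP/(_ _ p0) nP := @zeta_cvg0 _ (char_conj chi) (-1) rb normcN1.
apply/eqP; rewrite -normr_eq0 eq_le normr_ge0 andbT; apply/ler_addgt0Pr => e e0; rewrite add0r.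
pose A := normc L + 1; have A0 : 0 < A by rewrite ltr_wpDl ?normcr_ge0.
have e2 : 0 < Num.min 1 (e / 2) by rewrite lt_min ltr01 divr_gt0.
have /cvg_normcP/(_ _ e2) nL := cL.
have [d d0 hd] : exists2 d : R, 0 < d & forall h : R[i], h != 0 -> normc h < d ->
   normc (zeta dx phi (char_conj chi) (2^-1 + -1 * h) - zeta dx phi (char_conj chi) 2^-1) <
     normc (zeta dx phi (char_conj chi) 2^-1) /\
   normc (gamma_slope chi h / Gamma chi 2^-1 - L) < Num.min 1 (e / 2).
  have : \forall h \near (0 : R[i])^', normc (zeta dx phi (char_conj chi) (2^-1 + -1 * h) - zeta dx phi (char_conj chi) 2^-1) <
     normc (zeta dx phi (char_conj chi) 2^-1) /\
   normc (gamma_slope chi h / Gamma chi 2^-1 - L) < Num.min 1 (e / 2) by exact: filterI.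
  rewrite near_withinE => /nbhs_ballP[k /= k0 hk].
  move: k0; rewrite ltcE => /andP[/eqP/= ik rk]; exists (complex.Re k) => // h h0 hh.
  apply: hk => //=; have -> : k = (complex.Re k)%:C by apply: complex_eq.
  by rewrite -ball_normE /= sub0r normr_normc ltcR normc_opp.
(* t < d keeps h = it where w is close to L and the zeta integral does not vanish; t < e / A^2 makes
   t |w|^2 at most e. *)
pose t := Num.min d (e / A ^+ 2) / 2.
have A2 : 0 < A ^+ 2 by rewrite exprn_gt0.
have m0 : 0 < Num.min d (e / A ^+ 2) by rewrite lt_min d0 divr_gt0.
have t0 : 0 < t by rewrite divr_gt0.
have : t < Num.min d (e / A ^+ 2) by rewrite /t; lra.
rewrite lt_min ltr_pdivlMr// => /andP[td te].
pose h : R[i] := 0 +i* t.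
have hE : h = (0 +i* 1) * t%:C by apply: complex_eq; rewrite ?(ReM, ImM) /=; ring.
have nh : normc h = t.
  by rewrite /h /normc expr0n add0r sqrtr_sqr gtr0_norm.
have h0 : h != 0 by rewrite -normc_eq0 nh gt_eqF.
have [H1 H2] := hd h h0 ltac:(by rewrite nh).
have z1 : zeta dx phi (char_conj chi) (2^-1 - h) != 0.
  apply/negP => /eqP E; move: H1; rewrite mulN1r E sub0r normc_opp ltxx//.
have q1 := @gamma_norm chi h b erefl (sb0_test sb) z1.
set w := gamma_slope chi h / Gamma chi 2^-1 in H2.
have qE : Gamma chi (2^-1 + h) = Gamma chi 2^-1 * (1 + h * w).
  by rewrite /w /gamma_slope; field; rewrite g0 h0.
have n1 : normc (1 + h * w) ^+ 2 = 1.
  have : normc (Gamma chi (2^-1 + h)) = 1.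
    have := congr1 (@normc R) q1; rewrite normc_mul normc_conj normc1 -expr2.
    by move/eqP; rewrite sqrf_eq1 => /orP[/eqP//|/eqP k]; have := normcr_ge0 (Gamma chi (2^-1 + h)); rewrite k; lra.
  by rewrite qE normc_mul normc_gamma_half mul1r => ->; rewrite expr1n.
move: H2; rewrite lt_min => /andP[H2 H3].
have wA : normc w <= A.
  by rewrite -[w](subrK L) /A [normc L + 1]addrC; apply: le_trans (normc_add _ _) _; rewrite lerD2r ltW.
have imw : 2 * complex.Im w = t * normc w ^+ 2.
  move: n1; rewrite !normcE2 !(ReD, ImD, ReM, ImM) /= !mul0r => n1.
  apply: (mulfI (lt0r_neq0 t0)); lra.
have i1 : `|complex.Im w| <= e / 2.
  have : t * normc w ^+ 2 <= e.
    apply: le_trans (ltW te); rewrite ler_wpM2l ?(ltW t0)// lerXn2r ?nnegrE ?normcr_ge0//; exact: ltW.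
  have : 0 <= t * normc w ^+ 2 by rewrite mulr_ge0 ?sqr_ge0 ?ltW.
  rewrite -imw => q2 q3; rewrite ger0_norm; lra.
have i2 : `|complex.Im (w - L)| <= e / 2 by apply: le_trans (Im_le_normc _) (ltW H3).
have -> : complex.Im L = complex.Im w - complex.Im (w - L) by rewrite ImD ImN; ring.
apply: le_trans (ler_normB _ _) _; lra.
Qed.

End gamma_factor.

(** * Transport under the isometries *)

Section truncation.
Context d (T : measurableType d) (R : realType).
Variable mu : {measure set T -> \bar R}.
Implicit Types (f g h : T -> R[i]) (A : set T).

Lemma cmeas_glue f (A : nat -> set T) (g : nat -> T -> R[i]) : (forall n, measurable (A n)) ->
  (forall x, exists n, A n x) -> (forall n, cmeasurable (g n)) ->
  (forall n x, A n x -> f x = g n x) -> cmeasurable f.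
Proof.
move=> mA cA mg fg.
have H (p : R[i] -> R) : (forall n, measurable_fun setT (fun x => p (g n x))) ->
    measurable_fun setT (fun x => p (f x)).
  move=> mp _ B mB; rewrite setTI.
  have -> : (fun x => p (f x)) @^-1` B = \bigcup_n (A n `&` (fun x => p (g n x)) @^-1` B).
    apply/seteqP; split=> [x /= Bx|x [n _ [/= Ax]]]; last by rewrite -(fg n x Ax).
    by have [n An] := cA x; exists n => //; split => //=; rewrite -(fg n x An).
  apply: bigcup_measurable => n _; apply: measurableI => //.
  by rewrite -[X in measurable X]setTI; exact: mp.
by split; apply: H => n; have [] := mg n.
Qed.

Definition trunc A f x : R[i] := (\1_A x : R)%:C * f x.

Lemma cmeas_trunc A f : measurable A -> cmeasurable f -> cmeasurable (trunc A f).
Proof. by move=> mA mf; apply: cmeasM => //; apply: cmeas_real; exact: measurable_indic. Qed.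

Lemma truncE A f x : A x -> trunc A f x = f x.
Proof. by move=> Ax; rewrite /trunc indicE mem_set// mul1r. Qed.

Lemma normc_trunc A f x : normc (trunc A f x) <= normc (f x).
Proof.
rewrite /trunc indicE; case: (x \in A); first by rewrite mul1r.
by rewrite mul0r normc00 normcr_ge0.
Qed.

Lemma L2_trunc A f : measurable A -> L2 mu f -> L2 mu (trunc A f).
Proof.
move=> mA [mf lf]; have mt := cmeas_trunc mA mf; split=> //.
by apply: le_lt_trans lf; apply: le_sqnorm => // x; exact: normc_trunc.
Qed.

(** On a set of finite measure |f| <= 1 + |f|^2 suffices. *)
Lemma L1_trunc A f : measurable A -> (mu A < +oo)%E -> L2 mu f -> L1 mu (trunc A f).
Proof.
move=> mA fA [mf lf]; apply/L1P; split; first exact: cmeas_trunc.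
have mi : measurable_fun setT (fun x => (\1_A x : R)%:E).
  by apply/measurable_EFinP; exact: measurable_indic.
apply: (@le_lt_trans _ _ (\int[mu]_x ((\1_A x : R)%:E + (normc (f x) ^+ 2)%:E))%E).
  apply: ge0_le_integral => //.
  - by move=> x _; rewrite lee_fin normcr_ge0.
  - by apply: measurable_normE; exact: cmeas_trunc.
  - by apply: emeasurable_funD => //; exact: measurable_sqnormE.
  move=> x _; rewrite -EFinD lee_fin /trunc indicE; have n0 := normcr_ge0 (f x).
  case: (x \in A); last by rewrite mul0r normc00 add0r sqr_ge0.
  rewrite mul1r -[true%:R]/(1 : R); have := sqr_ge0 (normc (f x) - 1); rewrite !expr2; nra.
rewrite ge0_integralD//; [|by move=> x _; exact: sqnormE_ge0|exact: measurable_sqnormE].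
by rewrite integral_indicT// lte_add_pinfty.
Qed.

Lemma cvg_trunc (A : nat -> set T) f : (forall n, measurable (A n)) ->
  {ae mu, forall x, exists N, forall n, (N <= n)%N -> A n x} -> L2 mu f ->
  cvgL2 mu (fun n => trunc (A n) f) f.
Proof.
move=> mA Aae [mf lf].
pose h n x := (normc (trunc (A n) f x - f x) ^+ 2)%:E.
have mh n : measurable_fun setT (h n).
  by apply: measurable_sqnormE; apply: cmeasB => //; exact: cmeas_trunc.
have H1 : {ae mu, forall x, setT x -> h ^~ x @ \oo --> 0%E}.
  apply: filterS Aae => x [N hN] _; apply: cvg_near_cst; exists N => // n /= /hN An.
  by rewrite /h truncE// subrr normc00 expr0n.
have ig : mu.-integrable setT (fun x => (normc (f x) ^+ 2)%:E).
  apply/integrableP; split; first exact: measurable_sqnormE.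
  by under eq_integral do rewrite gee0_abs ?sqnormE_ge0//.
have H2 : {ae mu, forall x n, setT x -> (`|h n x| <= (normc (f x) ^+ 2)%:E)%E}.
  apply: aeW => x n _; rewrite /h gee0_abs ?sqnormE_ge0// lee_fin.
  have -> : trunc (A n) f x - f x = - trunc (~` A n) f x.
    by rewrite /trunc !indicE in_setC; case: (x \in A n) => /=; ring.
  by rewrite normc_opp lerXn2r ?nnegrE ?normcr_ge0// normc_trunc.
have [_ _] := dominated_convergence measurableT mh (measurable_cst 0%E) H1 ig H2.
by rewrite integral0.
Qed.

Lemma sqnorm_tri f g h (a b : R) : cmeasurable f -> cmeasurable g -> cmeasurable h ->
  (sqnormL2 mu (fun x => (f x - g x)%R) <= a%:E)%E -> (sqnormL2 mu (fun x => (g x - h x)%R) <= b%:E)%E ->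
  (sqnormL2 mu (fun x => (f x - h x)%R) <= (2 * a + 2 * b)%:E)%E.
Proof.
move=> mf mg mh fg gh; have H2 : (0 <= 2%:E :> \bar R)%E by rewrite lee_fin.
rewrite EFinD !EFinM; apply: le_trans (sqnormB _ mf mg mh) _.
by apply: leeD; apply: lee_wpmul2l.
Qed.

Lemma sqnorm_near f g (a : R) : cmeasurable f -> cmeasurable g ->
  (sqnormL2 mu (fun x => (f x - g x)%R) <= a%:E)%E ->
  (sqnormL2 mu f <= 2%:E * a%:E + 2%:E * sqnormL2 mu g)%E.
Proof.
move=> mf mg fg; have H2 : (0 <= 2%:E :> \bar R)%E by rewrite lee_fin.
have -> : sqnormL2 mu f = sqnormL2 mu (fun x => ((f x - g x) + g x)%R).
  by congr (sqnormL2 mu _); apply/funext => x; rewrite subrK.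
apply: le_trans (sqnormD _ (cmeasB mf mg) mg) _.
by apply: leeD => //; apply: lee_wpmul2l.
Qed.

Lemma sqnorm_fin f : L2 mu f -> sqnormL2 mu f = (fine (sqnormL2 mu f))%:E.
Proof. by move=> [_ lf]; rewrite fineK// ge0_fin_numE ?sqnorm_ge0. Qed.

End truncation.

(** * Extension of an isometry from the intersection of L1 and L2 *)

Section extension.
Context (R : realType) d1 (T1 : measurableType d1) d2 (T2 : measurableType d2).
Variables (mu1 : {measure set T1 -> \bar R}) (mu2 : {measure set T2 -> \bar R}).
Variable U : (T1 -> R[i]) -> T2 -> R[i].
Implicit Types (f u w : T1 -> R[i]) (g : T2 -> R[i]).
Hypothesis UL2 : forall u, L1 mu1 u -> L2 mu1 u ->
  L2 mu2 (U u) /\ sqnormL2 mu2 (U u) = sqnormL2 mu1 u.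
Hypothesis Ulin : forall (z : R[i]) u w, L1 mu1 u -> L1 mu1 w ->
  U (fun x => z * u x + w x) = fun y => z * U u y + U w y.
Local Notation ext := (extensionL2 mu1 mu2 U).

(** One approximant for each e replaces the sequence in [extensionL2]. In this form closedness of
    the graph is a triangle inequality, and the sequence is recovered by taking e = 1/(n+1). *)
Lemma extP f g : ext f g <-> [/\ L2 mu1 f, L2 mu2 g & forall e : R, 0 < e ->
  exists u, [/\ L1 mu1 u, L2 mu1 u, (sqnormL2 mu1 (fun x => (u x - f x)%R) <= e%:E)%E &
    (sqnormL2 mu2 (fun y => (U u y - g y)%R) <= e%:E)%E]].
Proof.
split=> [[Lf Lg [u [Lu /cvgL2P cu /cvgL2P cU]]]|[Lf Lg H]]; split=> //.
  move=> e e0; have [N1 h1] := cu e e0; have [N2 h2] := cU e e0.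
  exists (u (maxn N1 N2)); have [a b c] := Lu (maxn N1 N2).
  by split=> //; [exact: h1 (leq_maxl _ _)|exact: h2 (leq_maxr _ _)].
have pos n : 0 < n.+1%:R^-1 :> R by rewrite invr_gt0.
pose u n := projT1 (cid (H _ (pos n))).
have hu n := projT2 (cid (H _ (pos n))); rewrite -/(u _) in hu.
exists u; split.
- by move=> n; have [a b _ _] := hu n; split=> //; have [] := UL2 a b.
- by apply: cvgL2_invn => n; have [_ _] := hu n.
- by apply: cvgL2_invn => n; have [_ _] := hu n.
Qed.

Lemma UB u w : L1 mu1 u -> L1 mu1 w -> U (fun x => u x - w x) = fun y => U u y - U w y.
Proof.
move=> Lu Lw; have := @Ulin (-1) w u Lw Lu.
have -> : (fun x => -1 * w x + u x) = (fun x => u x - w x) by apply/funext => x; ring.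
by move=> ->; apply/funext => y; ring.
Qed.

Lemma ext_L1 f : L1 mu1 f -> L2 mu1 f -> ext f (U f).
Proof.
move=> L1f L2f; have [LU _] := UL2 L1f L2f; apply/extP; split=> // e e0; exists f; split=> //.
  have -> : (fun x => f x - f x) = (fun=> 0) by apply/funext => x; rewrite subrr.
  rewrite /sqnormL2; under eq_integral do rewrite normc00 expr0n.
  by rewrite integral0 lee_fin ltW.
have -> : (fun x => U f x - U f x) = (fun=> 0) by apply/funext => x; rewrite subrr.
rewrite /sqnormL2; under eq_integral do rewrite normc00 expr0n.
by rewrite integral0 lee_fin ltW.
Qed.

(** Going from g to U u and from u to f each doubles the squared norm, giving b <= 6e + 4a and, by
    symmetry, a <= 6e + 4b. The constant 4 in place of 1 still yields injectivity and closedness. *)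
Lemma ext_le f g : ext f g ->
  (sqnormL2 mu2 g <= 4%:E * sqnormL2 mu1 f)%E /\ (sqnormL2 mu1 f <= 4%:E * sqnormL2 mu2 g)%E.
Proof.
move=> /extP[Lf Lg H]; have mf := L2_cmeas Lf; have mg := L2_cmeas Lg.
rewrite (sqnorm_fin Lf) (sqnorm_fin Lg); set a := fine _; set b := fine _.
have key (e : R) : 0 < e -> b <= 6 * e + 4 * a /\ a <= 6 * e + 4 * b.
  move=> e0; have [u [L1u L2u uf ug]] := H e e0.
  have [LU eU] := UL2 L1u L2u; have mu := L2_cmeas L2u; have mU := L2_cmeas LU.
  have fu := uf; rewrite (sqnormC _ u f) in fu; have gu := ug; rewrite (sqnormC _ (U u) g) in gu.
  have h1 := sqnorm_near mf mu fu; have h2 := sqnorm_near mg mU gu.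
  have h3 := sqnorm_near mu mf uf; have h4 := sqnorm_near mU mg ug.
  move: h1 h2 h3 h4; rewrite eU (sqnorm_fin Lf) (sqnorm_fin Lg) (sqnorm_fin L2u) -/a -/b.
  by rewrite -!EFinM -!EFinD !lee_fin; split; lra.
rewrite -!EFinM !lee_fin; split; apply/ler_addgt0Pr => e e0;
  (have e6 : 0 < e / 6 by rewrite divr_gt0); have [h1 h2] := key _ e6; lra.
Qed.

Lemma ext_lim f g : L2 mu1 f -> L2 mu2 g -> (forall e : R, 0 < e -> exists f' g',
  [/\ ext f' g', (sqnormL2 mu1 (fun x => (f' x - f x)%R) <= e%:E)%E &
    (sqnormL2 mu2 (fun y => (g' y - g y)%R) <= e%:E)%E]) -> ext f g.
Proof.
move=> Lf Lg H; apply/extP; split=> // e e0.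
have e4 : 0 < e / 4 by rewrite divr_gt0.
have [f' [g' [/extP[Lf' Lg' H'] ff gg]]] := H _ e4.
have [u [L1u L2u uf ug]] := H' _ e4; have [LU _] := UL2 L1u L2u.
exists u; have E : e = 2 * (e / 4) + 2 * (e / 4) by field.
have h1 := sqnorm_tri (L2_cmeas L2u) (L2_cmeas Lf') (L2_cmeas Lf) uf ff.
have h2 := sqnorm_tri (L2_cmeas LU) (L2_cmeas Lg') (L2_cmeas Lg) ug gg.
by rewrite -E in h1 h2; split.
Qed.

Lemma ext_lin (z : R[i]) f g f' g' : ext f g -> ext f' g' ->
  ext (fun x => z * f x + f' x) (fun y => z * g y + g' y).
Proof.
move=> /extP[Lf Lg H] /extP[Lf' Lg' H']; apply/extP.
split; [by apply: L2D => //; exact: L2Z|by apply: L2D => //; exact: L2Z|move=> e e0].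
pose k := 2 * (normc z ^+ 2 + 1); have k0 : 0 < k by rewrite mulr_gt0// ltr_wpDl// sqr_ge0.
have ek : 0 < e / k by rewrite divr_gt0.
have [u [L1u L2u uf ug]] := H _ ek; have [u' [L1u' L2u' uf' ug']] := H' _ ek.
have [LU _] := UL2 L1u L2u; have [LU' _] := UL2 L1u' L2u'.
have est d (T : measurableType d) (m : {measure set T -> \bar R}) (p p' q q' : T -> R[i]) :
    L2 m p -> L2 m p' -> L2 m q -> L2 m q' ->
    (sqnormL2 m (fun x => (p x - q x)%R) <= (e / k)%:E)%E ->
    (sqnormL2 m (fun x => (p' x - q' x)%R) <= (e / k)%:E)%E ->
    (sqnormL2 m (fun x => ((z * p x + p' x) - (z * q x + q' x))%R) <= e%:E)%E.
  move=> Lp Lp' Lq Lq' pq pq'.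
  have -> : (fun x => ((z * p x + p' x) - (z * q x + q' x))%R) =
      fun x => z * (p x - q x) + (p' x - q' x) by apply/funext => x; ring.
  have mpq := L2_cmeas (L2B Lp Lq); have mpq' := L2_cmeas (L2B Lp' Lq').
  apply: le_trans (sqnormD _ (cmeasZ z mpq) mpq') _.
  rewrite (sqnormZ _ z mpq).
  have H2 : (0 <= 2%:E :> \bar R)%E by rewrite lee_fin.
  apply: (@le_trans _ _ (2%:E * ((normc z ^+ 2)%:E * (e / k)%:E) + 2%:E * (e / k)%:E)%E).
    by apply: leeD; apply: lee_wpmul2l => //; apply: lee_wpmul2l => //; exact: sqnormE_ge0.
  rewrite -!EFinM -EFinD lee_fin.
  have -> : 2 * (normc z ^+ 2 * (e / k)) + 2 * (e / k) = k * (e / k) by rewrite /k; ring.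
  by rewrite mulrC divfK// gt_eqF.
exists (fun x => z * u x + u' x); split; [|by apply: L2D => //; exact: L2Z|exact: est|].
  by apply: L1D => //; exact: L1Z.
by rewrite Ulin//; exact: est.
Qed.

(** The images of approximants of f form a Cauchy sequence by the isometry, and Riesz-Fischer gives
    their limit. *)
Lemma ext_exists f : L2 mu1 f -> (forall e : R, 0 < e ->
  exists u, [/\ L1 mu1 u, L2 mu1 u & (sqnormL2 mu1 (fun x => (u x - f x)%R) <= e%:E)%E]) ->
  exists g, ext f g.
Proof.
move=> Lf H.
have pos n : 0 < n.+1%:R^-1 :> R by rewrite invr_gt0.
pose u n := projT1 (cid (H _ (pos n))).
have hu n := projT2 (cid (H _ (pos n))); rewrite -/(u _) in hu.
have LU n : L2 mu2 (U (u n)) by have [a b _] := hu n; have [] := UL2 a b.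
have [|g Lg cg] := riesz_fischer LU.
  move=> e e0; have e4 : 0 < e / 4 by rewrite divr_gt0.
  have [N _ hN] : \forall n \near \oo, (n.+1%:R^-1 : R) < e / 4.
    by have := near_infty_natSinv_lt (PosNum e4).
  exists N => m n Nm Nn; have [a b c] := hu m; have [a' b' c'] := hu n.
  rewrite -UB//; have [_ ->] := UL2 (L1B a a') (L2B b b').
  rewrite (sqnormC _ (u n) f) in c'.
  apply: le_trans (sqnorm_tri (L2_cmeas b) (L2_cmeas Lf) (L2_cmeas b') c c') _.
  by rewrite lee_fin; have := hN m Nm; have := hN n Nn => /=; move: (m.+1%:R^-1) (n.+1%:R^-1) => i j; lra.
exists g; split=> //; exists u; split=> //.
- by move=> n; have [a b _] := hu n.
- by apply: cvgL2_invn => n; have [_ _] := hu n.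
Qed.

End extension.

(** * Measurability of Gamma and Lambda at 1/2 in the character *)

Section gamma_measurable.
Context (R : realType) (F : fieldExtType rat) (K0 : fieldType)
  (v : absolute_value R K0) (iota : {rmorphism F -> valued v}).
Local Notation K := (valued v).
Local Notation X := (Xnu v).
Implicit Types (x y t u : K) (chi eta : X) (s h : R[i]) (phi psi : K -> R[i]).
Hypothesis Hc : is_completion iota.
Variables (dx dt : {measure set (borel K) -> \bar R}) (alpha : R).
Variable mu : {measure set (borel X) -> \bar R}.
Variable Gamma : X -> R[i] -> R[i].
Hypothesis Hself : is_self_dual_haar dx.
Hypothesis Hdt : @is_haar R K [set t | t != 0] *%R dt.
Hypothesis Ha : is_alpha dx dt alpha.
Hypothesis Hpl : is_plancherel dt mu.
Hypothesis Hgam : is_gamma dx Gamma.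
Local Notation md t := (modulus dx t).
Local Notation lmd x := (ln (md x))%:C.
Local Notation fi := (first_isometry dx alpha).
Local Notation sb0 := (@schwartz_bruhat0 R K0 v).
Local Notation mel := (@mellin R K0 v dt).
Local Notation FT := (@fourier R K0 v dx).
Let Hdx : @is_haar R K setT +%R dx. Proof. by case: Hself. Qed.

Lemma log_first_isometry phi : rapid dx phi ->
  L1 dt (fi (fun x => lmd x * phi x) : borel K -> R[i]) /\
  L2 dt (fi (fun x => lmd x * phi x) : borel K -> R[i]).
Proof.
move=> rphi; have a34 : -3/4 <= (- 2^-1 : R) <= 0 by apply/andP; split; lra.
have n1 (x : borel K) : normc (1 : R[i]) <= 1 by rewrite normc1.
have := L1_log Hc Hdx rphi a34 (cmeas_cst (borel K) (1 : R[i])) n1.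
have -> : (fun x : borel K => (md x `^ (- 2^-1))%:C * (lmd x * phi x * 1)) =
  fun x : borel K => (md x `^ (- 2^-1))%:C * (lmd x * phi x) by apply/funext => x; rewrite mulr1.
move=> L1l; have L2l := L2_log Hc Hdx rphi.
split; last exact: (L2_first_isometry Hc Hdx Hdt Ha L2l).
exact: (L1_first_isometry Hc Hdx Hdt Ha (L2_cmeas L2l) L1l).
Qed.

Lemma mellin_log phi chi : rapid dx phi ->
  mel (fi (fun x => lmd x * phi x)) chi = (alpha^-1)%:C * zeta' dx phi chi.
Proof.
move=> rphi; have a34 : -3/4 <= (- 2^-1 : R) <= 0 by apply/andP; split; lra.
have L1l := L1_log Hc Hdx rphi a34 (char_cmeas chi) (normc_char_le chi).
have L2l := L2_log Hc Hdx rphi.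
exact: (cintegral_first_isometry Hc Hdx Hdt Ha (L2_cmeas L2l) (char_cmeas chi) L1l).
Qed.

(** Measurability in chi is read off Plancherel's statement: the Mellin transform is in L2, which
    includes measurability, and the zeta integral differs from it by the factor alpha. *)
Lemma zeta'_cmeas phi : rapid dx phi -> cmeasurable (fun chi : borel X => zeta' dx phi chi).
Proof.
move=> rphi; have [l1 l2] := log_first_isometry rphi.
have [[ml _] _] := mellin_L2 Hpl l1 l2.
have -> : (fun chi : borel X => zeta' dx phi chi) =
    fun chi : borel X => alpha%:C * mel (fi (fun x => lmd x * phi x)) chi.
  apply/funext => chi; rewrite (mellin_log _ rphi) mulrA -rmorphM /= divff ?mul1r//.
  by have [a0 _] := Ha; rewrite gt_eqF.
exact: cmeasZ.
Qed.

Lemma zeta_half_cmeas phi : rapid dx phi -> cmeasurable (fun chi : borel X => zeta dx phi chi 2^-1).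
Proof.
move=> rphi; have [l1 l2] := rapid_first_isometry Hc Hdx Hdt Ha rphi.
have [[ml _] _] := mellin_L2 Hpl l1 l2.
have -> : (fun chi : borel X => zeta dx phi chi 2^-1) = fun chi : borel X => alpha%:C * mel (fi phi) chi.
  apply/funext => chi; rewrite (mellin_zeta Hc Hself Hdt Ha _ rphi) mulrA -rmorphM /= divff ?mul1r//.
  by have [a0 _] := Ha; rewrite gt_eqF.
exact: cmeasZ.
Qed.

Lemma cmeas_char_conj (f : X -> R[i]) : cmeasurable (f : borel X -> R[i]) ->
  cmeasurable (fun chi : borel X => f (char_conj chi)).
Proof. by move=> mf; exact: (cmeas_comp (measurable_char_conj Hc) mf). Qed.

(** The bumps at 1 give countably many measurable sets of characters, on each of which a fixed zeta
    integral does not vanish; they cover [Xnu], and on each f has a measurable formula. *)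
Lemma gamma_glue (f : X -> R[i]) (g : (K -> R[i]) -> X -> R[i]) :
  (forall phi, test phi -> cmeasurable (g phi : borel X -> R[i])) ->
  (forall phi chi, test phi -> zeta dx phi (char_conj chi) 2^-1 != 0 -> f chi = g phi chi) ->
  cmeasurable (f : borel X -> R[i]).
Proof.
move=> mg fg; have [b hb] := bumps_at1 Hc.
pose phi n := fun x => (b n x)%:C : R[i].
have sb n : sb0 (phi n) by have [] := hb n.
have rb n := sb0_rapid Hc Hdx (sb n).
have mz n := cmeas_char_conj (zeta_half_cmeas (rb n)).
pose A n : set (borel X) := [set chi : borel X | zeta dx (phi n) (char_conj (chi : X)) 2^-1 != 0].
apply: (@cmeas_glue _ (borel X) R f A (fun n => g (phi n) : borel X -> R[i])) => [n|chi|n|n chi Achi].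
- have -> : A n = (fun chi : borel X => normc (zeta dx (phi n) (char_conj (chi : X)) 2^-1)) @^-1` (~` [set 0]).
    apply/seteqP; split=> [chi Achi|chi /eqP]; last by rewrite normc_eq0.
    by apply/eqP; rewrite normc_eq0.
  rewrite -[X in measurable X]setTI; apply: (measurable_normc (mz n)) => //.
  by apply: measurableC; exact: measurable_set1.
- have [n] := mellin_bump_neq0 Hc Hdx Hdt Ha hb (char_conj chi).
  rewrite (mellin_zeta Hc Hself Hdt Ha _ (rb n)) mulf_eq0 negb_or => /andP[_ z0].
  by exists n.
- by apply: mg; exact: sb0_test.
- by apply: fg => //; exact: sb0_test.
Qed.

Lemma gamma_half_cmeas : cmeasurable (fun chi : borel X => Gamma chi 2^-1).
Proof.
apply: (@gamma_glue _ (fun phi chi => zeta dx (FT phi) chi 2^-1 * (zeta dx phi (char_conj chi) 2^-1)^-1)) => [phi tphi|phi chi tphi z0].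
  apply: cmeasM; first by apply: zeta_half_cmeas; exact: (rapid_fourier Hc Hself).
  apply: cmeasV; apply: (cmeas_char_conj (f := fun chi => zeta dx phi chi 2^-1)).
  by apply: zeta_half_cmeas; exact: (schwartz_rapid Hc Hdx tphi.1).
by rewrite (gamma_zeta_half Hgam chi tphi.1) mulfK.
Qed.

Lemma Lambda_half_cmeas : cmeasurable (fun chi : borel X => Lambda Gamma chi 2^-1).
Proof.
apply: cmeasN; apply: cmeasM; last by apply: cmeasV; exact: gamma_half_cmeas.
apply: (@gamma_glue _ (fun phi chi => (zeta' dx (FT phi) chi + Gamma chi 2^-1 * zeta' dx phi (char_conj chi)) *
   (zeta dx phi (char_conj chi) 2^-1)^-1)) => [phi tphi|phi chi tphi z0].
  have rF := rapid_fourier Hc Hself tphi; have rb := schwartz_rapid Hc Hdx tphi.1.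
  apply: cmeasM; last first.
    by apply: cmeasV; apply: (cmeas_char_conj (f := fun chi => zeta dx phi chi 2^-1)); exact: zeta_half_cmeas.
  apply: cmeasD; first exact: zeta'_cmeas.
  apply: cmeasM; first exact: gamma_half_cmeas.
  by apply: (cmeas_char_conj (f := fun chi => zeta' dx phi chi)); exact: zeta'_cmeas.
by rewrite (gamma_leibniz Hc Hself Hdt Ha Hgam chi tphi.1 (rapid_fourier Hc Hself tphi)) subrK mulfK.
Qed.

End gamma_measurable.

(** * The composite isometry as a closed injective graph *)

Section isometry_graph.
Context (R : realType) (F : fieldExtType rat) (K0 : fieldType)
  (v : absolute_value R K0) (iota : {rmorphism F -> valued v}).
Local Notation K := (valued v).
Local Notation X := (Xnu v).
Implicit Types (x y t u : K) (chi eta : X) (s h : R[i]) (phi psi : K -> R[i]).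
Implicit Types f g : X -> R[i].
Hypothesis Hc : is_completion iota.
Variables (dx dt : {measure set (borel K) -> \bar R}) (alpha : R).
Variable mu : {measure set (borel X) -> \bar R}.
Hypothesis Hdx : @is_haar R K setT +%R dx.
Hypothesis Hdt : @is_haar R K [set t | t != 0] *%R dt.
Hypothesis Ha : is_alpha dx dt alpha.
Hypothesis Hpl : is_plancherel dt mu.
Local Notation fi := (first_isometry dx alpha).
Local Notation mel := (@mellin R K0 v dt).
Local Notation iso := (Defs.isometry dx dt alpha mu).

Let ML2 (p : borel K -> R[i]) : L1 dt p -> L2 dt p ->
  L2 mu (mel p : borel X -> R[i]) /\ sqnormL2 mu (mel p : borel X -> R[i]) = sqnormL2 dt p.
Proof. exact: (mellin_L2 Hpl). Qed.

Let Mlin (z : R[i]) (p q : borel K -> R[i]) : L1 dt p -> L1 dt q ->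
  mel (fun x => z * p x + q x) = fun chi => z * mel p chi + mel q chi.
Proof.
move=> Lp Lq; apply/funext => chi.
by rewrite (mellinD (f := fun x => z * p x) chi (L1Z z Lp) Lq) (mellinZ z chi Lp).
Qed.

Lemma iso_L2 phi f : iso phi f -> L2 dx (phi : borel K -> R[i]) /\ L2 mu (f : borel X -> R[i]).
Proof. by move=> [Lp [_ Lf _]]. Qed.

Lemma iso_le phi f : iso phi f ->
  (sqnormL2 mu (f : borel X -> R[i]) <= 4%:E * sqnormL2 dx (phi : borel K -> R[i]))%E /\
  (sqnormL2 dx (phi : borel K -> R[i]) <= 4%:E * sqnormL2 mu (f : borel X -> R[i]))%E.
Proof.
move=> [[mphi _] E]; rewrite -(sqnorm_first_isometry Hc Hdx Hdt Ha mphi).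
exact: (ext_le ML2 E).
Qed.

Lemma iso_lin (z : R[i]) phi f psi g : iso phi f -> iso psi g ->
  iso (fun x => z * phi x + psi x) (fun chi => z * f chi + g chi).
Proof.
move=> [Lphi E] [Lpsi E']; split; first by apply: L2D => //; exact: L2Z.
have -> : fi (fun x => z * phi x + psi x) = fun x => z * fi phi x + fi psi x.
  by apply/funext => x; rewrite /first_isometry; ring.
exact: (ext_lin ML2 Mlin z E E').
Qed.

Lemma isoB phi f psi g : iso phi f -> iso psi g ->
  iso (fun x => phi x - psi x) (fun chi => f chi - g chi).
Proof.
move=> h h'; have := iso_lin (-1) h' h.
have -> : (fun x => -1 * psi x + phi x) = (fun x => phi x - psi x) by apply/funext => x; ring.
by have -> : (fun chi => -1 * g chi + f chi) = (fun chi => f chi - g chi) by apply/funext => chi; ring.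
Qed.

Lemma isoD phi f psi g : iso phi f -> iso psi g ->
  iso (fun x => phi x + psi x) (fun chi => f chi + g chi).
Proof.
move=> h h'; have := iso_lin 1 h h'.
have -> : (fun x => 1 * phi x + psi x) = (fun x => phi x + psi x) by apply/funext => x; ring.
by have -> : (fun chi => 1 * f chi + g chi) = (fun chi => f chi + g chi) by apply/funext => chi; ring.
Qed.

Lemma iso_lim phi f : L2 dx (phi : borel K -> R[i]) -> L2 mu (f : borel X -> R[i]) ->
  (forall e : R, 0 < e -> exists phi' f', [/\ iso phi' f',
    (sqnormL2 dx (fun x : borel K => (phi' x - phi x)%R) <= e%:E)%E &
    (sqnormL2 mu (fun chi : borel X => (f' chi - f chi)%R) <= e%:E)%E]) -> iso phi f.
Proof.
move=> Lphi Lf H; split=> //.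
apply: (ext_lim ML2 (L2_first_isometry Hc Hdx Hdt Ha Lphi) Lf) => e e0.
have [phi' [f' [[Lphi' E] pe fe]]] := H e e0; exists (fi phi'), f'; split=> //.
apply: le_trans pe; rewrite -(sqnorm_first_isometry Hc Hdx Hdt Ha (L2_cmeas (L2B Lphi' Lphi))).
rewrite le_eqVlt; apply/orP; left; apply/eqP; congr (sqnormL2 dt _).
by apply/funext => x; rewrite (first_isometryB dx alpha phi' phi x).
Qed.

Lemma iso_ae phi f psi g : iso phi f -> L2 dx (psi : borel K -> R[i]) -> L2 mu (g : borel X -> R[i]) ->
  eqL2 dx (phi : borel K -> R[i]) psi -> eqL2 mu (f : borel X -> R[i]) g -> iso psi g.
Proof.
move=> h Lpsi Lg e1 e2; have [Lphi Lf] := iso_L2 h.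
apply: iso_lim => // e e0; exists phi, f; split=> //.
  by rewrite (sqnormB_eq0 _ (L2_cmeas Lphi) (L2_cmeas Lpsi)).2// lee_fin ltW.
by rewrite (sqnormB_eq0 _ (L2_cmeas Lf) (L2_cmeas Lg)).2// lee_fin ltW.
Qed.

Lemma iso_inj phi psi f : iso phi f -> iso psi f -> eqL2 dx (phi : borel K -> R[i]) psi.
Proof.
move=> h h'; have [Lphi Lf] := iso_L2 h; have [Lpsi _] := iso_L2 h'.
apply/(sqnormB_eq0 _ (L2_cmeas Lphi) (L2_cmeas Lpsi)).
have [_ le] := iso_le (isoB h h'); apply/eqP; rewrite eq_le sqnorm_ge0 andbT.
apply: le_trans le _.
rewrite (sqnormB_eq0 _ (L2_cmeas Lf) (L2_cmeas Lf)).2 ?mule0//.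
exact: aeW.
Qed.

Lemma iso_fun phi f g : iso phi f -> iso phi g -> eqL2 mu (f : borel X -> R[i]) g.
Proof.
move=> h h'; have [Lphi Lf] := iso_L2 h; have [_ Lg] := iso_L2 h'.
apply/(sqnormB_eq0 _ (L2_cmeas Lf) (L2_cmeas Lg)).
have [le _] := iso_le (isoB h h'); apply/eqP; rewrite eq_le sqnorm_ge0 andbT.
apply: le_trans le _.
rewrite (sqnormB_eq0 _ (L2_cmeas Lphi) (L2_cmeas Lphi)).2 ?mule0//.
exact: aeW.
Qed.

Lemma iso_L1 phi : L2 dx (phi : borel K -> R[i]) -> L1 dt (fi phi : borel K -> R[i]) ->
  iso phi (mel (fi phi)).
Proof. by move=> Lphi L1f; split=> //; exact: (ext_L1 ML2 L1f (L2_first_isometry Hc Hdx Hdt Ha Lphi)). Qed.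

Lemma iso_rapid phi : rapid dx phi -> iso phi (mel (fi phi)).
Proof.
by move=> r; apply: iso_L1; [exact: (rapid_L2 Hc Hdx)|exact: (rapid_first_isometry Hc Hdx Hdt Ha r).1].
Qed.

(** Annuli have finite dt measure, so truncating an L2 function to them lands in the intersection of
    L1 and L2, where the Mellin integral is defined. *)
Lemma cvg_annuli (p : borel K -> R[i]) : L2 dt p -> forall e : R, 0 < e ->
  exists q : borel K -> R[i], [/\ L1 dt q, L2 dt q & (sqnormL2 dt (fun x => (q x - p x)%R) <= e%:E)%E].
Proof.
move=> Lp e e0.
pose A (n : nat) : set (borel K) := [set x : K | v x <= n.+1%:R] `&` [set x : K | n.+1%:R^-1 <= v x].
have mA n : measurable (A n) by apply: borel_closed; exact: closed_annulus.
have fA n : (dt (A n) < +oo)%E by apply: (dt_annulus_lty Hc Hdt); rewrite invr_gt0.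
have Aae : {ae dt, forall x : borel K, exists N, forall n, (N <= n)%N -> A n x}.
  apply: filterS (dt_ae_neq0 Hdt) => x x0.
  have vx : 0 < v x by rewrite v_gt0.
  exists (maxn (Num.truncn (v x)) (Num.truncn (v x)^-1)) => n; rewrite geq_max => /andP[n1 n2]; split=> /=.
    by apply/ltW/(lt_le_trans (truncnS_gt _)); rewrite ler_nat ltnS.
  rewrite invf_ple ?posrE//; apply/ltW/(lt_le_trans (truncnS_gt _)).
  by rewrite ler_nat ltnS.
have /cvgL2P/(_ e e0)[N hN] := cvg_trunc mA Aae Lp.
exists (trunc (A N) p); split; [exact: L1_trunc|exact: L2_trunc|exact: hN].
Qed.

Lemma iso_exists phi : L2 dx (phi : borel K -> R[i]) -> exists f, iso phi f.
Proof.
move=> Lphi; have Lf := L2_first_isometry Hc Hdx Hdt Ha Lphi.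
by have [g E] := ext_exists ML2 Mlin Lf (cvg_annuli Lf); exists g.
Qed.

End isometry_graph.

Section transport_theorems.
Context (R : realType) (F : fieldExtType rat) (K0 : fieldType)
  (v : absolute_value R K0) (iota : {rmorphism F -> valued v}).
Local Notation K := (valued v).
Local Notation X := (Xnu v).
Implicit Types (x y t u : K) (chi eta : X) (s h : R[i]) (phi psi : K -> R[i]).
Implicit Types f g : X -> R[i].
Hypothesis Hc : is_completion iota.
Variables (dx dt : {measure set (borel K) -> \bar R}) (alpha : R).
Variable mu : {measure set (borel X) -> \bar R}.
Variable Gamma : X -> R[i] -> R[i].
Hypothesis Hself : is_self_dual_haar dx.
Hypothesis Hdt : @is_haar R K [set t | t != 0] *%R dt.
Hypothesis Ha : is_alpha dx dt alpha.
Hypothesis Hpl : is_plancherel dt mu.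
Hypothesis Hgam : is_gamma dx Gamma.
Local Notation md t := (modulus dx t).
Local Notation lmd x := (ln (md x))%:C.
Local Notation fi := (first_isometry dx alpha).
Local Notation sb0 := (@schwartz_bruhat0 R K0 v).
Local Notation mel := (@mellin R K0 v dt).
Local Notation FT := (@fourier R K0 v dx).
Local Notation iso := (Defs.isometry dx dt alpha mu).
Let Hdx : @is_haar R K setT +%R dx. Proof. by case: Hself. Qed.
Local Notation inv f := (fun chi : X => f (char_conj chi)).
Local Notation fou f := (fun chi : X => Gamma chi 2^-1 * f (char_conj chi)).
Local Notation con f := (fun chi : X => - Lambda Gamma chi 2^-1 * f chi).

(** Both directions of the equivalence follow once A phi is known to correspond to B f: the graph
    respects equality almost everywhere, and the isometry is injective up to it. *)
Lemma transport_graph (D : (K -> R[i]) -> Prop) (A : (K -> R[i]) -> K -> R[i])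
    (B : (X -> R[i]) -> X -> R[i]) : (forall phi, D phi -> L2 dx (phi : borel K -> R[i])) ->
  (forall phi f, D phi -> iso phi f -> iso (A phi) (B f)) ->
  transported dx dt alpha mu D (graphL2 dx A) B.
Proof.
move=> DL H phi Dphi; split; first exact: (iso_exists Hc Hdx Hdt Ha Hpl (DL _ Dphi)).
move=> f psi If; have IA := H _ _ Dphi If; have [LA LB] := iso_L2 IA.
split=> [[Lpsi e]|Ipsi].
  apply: (iso_ae Hc Hdx Hdt Ha Hpl IA Lpsi LB); last exact: aeW.
  by apply: filterS e => x ->.
have [Lpsi _] := iso_L2 Ipsi; split=> //; exact: (iso_inj Hc Hdx Hdt Ha Hpl Ipsi IA).
Qed.

(** sqrt|x| / |x| = sqrt|x^-1|, both sides being 0 at 0. The Inversion thus becomes t -> t^-1 on the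
    multiplicative group, which preserves dt. *)
Lemma first_isometry_inversion phi x : fi (inversion dx phi) x = fi phi x^-1.
Proof.
rewrite /first_isometry /inversion mulrA -rmorphM /= (modulusV Hc Hdx); congr (_%:C * _).
have [->|x0] := eqVneq x 0; first by rewrite (modulus0 Hc Hdx) sqrtr0 invr0 sqrtr0 !mulr0.
have m0 : 0 < md x by rewrite (modulus_gt0 Hc Hdx).
have s0 : Num.sqrt (md x) != 0 by rewrite gt_eqF// sqrtr_gt0.
rewrite sqrtrV ?ltW// -[X in _ * X^-1](sqr_sqrtr (ltW m0)).
by field.
Qed.

Lemma L2_inversion phi : L2 dx (phi : borel K -> R[i]) -> L2 dx (inversion dx phi : borel K -> R[i]).
Proof.
move=> Lphi; have [mphi _] := Lphi.
have mi : cmeasurable (inversion dx phi : borel K -> R[i]).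
  have -> : (inversion dx phi : borel K -> R[i]) = fun x : borel K => ((md x)^-1)%:C * ((phi : borel K -> R[i]) \o (fun x : borel K => x^-1 : borel K)) x by [].
  apply: cmeasM; last by apply: cmeas_comp mphi; case: (dt_inv Hc Hdt).
  apply: cmeas_real; apply: measurable_inv_ge0; first exact: (modulus_ge0 Hc Hdx).
  exact: (measurable_modulus Hc Hdx).
split=> //; rewrite -(sqnorm_first_isometry Hc Hdx Hdt Ha mi).
have [mf lf] := L2_first_isometry Hc Hdx Hdt Ha Lphi.
have -> : (fi (inversion dx phi) : borel K -> R[i]) = (fi phi : borel K -> R[i]) \o (fun x : borel K => x^-1 : borel K).
  by apply/funext => x; exact: first_isometry_inversion.
by rewrite (preserves_sqnorm (dt_inv Hc Hdt) mf).
Qed.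

Lemma mellin_inv (p : borel K -> R[i]) chi : L1 dt p ->
  mel (fun x => p x^-1) chi = mel p (char_conj chi).
Proof.
move=> Lp; have Lc := L1_char (char_conj chi) Lp.
rewrite /mellin -(preserves_cintegral (dt_inv Hc Hdt) Lc); congr (cintegral dt _).
by apply/funext => x /=; rewrite char_conjE -charV invrK.
Qed.

Lemma iso_inversion phi f : iso phi f -> iso (inversion dx phi) (inv f).
Proof.
move=> [Lphi [Lf Lg [u [Lu cu cU]]]].
have pi := dt_inv Hc Hdt; have pc := mu_conj Hc Hdx Hdt Ha Hpl.
have fE : (fi (inversion dx phi) : borel K -> R[i]) = (fi phi : borel K -> R[i]) \o (fun x : borel K => x^-1 : borel K).
  by apply/funext => x; exact: first_isometry_inversion.
split; first exact: L2_inversion.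
split.
- by rewrite fE; exact: (preserves_L2 pi Lf).
- exact: (preserves_L2 pc Lg).
have mE n : (mel (fun x => u n x^-1) : borel X -> R[i]) = (mel (u n) : borel X -> R[i]) \o (fun chi : borel X => char_conj chi : borel X).
  by apply/funext => chi; apply: mellin_inv; have [] := Lu n.
exists (fun n x => u n x^-1); split.
- move=> n; have [a b c] := Lu n; split; [exact: (preserves_L1 pi a)|exact: (preserves_L2 pi b)|].
  by rewrite mE; exact: (preserves_L2 pc c).
- move/cvgL2P : cu => cu; apply/cvgL2P => e e0; have [N hN] := cu e e0; exists N => n /hN.
  have [_ b _] := Lu n; rewrite -(preserves_sqnorm pi (L2_cmeas (L2B b Lf))).
  by rewrite fE.
- move/cvgL2P : cU => cU; apply/cvgL2P => e e0; have [N hN] := cU e e0; exists N => n /hN.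
  have [_ _ c] := Lu n; rewrite -(preserves_sqnorm pc (L2_cmeas (L2B c Lg))).
  by rewrite mE.
Qed.

Lemma unitary_inv : unitaryL2 mu (fun f => inv f).
Proof.
have pc := mu_conj Hc Hdx Hdt Ha Hpl; split=> [//|f Lf|g Lg].
  by split; [exact: (preserves_L2 pc Lf)|exact: (preserves_sqnorm pc (L2_cmeas Lf))].
exists (inv g); first exact: (preserves_L2 pc Lg).
by apply: aeW => chi /=; rewrite char_conjK.
Qed.

Lemma transported_inversion :
  transported dx dt alpha mu (L2 dx) (graphL2 dx (inversion dx)) (fun f => inv f).
Proof. by apply: transport_graph => // phi f _; exact: iso_inversion. Qed.

Let gn chi : normc (Gamma chi 2^-1) = 1.
Proof. exact: (normc_gamma_half Hc Hself Hdt Ha Hgam). Qed.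

Lemma fou_L2 f : L2 mu (f : borel X -> R[i]) ->
  L2 mu (fou f : borel X -> R[i]) /\ sqnormL2 mu (fou f : borel X -> R[i]) = sqnormL2 mu (f : borel X -> R[i]).
Proof.
move=> Lf; have pc := mu_conj Hc Hdx Hdt Ha Hpl.
have [mi li] := preserves_L2 pc Lf; have mG := gamma_half_cmeas Hc Hself Hdt Ha Hpl Hgam.
have E : sqnormL2 mu (fou f : borel X -> R[i]) = sqnormL2 mu (f : borel X -> R[i]).
  rewrite -(preserves_sqnorm pc (L2_cmeas Lf)); apply: eq_integral => chi _.
  by rewrite normc_mul gn mul1r.
split=> //; split; first by apply: cmeasM.
by rewrite E; case: Lf.
Qed.

Lemma fouB_sqnorm f g : L2 mu (f : borel X -> R[i]) -> L2 mu (g : borel X -> R[i]) ->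
  sqnormL2 mu (fun chi : borel X => (fou f chi - fou g chi)%R) = sqnormL2 mu (fun chi : borel X => (f chi - g chi)%R).
Proof.
move=> Lf Lg; have [_ <-] := fou_L2 (L2B Lf Lg); congr (sqnormL2 mu _).
by apply/funext => chi; ring.
Qed.

Lemma unitary_fou : unitaryL2 mu (fun f => fou f).
Proof.
split=> [a f g|f Lf|g Lg]; first by apply/funext => chi; ring.
  exact: fou_L2.
(* The preimage of g: conjugation of characters is an involution, so Gamma is inverted at the
   conjugate character. *)
pose f chi := (Gamma (char_conj chi) 2^-1)^-1 * g (char_conj chi).
have g0 chi : Gamma chi 2^-1 != 0 by rewrite -normc_eq0 gn oner_eq0.
exists f; last by apply: aeW => chi; rewrite /f char_conjK mulrA divff// mul1r.
have pc := mu_conj Hc Hdx Hdt Ha Hpl; have mG := gamma_half_cmeas Hc Hself Hdt Ha Hpl Hgam.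
have [mi li] := preserves_L2 pc Lg.
have mf : cmeasurable (f : borel X -> R[i]).
  by apply: cmeasM => //; apply: (cmeas_char_conj Hc (f := fun chi => (Gamma chi 2^-1)^-1)); exact: cmeasV.
split=> //; apply: le_lt_trans li; apply: le_sqnorm => // chi.
rewrite /f normc_mul (_ : normc (Gamma (char_conj chi) 2^-1)^-1 = 1) ?mul1r//.
have := congr1 (@normc R) (mulfV (g0 (char_conj chi))); rewrite normc_mul gn mul1r => ->.
exact: normc1.
Qed.

Lemma iso_fourier_sb0 phi : sb0 phi -> iso (FT phi) (fou (mel (fi phi))).
Proof.
move=> sb; have tb := sb0_test sb; have rb := sb0_rapid Hc Hdx sb.
have rF := rapid_fourier Hc Hself tb; have := iso_rapid Hc Hdx Hdt Ha Hpl rF.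
suff -> : mel (fi (FT phi)) = fou (mel (fi phi)) by [].
apply/funext => chi; rewrite (mellin_zeta Hc Hself Hdt Ha _ rF) (mellin_zeta Hc Hself Hdt Ha _ rb).
by rewrite (gamma_zeta_half Hgam chi tb.1) mulrCA.
Qed.

(** The operator on the character side preserves the norm; passing through [iso_le] on each side
    costs 4, hence 16. *)
Lemma fourier_sb0_le phi : sb0 phi ->
  (sqnormL2 dx (FT phi : borel K -> R[i]) <= 16%:E * sqnormL2 dx (phi : borel K -> R[i]))%E.
Proof.
move=> sb; have [_ le] := iso_le Hc Hdx Hdt Ha Hpl (iso_fourier_sb0 sb).
have I := iso_rapid Hc Hdx Hdt Ha Hpl (sb0_rapid Hc Hdx sb); have [Lphi Lf] := iso_L2 I.
have [_ E] := fou_L2 Lf; rewrite E in le.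
apply: le_trans le _; have [le2 _] := iso_le Hc Hdx Hdt Ha Hpl I.
have -> : (16%:E = 4%:E * 4%:E :> \bar R)%E by rewrite -EFinM; congr (_%:E); ring.
by rewrite -muleA; apply: lee_wpmul2l => //; rewrite lee_fin.
Qed.

Lemma sb0B phi psi : sb0 phi -> sb0 psi -> sb0 (fun x => phi x - psi x).
Proof.
move=> h h'; have := sb0D Hc h (sb0Z Hc (-1) h').
by have -> : (fun x => phi x + -1 * psi x) = fun x => phi x - psi x by apply/funext => x; ring.
Qed.

Lemma sb0_approx_seq phi : L1 dx (phi : borel K -> R[i]) -> L2 dx (phi : borel K -> R[i]) ->
  exists p : nat -> K -> R[i], (forall n, sb0 (p n)) /\
    forall n, (norm12 dx (fun x : borel K => (phi x - p n x)%R) <= n.+1%:R^-1%:E)%E.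
Proof.
move=> l1 l2; have pos n : 0 < n.+1%:R^-1 :> R by rewrite invr_gt0.
pose H n := cid2 (sb0_dense Hc Hdx l1 l2 (pos n)).
by exists (fun n => s2val (H n)); split=> n; [exact: (s2valP (H n))|exact: (s2valP' (H n))].
Qed.

Lemma fourier_sb0_cvg phi (p : nat -> K -> R[i]) : L1 dx (phi : borel K -> R[i]) ->
  (forall n, sb0 (p n)) ->
  (forall n, (norm12 dx (fun x : borel K => (phi x - p n x)%R) <= n.+1%:R^-1%:E)%E) ->
  forall y (e : R), 0 < e -> exists N, forall n, (N <= n)%N -> normc (FT (p n) y - FT phi y) <= e.
Proof.
move=> l1 sp hp y e e0; have e2 : 0 < e / 2 by rewrite divr_gt0.
have [N _ hN] : \forall n \near \oo, (n.+1%:R^-1 : R) < e / 2.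
  by have := near_infty_natSinv_lt (PosNum e2).
exists N => n Nn; have lp := rapid_L10 Hc Hdx (sb0_rapid Hc Hdx (sp n)).
rewrite -normc_opp opprB -(fourierB Hc y l1 lp) -lee_fin.
apply: le_trans (fourier_bound Hc y (L1B l1 lp)) _.
have H2 : (0 <= 2%:E :> \bar R)%E by rewrite lee_fin.
apply: le_trans (lee_wpmul2l H2 (le_trans (norm1_le12 _ (L1_cmeas (L1B l1 lp))) (hp n))) _.
have := hN n Nn => /=; rewrite -EFinM lee_fin; move: (n.+1%:R^-1) => i; lra.
Qed.

Lemma fourier_sb0_diff phi (p : nat -> K -> R[i]) : L1 dx (phi : borel K -> R[i]) -> L2 dx (phi : borel K -> R[i]) ->
  (forall n, sb0 (p n)) ->
  (forall n, (norm12 dx (fun x : borel K => (phi x - p n x)%R) <= n.+1%:R^-1%:E)%E) ->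
  forall m n, (sqnormL2 dx (fun y : borel K => (FT (p m) y - FT (p n) y)%R) <=
    (32 * m.+1%:R^-1 + 32 * n.+1%:R^-1)%:E)%E.
Proof.
move=> l1 l2 sp hp m n.
have lp k := rapid_L10 Hc Hdx (sb0_rapid Hc Hdx (sp k)).
have mp k : cmeasurable (p k : borel K -> R[i]) := L1_cmeas (lp k).
have h k : (sqnormL2 dx (fun x : borel K => (phi x - p k x)%R) <= k.+1%:R^-1%:E)%E.
  by apply: le_trans (hp k); apply: sqnorm_le12; apply: cmeasB => //; exact: L1_cmeas l1.
have E : (fun y : borel K => FT (p m) y - FT (p n) y) = (FT (fun x => p m x - p n x) : borel K -> R[i]).
  by apply/funext => y; rewrite (fourierB Hc y (lp m) (lp n)).
rewrite E; apply: le_trans (fourier_sb0_le (sb0B (sp m) (sp n))) _.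
have h' := h m; rewrite (sqnormC _ (phi : borel K -> R[i]) (p m)) in h'.
have H16 : (0 <= 16%:E :> \bar R)%E by rewrite lee_fin.
apply: le_trans (lee_wpmul2l H16 (sqnorm_tri (mp m) (L1_cmeas l1) (mp n) h' (h n))) _.
by rewrite -EFinM lee_fin; move: (m.+1%:R^-1) (n.+1%:R^-1) => i j; lra.
Qed.

(** L1 convergence gives pointwise convergence of F p_n to F phi, and the L2 bound on S_0 makes F
    p_n Cauchy in L2. Fatou identifies the two limits: 32/(n+1) + 32/(m+1) is at most 64/(n+1) for m
    >= n. *)
Lemma fourier_lim phi (p : nat -> K -> R[i]) : L1 dx (phi : borel K -> R[i]) -> L2 dx (phi : borel K -> R[i]) ->
  (forall n, sb0 (p n)) ->
  (forall n, (norm12 dx (fun x : borel K => (phi x - p n x)%R) <= n.+1%:R^-1%:E)%E) ->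
  L2 dx (FT phi : borel K -> R[i]) /\
  forall n, (sqnormL2 dx (fun y : borel K => (FT (p n) y - FT phi y)%R) <= (64 * n.+1%:R^-1)%:E)%E.
Proof.
move=> l1 l2 sp hp; have pw := fourier_sb0_cvg l1 sp hp.
have LF n := rapid_L2 Hc Hdx (rapid_fourier Hc Hself (sb0_test (sp n))).
have mF n : cmeasurable (FT (p n) : borel K -> R[i]) := L2_cmeas (LF n).
have cvgr (q : R[i] -> R) (y : K) : (forall z w, `|q z - q w| <= normc (z - w)) ->
    (fun n => q (FT (p n) y)) @ \oo --> q (FT phi y).
  move=> hq; apply/cvgrPdist_le => e e0; have [N hN] := pw y e e0; exists N => // n /= /hN hn.
  by apply: le_trans hn; rewrite distrC.
have hRe (z w : R[i]) : `|complex.Re z - complex.Re w| <= normc (z - w).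
  by rewrite -ReN -ReD Re_le_normc.
have hIm (z w : R[i]) : `|complex.Im z - complex.Im w| <= normc (z - w).
  by rewrite -ImN -ImD Im_le_normc.
have mphi : cmeasurable (FT phi : borel K -> R[i]).
  split.
    apply: (@measurable_fun_cvg _ _ _ _ (fun n (y : borel K) => complex.Re (FT (p n) y))) => [n|y _].
      by have [] := mF n.
    exact: (cvgr (fun z => complex.Re z)).
  apply: (@measurable_fun_cvg _ _ _ _ (fun n (y : borel K) => complex.Im (FT (p n) y))) => [n|y _].
    by have [] := mF n.
  exact: (cvgr (fun z => complex.Im z)).
have est n : (sqnormL2 dx (fun y : borel K => (FT (p n) y - FT phi y)%R) <= (64 * n.+1%:R^-1)%:E)%E.
  apply: (@fatou_le _ _ _ dx (fun m y => (normc (FT (p n) y - FT (p m) y) ^+ 2)%:E) _ _ n).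
  - by move=> m; apply: measurable_sqnormE; exact: cmeasB.
  - by move=> m y; exact: sqnormE_ge0.
  - move=> y; apply/fine_cvgP; split; first exact: nearW.
    rewrite (_ : fine \o _ = fun m => normc (FT (p n) y - FT (p m) y) * normc (FT (p n) y - FT (p m) y)); last first.
      by apply/funext => m /=; rewrite expr2.
    rewrite expr2; have c : (fun m => normc (FT (p n) y - FT (p m) y)) @ \oo --> normc (FT (p n) y - FT phi y).
      apply: (cvgr (fun z => normc (FT (p n) y - z))) => z w.
      have e : z - w = (FT (p n) y - w) - (FT (p n) y - z) by ring.
      rewrite ler_norml; apply/andP; split.
        rewrite lerNl opprB lerBlDr.
        have -> : FT (p n) y - w = (z - w) + (FT (p n) y - z) by ring.
        exact: normc_add.
      rewrite lerBlDr -[normc (z - w)]normc_opp.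
      have {1}-> : FT (p n) y - z = - (z - w) + (FT (p n) y - w) by ring.
      exact: normc_add.
    exact: (cvgM c c).
  move=> m nm; apply: le_trans (fourier_sb0_diff l1 l2 sp hp n m) _.
  rewrite lee_fin; have : (m.+1%:R^-1 : R) <= n.+1%:R^-1 by rewrite lef_pV2 ?posrE// ler_nat ltnS.
  by move: (m.+1%:R^-1) (n.+1%:R^-1) => i j; lra.
split=> //; split=> //.
have h := est 0%N; rewrite (sqnormC _ (FT (p 0%N) : borel K -> R[i]) (FT phi)) in h.
apply: le_lt_trans (sqnorm_near mphi (mF 0%N) h) _.
by rewrite (sqnorm_fin (LF 0%N)) -!EFinM -EFinD ltry.
Qed.

(** The integral formula for F has to be handled on all of L1 and L2 together, not only on S_0: the
    conductor applies it to log|y| F^-1 phi, whose logarithm is singular at 0. *)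
Lemma iso_fourier phi f : L1 dx (phi : borel K -> R[i]) -> iso phi f ->
  iso (FT phi) (fou f).
Proof.
move=> l1 I; have [l2 Lf] := iso_L2 I; have [p [sp hp]] := sb0_approx_seq l1 l2.
have [LF est] := fourier_lim l1 l2 sp hp; have [Lfou _] := fou_L2 Lf.
apply: (iso_lim Hc Hdx Hdt Ha Hpl LF Lfou) => e e0.
have e64 : 0 < e / 64 by rewrite divr_gt0.
have [N _ hN] : \forall n \near \oo, (n.+1%:R^-1 : R) < e / 64.
  by have := near_infty_natSinv_lt (PosNum e64).
have {hN} hN := hN N (leqnn N); rewrite /= in hN.
have rp := sb0_rapid Hc Hdx (sp N).
have Ip := iso_rapid Hc Hdx Hdt Ha Hpl rp; have [Lp Lm] := iso_L2 Ip.
exists (FT (p N)), (fou (mel (fi (p N)))); split; first exact: iso_fourier_sb0.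
  by apply: le_trans (est N) _; rewrite lee_fin; move: hN; move: (N.+1%:R^-1) => i; lra.
rewrite fouB_sqnorm//; have [le _] := iso_le Hc Hdx Hdt Ha Hpl (isoB Hpl Ip I).
apply: le_trans le _.
have h : (sqnormL2 dx (fun x : borel K => (p N x - phi x)%R) <= N.+1%:R^-1%:E)%E.
  rewrite sqnormC; apply: le_trans (hp N); apply: sqnorm_le12.
  exact: (cmeasB (L2_cmeas l2) (L2_cmeas Lp)).
have H4 : (0 <= 4%:E :> \bar R)%E by rewrite lee_fin.
apply: le_trans (lee_wpmul2l H4 h) _; rewrite -EFinM lee_fin.
by move: hN; move: (N.+1%:R^-1) => i; lra.
Qed.

Lemma sb0_dense_L2 phi : L2 dx (phi : borel K -> R[i]) -> forall e : R, 0 < e ->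
  exists2 p, sb0 p & (sqnormL2 dx (fun x : borel K => (p x - phi x)%R) <= e%:E)%E.
Proof.
move=> Lphi e e0; have e4 : 0 < e / 4 by rewrite divr_gt0.
have Aae : {ae dx, forall x : borel K, exists N, forall n, (N <= n)%N -> @shell R K0 v n x}.
  apply: filterS (dx_ae_neq0 Hc Hdx) => x x0.
  have vx : 0 < v x by rewrite v_gt0.
  exists (maxn (Num.truncn (v x)) (Num.truncn (v x)^-1)).+1 => n; rewrite gtn_max => /andP[n1 n2].
  apply/andP; split.
    rewrite invf_plt ?posrE//; apply/(lt_le_trans (truncnS_gt _)); rewrite ler_nat; exact: leqW.
  by apply/(lt_le_trans (truncnS_gt _)); rewrite ler_nat; exact: leqW.
have /cvgL2P/(_ _ e4)[N hN] := cvg_trunc (@measurable_shell R K0 v) Aae Lphi.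
have mS := @measurable_shell R K0 v N.
have l1 := L1_trunc mS (shell_lty Hc Hdx N) Lphi; have l2 := L2_trunc mS Lphi.
have [p sp hp] := sb0_dense Hc Hdx l1 l2 e4; exists p => //.
have mp : cmeasurable (p : borel K -> R[i]) by exact: (sb0_cmeas Hc).
have h : (sqnormL2 dx (fun x : borel K => (p x - trunc (shell N) phi x)%R) <= (e / 4)%:E)%E.
  rewrite sqnormC; apply: le_trans hp; apply: sqnorm_le12.
  by apply: cmeasB => //; exact: L2_cmeas l2.
apply: le_trans (sqnorm_tri mp (L2_cmeas l2) (L2_cmeas Lphi) h (hN N (leqnn N))) _.
by rewrite lee_fin; lra.
Qed.

Lemma transported_fourier :
  transported dx dt alpha mu (L2 dx) (fourierL2 dx) (fun f => fou f).
Proof.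
move=> phi Lphi; split; first exact: (iso_exists Hc Hdx Hdt Ha Hpl Lphi).
move=> f psi I; have [_ Lf] := iso_L2 I; have [Lfou _] := fou_L2 Lf.
split=> [[_ Lpsi [u [Lu /cvgL2P cu /cvgL2P cU]]]|Ipsi].
  apply: (iso_lim Hc Hdx Hdt Ha Hpl Lpsi Lfou) => e e0.
  have e4 : 0 < e / 4 by rewrite divr_gt0.
  have [N1 h1] := cu _ e4; have [N2 h2] := cU _ e0; pose n := maxn N1 N2.
  have [l1 l2 _] := Lu n; have [g Ig] := iso_exists Hc Hdx Hdt Ha Hpl l2.
  have [_ Lg] := iso_L2 Ig.
  exists (FT (u n)), (fou g); split; first exact: iso_fourier.
    exact: (h2 _ (leq_maxr _ _)).
  rewrite fouB_sqnorm//; have [le _] := iso_le Hc Hdx Hdt Ha Hpl (isoB Hpl Ig I).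
  apply: le_trans le _; have H4 : (0 <= 4%:E :> \bar R)%E by rewrite lee_fin.
  apply: le_trans (lee_wpmul2l H4 (h1 _ (leq_maxl _ _))) _; rewrite -EFinM lee_fin; lra.
have [Lpsi _] := iso_L2 Ipsi; split=> //.
(* Two uses of [iso_le] will cost a factor 4 each; dividing by 16 leaves 1/(n+1) for
   [cvgL2_invn]. *)
have pos n : 0 < n.+1%:R^-1 / 16 :> R by rewrite divr_gt0// invr_gt0.
pose H n := cid2 (sb0_dense_L2 Lphi (pos n)); pose p n := s2val (H n).
have sp n : sb0 (p n) := s2valP (H n).
have hp n : (sqnormL2 dx (fun x : borel K => (p n x - phi x)%R) <= (n.+1%:R^-1 / 16)%:E)%E := s2valP' (H n).
have rp n := sb0_rapid Hc Hdx (sp n).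
exists p; split=> [n||].
- split; [exact: (rapid_L10 Hc Hdx)|exact: (rapid_L2 Hc Hdx)|].
  exact: (rapid_L2 Hc Hdx (rapid_fourier Hc Hself (sb0_test (sp n)))).
- apply: cvgL2_invn => n; apply: le_trans (hp n) _; rewrite lee_fin.
  by have := pos n; move: (n.+1%:R^-1) => i; lra.
apply: cvgL2_invn => n.
have Ip := iso_rapid Hc Hdx Hdt Ha Hpl (rp n); have [_ Lm] := iso_L2 Ip.
have IF := iso_fourier_sb0 (sp n).
have [_ le] := iso_le Hc Hdx Hdt Ha Hpl (isoB Hpl IF Ipsi).
rewrite fouB_sqnorm// in le; apply: le_trans le _.
have [le2 _] := iso_le Hc Hdx Hdt Ha Hpl (isoB Hpl Ip I).
have H4 : (0 <= 4%:E :> \bar R)%E by rewrite lee_fin.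
apply: le_trans (lee_wpmul2l H4 (le_trans le2 (lee_wpmul2l H4 (hp n)))) _.
by rewrite -!EFinM lee_fin; move: (n.+1%:R^-1) => i; lra.
Qed.

Lemma con_cmeas f : cmeasurable (f : borel X -> R[i]) -> cmeasurable (con f : borel X -> R[i]).
Proof.
move=> mf; apply: cmeasM => //; apply: cmeasN.
exact: (Lambda_half_cmeas Hc Hself Hdt Ha Hpl Hgam).
Qed.

Lemma iso_conductor phi : sb0 phi -> iso (conductor dx phi) (con (mel (fi phi))).
Proof.
move=> sb; have tb := sb0_test sb; have rb := sb0_rapid Hc Hdx sb.
have tr := test_reflect Hc tb; have rr := rapid_fourier Hc Hself tr.
(* F^-1 phi, written as F of the reflected phi so that the results on F apply to it; then F psi =
   phi. *)
pose psi := FT (fun x => phi (- x)).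
have spsi : schwartz_bruhat psi := fourier_test Hc Hdx Hself tr.
have FTpsi : FT psi = phi.
  by apply/funext => x; rewrite (fourier_fourier _ Hself tr.1) opprK.
have psiE : fourier_inv dx phi = psi.
  by apply/funext => y; rewrite fourier_invE /psi (fourier_opp Hc Hdx y (rapid_L10 Hc Hdx rb)).
have l1 : L1 dx (fun x : borel K => lmd x * psi x).
  have a34 : -3/4 <= (0 : R) <= 0 by apply/andP; split; lra.
  have n1 (x : borel K) : normc (1 : R[i]) <= 1 by rewrite normc1.
  have := L1_log Hc Hdx rr a34 (cmeas_cst (borel K) (1 : R[i])) n1.
  by under eq_fun do rewrite powRr0 mul1r mulr1.
have l2 := L2_log Hc Hdx rr; have l2' := L2_log Hc Hdx rb.
have [m1 _] := log_first_isometry Hc Hself Hdt Ha rr.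
have [m1' _] := log_first_isometry Hc Hself Hdt Ha rb.
have I1 := iso_fourier l1 (iso_L1 Hc Hdx Hdt Ha Hpl l2 m1).
have I2 := iso_L1 Hc Hdx Hdt Ha Hpl l2' m1'.
have := isoD Hpl I2 I1.
have -> : (fun x => lmd x * phi x + FT (fun x => lmd x * psi x) x) = conductor dx phi.
  by apply/funext => x; rewrite /conductor psiE.
suff -> : (fun chi => mel (fi (fun x => lmd x * phi x)) chi + fou (mel (fi (fun x => lmd x * psi x))) chi) =
   con (mel (fi phi)) by [].
apply/funext => chi.
have rF : rapid dx (FT psi) by rewrite FTpsi.
have g0 : Gamma chi 2^-1 != 0 by rewrite -normc_eq0 gn oner_eq0.
have := gamma_leibniz Hc Hself Hdt Ha Hgam chi spsi rF; have := gamma_zeta_half Hgam chi spsi.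
rewrite FTpsi => e1 e2.
rewrite (mellin_log Hc Hself Hdt Ha chi rb) (mellin_log Hc Hself Hdt Ha (char_conj chi) rr).
rewrite (mellin_zeta Hc Hself Hdt Ha chi rb) e1 -/psi e2 /Lambda.
move: g0 (zeta dx psi (char_conj chi) 2^-1) (zeta' dx psi (char_conj chi)) (derive1 (Gamma chi) 2^-1) ((alpha^-1)%:C : R[i]).
by move: (Gamma chi 2^-1) => G G0 z z' G' a; field.
Qed.

Lemma transported_conductor :
  transported dx dt alpha mu sb0 (graphL2 dx (conductor dx)) (fun f => con f).
Proof.
have Lsb phi : sb0 phi -> L2 dx (phi : borel K -> R[i]).
  by move=> sb; exact: (rapid_L2 Hc Hdx (sb0_rapid Hc Hdx sb)).
apply: transport_graph => // phi f sb I.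
have IC := iso_conductor sb; have [LC LcM] := iso_L2 IC.
have Im := iso_rapid Hc Hdx Hdt Ha Hpl (sb0_rapid Hc Hdx sb).
have [_ Lf] := iso_L2 I; have [_ Lm] := iso_L2 Im.
(* f is only known to be a partner of phi in the graph, so it agrees with the Mellin integral almost
   everywhere; the result for the integral is moved to f along this equality. *)
have E := iso_fun Hc Hdx Hdt Ha Hpl Im I.
have mc := con_cmeas (L2_cmeas Lf).
have E' : eqL2 mu (con (mel (fi phi)) : borel X -> R[i]) (con f) by apply: filterS E => chi /= ->.
have Lc : L2 mu (con f : borel X -> R[i]).
  split=> //; rewrite -(eqL2_sqnorm (con_cmeas (L2_cmeas Lm)) mc E'); exact: LcM.2.
by apply: (iso_ae Hc Hdx Hdt Ha Hpl IC LC Lc) => //; exact: aeW.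
Qed.

(** Multiplication by a real measurable function: truncating f to the set where |Lambda| <= n puts
    it in the domain and converges to f, and reality of Lambda gives the symmetry. *)
Lemma hermitian_con : hermitianL2 mu (fun f => con f).
Proof.
split=> [a f g|f Lf|f g _ _]; first by apply/funext => chi; ring.
  have mL := Lambda_half_cmeas Hc Hself Hdt Ha Hpl Hgam.
  pose A (n : nat) : set (borel X) := [set chi : borel X | normc (Lambda Gamma (chi : X) 2^-1) <= n%:R].
  have mA n : measurable (A n).
    rewrite -[X in measurable X]setTI.
    have -> : A n = (fun chi : borel X => normc (Lambda Gamma (chi : X) 2^-1)) @^-1` `]-oo, n%:R].
      by apply/seteqP; split=> chi; rewrite /A /= in_itv.
    exact: (measurable_normc mL).
  have Aae : {ae mu, forall chi : borel X, exists N, forall n, (N <= n)%N -> A n chi}.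
    apply: aeW => chi; exists (Num.truncn (normc (Lambda Gamma chi 2^-1))).+1 => n hn.
    by apply/ltW/(lt_le_trans (truncnS_gt _)); rewrite ler_nat.
  exists (fun n => trunc (A n) f); last exact: cvg_trunc.
  move=> n; split; first exact: L2_trunc.
  have mt := con_cmeas (cmeas_trunc (mA n) (L2_cmeas Lf)); split=> //.
  have LnZ := L2Z (n%:R : R[i]) Lf.
  apply: le_lt_trans LnZ.2; apply: (le_sqnorm _ mt (L2_cmeas LnZ)) => chi; rewrite 2!normc_mul normc_opp.
  have -> : normc (n%:R : R[i]) = n%:R.
    by have := normc_real (n%:R : R); rewrite rmorph_nat ger0_norm.
  rewrite /trunc indicE; have [Ac|_] := boolP (chi \in A n); last first.
    by rewrite normc_mul normc00 mul0r mulr0 mulr_ge0 ?normcr_ge0.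
  rewrite mul1r ler_wpM2r ?normcr_ge0//; by move: Ac; rewrite inE.
rewrite /innerL2; congr (cintegral mu _); apply/funext => chi.
have e : (- Lambda Gamma chi 2^-1 * g chi)^* = - Lambda Gamma chi 2^-1 * (g chi)^*.
  rewrite rmorphM rmorphN; congr (- _ * _).
  exact: (Lambda_real Hc Hself Hdt Ha Hgam).
apply: (etrans _ (esym (congr1 (fun z => f chi * z) e))).
by rewrite mulrCA mulrA.
Qed.

End transport_theorems.

Theorem theoremG1 (R : realType) (F : fieldExtType rat) (K : fieldType)
    (v : absolute_value R K) (iota : {rmorphism F -> valued v})
    (dx dt : {measure set (borel (valued v)) -> \bar R}) (alpha : R)
    (mu : {measure set (borel (Xnu v)) -> \bar R})
    (Gamma : Xnu v -> R[i] -> R[i]) :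
  is_completion iota -> is_self_dual_haar dx -> is_normalized_mulhaar dx dt ->
  is_alpha dx dt alpha -> is_plancherel dt mu -> is_gamma dx Gamma ->
  let inv := fun (f : Xnu v -> R[i]) chi => f (char_conj chi) in
  let fou := fun (f : Xnu v -> R[i]) chi =>
    Gamma chi 2^-1 * f (char_conj chi) in
  let con := fun (f : Xnu v -> R[i]) chi => - Lambda Gamma chi 2^-1 * f chi in
  [/\ unitaryL2 mu inv /\
        transported dx dt alpha mu (L2 dx) (graphL2 dx (inversion dx)) inv,
      unitaryL2 mu fou /\
        transported dx dt alpha mu (L2 dx) (fourierL2 dx) fou
    & hermitianL2 mu con /\
        transported dx dt alpha mu (@schwartz_bruhat0 R K v)
          (graphL2 dx (conductor dx)) con].
Proof.
move=> Hc Hself [Hdt _ _] Ha Hpl Hgam inv fou con.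
have Hdx : @is_haar R (valued v) setT +%R dx by case: Hself.
split; split.
- exact: (unitary_inv Hc Hself Hdt Ha Hpl).
- exact: (transported_inversion Hc Hself Hdt Ha Hpl).
- exact: (unitary_fou Hc Hself Hdt Ha Hpl Hgam).
- exact: (transported_fourier Hc Hself Hdt Ha Hpl Hgam).
- exact: (hermitian_con Hc Hself Hdt Ha Hpl Hgam).
- exact: (transported_conductor Hc Hself Hdt Ha Hpl Hgam).
Qed.
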